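(* Let $T>0$, $\mathcal{O}=(X_{\min},X_{\max})$ bounded, and let $\sigma,b,r,f,\varphi,v_0$ be Lipschitz continuous functions (of $(t,x)$, resp. $x$ for $v_0$) with $v_0(x)\ge\varphi(0,x)+f(0,x)$. Let $\mathcal{A}w:=-a(t,x)w_{xx}+b(t,x)w_x+r(t,x)w$ with $a=\tfrac12\sigma^2$, and let $v$ be the exact (viscosity) solution of $\min(v_t+\mathcal{A}v,\ v-\varphi)=f$ on $(0,T)\times\mathcal{O}$, $v(0,x)=v_0(x)$, with Dirichlet boundary data $v(t,X_{\min})=v_\ell(t)$, $v(t,X_{\max})=v_r(t)$. Assume: (A1) $a,b,r$ are bounded, $a\ge\eta_0>0$, and $|a(t,x)-a(t,y)|\le L|x-y|$ for all $t,x,y$; (A2) there exist an integer $p\ge0$ and continuous functions $y_1,\dots,y_p:[0,T]\to[X_{\min},X_{\max}]$ such that, with $\mathcal{O}_{\epsilon,T}:=\{(t,x)\in(\epsilon,T)\times\mathcal{O}: x\notin\{y_1(t),\dots,y_p(t)\}\}$, $v$ is $C^{2,3}$ (twice continuously differentiable in $t$, three times in $x$) on $\mathcal{O}_{0,T}$, and there are constants $\alpha_i\ge0$, $C_i\ge0$ ($i=1,\dots,4$) with, for all $\epsilon>0$, $\|v_t\|_{L^\infty(\mathcal{O}_{\epsilon,T})}\le C_1\epsilon^{-\alpha_1}$, $\|v_{tt}\|_{L^\infty(\mathcal{O}_{\epsilon,T})}\le C_2\epsilon^{-\alpha_2}$, $\|v_{xx}\|_{L^\infty(\mathcal{O}_{\epsilon,T})}\le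 C_3\epsilon^{-\alpha_3}$, $\|v_{xxx}\|_{L^\infty(\mathcal{O}_{\epsilon,T})}\le C_4\epsilon^{-\alpha_4}$; (A3) there exists $\alpha_0\in(0,1]$ such that each $y_i$ is $\alpha_0$-Hölder continuous on $[0,T]$; and assume $\alpha_2<1$. Discretization: for $J,N\ge1$ let $h=\frac{X_{\max}-X_{\min}}{J+1}$, $x_j=X_{\min}+jh$, $\tau=T/N$, $t_n=n\tau$; $A^{(n)}$ is the tridiagonal $J\times J$ matrix with $A^{(n)}_{i,i-1}=-\beta^n_i-\gamma^n_i$, $A^{(n)}_{i,i}=2\beta^n_i+r(t_n,x_i)$, $A^{(n)}_{i,i+1}=-\beta^n_i+\gamma^n_i$, $\beta^n_i=\frac{\sigma^2(t_n,x_i)}{2h^2}$, $\gamma^n_i=\frac{b(t_n,x_i)}{2h}$; $u^n_0=v_\ell(t_n)$, $u^n_{J+1}=v_r(t_n)$; $q^n\in\mathbb{R}^J$ has first entry $(-\beta^n_1-\gamma^n_1)u^n_0$, last entry $(-\beta^n_J+\gamma^n_J)u^n_{J+1}$, other entries $0$; $f^n_j=f(t_n,x_j)$, $\varphi^n_j=\varphi(t_n,x_j)$; $u^0_j=v_0(x_j)$. The first step $u^1$ is computed either by the implicit Euler (IE) step $\min\big(\frac{u^1_j-u^0_j}{\tau}+(A^{(1)}u^1+q^1)_j,\ u^1_j-\varphi^1_j\big)-f^1_j=0$, or by the Crank–Nicolson (CN) step $\min\big(\frac{u^1_j-u^0_j}{\tau}+\frac12(A^{(1)}u^1+A^{(0)}u^0)_j+\frac12(q^0_j+q^1_j)-f^{1/2}_j,\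 u^1_j-\varphi^1_j-f^1_j\big)=0$ (with $f^{1/2}_j=f(\tau/2,x_j)$); in the CN case assume furthermore (A4): $v_0$ is Lipschitz continuous and piecewise $C^2$ on $\mathcal{O}$. For $n\ge1$, $u^{n+1}$ is given by the BDF2 obstacle scheme $\min\big(\frac{3u^{n+1}_j-4u^n_j+u^{n-1}_j}{2\tau}+(A^{(n+1)}u^{n+1}+q^{n+1})_j,\ u^{n+1}_j-\varphi^{n+1}_j\big)-f^{n+1}_j=0$, $j=1,\dots,J$. Let $\|\bar e^n\|_{L^2(\mathcal{O})}:=\big(\sum_{i=1}^J h|u^n_i-v(t_n,x_i)|^2\big)^{1/2}$. Then, with $\beta_i:=1-2\alpha_i$ ($i=1,\dots,4$) all nonzero, there exists $C\ge0$ independent of $(\tau,h)$ such that as $(\tau,h)\to0$, $$\max_{1\le n\le N}\|\bar e^n\|^2_{L^2(\mathcal{O})}\le C\Big(h^2\tau^{1-2\alpha_4}+h\tau^{1-2\alpha_3}+\tau^2\tau^{1-2\alpha_2}+(\tau^{\alpha_0}+h)\tau^{1-2\alpha_1}+\tau^{\alpha_0}+h+\frac{\tau^2}{h}\Big);$$ if some $\beta_i=0$, the corresponding factor $\tau^{\beta_i}$ is replaced by $|\ln\tau|$. If $u^1$ is computed by the IE step, the term $\frac{\tau^2}{h}$ can be omitted.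
   Context: $\mathcal{O}_{\epsilon,T}$ is the set of points of $(\epsilon,T)\times\mathcal{O}$ away from the singular curves $x=y_i(t)$; $v_{xx}$ may be discontinuous across these curves. *)

(* Defs.v *)
From Stdlib Require Import Reals Lra.
From Coquelicot Require Import Coquelicot.
Open Scope R_scope.

Definition Lip2 (T Xmin Xmax : R) (g : R -> R -> R) : Prop :=
  exists L, 0 <= L /\ forall t s x y, 0 <= t <= T -> 0 <= s <= T ->
    Xmin <= x <= Xmax -> Xmin <= y <= Xmax ->
    Rabs (g t x - g s y) <= L * (Rabs (t - s) + Rabs (x - y)).

Definition Lip1 (Xmin Xmax : R) (g : R -> R) : Prop :=
  exists L, 0 <= L /\ forall x y, Xmin <= x <= Xmax -> Xmin <= y <= Xmax ->
    Rabs (g x - g y) <= L * Rabs (x - y).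

Definition cont_on_rect (T Xmin Xmax : R) (g : R -> R -> R) : Prop :=
  forall t x, 0 <= t <= T -> Xmin <= x <= Xmax ->
  forall eps, 0 < eps -> exists delta, 0 < delta /\
    forall s y, 0 <= s <= T -> Xmin <= y <= Xmax ->
      Rabs (s - t) < delta -> Rabs (y - x) < delta -> Rabs (g s y - g t x) < eps.

Definition cont_on_interval (T : R) (g : R -> R) : Prop :=
  forall t, 0 <= t <= T -> forall eps, 0 < eps -> exists delta, 0 < delta /\
    forall s, 0 <= s <= T -> Rabs (s - t) < delta -> Rabs (g s - g t) < eps.

Definition dt (g : R -> R -> R) : R -> R -> R := fun t x => Derive (fun s => g s x) t.
Definition dx (g : R -> R -> R) : R -> R -> R := fun t x => Derive (fun y => g t y) x.

Definition C12 (psi : R -> R -> R) : Prop :=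
  forall t x,
    ex_derive (fun s => psi s x) t /\ ex_derive (fun y => psi t y) x /\
    ex_derive (fun y => dx psi t y) x /\
    continuity_2d_pt psi t x /\ continuity_2d_pt (dt psi) t x /\
    continuity_2d_pt (dx psi) t x /\ continuity_2d_pt (dx (dx psi)) t x.

Definition a_of (sigma : R -> R -> R) : R -> R -> R := fun t x => sigma t x ^ 2 / 2.

Definition Fobs (sigma b r f phi : R -> R -> R) (t x w wt wx wxx : R) : R :=
  Rmin (wt - a_of sigma t x * wxx + b t x * wx + r t x * w) (w - phi t x) - f t x.

Definition in_open (T Xmin Xmax t x : R) : Prop := 0 < t < T /\ Xmin < x < Xmax.

Definition loc_max (T Xmin Xmax : R) (g : R -> R -> R) (t0 x0 : R) : Prop :=
  exists delta, 0 < delta /\ forall t x, in_open T Xmin Xmax t x ->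
    Rabs (t - t0) < delta -> Rabs (x - x0) < delta -> g t x <= g t0 x0.
Definition loc_min (T Xmin Xmax : R) (g : R -> R -> R) (t0 x0 : R) : Prop :=
  exists delta, 0 < delta /\ forall t x, in_open T Xmin Xmax t x ->
    Rabs (t - t0) < delta -> Rabs (x - x0) < delta -> g t0 x0 <= g t x.

Definition viscosity_solution (T Xmin Xmax : R) (sigma b r f phi : R -> R -> R)
    (v0 vl vr : R -> R) (v : R -> R -> R) : Prop :=
  cont_on_rect T Xmin Xmax v /\
  (forall x, Xmin <= x <= Xmax -> v 0 x = v0 x) /\
  (forall t, 0 <= t <= T -> v t Xmin = vl t /\ v t Xmax = vr t) /\
  (forall psi t0 x0, C12 psi -> in_open T Xmin Xmax t0 x0 ->
     loc_max T Xmin Xmax (fun t x => v t x - psi t x) t0 x0 ->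
     Fobs sigma b r f phi t0 x0 (v t0 x0) (dt psi t0 x0) (dx psi t0 x0)
          (dx (dx psi) t0 x0) <= 0) /\
  (forall psi t0 x0, C12 psi -> in_open T Xmin Xmax t0 x0 ->
     loc_min T Xmin Xmax (fun t x => v t x - psi t x) t0 x0 ->
     0 <= Fobs sigma b r f phi t0 x0 (v t0 x0) (dt psi t0 x0) (dx psi t0 x0)
          (dx (dx psi) t0 x0)).

Definition O_eps (T Xmin Xmax : R) (p : nat) (y : nat -> R -> R) (eps t x : R) : Prop :=
  eps < t < T /\ Xmin < x < Xmax /\ forall i, (i < p)%nat -> x <> y i t.

Definition C23_on (T Xmin Xmax : R) (p : nat) (y : nat -> R -> R) (v : R -> R -> R) : Prop :=
  forall t x, O_eps T Xmin Xmax p y 0 t x ->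
    ex_derive (fun s => v s x) t /\ ex_derive (fun s => dt v s x) t /\
    ex_derive (fun z => v t z) x /\ ex_derive (fun z => dx v t z) x /\
    ex_derive (fun z => dx (dx v) t z) x /\
    continuity_2d_pt v t x /\ continuity_2d_pt (dt v) t x /\
    continuity_2d_pt (dt (dt v)) t x /\ continuity_2d_pt (dx v) t x /\
    continuity_2d_pt (dx (dx v)) t x /\ continuity_2d_pt (dx (dx (dx v))) t x.

Definition Linf_bound (T Xmin Xmax : R) (p : nat) (y : nat -> R -> R) (eps : R)
    (g : R -> R -> R) (B : R) : Prop :=
  forall t x, O_eps T Xmin Xmax p y eps t x -> Rabs (g t x) <= B.

(* piecewise C^2 on [Xmin,Xmax]: C^2 on each closed piece of a finite partition
   (expressed as: agrees on the piece with a C^2 function on R) *)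
Definition piecewise_C2 (Xmin Xmax : R) (g : R -> R) : Prop :=
  exists (m : nat) (z : nat -> R), z 0%nat = Xmin /\ z m = Xmax /\
    (forall k, (k < m)%nat -> z k < z (S k)) /\
    forall k, (k < m)%nat -> exists w : R -> R,
      (forall x, ex_derive w x /\ ex_derive (Derive w) x /\
                 continuous (Derive (Derive w)) x) /\
      (forall x, z k <= x <= z (S k) -> w x = g x).

Fixpoint sum1 (n : nat) (g : nat -> R) : R :=
  match n with O => 0 | S k => sum1 k g + g n end.

Definition hh (Xmin Xmax : R) (J : nat) : R := (Xmax - Xmin) / INR (J + 1).
Definition xg (Xmin Xmax : R) (J j : nat) : R := Xmin + INR j * hh Xmin Xmax J.
Definition tau (T : R) (N : nat) : R := T / INR N.
Definition tg (T : R) (N n : nat) : R := INR n * tau T N.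

(* (A^{(n)} w + q^{(n)})_j, where w 0 and w (J+1) carry the boundary values
   u^n_0 and u^n_{J+1} entering q^{(n)} *)
Definition Lh (T Xmin Xmax : R) (sigma b r : R -> R -> R) (J N n : nat)
    (w : nat -> R) (j : nat) : R :=
  let h := hh Xmin Xmax J in
  let t := tg T N n in
  let x := xg Xmin Xmax J j in
  let be := sigma t x ^ 2 / (2 * h ^ 2) in
  let ga := b t x / (2 * h) in
  (- be - ga) * w (j - 1)%nat + (2 * be + r t x) * w j + (- be + ga) * w (S j).

Definition scheme_common (T Xmin Xmax : R) (sigma b r f phi : R -> R -> R)
    (v0 vl vr : R -> R) (J N : nat) (u : nat -> nat -> R) : Prop :=
  (forall n, (n <= N)%nat -> u n 0%nat = vl (tg T N n) /\ u n (J + 1)%nat = vr (tg T N n)) /\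
  (forall j, (1 <= j <= J)%nat -> u 0%nat j = v0 (xg Xmin Xmax J j)) /\
  (forall n j, (1 <= n)%nat -> (n + 1 <= N)%nat -> (1 <= j <= J)%nat ->
     Rmin ((3 * u (S n) j - 4 * u n j + u (n - 1)%nat j) / (2 * tau T N)
             + Lh T Xmin Xmax sigma b r J N (S n) (u (S n)) j)
          (u (S n) j - phi (tg T N (S n)) (xg Xmin Xmax J j))
     - f (tg T N (S n)) (xg Xmin Xmax J j) = 0).

Definition first_step_IE (T Xmin Xmax : R) (sigma b r f phi : R -> R -> R)
    (J N : nat) (u : nat -> nat -> R) : Prop :=
  forall j, (1 <= j <= J)%nat ->
    Rmin ((u 1%nat j - u 0%nat j) / tau T N + Lh T Xmin Xmax sigma b r J N 1 (u 1%nat) j)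
         (u 1%nat j - phi (tg T N 1) (xg Xmin Xmax J j))
    - f (tg T N 1) (xg Xmin Xmax J j) = 0.

Definition first_step_CN (T Xmin Xmax : R) (sigma b r f phi : R -> R -> R)
    (J N : nat) (u : nat -> nat -> R) : Prop :=
  forall j, (1 <= j <= J)%nat ->
    Rmin ((u 1%nat j - u 0%nat j) / tau T N
           + / 2 * (Lh T Xmin Xmax sigma b r J N 1 (u 1%nat) j
                    + Lh T Xmin Xmax sigma b r J N 0 (u 0%nat) j)
           - f (tau T N / 2) (xg Xmin Xmax J j))
         (u 1%nat j - phi (tg T N 1) (xg Xmin Xmax J j) - f (tg T N 1) (xg Xmin Xmax J j))
    = 0.

Definition err2 (T Xmin Xmax : R) (v : R -> R -> R) (J N : nat)
    (u : nat -> nat -> R) (n : nat) : R :=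
  sum1 J (fun i => hh Xmin Xmax J * (u n i - v (tg T N n) (xg Xmin Xmax J i)) ^ 2).

Definition Pw (be ta : R) : R :=
  if Req_EM_T be 0 then Rabs (ln ta) else Rpower ta be.

Definition Bnd (al0 al1 al2 al3 al4 ta h : R) : R :=
  h ^ 2 * Pw (1 - 2 * al4) ta + h * Pw (1 - 2 * al3) ta
  + ta ^ 2 * Pw (1 - 2 * al2) ta + (Rpower ta al0 + h) * Pw (1 - 2 * al1) ta
  + Rpower ta al0 + h.

(* Main.v *)
Require Import Defs.
From Stdlib Require Import Reals Lra Lia ClassicalEpsilon FunctionalExtensionality List.
From Coquelicot Require Import Coquelicot.
Open Scope R_scope.

(* The equation alone limits how rough [v] can be at the curves. Times at which any two
   curves locally coincide or stay apart are dense; at such a time a convex kink of [v] on a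
   curve would contradict the viscosity supersolution property, so [v_xx <= C m] holds on
   the whole slice in the viscosity sense, where [m >= 1] bounds [|v_t|]. Applied to [v],
   and to [- v] off the contact set, this makes [v] Lipschitz and semiconcave in space with
   constants [C m], and then, by a barrier argument, Lipschitz in time across the curves.
   Consistency is of full order away from the curves; at the nodes within
   [tau^al0 + h] of a curve second differences of [v] are bounded above by [C m], and below by
   [- C m] off the contact set, the contact set being handled by complementarity. Garding's
   inequality for the central differences and the G-stability of BDF2 turn this into the
   error bound, the sums [tau * Sum (k tau)^(- 2 al)] giving the powers of [tau]. *)

(** * Continuity on closed boxes *)

(** Across a curve [v] is only known to be continuous, so a stencil crossing one could have a second
    difference as large as the oscillation of [v] over [h ^ 2], and no count of such nodes would
    absorb that. One-sidedness helps: the residual is always tested with [v - g - Gu], [Gu >= 0]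
    being the discrete excess over the obstacle. A large positive value of the discrete operator is
    harmless if contact occurs inside the stencil, since it is at most of order [m / h] while
    [v - g] is of order [m h]. Bounded [v_t] on both sides of a curve does not by itself forbid a
    kink, because a moving kink changes [v] quickly on the curve; so the curve is first shown to be
    slow near a kink. This needs a single curve nearby, hence the detour through good times, and
    closed inequalities between values of [v], which survive the passage to all times. All bounds
    are linear in [m], which grows like [t ^ (- al1)]. Its square, weighted by the share
    [tau ^ al0 + h] of nodes near curves and summed over time, gives the term with [al1]. In the
    first two steps the residual need not be small; a single step gives its square the weight
    [tau ^ 2], which suffices. *)

Lemma choice2 (A B C : Type) (P : A -> B -> C -> Prop) :
  (forall a b, exists c, P a b c) -> exists f : A -> B -> C, forall a b, P a b (f a b).
Proof.
  intros H. exists (fun a b => proj1_sig (constructive_indefinite_description _ (H a b))).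
  intros a b. exact (proj2_sig (constructive_indefinite_description _ (H a b))).
Qed.

Definition cont_on (a b : R) (f : R -> R) : Prop :=
  forall x, a <= x <= b -> forall eps, 0 < eps -> exists delta, 0 < delta /\
    forall y, a <= y <= b -> Rabs (y - x) < delta -> Rabs (f y - f x) < eps.

(** Continuity relative to the closed box: the data and [v] are arbitrary outside the rectangle, so
    [continuity_2d_pt] would ask too much at its boundary. *)
Definition cont_box (t1 t2 x1 x2 : R) (F : R -> R -> R) : Prop :=
  forall t x, t1 <= t <= t2 -> x1 <= x <= x2 ->
  forall eps, 0 < eps -> exists delta, 0 < delta /\
    forall s y, t1 <= s <= t2 -> x1 <= y <= x2 ->
      Rabs (s - t) < delta -> Rabs (y - x) < delta -> Rabs (F s y - F t x) < eps.

Lemma cont_box_sub (t1 t2 x1 x2 s1 s2 y1 y2 : R) (F : R -> R -> R) :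
  t1 <= s1 -> s2 <= t2 -> x1 <= y1 -> y2 <= x2 ->
  cont_box t1 t2 x1 x2 F -> cont_box s1 s2 y1 y2 F.
Proof.
  intros H1 H2 H3 H4 HF t x Ht Hx eps He.
  destruct (HF t x ltac:(lra) ltac:(lra) eps He) as [d [Hd H]].
  exists d; split; auto. intros s y Hs Hy; apply H; lra.
Qed.

Lemma cont_box_plus (t1 t2 x1 x2 : R) (F G : R -> R -> R) :
  cont_box t1 t2 x1 x2 F -> cont_box t1 t2 x1 x2 G ->
  cont_box t1 t2 x1 x2 (fun t x => F t x + G t x).
Proof.
  intros HF HG t x Ht Hx eps He.
  destruct (HF t x Ht Hx (eps / 2) ltac:(lra)) as [d1 [Hd1 H1]].
  destruct (HG t x Ht Hx (eps / 2) ltac:(lra)) as [d2 [Hd2 H2]].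
  exists (Rmin d1 d2); split. { apply Rmin_pos; auto. }
  intros s y Hs Hy Hst Hyx.
  pose proof (Rmin_l d1 d2); pose proof (Rmin_r d1 d2).
  specialize (H1 s y Hs Hy ltac:(lra) ltac:(lra)).
  specialize (H2 s y Hs Hy ltac:(lra) ltac:(lra)).
  apply Rabs_def2 in H1; apply Rabs_def2 in H2; apply Rabs_def1; lra.
Qed.

Lemma cont_box_opp (t1 t2 x1 x2 : R) (F : R -> R -> R) :
  cont_box t1 t2 x1 x2 F -> cont_box t1 t2 x1 x2 (fun t x => - F t x).
Proof.
  intros HF t x Ht Hx eps He.
  destruct (HF t x Ht Hx eps He) as [d [Hd H]].
  exists d; split; auto. intros s y Hs Hy Hst Hyx.
  replace (- F s y - - F t x) with (- (F s y - F t x)) by ring.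
  rewrite Rabs_Ropp; auto.
Qed.

Lemma cont_box_minus (t1 t2 x1 x2 : R) (F G : R -> R -> R) :
  cont_box t1 t2 x1 x2 F -> cont_box t1 t2 x1 x2 G ->
  cont_box t1 t2 x1 x2 (fun t x => F t x - G t x).
Proof.
  intros HF HG. exact (cont_box_plus _ _ _ _ _ _ HF (cont_box_opp _ _ _ _ _ HG)).
Qed.

Lemma continuity_2d_pt_box (t1 t2 x1 x2 : R) (F : R -> R -> R) :
  (forall t x, continuity_2d_pt F t x) -> cont_box t1 t2 x1 x2 F.
Proof.
  intros H t x _ _ eps He. destruct (H t x (mkposreal eps He)) as [d Hd].
  exists d; split. { apply cond_pos. } intros; apply Hd; auto.
Qed.

Lemma cont_box_space (t1 t2 x1 x2 t : R) (F : R -> R -> R) :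
  cont_box t1 t2 x1 x2 F -> t1 <= t <= t2 -> cont_on x1 x2 (F t).
Proof.
  intros HF Ht x Hx eps He. destruct (HF t x Ht Hx eps He) as [d [Hd H]].
  exists d; split; auto. intros y Hy Hyx; apply H; auto.
  rewrite Rminus_diag, Rabs_R0; auto.
Qed.

Lemma cont_box_time (t1 t2 x1 x2 x : R) (F : R -> R -> R) :
  cont_box t1 t2 x1 x2 F -> x1 <= x <= x2 -> cont_on t1 t2 (fun t => F t x).
Proof.
  intros HF Hx t Ht eps He. destruct (HF t x Ht Hx eps He) as [d [Hd H]].
  exists d; split; auto. intros y Hy Hyx; apply H; auto.
  rewrite Rminus_diag, Rabs_R0; auto.
Qed.

Lemma cont_box_of_cont_on (t1 t2 x1 x2 : R) (f : R -> R) :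
  cont_on x1 x2 f -> cont_box t1 t2 x1 x2 (fun _ x => f x).
Proof.
  intros Hf t x _ Hx eps He. destruct (Hf x Hx eps He) as [d [Hd H]].
  exists d; split; auto.
Qed.

Lemma cont_on_sub (a b c d : R) (f : R -> R) :
  a <= c -> d <= b -> cont_on a b f -> cont_on c d f.
Proof.
  intros H1 H2 Hf x Hx eps He. destruct (Hf x ltac:(lra) eps He) as [e [Hd H]].
  exists e; split; auto. intros y Hy; apply H; lra.
Qed.

Lemma continuous_cont_on (a b : R) (f : R -> R) :
  (forall x, a <= x <= b -> continuous f x) -> cont_on a b f.
Proof.
  intros H x Hx eps He.
  assert (H1 := proj1 (filterlim_locally f (f x)) (H x Hx) (mkposreal eps He)).
  destruct H1 as [d Hd]. exists d; split. { apply cond_pos. }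
  intros y _ Hy. apply (Hd y). exact Hy.
Qed.

Lemma cont_on_plus (a b : R) (f g : R -> R) :
  cont_on a b f -> cont_on a b g -> cont_on a b (fun x => f x + g x).
Proof.
  intros Hf Hg.
  apply (cont_box_space 0 0 a b 0 (fun _ x => f x + g x)); [|lra].
  apply cont_box_plus; apply cont_box_of_cont_on; auto.
Qed.

Lemma cont_on_opp (a b : R) (f : R -> R) :
  cont_on a b f -> cont_on a b (fun x => - f x).
Proof.
  intros Hf. apply (cont_box_space 0 0 a b 0 (fun _ x => - f x)); [|lra].
  apply cont_box_opp; apply cont_box_of_cont_on; auto.
Qed.

Lemma cont_on_minus (a b : R) (f g : R -> R) :
  cont_on a b f -> cont_on a b g -> cont_on a b (fun x => f x - g x).
Proof.
  intros Hf Hg. exact (cont_on_plus _ _ _ _ Hf (cont_on_opp _ _ _ Hg)).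
Qed.

(** Compactness in the form of a gauge; classical logic removes the double negation in
    [compactness_value_2d]. The compactness arguments below choose [D] so that a uniform lower bound
    on the gauge is already the claim. *)
Lemma cont_box_cover (t1 t2 x1 x2 : R) (D : R -> R -> posreal) :
  exists d, 0 < d /\ forall t x, t1 <= t <= t2 -> x1 <= x <= x2 ->
    exists s y, t1 <= s <= t2 /\ x1 <= y <= x2 /\
      Rabs (t - s) < D s y /\ Rabs (x - y) < D s y /\ d <= D s y.
Proof.
  destruct (compactness_value_2d t1 t2 x1 x2 D) as [d Hd].
  exists d; split. { apply cond_pos. }
  intros t x Ht Hx. apply NNPP. exact (Hd t x Ht Hx).
Qed.

Lemma cont_box_unif (t1 t2 x1 x2 : R) (F : R -> R -> R) :
  cont_box t1 t2 x1 x2 F -> forall eps, 0 < eps -> exists d, 0 < d /\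
  forall t x s y, t1 <= t <= t2 -> x1 <= x <= x2 -> t1 <= s <= t2 -> x1 <= y <= x2 ->
    Rabs (s - t) < d -> Rabs (y - x) < d -> Rabs (F s y - F t x) < eps.
Proof.
  intros HF eps He.
  assert (HD : forall t x, exists d : posreal, t1 <= t <= t2 -> x1 <= x <= x2 ->
    forall s y, t1 <= s <= t2 -> x1 <= y <= x2 ->
      Rabs (s - t) < 2 * d -> Rabs (y - x) < 2 * d -> Rabs (F s y - F t x) < eps / 2).
  { intros t x. destruct (classic (t1 <= t <= t2 /\ x1 <= x <= x2)) as [[Ht Hx]|N].
    - destruct (HF t x Ht Hx (eps / 2) ltac:(lra)) as [d [Hd H]].
      assert (H2 : 0 < d / 2) by lra. exists (mkposreal _ H2); simpl.
      intros _ _ s y Hs Hy A B; simpl in A, B; apply H; auto; lra.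
    - exists (mkposreal 1 Rlt_0_1). tauto. }
  destruct (choice2 _ _ _ _ HD) as [D HP0].
  destruct (cont_box_cover t1 t2 x1 x2 D) as [d [Hd H]].
  exists d; split; auto. intros t x s y Ht Hx Hs Hy Hst Hyx.
  destruct (H t x Ht Hx) as (u & w & Hu & Hw & A & B & C).
  assert (HP := HP0 u w Hu Hw).
  pose proof (cond_pos (D u w)).
  assert (A1 := HP t x Ht Hx ltac:(lra) ltac:(lra)).
  assert (A2 : Rabs (s - u) < 2 * D u w).
  { apply Rabs_def2 in A; apply Rabs_def2 in Hst; apply Rabs_def1; lra. }
  assert (A3 : Rabs (y - w) < 2 * D u w).
  { apply Rabs_def2 in B; apply Rabs_def2 in Hyx; apply Rabs_def1; lra. }
  assert (A4 := HP s y Hs Hy A2 A3).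
  apply Rabs_def2 in A1; apply Rabs_def2 in A4; apply Rabs_def1; lra.
Qed.

Lemma cont_box_bounded (t1 t2 x1 x2 : R) (F : R -> R -> R) :
  cont_box t1 t2 x1 x2 F -> exists M, 0 < M /\
    forall t x, t1 <= t <= t2 -> x1 <= x <= x2 -> Rabs (F t x) <= M.
Proof.
  intros HF.
  (* The gauge also encodes the size of [F] through [d * (1 + |F|) <= 1], so a positive lower bound
     for the gauge bounds [F]. *)
  assert (HD : forall t x, exists d : posreal, t1 <= t <= t2 -> x1 <= x <= x2 ->
    (forall s y, t1 <= s <= t2 -> x1 <= y <= x2 ->
      Rabs (s - t) < d -> Rabs (y - x) < d -> Rabs (F s y - F t x) < 1) /\
      d * (1 + Rabs (F t x)) <= 1).
  { intros t x. destruct (classic (t1 <= t <= t2 /\ x1 <= x <= x2)) as [[Ht Hx]|N].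
    - destruct (HF t x Ht Hx 1 ltac:(lra)) as [d [Hd H]].
      pose proof (Rabs_pos (F t x)) as Hp.
      assert (H2 : 0 < Rmin d (/ (1 + Rabs (F t x)))).
      { apply Rmin_pos; auto. apply Rinv_0_lt_compat; lra. }
      exists (mkposreal _ H2); simpl. intros _ _; split.
      + intros s y Hs Hy A B. pose proof (Rmin_l d (/ (1 + Rabs (F t x)))).
        apply H; auto; lra.
      + apply Rle_trans with (/ (1 + Rabs (F t x)) * (1 + Rabs (F t x))).
        * apply Rmult_le_compat_r; [lra| apply Rmin_r].
        * rewrite Rinv_l; lra.
    - exists (mkposreal 1 Rlt_0_1). tauto. }
  destruct (choice2 _ _ _ _ HD) as [D HP0].
  destruct (cont_box_cover t1 t2 x1 x2 D) as [d [Hd H]].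
  assert (Hid : 0 < / d) by (apply Rinv_0_lt_compat; auto).
  exists (/ d + 1); split. { lra. }
  intros t x Ht Hx. destruct (H t x Ht Hx) as (u & w & Hu & Hw & A & B & C).
  destruct (HP0 u w Hu Hw) as [P1 P2].
  specialize (P1 t x Ht Hx A B).
  assert (P3 : d * (1 + Rabs (F u w)) <= 1).
  { apply Rle_trans with (D u w * (1 + Rabs (F u w))); auto.
    apply Rmult_le_compat_r; auto. pose proof (Rabs_pos (F u w)); lra. }
  assert (P4 : 1 + Rabs (F u w) <= / d).
  { apply Rmult_le_reg_l with d; auto. rewrite Rinv_r; lra. }
  replace (F t x) with ((F t x - F u w) + F u w) by ring.
  eapply Rle_trans; [apply Rabs_triang|]. lra.
Qed.

Lemma cont_box_min (t1 t2 x1 x2 : R) (F : R -> R -> R) :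
  t1 <= t2 -> x1 <= x2 -> cont_box t1 t2 x1 x2 F ->
  exists t x, t1 <= t <= t2 /\ x1 <= x <= x2 /\
    forall s y, t1 <= s <= t2 -> x1 <= y <= x2 -> F t x <= F s y.
Proof.
  intros Ht12 Hx12 HF.
  destruct (cont_box_bounded _ _ _ _ _ HF) as [M [HM HB]].
  destruct (completeness (fun z => exists t x, t1 <= t <= t2 /\ x1 <= x <= x2 /\ z = - F t x))
    as [l [Hl1 Hl2]].
  { exists M. intros z (t & x & Ht & Hx & ->).
    specialize (HB t x Ht Hx). apply Rabs_le_between in HB; lra. }
  { exists (- F t1 x1), t1, x1. repeat split; lra. }
  apply NNPP; intro N.
  assert (Hpos : forall t x, t1 <= t <= t2 -> x1 <= x <= x2 -> 0 < F t x + l).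
  { intros t x Ht Hx. apply Rnot_le_lt; intro Hle. apply N.
    exists t, x. split; auto. split; auto. intros s y Hs Hy.
    assert (- F s y <= l) by (apply Hl1; exists s, y; auto). lra. }
  (* If the infimum [- l] is not attained, [F + l] is positive everywhere. A gauge lying below it
     has a uniform positive lower bound, against the choice of [l] as the supremum of [- F]. *)
  assert (HD : forall t x, exists d : posreal, t1 <= t <= t2 -> x1 <= x <= x2 ->
    (forall s y, t1 <= s <= t2 -> x1 <= y <= x2 ->
      Rabs (s - t) < d -> Rabs (y - x) < d -> d <= F s y + l)).
  { intros t x. destruct (classic (t1 <= t <= t2 /\ x1 <= x <= x2)) as [[Ht Hx]|Nb].
    - assert (Hp := Hpos t x Ht Hx).
      destruct (HF t x Ht Hx ((F t x + l) / 2) ltac:(lra)) as [d [Hd H]].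
      assert (H2 : 0 < Rmin d ((F t x + l) / 2)). { apply Rmin_pos; lra. }
      exists (mkposreal _ H2); simpl. intros _ _ s y Hs Hy A B.
      pose proof (Rmin_l d ((F t x + l) / 2)). pose proof (Rmin_r d ((F t x + l) / 2)).
      specialize (H s y Hs Hy ltac:(lra) ltac:(lra)). apply Rabs_def2 in H. lra.
    - exists (mkposreal 1 Rlt_0_1). tauto. }
  destruct (choice2 _ _ _ _ HD) as [D HP0].
  destruct (cont_box_cover t1 t2 x1 x2 D) as [d [Hd H]].
  assert (l <= l - d); [|lra].
  apply Hl2. intros z (t & x & Ht & Hx & ->).
  destruct (H t x Ht Hx) as (u & w & Hu & Hw & A & B & C).
  assert (HP := HP0 u w Hu Hw). specialize (HP t x Ht Hx A B). lra.
Qed.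

Lemma cont_on_min (a b : R) (f : R -> R) :
  a <= b -> cont_on a b f ->
  exists x, a <= x <= b /\ forall y, a <= y <= b -> f x <= f y.
Proof.
  intros Hab Hf.
  destruct (cont_box_min 0 0 a b (fun _ x => f x)) as (t & x & _ & Hx & H); try lra.
  { apply cont_box_of_cont_on; auto. }
  exists x; split; auto. intros y Hy. apply (H 0 y); lra.
Qed.

(** * Mean value theorem and second-order conditions on closed intervals *)

Definition clamp (a b x : R) : R := Rmax a (Rmin x b).

Lemma clamp_in (a b x : R) : a <= b -> a <= clamp a b x <= b.
Proof.
  intros H; unfold clamp; split; [apply Rmax_l|].
  apply Rmax_lub; auto. apply Rmin_r.
Qed.

Lemma clamp_id (a b x : R) : a <= x <= b -> clamp a b x = x.
Proof.
  intros H; unfold clamp. rewrite Rmin_left by lra. apply Rmax_right; lra.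
Qed.

Lemma clamp_lip (a b x y : R) : a <= b -> Rabs (clamp a b x - clamp a b y) <= Rabs (x - y).
Proof.
  intros H; unfold clamp, Rmax, Rmin.
  repeat destruct Rle_dec; unfold Rabs; repeat destruct Rcase_abs; lra.
Qed.

(** Precomposition with [clamp] extends [f] to the line, which turns relative continuity into
    two-sided continuity at the end points, as needed to apply [MVT]. *)
Lemma clamp_continuous (a b : R) (f : R -> R) (x : R) :
  a <= b -> cont_on a b f -> continuity_pt (fun z => f (clamp a b z)) x.
Proof.
  intros Hab Hf eps He.
  destruct (Hf (clamp a b x) (clamp_in a b x Hab) eps He) as [d [Hd H]].
  exists d; split; auto. intros z [_ Hz]. simpl in *. unfold R_dist in *.
  apply H. { apply clamp_in; auto. }
  eapply Rle_lt_trans; [apply clamp_lip; auto|]. auto.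
Qed.

Lemma MVT_on (a b : R) (f df : R -> R) :
  a < b -> (forall x, a < x < b -> is_derive f x (df x)) -> cont_on a b f ->
  exists c, a < c < b /\ f b - f a = df c * (b - a).
Proof.
  intros Hab Hd Hc.
  pose (F := fun z => f (clamp a b z)).
  assert (HdF : forall x, a < x < b -> derivable_pt_lim F x (df x)).
  { intros x Hx. apply is_derive_Reals. apply is_derive_ext_loc with f; auto.
    assert (Hp : 0 < Rmin (x - a) (b - x)) by (apply Rmin_pos; lra).
    exists (mkposreal _ Hp). intros z Hz. unfold F. rewrite clamp_id; auto.
    change (Rabs (z - x) < Rmin (x - a) (b - x)) in Hz. apply Rabs_def2 in Hz.
    pose proof (Rmin_l (x - a) (b - x)); pose proof (Rmin_r (x - a) (b - x)). lra. }
  destruct (MVT F id a b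
    (fun c Hc => exist _ (df c) (HdF c Hc))
    (fun c _ => derivable_pt_id c) Hab) as (c & Pc & E).
  { intros c Hc'. apply clamp_continuous; auto; lra. }
  { intros c _. apply derivable_continuous_pt, derivable_pt_id. }
  exists c; split; auto.
  rewrite derive_pt_id in E. simpl in E.
  unfold id, F in E. rewrite !clamp_id in E by lra. lra.
Qed.

Lemma MVT_abs_le (a b K : R) (f df : R -> R) :
  a <= b -> (forall x, a < x < b -> is_derive f x (df x)) -> cont_on a b f ->
  (forall x, a < x < b -> Rabs (df x) <= K) -> Rabs (f b - f a) <= K * (b - a).
Proof.
  intros Hab Hd Hc HK. destruct (Req_dec a b) as [->|N].
  { rewrite !Rminus_diag, Rabs_R0; lra. }
  destruct (MVT_on a b f df) as (c & Hc' & E); auto; try lra.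
  rewrite E, Rabs_mult, (Rabs_right (b - a)) by lra.
  apply Rmult_le_compat_r; [lra | auto].
Qed.

(** With a negative second derivative, [df] would be negative just to the right of its zero [x], and
    the mean value theorem would make [f] drop below its minimum. *)
Lemma derive_2_at_min (f df : R -> R) (x d l : R) :
  0 < d -> (forall y, Rabs (y - x) < d -> is_derive f y (df y)) ->
  is_derive df x l -> (forall y, Rabs (y - x) < d -> f x <= f y) ->
  df x = 0 /\ 0 <= l.
Proof.
  intros Hd Hf Hl Hmin.
  assert (Hx0 : Rabs (x - x) < d) by (rewrite Rminus_diag, Rabs_R0; auto).
  assert (H0 : df x = 0).
  { assert (Hx := Hf x Hx0). apply is_derive_Reals in Hx.
    pose (pr := exist _ (df x) Hx : derivable_pt f x).
    assert (E := deriv_minimum f (x - d) (x + d) x pr ltac:(lra) ltac:(lra)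
      (fun y Hy1 Hy2 => Hmin y ltac:(apply Rabs_def1; lra))).
    exact E. }
  split; auto. apply Rnot_lt_le; intro Hlt.
  apply is_derive_Reals in Hl.
  destruct (Hl (- l / 2) ltac:(lra)) as [e He].
  set (h := Rmin (d / 2) (e / 2)).
  assert (Hh : 0 < h) by (apply Rmin_pos; [lra | destruct e; simpl; lra]).
  assert (Hh1 : h <= d / 2) by apply Rmin_l.
  assert (Hh2 : h <= e / 2) by apply Rmin_r.
  destruct (MVT_on x (x + h) f df) as (c & Hc & E); try lra.
  { intros y Hy. apply Hf. apply Rabs_def1; lra. }
  { apply continuous_cont_on. intros y Hy.
    apply (ex_derive_continuous f y). eexists. apply Hf. apply Rabs_def1; lra. }
  assert (f x <= f (x + h)) by (apply Hmin; apply Rabs_def1; lra).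
  assert (Hc0 : 0 <= df c).
  { apply Rnot_lt_le; intro. nra. }
  specialize (He (c - x) ltac:(lra)).
  assert (Rabs (c - x) < e).
  { destruct e as [e Hpe]; simpl in *. apply Rabs_def1; lra. }
  specialize (He H1). replace (x + (c - x)) with c in He by ring.
  rewrite H0 in He. apply Rabs_def2 in He.
  assert ((df c - 0) / (c - x) >= 0).
  { apply Rle_ge. apply Rmult_le_pos; [lra|]. left; apply Rinv_0_lt_compat; lra. }
  lra.
Qed.

(** * Testing with quadratic polynomials *)

(** No constant term: only differences of [w - quad] are ever compared. The coefficient [K] lets a
    test function win on the sides [t = t1] and [t = t2] of a box without moving fast near the
    centre. *)
Definition quad (q K s A t0 x0 t x : R) : R :=
  q * (t - t0) + K * (t - t0) ^ 2 + s * (x - x0) + A * (x - x0) ^ 2.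

Lemma quad_dt (q K s A t0 x0 : R) :
  dt (quad q K s A t0 x0) = fun t _ => q + 2 * K * (t - t0).
Proof.
  apply functional_extensionality; intro t; apply functional_extensionality; intro x.
  unfold dt, quad. apply is_derive_unique. auto_derive; auto. ring.
Qed.

Lemma quad_dx (q K s A t0 x0 : R) :
  dx (quad q K s A t0 x0) = fun _ x => s + 2 * A * (x - x0).
Proof.
  apply functional_extensionality; intro t; apply functional_extensionality; intro x.
  unfold dx, quad. apply is_derive_unique. auto_derive; auto. ring.
Qed.

Lemma quad_dxx (q K s A t0 x0 : R) :
  dx (dx (quad q K s A t0 x0)) = fun _ _ => 2 * A.
Proof.
  rewrite quad_dx.
  apply functional_extensionality; intro t; apply functional_extensionality; intro x.
  unfold dx. apply is_derive_unique. auto_derive; auto. ring.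
Qed.

Lemma affine_continuity_2d_1 (c k t0 t x : R) :
  continuity_2d_pt (fun u _ => c + k * (u - t0)) t x.
Proof.
  apply continuity_2d_pt_plus; [apply continuity_2d_pt_const|].
  apply continuity_2d_pt_mult; [apply continuity_2d_pt_const|].
  apply continuity_2d_pt_minus; [apply continuity_2d_pt_id1 | apply continuity_2d_pt_const].
Qed.

Lemma affine_continuity_2d_2 (c k x0 t x : R) :
  continuity_2d_pt (fun _ y => c + k * (y - x0)) t x.
Proof.
  apply continuity_2d_pt_plus; [apply continuity_2d_pt_const|].
  apply continuity_2d_pt_mult; [apply continuity_2d_pt_const|].
  apply continuity_2d_pt_minus; [apply continuity_2d_pt_id2 | apply continuity_2d_pt_const].
Qed.

Lemma quad_continuity_2d (q K s A t0 x0 t x : R) :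
  continuity_2d_pt (quad q K s A t0 x0) t x.
Proof.
  apply continuity_2d_pt_ext with (fun u y =>
    (0 + 1 * (u - t0)) * (q + K * (u - t0)) + (0 + 1 * (y - x0)) * (s + A * (y - x0))).
  { intros; unfold quad; ring. }
  apply continuity_2d_pt_plus; apply continuity_2d_pt_mult;
    first [apply affine_continuity_2d_1 | apply affine_continuity_2d_2].
Qed.

Lemma quad_C12 (q K s A t0 x0 : R) : C12 (quad q K s A t0 x0).
Proof.
  intros t x. rewrite quad_dxx, quad_dt, quad_dx.
  split. { unfold quad; auto_derive; auto. }
  split. { unfold quad; auto_derive; auto. }
  split. { auto_derive; auto. }
  split. { apply quad_continuity_2d. }
  split. { apply affine_continuity_2d_1. }
  split. { apply affine_continuity_2d_2. }
  apply continuity_2d_pt_const.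
Qed.

(* [w] is a supersolution of [w_t - a w_xx + b w_x + r w >= F] on [Om], tested only
   with quadratic polynomials on boxes; this one-sided notion covers [v] (with [F = f],
   everywhere) and [- v] (with [F = - f], off the contact set) at once. *)
Definition box_super (T Xmin Xmax : R) (a b r w F : R -> R -> R) (Om : R -> R -> Prop) : Prop :=
  forall t1 t2 x1 x2 q K s A t0 x0 ti xi,
  0 < t1 -> t2 < T -> Xmin < x1 -> x2 < Xmax ->
  (forall t x, t1 <= t <= t2 -> x1 <= x <= x2 -> Om t x) ->
  t1 < ti < t2 -> x1 < xi < x2 ->
  (forall t x, t1 <= t <= t2 -> x1 <= x <= x2 -> (t = t1 \/ t = t2 \/ x = x1 \/ x = x2) ->
     w ti xi - quad q K s A t0 x0 ti xi <= w t x - quad q K s A t0 x0 t x) ->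
  exists t x, t1 < t < t2 /\ x1 < x < x2 /\
    F t x <= q + 2 * K * (t - t0) - a t x * (2 * A) + b t x * (s + 2 * A * (x - x0))
             + r t x * w t x.

(** A minimum on the boundary can be traded for [(ti, xi)], which is no worse. So no strict
    inequality on the boundary is needed to find an interior minimum. *)
Lemma box_interior_min (t1 t2 x1 x2 ti xi : R) (W : R -> R -> R) :
  cont_box t1 t2 x1 x2 W -> t1 < ti < t2 -> x1 < xi < x2 ->
  (forall t x, t1 <= t <= t2 -> x1 <= x <= x2 -> (t = t1 \/ t = t2 \/ x = x1 \/ x = x2) ->
     W ti xi <= W t x) ->
  exists t x, t1 < t < t2 /\ x1 < x < x2 /\
    forall s y, t1 <= s <= t2 -> x1 <= y <= x2 -> W t x <= W s y.
Proof.
  intros HW Hti Hxi Hbd.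
  destruct (cont_box_min t1 t2 x1 x2 W) as (t & x & Ht & Hx & Hmin); try lra; auto.
  destruct (classic (t = t1 \/ t = t2 \/ x = x1 \/ x = x2)) as [B|B].
  - exists ti, xi; repeat split; try lra. intros s y Hs Hy.
    apply Rle_trans with (W t x); [apply Hbd | apply Hmin]; auto.
  - exists t, x. assert (t <> t1 /\ t <> t2 /\ x <> x1 /\ x <> x2) as (N1 & N2 & N3 & N4) by tauto.
    repeat split; auto; lra.
Qed.

Section Viscosity.
Context (T Xmin Xmax : R) (sigma b r f phi : R -> R -> R) (v0 vl vr : R -> R) (v : R -> R -> R).
Context (Hvisc : viscosity_solution T Xmin Xmax sigma b r f phi v0 vl vr v).

Let g t x := phi t x + f t x.

(** A minimum is bounded below only if both its entries are, so one and the same contact point lies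
    above the obstacle and satisfies the differential inequality. *)
Lemma visc_interior_min (t1 t2 x1 x2 q K s A t0 x0 ti xi : R) :
  0 < t1 -> t2 < T -> Xmin < x1 -> x2 < Xmax ->
  t1 < ti < t2 -> x1 < xi < x2 ->
  (forall t x, t1 <= t <= t2 -> x1 <= x <= x2 -> (t = t1 \/ t = t2 \/ x = x1 \/ x = x2) ->
     v ti xi - quad q K s A t0 x0 ti xi <= v t x - quad q K s A t0 x0 t x) ->
  exists t x, t1 < t < t2 /\ x1 < x < x2 /\ g t x <= v t x /\
    f t x <= q + 2 * K * (t - t0) - a_of sigma t x * (2 * A) + b t x * (s + 2 * A * (x - x0))
             + r t x * v t x.
Proof.
  intros Ht1 Ht2 Hx1 Hx2 Hti Hxi Hbd.
  destruct Hvisc as (Hc & _ & _ & _ & Hsup).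
  destruct (box_interior_min t1 t2 x1 x2 ti xi (fun t x => v t x - quad q K s A t0 x0 t x))
    as (t & x & Ht & Hx & Hmin); auto.
  { apply cont_box_minus.
    - apply cont_box_sub with 0 T Xmin Xmax; auto; lra.
    - apply continuity_2d_pt_box. intros; apply quad_continuity_2d. }
  exists t, x; split; auto; split; auto.
  assert (H := Hsup (quad q K s A t0 x0) t x (quad_C12 _ _ _ _ _ _)).
  rewrite quad_dxx, quad_dt, quad_dx in H. unfold Fobs in H.
  assert (HF := H ltac:(unfold in_open; lra)).
  match type of HF with ?P -> _ => assert (HP : P) end.
  { pose (d := Rmin (Rmin (t - t1) (t2 - t)) (Rmin (x - x1) (x2 - x))).
    exists d; split.
    { unfold d; repeat apply Rmin_pos; lra. }
    intros t' x' _ Ht' Hx'. apply Hmin.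
    - unfold d in *. pose proof (Rmin_l (Rmin (t - t1) (t2 - t)) (Rmin (x - x1) (x2 - x))).
      pose proof (Rmin_l (t - t1) (t2 - t)). pose proof (Rmin_r (t - t1) (t2 - t)).
      apply Rabs_def2 in Ht'; lra.
    - unfold d in *. pose proof (Rmin_r (Rmin (t - t1) (t2 - t)) (Rmin (x - x1) (x2 - x))).
      pose proof (Rmin_l (x - x1) (x2 - x)). pose proof (Rmin_r (x - x1) (x2 - x)).
      apply Rabs_def2 in Hx'; lra. }
  specialize (HF HP).
  pose proof (Rmin_l (q + 2 * K * (t - t0) - a_of sigma t x * (2 * A)
     + b t x * (s + 2 * A * (x - x0)) + r t x * v t x) (v t x - phi t x)).
  pose proof (Rmin_r (q + 2 * K * (t - t0) - a_of sigma t x * (2 * A)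
     + b t x * (s + 2 * A * (x - x0)) + r t x * v t x) (v t x - phi t x)).
  unfold g; split; lra.
Qed.

Lemma visc_box_super : box_super T Xmin Xmax (a_of sigma) b r v f (fun _ _ => True).
Proof.
  intros t1 t2 x1 x2 q K s A t0 x0 ti xi Ht1 Ht2 Hx1 Hx2 _ Hti Hxi Hbd.
  destruct (visc_interior_min t1 t2 x1 x2 q K s A t0 x0 ti xi) as (t & x & Ht & Hx & _ & HF); auto.
  exists t, x; auto.
Qed.

(** Off the contact set the entry [v - phi] of the minimum exceeds [f], so a subsolution test forces
    the differential entry to be at most [f]. For [- v] this reads as a supersolution inequality. *)
Lemma visc_box_sub :
  box_super T Xmin Xmax (a_of sigma) b r (fun t x => - v t x) (fun t x => - f t x)
    (fun t x => g t x < v t x).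
Proof.
  intros t1 t2 x1 x2 q K s A t0 x0 ti xi Ht1 Ht2 Hx1 Hx2 HOm Hti Hxi Hbd.
  destruct Hvisc as (Hc & _ & _ & Hsub & _).
  destruct (box_interior_min t1 t2 x1 x2 ti xi (fun t x => - v t x - quad q K s A t0 x0 t x))
    as (t & x & Ht & Hx & Hmin); auto.
  { apply cont_box_minus.
    - apply cont_box_opp. apply cont_box_sub with 0 T Xmin Xmax; auto; lra.
    - apply continuity_2d_pt_box. intros; apply quad_continuity_2d. }
  exists t, x; split; auto; split; auto.
  assert (H := Hsub (quad (- q) (- K) (- s) (- A) t0 x0) t x (quad_C12 _ _ _ _ _ _)).
  rewrite quad_dxx, quad_dt, quad_dx in H. unfold Fobs in H.
  assert (HF := H ltac:(unfold in_open; lra)).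
  match type of HF with ?P -> _ => assert (HP : P) end.
  { pose (d := Rmin (Rmin (t - t1) (t2 - t)) (Rmin (x - x1) (x2 - x))).
    exists d; split.
    { unfold d; repeat apply Rmin_pos; lra. }
    intros t' x' _ Ht' Hx'.
    assert (- v t x - quad q K s A t0 x0 t x <= - v t' x' - quad q K s A t0 x0 t' x').
    { apply Hmin.
      - unfold d in *. pose proof (Rmin_l (Rmin (t - t1) (t2 - t)) (Rmin (x - x1) (x2 - x))).
        pose proof (Rmin_l (t - t1) (t2 - t)). pose proof (Rmin_r (t - t1) (t2 - t)).
        apply Rabs_def2 in Ht'; lra.
      - unfold d in *. pose proof (Rmin_r (Rmin (t - t1) (t2 - t)) (Rmin (x - x1) (x2 - x))).
        pose proof (Rmin_l (x - x1) (x2 - x)). pose proof (Rmin_r (x - x1) (x2 - x)).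
        apply Rabs_def2 in Hx'; lra. }
    unfold quad in *; lra. }
  specialize (HF HP).
  assert (HO := HOm t x ltac:(lra) ltac:(lra)). unfold g in HO.
  unfold Rmin in HF. destruct Rle_dec; lra.
Qed.

(** The definition yields [g <= v] only where a test function touches [v] from below. Such points
    are dense, because a steep concave paraboloid touches [v] inside any small box; a box inside the
    set where [v < g] is contradictory. *)
Lemma visc_above_obstacle :
  0 < T -> Xmin < Xmax -> cont_box 0 T Xmin Xmax g ->
  forall t x, 0 <= t <= T -> Xmin <= x <= Xmax -> g t x <= v t x.
Proof.
  intros HT HO Hg t x Ht Hx.
  assert (Hvc : cont_box 0 T Xmin Xmax v) by apply Hvisc.
  apply Rnot_lt_le; intro Hlt.
  destruct (cont_box_minus _ _ _ _ _ _ Hg Hvc t x Ht Hx (g t x - v t x) ltac:(lra))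
    as [d [Hd H]].
  assert (Hneg : forall s y, 0 <= s <= T -> Xmin <= y <= Xmax ->
    Rabs (s - t) < d -> Rabs (y - x) < d -> v s y < g s y).
  { intros s y Hs Hy H1 H2. specialize (H s y Hs Hy H1 H2). apply Rabs_def2 in H. lra. }
  destruct (cont_box_bounded _ _ _ _ _ Hvc) as [V [HV HVb]].
  (* The given point may lie on the boundary of the rectangle; the box is close to it but inside the
     open rectangle, where tests are allowed. *)
  assert (Hbox : forall L z, 0 < L -> 0 <= z <= L -> exists z1 z2,
    0 < z1 /\ z1 < z2 /\ z2 < L /\ z - d < z1 /\ z2 < z + d).
  { intros L z HL Hz. pose (l := Rmax 0 (z - d)). pose (u := Rmin L (z + d)).
    assert (l < u).
    { unfold l, u. apply Rmax_lub_lt; apply Rmin_glb_lt; lra. }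
    assert (0 <= l) by apply Rmax_l. assert (z - d <= l) by apply Rmax_r.
    assert (u <= L) by apply Rmin_l. assert (u <= z + d) by apply Rmin_r.
    exists (l + (u - l) / 3), (u - (u - l) / 3). repeat split; lra. }
  destruct (Hbox T t HT Ht) as (t1 & t2 & A1 & A2 & A3 & A4 & A5).
  destruct (Hbox (Xmax - Xmin) (x - Xmin) ltac:(lra) ltac:(lra)) as (y1 & y2 & B1 & B2 & B3 & B4 & B5).
  set (tm := (t1 + t2) / 2). set (xm := Xmin + (y1 + y2) / 2).
  set (e := Rmin ((t2 - t1) / 2) ((y2 - y1) / 2)).
  assert (He : 0 < e) by (apply Rmin_pos; lra).
  (* On the boundary of the box the paraboloid has dropped by at least [K * e ^ 2 = 2 * V], which
     covers the oscillation of [v]. *)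
  set (K := 2 * V / e ^ 2).
  assert (HK : K * e ^ 2 = 2 * V) by (unfold K; field; lra).
  assert (HK0 : 0 <= K) by (unfold K; apply Rmult_le_pos; [lra| left; apply Rinv_0_lt_compat; nra]).
  assert (He1 : e <= (t2 - t1) / 2) by apply Rmin_l.
  assert (He2 : e <= (y2 - y1) / 2) by apply Rmin_r.
  destruct (visc_interior_min t1 t2 (Xmin + y1) (Xmin + y2) 0 (- K) 0 (- K) tm xm tm xm)
    as (t' & x' & Ht' & Hx' & HG & _); try (unfold tm, xm; lra).
  { intros s y Hs Hy Hbd.
    assert (Hvm := HVb tm xm ltac:(unfold tm; lra) ltac:(unfold xm; lra)).
    assert (Hvs := HVb s y ltac:(lra) ltac:(lra)).
    apply Rabs_le_between in Hvm. apply Rabs_le_between in Hvs.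
    assert (e ^ 2 <= (s - tm) ^ 2 \/ e ^ 2 <= (y - xm) ^ 2) as [Hq|Hq].
    { unfold tm, xm; destruct Hbd as [-> | [-> | [-> | ->]]]; [left|left|right|right]; nra. }
    - pose proof (pow2_ge_0 (y - xm)). unfold quad. nra.
    - pose proof (pow2_ge_0 (s - tm)). unfold quad. nra. }
  assert (v t' x' < g t' x'); [|lra].
  apply Hneg; try lra; apply Rabs_def1; lra.
Qed.

End Viscosity.

(** * Classical solutions off the curves *)

Lemma MVT_abs_ball (f df : R -> R) (c z K : R) :
  (forall y, Rabs (y - c) <= Rabs (z - c) -> is_derive f y (df y) /\ Rabs (df y) <= K) ->
  Rabs (f z - f c) <= K * Rabs (z - c).
Proof.
  intros H.
  assert (Hc : forall a b, (forall y, a <= y <= b -> Rabs (y - c) <= Rabs (z - c)) ->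
    a <= b -> Rabs (f b - f a) <= K * (b - a)).
  { intros a b Hab Hle. apply MVT_abs_le with df; auto.
    - intros x Hx; apply H, Hab; lra.
    - apply continuous_cont_on. intros x Hx. apply (ex_derive_continuous f x).
      eexists. apply H, Hab; auto.
    - intros x Hx; apply H, Hab; lra. }
  destruct (Rle_dec c z).
  - rewrite (Rabs_right (z - c)) by lra. apply Hc; auto.
    intros y Hy. rewrite !Rabs_right; lra.
  - rewrite (Rabs_left (z - c)) by lra.
    replace (f z - f c) with (- (f c - f z)) by ring. rewrite Rabs_Ropp.
    replace (- (z - c)) with (c - z) by ring. apply Hc; [|lra].
    intros y Hy. rewrite !Rabs_left1; lra.
Qed.

Lemma O_eps_open (T Xmin Xmax : R) (p : nat) (y : nat -> R -> R) (eps t0 x0 : R) :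
  0 <= eps ->
  (forall i, (i < p)%nat -> cont_on 0 T (y i)) -> O_eps T Xmin Xmax p y eps t0 x0 ->
  exists d, 0 < d /\ forall t x, Rabs (t - t0) < d -> Rabs (x - x0) < d ->
    O_eps T Xmin Xmax p y eps t x.
Proof.
  intros He0 Hy (Ht & Hx & Hn).
  assert (Hi : exists d, 0 < d /\ forall t x, Rabs (t - t0) < d -> Rabs (x - x0) < d ->
    0 <= t <= T -> forall i, (i < p)%nat -> x <> y i t).
  { clear Hx. induction p as [|p IH].
    - exists 1; split; [lra|]. intros; lia.
    - destruct IH as [d [Hd IH]].
      { intros; apply Hy; lia. } { intros; apply Hn; lia. }
      assert (Hne := Hn p ltac:(lia)).
      assert (Hgap : 0 < Rabs (x0 - y p t0)) by (apply Rabs_pos_lt; lra).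
      destruct (Hy p ltac:(lia) t0 ltac:(lra) (Rabs (x0 - y p t0) / 2) ltac:(lra)) as [e [He H]].
      exists (Rmin d (Rmin e (Rabs (x0 - y p t0) / 2))). split.
      { repeat apply Rmin_pos; lra. }
      intros t x H1 H2 Ht' i Hi.
      pose proof (Rmin_l d (Rmin e (Rabs (x0 - y p t0) / 2))).
      pose proof (Rmin_r d (Rmin e (Rabs (x0 - y p t0) / 2))).
      pose proof (Rmin_l e (Rabs (x0 - y p t0) / 2)).
      pose proof (Rmin_r e (Rabs (x0 - y p t0) / 2)).
      destruct (Nat.eq_dec i p) as [->|Nip].
      + intro E. specialize (H t Ht' ltac:(lra)).
        assert (Rabs (x0 - y p t0) < Rabs (x0 - y p t0)); [|lra].
        replace (x0 - y p t0) with ((y p t - y p t0) + - (x - x0)) at 1 by lra.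
        eapply Rle_lt_trans; [apply Rabs_triang|]. rewrite Rabs_Ropp. lra.
      + apply IH; auto; try lra; lia. }
  destruct Hi as [d [Hd Hi]].
  pose (e := Rmin (Rmin (t0 - eps) (T - t0)) (Rmin (x0 - Xmin) (Xmax - x0))).
  assert (He : 0 < e) by (unfold e; repeat apply Rmin_pos; lra).
  assert (E1 : e <= t0 - eps /\ e <= T - t0 /\ e <= x0 - Xmin /\ e <= Xmax - x0).
  { unfold e.
    pose proof (Rmin_l (Rmin (t0 - eps) (T - t0)) (Rmin (x0 - Xmin) (Xmax - x0))).
    pose proof (Rmin_r (Rmin (t0 - eps) (T - t0)) (Rmin (x0 - Xmin) (Xmax - x0))).
    pose proof (Rmin_l (t0 - eps) (T - t0)). pose proof (Rmin_r (t0 - eps) (T - t0)).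
    pose proof (Rmin_l (x0 - Xmin) (Xmax - x0)). pose proof (Rmin_r (x0 - Xmin) (Xmax - x0)).
    lra. }
  exists (Rmin d e); split. { apply Rmin_pos; auto. }
  intros t x H1 H2. pose proof (Rmin_l d e). pose proof (Rmin_r d e).
  assert (A1 := Rabs_def2 _ _ H1). assert (A2 := Rabs_def2 _ _ H2).
  repeat split; try lra. intros i Hi'. apply Hi; auto; lra.
Qed.

Lemma dt_opp (w : R -> R -> R) : dt (fun t x => - w t x) = fun t x => - dt w t x.
Proof.
  apply functional_extensionality; intro t; apply functional_extensionality; intro x.
  unfold dt. apply (Derive_opp (fun s => w s x)).
Qed.

Lemma dx_opp (w : R -> R -> R) : dx (fun t x => - w t x) = fun t x => - dx w t x.
Proof.
  apply functional_extensionality; intro t; apply functional_extensionality; intro x.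
  unfold dx. apply (Derive_opp (fun z => w t z)).
Qed.

Lemma C23_on_opp (T Xmin Xmax : R) (p : nat) (y : nat -> R -> R) (w : R -> R -> R) :
  C23_on T Xmin Xmax p y w -> C23_on T Xmin Xmax p y (fun t x => - w t x).
Proof.
  intros H t x Ho. rewrite !dt_opp, !dx_opp.
  destruct (H t x Ho) as (D1 & D2 & D3 & D4 & D5 & D6 & D7 & D8 & D9 & D10 & D11).
  repeat split; try (apply continuity_2d_pt_opp; assumption).
  - apply (ex_derive_opp (fun s => w s x)); auto.
  - apply (ex_derive_opp (fun s => dt w s x)); auto.
  - apply (ex_derive_opp (fun z => w t z)); auto.
  - apply (ex_derive_opp (fun z => dx w t z)); auto.
  - apply (ex_derive_opp (fun z => dx (dx w) t z)); auto.
Qed.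

Lemma cont_box_seq (t1 t2 x1 x2 t0 x0 : R) (F : R -> R -> R) (s z : nat -> R) :
  cont_box t1 t2 x1 x2 F -> t1 <= t0 <= t2 -> x1 <= x0 <= x2 ->
  (forall n, t1 <= s n <= t2) -> (forall n, x1 <= z n <= x2) ->
  is_lim_seq s t0 -> is_lim_seq z x0 -> is_lim_seq (fun n => F (s n) (z n)) (F t0 x0).
Proof.
  intros HF Ht Hx Hs Hz Ls Lz. apply is_lim_seq_spec. intros eps.
  destruct (HF t0 x0 Ht Hx eps (cond_pos eps)) as [d [Hd H]].
  apply is_lim_seq_spec in Ls. apply is_lim_seq_spec in Lz.
  destruct (Ls (mkposreal d Hd)) as [N1 H1]. destruct (Lz (mkposreal d Hd)) as [N2 H2].
  exists (max N1 N2). intros n Hn. apply H; auto.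
  - apply H1; lia.
  - apply H2; lia.
Qed.

Lemma is_lim_seq_inv_n : is_lim_seq (fun n => / (INR n + 1)) 0.
Proof.
  replace (Finite 0) with (Rbar_inv p_infty) by reflexivity.
  apply is_lim_seq_inv; [|discriminate].
  apply is_lim_seq_plus with p_infty 1; [apply is_lim_seq_INR | apply is_lim_seq_const |].
  reflexivity.
Qed.

Lemma inv_n_pos (n : nat) : 0 < / (INR n + 1).
Proof. apply Rinv_0_lt_compat. pose proof (pos_INR n); lra. Qed.

Lemma is_lim_seq_dist (u e : nat -> R) (l : R) :
  (forall n, Rabs (u n - l) <= e n) -> is_lim_seq e 0 -> is_lim_seq u l.
Proof.
  intros H He. apply is_lim_seq_spec. intros eps.
  apply is_lim_seq_spec in He. destruct (He eps) as [N HN].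
  exists N. intros n Hn. specialize (HN n Hn). rewrite Rminus_0_r in HN.
  eapply Rle_lt_trans; [apply H|]. eapply Rle_lt_trans; [apply Rle_abs|]. auto.
Qed.

Section Regular.
Context (T Xmin Xmax : R) (p : nat) (y : nat -> R -> R) (w : R -> R -> R).
Context (Hy : forall i, (i < p)%nat -> cont_on 0 T (y i)).
Context (HC : C23_on T Xmin Xmax p y w).

Lemma C23_dt (t x : R) : O_eps T Xmin Xmax p y 0 t x ->
  is_derive (fun s => w s x) t (dt w t x).
Proof. intros H. destruct (HC t x H) as (D & _). exact (Derive_correct _ _ D). Qed.

Lemma C23_dtt (t x : R) : O_eps T Xmin Xmax p y 0 t x ->
  is_derive (fun s => dt w s x) t (dt (dt w) t x).
Proof. intros H. destruct (HC t x H) as (_ & D & _). exact (Derive_correct _ _ D). Qed.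

Lemma C23_dx (t x : R) : O_eps T Xmin Xmax p y 0 t x ->
  is_derive (fun z => w t z) x (dx w t x).
Proof. intros H. destruct (HC t x H) as (_ & _ & D & _). exact (Derive_correct _ _ D). Qed.

Lemma C23_dxx (t x : R) : O_eps T Xmin Xmax p y 0 t x ->
  is_derive (fun z => dx w t z) x (dx (dx w) t x).
Proof. intros H. destruct (HC t x H) as (_ & _ & _ & D & _). exact (Derive_correct _ _ D). Qed.

Lemma C23_dxxx (t x : R) : O_eps T Xmin Xmax p y 0 t x ->
  is_derive (fun z => dx (dx w) t z) x (dx (dx (dx w)) t x).
Proof. intros H. destruct (HC t x H) as (_ & _ & _ & _ & D & _). exact (Derive_correct _ _ D). Qed.

(** The expansion runs first in time at fixed [x] and then in space at [t0], so no mixed derivative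
    is involved. The parabolic scaling [th <= rho ^ 2] keeps the time error on the box below
    [k * rho ^ 2]. *)
Lemma C23_taylor (t0 x0 k r0 : R) :
  O_eps T Xmin Xmax p y 0 t0 x0 -> 0 < k -> 0 < r0 ->
  exists rho th, 0 < rho <= r0 /\ 0 < th <= r0 /\ th <= rho ^ 2 /\
    forall t x, Rabs (t - t0) <= th -> Rabs (x - x0) <= rho ->
      Rabs (w t x - (w t0 x0 + dt w t0 x0 * (t - t0) + dx w t0 x0 * (x - x0)
                     + dx (dx w) t0 x0 / 2 * (x - x0) ^ 2))
        <= k * Rabs (t - t0) + k * (x - x0) ^ 2.
Proof.
  intros HO Hk Hr0.
  destruct (O_eps_open _ _ _ _ _ _ _ _ (Rle_refl 0) Hy HO) as [d [Hd Hopen]].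
  destruct (HC t0 x0 HO) as (_ & _ & _ & _ & _ & _ & Ct & _ & _ & Cxx & _).
  destruct (Ct (mkposreal k Hk)) as [[d1 Hd1] H1].
  destruct (Cxx (mkposreal k Hk)) as [[d2 Hd2] H2]. simpl in H1, H2.
  set (rho := Rmin r0 (Rmin d (Rmin d1 d2)) / 2).
  assert (Hm : 0 < Rmin r0 (Rmin d (Rmin d1 d2))) by (repeat apply Rmin_pos; lra).
  assert (Hrho : 0 < rho) by (unfold rho; lra).
  assert (R1 : rho < r0 /\ rho < d /\ rho < d1 /\ rho < d2).
  { unfold rho. pose proof (Rmin_l r0 (Rmin d (Rmin d1 d2))).
    pose proof (Rmin_r r0 (Rmin d (Rmin d1 d2))). pose proof (Rmin_l d (Rmin d1 d2)).
    pose proof (Rmin_r d (Rmin d1 d2)). pose proof (Rmin_l d1 d2). pose proof (Rmin_r d1 d2).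
    lra. }
  exists rho, (Rmin rho (rho ^ 2)).
  pose proof (Rmin_l rho (rho ^ 2)). pose proof (Rmin_r rho (rho ^ 2)).
  split; [lra|]. split. { split; [apply Rmin_pos; nra | lra]. }
  split; [lra|].
  intros t x Ht Hx.
  assert (Z : Rabs (t0 - t0) = 0) by (rewrite Rminus_diag; apply Rabs_R0).
  assert (A : Rabs ((w t x - dt w t0 x0 * t) - (w t0 x - dt w t0 x0 * t0)) <= k * Rabs (t - t0)).
  { apply (MVT_abs_ball (fun s => w s x - dt w t0 x0 * s) (fun s => dt w s x - dt w t0 x0)).
    intros s Hs. split.
    - apply (is_derive_minus (fun s => w s x) (fun s => dt w t0 x0 * s)).
      + apply C23_dt, Hopen; lra.
      + auto_derive; auto. ring.
    - left. apply H1; lra. }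
  assert (B0 : forall z, Rabs (z - x0) <= rho ->
    Rabs ((dx w t0 z - dx (dx w) t0 x0 * z) - (dx w t0 x0 - dx (dx w) t0 x0 * x0))
      <= k * Rabs (z - x0)).
  { intros z Hz.
    apply (MVT_abs_ball (fun z => dx w t0 z - dx (dx w) t0 x0 * z)
       (fun z => dx (dx w) t0 z - dx (dx w) t0 x0)).
    intros s Hs. split.
    - apply (is_derive_minus (fun z => dx w t0 z) (fun z => dx (dx w) t0 x0 * z)).
      + apply C23_dxx, Hopen; lra.
      + auto_derive; auto. ring.
    - left. apply H2; lra. }
  assert (B : Rabs ((w t0 x - dx w t0 x0 * (x - x0) - dx (dx w) t0 x0 / 2 * (x - x0) ^ 2)
                - (w t0 x0 - dx w t0 x0 * (x0 - x0) - dx (dx w) t0 x0 / 2 * (x0 - x0) ^ 2))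
              <= (k * Rabs (x - x0)) * Rabs (x - x0)).
  { apply (MVT_abs_ball
      (fun z => w t0 z - dx w t0 x0 * (z - x0) - dx (dx w) t0 x0 / 2 * (z - x0) ^ 2)
      (fun z => dx w t0 z - dx w t0 x0 - dx (dx w) t0 x0 * (z - x0))).
    intros s Hs. split.
    - apply is_derive_ext with
        (fun z => w t0 z - (dx w t0 x0 * (z - x0) + dx (dx w) t0 x0 / 2 * (z - x0) ^ 2)).
      { intros; simpl; ring. }
      replace (dx w t0 s - dx w t0 x0 - dx (dx w) t0 x0 * (s - x0)) with
        (dx w t0 s - (dx w t0 x0 + dx (dx w) t0 x0 * (s - x0))) by ring.
      apply (is_derive_minus (fun z => w t0 z)).
      + apply C23_dx, Hopen; lra.
      + auto_derive; auto. field.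
    - replace (dx w t0 s - dx w t0 x0 - dx (dx w) t0 x0 * (s - x0)) with
        ((dx w t0 s - dx (dx w) t0 x0 * s) - (dx w t0 x0 - dx (dx w) t0 x0 * x0)) by ring.
      eapply Rle_trans; [apply B0; lra|]. apply Rmult_le_compat_l; lra. }
  assert (Hsq : Rabs (x - x0) * Rabs (x - x0) = (x - x0) ^ 2).
  { rewrite <- Rabs_mult, Rabs_right; [ring | apply Rle_ge, Rle_0_sqr]. }
  replace (k * Rabs (x - x0) * Rabs (x - x0)) with (k * (x - x0) ^ 2) in B
    by (rewrite <- Hsq; ring).
  replace (w t x - (w t0 x0 + dt w t0 x0 * (t - t0) + dx w t0 x0 * (x - x0)
                     + dx (dx w) t0 x0 / 2 * (x - x0) ^ 2)) with
    (((w t x - dt w t0 x0 * t) - (w t0 x - dt w t0 x0 * t0)) +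
     ((w t0 x - dx w t0 x0 * (x - x0) - dx (dx w) t0 x0 / 2 * (x - x0) ^ 2)
                - (w t0 x0 - dx w t0 x0 * (x0 - x0) - dx (dx w) t0 x0 / 2 * (x0 - x0) ^ 2)))
    by ring.
  eapply Rle_trans; [apply Rabs_triang|]. lra.
Qed.

(** The Taylor polynomial, with its curvature lowered by [O(k)], touches [w] from below near the
    point. Contact points converge to [(t0, x0)] as [k] tends to [0], and all terms of the
    inequality are continuous. *)
Lemma box_super_classical (a b r F : R -> R -> R) (Om : R -> R -> Prop) (t0 x0 d0 : R) :
  cont_box 0 T Xmin Xmax a -> cont_box 0 T Xmin Xmax b -> cont_box 0 T Xmin Xmax r ->
  cont_box 0 T Xmin Xmax F -> cont_box 0 T Xmin Xmax w ->
  box_super T Xmin Xmax a b r w F Om ->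
  O_eps T Xmin Xmax p y 0 t0 x0 -> 0 < d0 ->
  (forall t x, Rabs (t - t0) < d0 -> Rabs (x - x0) < d0 -> Om t x) ->
  F t0 x0 <= dt w t0 x0 - a t0 x0 * dx (dx w) t0 x0 + b t0 x0 * dx w t0 x0 + r t0 x0 * w t0 x0.
Proof.
  intros Ca Cb Cr CF Cw Hsup HO Hd0 HOm.
  assert (HO' := HO). destruct HO' as (Ht0 & Hx0 & _).
  set (e := Rmin (d0 / 2) (Rmin (Rmin (t0 / 2) ((T - t0) / 2)) (Rmin ((x0 - Xmin) / 2) ((Xmax - x0) / 2)))).
  assert (He : 0 < e) by (unfold e; repeat apply Rmin_pos; lra).
  assert (E1 : e <= d0 / 2 /\ e <= t0 / 2 /\ e <= (T - t0) / 2 /\ e <= (x0 - Xmin) / 2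
               /\ e <= (Xmax - x0) / 2).
  { unfold e.
    pose proof (Rmin_l (d0 / 2) (Rmin (Rmin (t0 / 2) ((T - t0) / 2)) (Rmin ((x0 - Xmin) / 2) ((Xmax - x0) / 2)))).
    pose proof (Rmin_r (d0 / 2) (Rmin (Rmin (t0 / 2) ((T - t0) / 2)) (Rmin ((x0 - Xmin) / 2) ((Xmax - x0) / 2)))).
    pose proof (Rmin_l (Rmin (t0 / 2) ((T - t0) / 2)) (Rmin ((x0 - Xmin) / 2) ((Xmax - x0) / 2))).
    pose proof (Rmin_r (Rmin (t0 / 2) ((T - t0) / 2)) (Rmin ((x0 - Xmin) / 2) ((Xmax - x0) / 2))).
    pose proof (Rmin_l (t0 / 2) ((T - t0) / 2)). pose proof (Rmin_r (t0 / 2) ((T - t0) / 2)).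
    pose proof (Rmin_l ((x0 - Xmin) / 2) ((Xmax - x0) / 2)).
    pose proof (Rmin_r ((x0 - Xmin) / 2) ((Xmax - x0) / 2)). lra. }
  set (wt := dt w t0 x0). set (wx := dx w t0 x0). set (wxx := dx (dx w) t0 x0).
  assert (Hn : forall n, exists tx : R * R,
    (Rabs (fst tx - t0) <= e /\ Rabs (fst tx - t0) <= / (INR n + 1)) /\
    (Rabs (snd tx - x0) <= e /\ Rabs (snd tx - x0) <= / (INR n + 1)) /\
    F (fst tx) (snd tx) <= wt + 4 * / (INR n + 1)
       - a (fst tx) (snd tx) * (wxx - 4 * / (INR n + 1))
       + b (fst tx) (snd tx) * (wx + (wxx - 4 * / (INR n + 1)) * (snd tx - x0))
       + r (fst tx) (snd tx) * w (fst tx) (snd tx)).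
  { intros n. set (k := / (INR n + 1)). assert (Hk : 0 < k) by apply inv_n_pos.
    destruct (C23_taylor t0 x0 k (Rmin e k) HO Hk) as (rho & th & Hrho & Hth & Hle & HT).
    { apply Rmin_pos; auto. }
    pose proof (Rmin_l e k). pose proof (Rmin_r e k).
    assert (Hkt : k / th * th = k) by (field; lra).
    assert (Hkt0 : 0 < k / th) by (apply Rdiv_lt_0_compat; lra).
    (* The time coefficient [- 2 k / th] is large, but on a box of half-height [th] it changes the
       time derivative by at most [4 k]. *)
    destruct (Hsup (t0 - th) (t0 + th) (x0 - rho) (x0 + rho) wt (- (2 * (k / th))) wx
      (wxx / 2 - 2 * k) t0 x0 t0 x0) as (t & x & Ht & Hx & HF); try lra.
    { intros t x Ht Hx. apply HOm; apply Rabs_def1; lra. }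
    { intros t x Ht Hx Hbd.
      assert (Ha : Rabs (t - t0) <= th) by (apply Rabs_le; lra).
      assert (Hb : Rabs (x - x0) <= rho) by (apply Rabs_le; lra).
      specialize (HT t x Ha Hb). fold wt wx wxx in HT. apply Rabs_le_between in HT.
      unfold quad. rewrite !Rminus_diag.
      assert (Hbig : k * Rabs (t - t0) <= k * (x - x0) ^ 2 + 2 * (k / th) * (t - t0) ^ 2).
      { assert (Hsq : (t - t0) ^ 2 = Rabs (t - t0) ^ 2) by (rewrite pow2_abs; auto).
        assert (Htt : Rabs (t - t0) = th \/ (x - x0) ^ 2 = rho ^ 2).
        { destruct Hbd as [-> | [-> | [-> | ->]]].
          - left. rewrite Rabs_left; lra.
          - left. rewrite Rabs_right; lra.
          - right; ring.
          - right; ring. }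
        pose proof (pow2_ge_0 (x - x0)). pose proof (pow2_ge_0 (t - t0)).
        destruct Htt as [E|E].
        - rewrite Hsq, E. replace (2 * (k / th) * th ^ 2) with (2 * (k * th)) by (field; lra).
          nra.
        - rewrite E.
          apply Rle_trans with (k * rho ^ 2).
          + apply Rmult_le_compat_l; lra.
          + assert (0 <= 2 * (k / th) * (t - t0) ^ 2) by (apply Rmult_le_pos; lra). lra. }
      simpl in *. lra. }
    exists (t, x); simpl.
    split. { split; apply Rabs_le; lra. }
    split. { split; apply Rabs_le; lra. }
    eapply Rle_trans; [apply HF|].
    assert (wt + 2 * - (2 * (k / th)) * (t - t0) <= wt + 4 * k).
    { assert (- th <= t - t0) by lra. nra. }
    replace (2 * (wxx / 2 - 2 * k)) with (wxx - 4 * k) by field. lra. }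
  apply choice in Hn. destruct Hn as [tx Htx].
  set (k := fun n => / (INR n + 1)).
  assert (Lk : is_lim_seq k 0) by apply is_lim_seq_inv_n.
  assert (Lt : is_lim_seq (fun n => fst (tx n)) t0).
  { apply is_lim_seq_dist with k; auto. intros n. apply Htx. }
  assert (Lx : is_lim_seq (fun n => snd (tx n)) x0).
  { apply is_lim_seq_dist with k; auto. intros n. apply Htx. }
  assert (Bt : forall n, 0 <= fst (tx n) <= T).
  { intros n. destruct (Htx n) as ((H & _) & _). apply Rabs_le_between in H. lra. }
  assert (Bx : forall n, Xmin <= snd (tx n) <= Xmax).
  { intros n. destruct (Htx n) as (_ & (H & _) & _). apply Rabs_le_between in H. lra. }
  assert (LS : forall G, cont_box 0 T Xmin Xmax G ->
    is_lim_seq (fun n => G (fst (tx n)) (snd (tx n))) (G t0 x0)).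
  { intros G HG. apply (cont_box_seq 0 T Xmin Xmax); auto; lra. }
  assert (Lrhs : is_lim_seq (fun n => wt + 4 * k n
       - a (fst (tx n)) (snd (tx n)) * (wxx - 4 * k n)
       + b (fst (tx n)) (snd (tx n)) * (wx + (wxx - 4 * k n) * (snd (tx n) - x0))
       + r (fst (tx n)) (snd (tx n)) * w (fst (tx n)) (snd (tx n)))
     (wt + 4 * 0 - a t0 x0 * (wxx - 4 * 0) + b t0 x0 * (wx + (wxx - 4 * 0) * (x0 - x0))
        + r t0 x0 * w t0 x0)).
  { assert (Lm : is_lim_seq (fun n => wxx - 4 * k n) (wxx - 4 * 0)).
    { apply is_lim_seq_minus'; [apply is_lim_seq_const|].
      apply (is_lim_seq_mult' (fun _ => 4)); [apply is_lim_seq_const | auto]. }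
    apply is_lim_seq_plus'; [apply is_lim_seq_plus'; [apply is_lim_seq_minus'|]|].
    - apply is_lim_seq_plus'; [apply is_lim_seq_const|].
      apply (is_lim_seq_mult' (fun _ => 4)); [apply is_lim_seq_const | auto].
    - apply is_lim_seq_mult'; auto.
    - apply is_lim_seq_mult'; auto. apply is_lim_seq_plus'; [apply is_lim_seq_const|].
      apply is_lim_seq_mult'; auto. apply is_lim_seq_minus'; auto. apply is_lim_seq_const.
    - apply is_lim_seq_mult'; auto. }
  assert (H := is_lim_seq_le _ _ _ _ (fun n => proj2 (proj2 (Htx n))) (LS F CF) Lrhs).
  simpl in H. eapply Rle_trans; [apply H|]. right; ring.
Qed.

End Regular.

Lemma cont_on_abs_limit (a b x B : R) (f : R -> R) :
  cont_on a b f -> a <= x <= b ->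
  (forall e, 0 < e -> exists z, a <= z <= b /\ Rabs (z - x) < e /\ Rabs (f z) <= B) ->
  Rabs (f x) <= B.
Proof.
  intros Hf Hx H. apply Rnot_lt_le; intro Hlt.
  destruct (Hf x Hx (Rabs (f x) - B) ltac:(lra)) as [d [Hd Hc]].
  destruct (H d Hd) as (z & Hz & Hzx & HB).
  specialize (Hc z Hz Hzx).
  assert (Rabs (f x) <= Rabs (f z) + Rabs (f z - f x)); [|lra].
  replace (f x) with (f z + - (f z - f x)) at 1 by ring.
  eapply Rle_trans; [apply Rabs_triang|]. rewrite Rabs_Ropp; lra.
Qed.

(** The hypothesis compares neighbouring chord slopes, cleared of denominators. In this form it
    carries a slope bound from one interval to the next, even if the latter is empty. *)
Lemma slope_right (w1 w2 w3 x1 x2 x3 M S : R) :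
  Rabs ((w3 - w2) * (x2 - x1) - (w2 - w1) * (x3 - x2)) <= M * (x3 - x1) * (x3 - x2) * (x2 - x1) ->
  Rabs (w2 - w1) <= S * (x2 - x1) -> x1 < x2 -> x2 <= x3 -> Rabs (w3 - w2) <= (S + M * (x3 - x1)) * (x3 - x2).
Proof.
  intros H HS H1 H2.
  apply Rabs_le_between in H. apply Rabs_le_between in HS.
  apply Rabs_le. split; apply Rmult_le_reg_r with (x2 - x1); try lra; nra.
Qed.

Lemma slope_left (w1 w2 w3 x1 x2 x3 M S : R) :
  Rabs ((w3 - w2) * (x2 - x1) - (w2 - w1) * (x3 - x2)) <= M * (x3 - x1) * (x3 - x2) * (x2 - x1) ->
  Rabs (w3 - w2) <= S * (x3 - x2) -> x1 <= x2 -> x2 < x3 -> Rabs (w2 - w1) <= (S + M * (x3 - x1)) * (x2 - x1).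
Proof.
  intros H HS H1 H2.
  apply Rabs_le_between in H. apply Rabs_le_between in HS.
  apply Rabs_le. split; apply Rmult_le_reg_r with (x3 - x2); try lra; nra.
Qed.

(** * Exclusion of convex kinks *)

Section Kink.
Context (w : R -> R -> R) (Y : R -> R) (t1 z k0 d M p ka : R).
Context (Hk0 : 0 < k0) (Hd : 0 < d) (HM : 0 < M) (Hka : 0 < ka).
Context (HY : cont_on (t1 - k0) (t1 + k0) Y) (HYz : Y t1 = z).
Context (Hw : cont_box (t1 - k0) (t1 + k0) (z - d) (z + d) w).
Context (Htime : forall x s t, z - d <= x <= z + d -> t1 - k0 <= s -> s <= t -> t <= t1 + k0 ->
  (forall u, s <= u <= t -> Y u <> x) -> Rabs (w t x - w s x) <= M * (t - s)).
Context (Hspace : forall t x1 x2 x3, t1 - k0 <= t <= t1 + k0 ->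
  z - d <= x1 -> x1 <= x2 -> x2 <= x3 -> x3 <= z + d -> (Y t <= x1 \/ x3 <= Y t) ->
  Rabs ((w t x3 - w t x2) * (x2 - x1) - (w t x2 - w t x1) * (x3 - x2))
    <= M * (x3 - x1) * (x3 - x2) * (x2 - x1)).
Context (Hkink : forall x, z - d <= x <= z + d -> w t1 z + p * (x - z) + ka * Rabs (x - z) <= w t1 x).

(* The values of [w] away from the curve change little in time, so a curve at distance [D]
   from [z] would place a kink of slope [ka] where [w ts] is still smooth. *)
Lemma curve_slow_core (ts D k : R) :
  0 < D -> 2 * D <= d -> 10 * M * D <= ka -> t1 - k0 <= ts <= t1 + k0 ->
  (Y ts = z + D \/ Y ts = z - D) ->
  (forall x, z - d <= x <= z + d -> D <= Rabs (x - z) -> Rabs (w ts x - w t1 x) <= M * k) ->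
  D <= 6 * M / ka * k.
Proof.
  intros HD HDd HDk Hts HYt Hu.
  (* If the curve is at [z + D], then at time [ts] the slopes over [[z - 2 D, z - D]] and
     [[z - D, z + D]] differ little, although at time [t1] the second interval contains the kink;
     each value involved moved by at most [M k]. By [10 M D <= ka] the quadratic term takes only
     half of [ka D], whence the factor [6]. *)
  assert (Hmain : ka * D <= 5 * M * D ^ 2 + 3 * (M * k)).
  { assert (K1 := Hkink (z + D) ltac:(lra)). assert (K2 := Hkink (z - D) ltac:(lra)).
    replace (z + D - z) with D in K1 by ring. replace (z - D - z) with (- D) in K2 by ring.
    rewrite Rabs_Ropp in K2. rewrite Rabs_right in K1, K2 by lra.
    destruct HYt as [E|E].
    - assert (U1 := Hu (z + D) ltac:(lra) ltac:(rewrite Rabs_right; lra)).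
      assert (U2 := Hu (z - D) ltac:(lra) ltac:(rewrite Rabs_left; lra)).
      assert (U3 := Hu (z - 2 * D) ltac:(lra) ltac:(rewrite Rabs_left; lra)).
      assert (S1 := Hspace ts (z - 2 * D) (z - D) (z + D) Hts
        ltac:(lra) ltac:(lra) ltac:(lra) ltac:(lra) ltac:(lra)).
      assert (S2 := Hspace t1 (z - 2 * D) (z - D) z ltac:(lra)
        ltac:(lra) ltac:(lra) ltac:(lra) ltac:(lra) ltac:(lra)).
      apply Rabs_le_between in U1, U2, U3, S1, S2.
      replace (z - D - (z - 2 * D)) with D in S1, S2 by ring.
      replace (z + D - (z - D)) with (2 * D) in S1 by ring.
      replace (z + D - (z - 2 * D)) with (3 * D) in S1 by ring.
      replace (z - (z - D)) with D in S2 by ring.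
      replace (z - (z - 2 * D)) with (2 * D) in S2 by ring.
      apply Rmult_le_reg_r with D; auto. nra.
    - assert (U1 := Hu (z - D) ltac:(lra) ltac:(rewrite Rabs_left; lra)).
      assert (U2 := Hu (z + D) ltac:(lra) ltac:(rewrite Rabs_right; lra)).
      assert (U3 := Hu (z + 2 * D) ltac:(lra) ltac:(rewrite Rabs_right; lra)).
      assert (S1 := Hspace ts (z - D) (z + D) (z + 2 * D) Hts
        ltac:(lra) ltac:(lra) ltac:(lra) ltac:(lra) ltac:(lra)).
      assert (S2 := Hspace t1 z (z + D) (z + 2 * D) ltac:(lra)
        ltac:(lra) ltac:(lra) ltac:(lra) ltac:(lra) ltac:(lra)).
      apply Rabs_le_between in U1, U2, U3, S1, S2.
      replace (z + 2 * D - (z + D)) with D in S1, S2 by ring.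
      replace (z + D - (z - D)) with (2 * D) in S1 by ring.
      replace (z + 2 * D - (z - D)) with (3 * D) in S1 by ring.
      replace (z + D - z) with D in S2 by ring.
      replace (z + 2 * D - z) with (2 * D) in S2 by ring.
      apply Rmult_le_reg_r with D; auto. nra. }
  apply Rmult_le_reg_l with ka; auto.
  replace (ka * (6 * M / ka * k)) with (6 * (M * k)) by (field; lra). nra.
Qed.

(** Let [D] be the largest distance of the curve from [z] between [t1] and [t], and [k] the elapsed
    time. Farther than [D] from [z] no curve is crossed and [w] changes by at most [M k]; nearer,
    the comparison goes through [z + D] by the Lipschitz bound in space on both slices. As
    [D = O(k)] by [curve_slow_core], both costs are linear in [k]. *)
Lemma kink_time_lipschitz :
  exists C k1 d1, 0 < C /\ 0 < k1 <= k0 /\ 0 < d1 <= d /\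
    forall t x, Rabs (t - t1) <= k1 -> Rabs (x - z) <= d1 ->
      w t1 x - C * Rabs (t - t1) <= w t x.
Proof.
  destruct (cont_box_bounded _ _ _ _ _ Hw) as [V [HV HVb]].
  (* Small enough for the two size conditions [2 * D <= d] and [10 * M * D <= ka] of
     [curve_slow_core]. *)
  set (de := Rmin (d / 4) (ka / (10 * M))).
  assert (Hde : 0 < de).
  { apply Rmin_pos; [lra|]. apply Rdiv_lt_0_compat; lra. }
  assert (Hde1 : de <= d / 4) by apply Rmin_l.
  assert (Hde2 : 10 * M * de <= ka).
  { assert (de <= ka / (10 * M)) by apply Rmin_r.
    apply Rle_trans with (10 * M * (ka / (10 * M))); [apply Rmult_le_compat_l; lra|].
    right; field; lra. }
  destruct (HY t1 ltac:(lra) de Hde) as [k1' [Hk1' Hclose]].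
  set (k1 := Rmin k0 (k1' / 2)).
  assert (Hk1 : 0 < k1) by (apply Rmin_pos; lra).
  assert (Hk1a : k1 <= k0) by apply Rmin_l.
  assert (Hk1b : k1 <= k1' / 2) by apply Rmin_r.
  assert (HYc : forall t, Rabs (t - t1) <= k1 -> Rabs (Y t - z) <= de).
  { intros t Ht. assert (Ht' := Ht). apply Rabs_le_between in Ht'. rewrite <- HYz.
    left; apply Hclose; lra. }
  (* Over a reference interval of length [d / 2] away from the curve the slope is at most [4 V / d],
     because [|w| <= V]; two transfers towards the curve add at most [4 M d]. *)
  set (S := 4 * V / d + 4 * M * d).
  assert (HS0 : 0 < S).
  { unfold S. assert (0 < 4 * V / d) by (apply Rdiv_lt_0_compat; lra). nra. }
  assert (HLip : forall t x x', Rabs (t - t1) <= k1 -> z - d / 4 <= x -> x <= x' -> x' <= z + d / 4 ->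
    Rabs (w t x' - w t x) <= S * (x' - x)).
  { intros t x x' Ht Hx Hxx Hx'.
    assert (HYt := HYc t Ht). apply Rabs_le_between in HYt.
    assert (Htk := Ht). apply Rabs_le_between in Htk.
    assert (HVd : 2 * V = 4 * V / d * (d / 2)) by (field; lra).
    assert (HL : forall x x', z - d / 4 <= x -> x <= x' -> x' <= Y t ->
      Rabs (w t x' - w t x) <= S * (x' - x)).
    { intros a b Ha Hab Hb.
      assert (B0 : Rabs (w t (z - d / 2) - w t (z - d)) <= 4 * V / d * ((z - d / 2) - (z - d))).
      { replace ((z - d / 2) - (z - d)) with (d / 2) by field. rewrite <- HVd.
        assert (B1 := HVb t (z - d / 2) ltac:(lra) ltac:(lra)).
        assert (B2 := HVb t (z - d) ltac:(lra) ltac:(lra)).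
        apply Rabs_le_between in B1, B2. apply Rabs_le; lra. }
      assert (B1 := slope_right _ _ _ _ _ _ _ _
        (Hspace t (z - d) (z - d / 2) a ltac:(lra) ltac:(lra) ltac:(lra) ltac:(lra) ltac:(lra)
           ltac:(lra)) B0 ltac:(lra) ltac:(lra)).
      assert (B2 := slope_right _ _ _ _ _ _ _ _
        (Hspace t (z - d / 2) a b ltac:(lra) ltac:(lra) ltac:(lra) ltac:(lra) ltac:(lra)
           ltac:(lra)) B1 ltac:(lra) Hab).
      eapply Rle_trans; [apply B2|]. apply Rmult_le_compat_r; [lra|].
      unfold S. rewrite Rplus_assoc. apply Rplus_le_compat_l.
      rewrite <- Rmult_plus_distr_l, (Rmult_comm 4 M), Rmult_assoc.
      apply Rmult_le_compat_l; lra. }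
    assert (HR : forall x x', x' <= z + d / 4 -> x <= x' -> Y t <= x ->
      Rabs (w t x' - w t x) <= S * (x' - x)).
    { intros a b Ha Hab Hb.
      assert (B0 : Rabs (w t (z + d) - w t (z + d / 2)) <= 4 * V / d * ((z + d) - (z + d / 2))).
      { replace ((z + d) - (z + d / 2)) with (d / 2) by field. rewrite <- HVd.
        assert (B1 := HVb t (z + d / 2) ltac:(lra) ltac:(lra)).
        assert (B2 := HVb t (z + d) ltac:(lra) ltac:(lra)).
        apply Rabs_le_between in B1, B2. apply Rabs_le; lra. }
      assert (B1 := slope_left _ _ _ _ _ _ _ _
        (Hspace t b (z + d / 2) (z + d) ltac:(lra) ltac:(lra) ltac:(lra) ltac:(lra) ltac:(lra)
           ltac:(lra)) B0 ltac:(lra) ltac:(lra)).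
      assert (B2 := slope_left _ _ _ _ _ _ _ _
        (Hspace t a b (z + d / 2) ltac:(lra) ltac:(lra) ltac:(lra) ltac:(lra) ltac:(lra)
           ltac:(lra)) B1 Hab ltac:(lra)).
      eapply Rle_trans; [apply B2|]. apply Rmult_le_compat_r; [lra|].
      unfold S. rewrite Rplus_assoc. apply Rplus_le_compat_l.
      rewrite <- Rmult_plus_distr_l, (Rmult_comm 4 M), Rmult_assoc.
      apply Rmult_le_compat_l; lra. }
    destruct (Rle_dec x' (Y t)). { apply HL; lra. }
    destruct (Rle_dec (Y t) x). { apply HR; lra. }
    assert (A1 := HL x (Y t) ltac:(lra) ltac:(lra) ltac:(lra)).
    assert (A2 := HR (Y t) x' ltac:(lra) ltac:(lra) ltac:(lra)).
    apply Rabs_le_between in A1, A2. apply Rabs_le; lra. }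
  set (C0 := 6 * M / ka). assert (HC0 : 0 < C0) by (apply Rdiv_lt_0_compat; lra).
  exists (M + 4 * S * C0), k1, (d / 4). repeat split; try lra. { nra. }
  intros t x Ht Hx.
  assert (Htk := Ht). apply Rabs_le_between in Htk.
  set (lo := Rmin t t1). set (hi := Rmax t t1).
  assert (Hlh : lo <= t1 <= hi /\ lo <= t <= hi /\ hi - lo = Rabs (t - t1)).
  { unfold lo, hi, Rmin, Rmax, Rabs. destruct Rle_dec, Rcase_abs; lra. }
  destruct Hlh as (Hl1 & Hl2 & Hl3).
  set (k := Rabs (t - t1)) in *.
  destruct (cont_on_min lo hi (fun s => - Rabs (Y s - z))) as (ts & Hts & Hmax); [lra| |].
  { apply cont_on_opp. intros s Hs e He. destruct (HY s ltac:(lra) e He) as [e' [He' H]].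
    exists e'; split; auto. intros u Hu Hus. eapply Rle_lt_trans; [apply Rabs_triang_inv2|].
    replace (Y u - z - (Y s - z)) with (Y u - Y s) by ring. apply H; auto; lra. }
  set (D := Rabs (Y ts - z)) in *.
  assert (HDde : D <= de). { apply HYc. apply Rabs_le; lra. }
  assert (Hfar : forall s u x0, lo <= s <= hi -> lo <= u <= hi -> D < Rabs (x0 - z) ->
    z - d <= x0 <= z + d -> Rabs (w s x0 - w u x0) <= M * k).
  { intros s u x0 Hs Hu HDx Hx0.
    assert (HH : forall s u, lo <= s -> s <= u -> u <= hi -> Rabs (w u x0 - w s x0) <= M * k).
    { intros s' u' A1 A2 A3. apply Rle_trans with (M * (u' - s')).
      - apply Htime; auto; try lra. intros q Hq E. specialize (Hmax q ltac:(lra)).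
        rewrite E in Hmax. lra.
      - apply Rmult_le_compat_l; lra. }
    destruct (Rle_dec s u).
    - rewrite Rabs_minus_sym. apply HH; lra.
    - apply HH; lra. }
  assert (HD0 : 0 <= D) by apply Rabs_pos.
  assert (Hfar' : forall s u x0, lo <= s <= hi -> lo <= u <= hi -> D <= Rabs (x0 - z) ->
    z - d < x0 < z + d -> Rabs (w s x0 - w u x0) <= M * k).
  { intros s u x0 Hs Hu HDx Hx0.
    apply (cont_on_abs_limit (z - d) (z + d) x0 (M * k) (fun x => w s x - w u x)); try lra.
    { apply cont_on_minus; apply (cont_box_space (t1 - k0) (t1 + k0)); auto; lra. }
    intros e He.
    destruct (Rle_dec z x0).
    - set (e' := Rmin (e / 2) ((z + d - x0) / 2)).
      assert (0 < e') by (apply Rmin_pos; lra).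
      assert (e' <= e / 2) by apply Rmin_l. assert (e' <= (z + d - x0) / 2) by apply Rmin_r.
      rewrite Rabs_right in HDx by lra.
      exists (x0 + e'). repeat split; try lra. { apply Rabs_def1; lra. }
      apply Hfar; auto; try lra. rewrite Rabs_right; lra.
    - set (e' := Rmin (e / 2) ((x0 - (z - d)) / 2)).
      assert (0 < e') by (apply Rmin_pos; lra).
      assert (e' <= e / 2) by apply Rmin_l. assert (e' <= (x0 - (z - d)) / 2) by apply Rmin_r.
      rewrite Rabs_left in HDx by lra.
      exists (x0 - e'). repeat split; try lra. { apply Rabs_def1; lra. }
      apply Hfar; auto; try lra. rewrite Rabs_left; lra. }
  assert (HDk : D <= C0 * k).
  { destruct (Req_dec D 0) as [E|E].
    { rewrite E. apply Rmult_le_pos; [lra | apply Rabs_pos]. }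
    apply (curve_slow_core ts D k); try lra.
    - nra.
    - unfold D, Rabs; destruct Rcase_abs; [right|left]; ring.
    - intros x0 Hx0 HDx.
      destruct (Req_dec x0 (z - d)) as [E1|E1]; [|destruct (Req_dec x0 (z + d)) as [E2|E2]].
      + apply Hfar; auto; try lra. rewrite E1, Rabs_left; lra.
      + apply Hfar; auto; try lra. rewrite E2, Rabs_right; lra.
      + apply Hfar'; auto; lra. }
  assert (Hk : 0 <= k) by apply Rabs_pos.
  apply Rabs_le_between in Hx.
  assert (HMS : 0 <= 4 * S * C0 * k) by (apply Rmult_le_pos; [apply Rmult_le_pos; lra | auto]).
  destruct (Rle_dec D (Rabs (x - z))) as [HDx|HDx].
  - assert (H := Hfar' t t1 x Hl2 Hl1 HDx ltac:(lra)). apply Rabs_le_between in H. nra.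
  - assert (HDx' : x - z < D /\ - D < x - z) by (apply Rabs_def2; lra).
    assert (A1 := HLip t x (z + D) Ht ltac:(lra) ltac:(lra) ltac:(lra)).
    assert (A2 := HLip t1 x (z + D) ltac:(rewrite Rminus_diag, Rabs_R0; lra)
      ltac:(lra) ltac:(lra) ltac:(lra)).
    assert (A3 := Hfar' t t1 (z + D) Hl2 Hl1 ltac:(rewrite Rabs_right; lra) ltac:(lra)).
    apply Rabs_le_between in A1, A2, A3.
    assert (S * (z + D - x) <= S * (2 * (C0 * k))) by (apply Rmult_le_compat_l; lra).
    lra.
Qed.

Context (T Xmin Xmax : R) (a b r F : R -> R -> R) (Om : R -> R -> Prop) (eta B : R).
Context (Heta : 0 < eta).
Context (Hin : 0 < t1 - k0 /\ t1 + k0 < T /\ Xmin < z - d /\ z + d < Xmax).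
Context (Hell : forall t x, 0 <= t <= T -> Xmin <= x <= Xmax -> eta <= a t x).
Context (HB : forall t x, 0 <= t <= T -> Xmin <= x <= Xmax ->
  Rabs (b t x) <= B /\ Rabs (r t x * w t x) <= B /\ Rabs (F t x) <= B).
Context (Hsup : box_super T Xmin Xmax a b r w F Om).
Context (HOm : forall t x, t1 - k0 <= t <= t1 + k0 -> z - d <= x <= z + d -> Om t x).

(* By [kink_time_lipschitz] a parabola of arbitrarily large curvature, moving down at a
   bounded speed, touches [w] from below near the kink. *)
Lemma no_convex_kink : False.
Proof.
  destruct kink_time_lipschitz as (C & k1 & d1 & HC & Hk1 & Hd1 & HL).
  assert (HB0 : 0 <= B).
  { destruct (HB t1 z ltac:(lra) ltac:(lra)) as (H & _).
    eapply Rle_trans; [apply Rabs_pos | apply H]. }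
  set (Q := 4 * C + B * (Rabs p + ka) + 2 * B + 1).
  assert (HQ : 0 < Q).
  { unfold Q. pose proof (Rabs_pos p). assert (0 <= B * (Rabs p + ka)) by (apply Rmult_le_pos; lra). lra. }
  (* A parabola with coefficient [A = ka / (2 W)] stays below the kink on a window of half-width
     [W], and [Q * W <= eta * ka] gives [2 * eta * A >= Q]. The constant [Q] exceeds the sum of all
     other terms of the equation by [1]. *)
  set (W := Rmin d1 (eta * ka / Q)).
  assert (HW : 0 < W).
  { apply Rmin_pos; [lra|]. apply Rdiv_lt_0_compat; auto. apply Rmult_lt_0_compat; lra. }
  assert (HW1 : W <= d1) by apply Rmin_l.
  assert (HW2 : Q * W <= eta * ka).
  { apply Rle_trans with (Q * (eta * ka / Q)).
    - apply Rmult_le_compat_l; [lra | apply Rmin_r].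
    - right; field; lra. }
  set (k := Rmin k1 (ka * W / (2 * C))).
  assert (Hk : 0 < k).
  { apply Rmin_pos; [lra|]. apply Rdiv_lt_0_compat; [apply Rmult_lt_0_compat; lra | lra]. }
  assert (Hkk : k <= k1) by apply Rmin_l.
  assert (Hk2 : C * k <= ka * W / 2).
  { apply Rle_trans with (C * (ka * W / (2 * C))).
    - apply Rmult_le_compat_l; [lra | apply Rmin_r].
    - right; field; lra. }
  set (A := ka / (2 * W)).
  assert (HA : A * W = ka / 2) by (unfold A; field; lra).
  assert (HA0 : 0 < A) by (apply Rdiv_lt_0_compat; lra).
  (* The quadratic term in time beats [C |t - t1|] at [|t - t1| = k], while the speed of the
     parabola stays below [2 * K * k = 4 * C], whatever [W] is. *)
  set (K := 2 * C / k).
  assert (HK : K * k = 2 * C) by (unfold K; field; lra).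
  assert (HK0 : 0 < K) by (apply Rdiv_lt_0_compat; lra).
  destruct (Hsup (t1 - k) (t1 + k) (z - W) (z + W) 0 (- K) p A t1 z t1 z)
    as (t & x & Ht & Hx & HF); try lra.
  { intros t x Ht Hx. apply HOm; lra. }
  { intros t x Ht Hx Hbd.
    assert (Ha : Rabs (t - t1) <= k) by (apply Rabs_le; lra).
    assert (Hb : Rabs (x - z) <= W) by (apply Rabs_le; lra).
    assert (H1 := HL t x ltac:(lra) ltac:(lra)).
    assert (H2 := Hkink x ltac:(lra)).
    unfold quad. rewrite !Rminus_diag.
    rewrite <- (pow2_abs (t - t1)), <- (pow2_abs (x - z)).
    assert (Hcase : Rabs (t - t1) = k \/ Rabs (x - z) = W).
    { destruct Hbd as [-> | [-> | [-> | ->]]]; [left|left|right|right].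
      - rewrite Rabs_left; lra.
      - rewrite Rabs_right; lra.
      - rewrite Rabs_left; lra.
      - rewrite Rabs_right; lra. }
    set (al := Rabs (t - t1)) in *. set (be := Rabs (x - z)) in *.
    assert (0 <= al) by apply Rabs_pos. assert (0 <= be) by apply Rabs_pos.
    assert (A * be ^ 2 <= ka / 2 * be).
    { rewrite <- HA. assert (0 <= A * be * (W - be)); [apply Rmult_le_pos; [apply Rmult_le_pos|]; lra | lra]. }
    enough (C * al <= K * al ^ 2 + ka / 2 * be) by lra.
    destruct Hcase as [E|E].
    - rewrite E. replace (K * k ^ 2) with (K * k * k) by ring. rewrite HK. nra.
    - rewrite E. assert (0 <= K * al ^ 2) by (apply Rmult_le_pos; nra). nra. }
  destruct (HB t x ltac:(lra) ltac:(lra)) as (B1 & B2 & B3).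
  assert (E1 := Hell t x ltac:(lra) ltac:(lra)).
  assert (Hx1 : Rabs (p + 2 * A * (x - z)) <= Rabs p + ka).
  { eapply Rle_trans; [apply Rabs_triang|]. apply Rplus_le_compat_l.
    rewrite Rabs_mult, (Rabs_right (2 * A)) by lra.
    assert (Rabs (x - z) <= W) by (apply Rabs_le; lra).
    replace ka with (2 * A * W) by lra. apply Rmult_le_compat_l; lra. }
  assert (Hx2 : b t x * (p + 2 * A * (x - z)) <= B * (Rabs p + ka)).
  { eapply Rle_trans; [apply Rle_abs|]. rewrite Rabs_mult.
    apply Rmult_le_compat; auto; apply Rabs_pos. }
  assert (Ht1 : 2 * - K * (t - t1) <= 4 * C).
  { replace (2 * - K * (t - t1)) with (2 * K * (t1 - t)) by ring.
    apply Rle_trans with (2 * K * k); [apply Rmult_le_compat_l; lra | lra]. }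
  assert (Hbig : Q <= a t x * (2 * A)).
  { apply Rle_trans with (eta * (2 * A)); [|apply Rmult_le_compat_r; lra].
    apply Rmult_le_reg_r with W; auto.
    replace (eta * (2 * A) * W) with (eta * (2 * (A * W))) by ring. rewrite HA. lra. }
  apply Rabs_le_between in B2, B3. unfold Q in Hbig. lra.
Qed.

End Kink.

(** * Slices satisfying a one-sided differential inequality *)

(* [G'' <= L1 + be |G'|] at [x] in the viscosity sense, tested with parabolas. *)
Definition below_test (G : R -> R) (L1 be x : R) : Prop :=
  forall s A d, 0 < d ->
    (forall z, Rabs (z - x) < d -> G x + s * (z - x) + A * (z - x) ^ 2 <= G z) ->
    2 * A <= L1 + be * Rabs s.

Lemma cont_on_ex_derive (a b : R) (f : R -> R) :
  (forall x, ex_derive f x) -> cont_on a b f.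
Proof.
  intros H. apply continuous_cont_on. intros x _. exact (ex_derive_continuous f x (H x)).
Qed.

Definition convex_kink (G : R -> R) (x : R) : Prop :=
  exists p ka e, 0 < ka /\ 0 < e /\
    forall z, Rabs (z - x) <= e -> G x + p * (z - x) + ka * Rabs (z - x) <= G z.

Lemma below_test_reflect (G : R -> R) (L1 be x : R) :
  below_test G L1 be x -> below_test (fun z => G (- z)) L1 be (- x).
Proof.
  intros H s A d Hd Hz. rewrite <- (Rabs_Ropp s). apply (H (- s) A d Hd).
  intros z Hzx. assert (H1 := Hz (- z)). rewrite !Ropp_involutive in H1.
  replace (- z - - x) with (- (z - x)) in H1 by ring. rewrite Rabs_Ropp in H1.
  specialize (H1 Hzx). eapply Rle_trans; [|apply H1]. right; ring.
Qed.

Lemma below_test_classical (G dG : R -> R) (x d l L1 be : R) :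
  0 < d -> (forall z, Rabs (z - x) < d -> is_derive G z (dG z)) -> is_derive dG x l ->
  l <= L1 + be * Rabs (dG x) -> below_test G L1 be x.
Proof.
  intros Hd HG Hl Hle s A e He Hz.
  destruct (derive_2_at_min (fun z => G z - (s * (z - x) + A * (z - x) ^ 2))
    (fun z => dG z - (s + 2 * A * (z - x))) x (Rmin d e) (l - 2 * A)) as [E1 E2].
  { apply Rmin_pos; auto. }
  { intros z Hzx. pose proof (Rmin_l d e).
    apply (is_derive_minus G). { apply HG; lra. }
    auto_derive; auto. ring. }
  { apply (is_derive_minus dG); auto. auto_derive; auto. ring. }
  { intros z Hzx. pose proof (Rmin_r d e). specialize (Hz z ltac:(lra)).
    rewrite Rminus_diag. simpl in *. lra. }
  assert (E : dG x = s).
  { rewrite Rminus_diag in E1. lra. }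
  rewrite E in Hle. lra.
Qed.

(* Tilting the test parabola by [th] in both directions moves its contact point off [x],
   where the classical inequality applies, unless [G] has a convex kink at [x]. *)
Lemma below_test_punctured (G dG ddG : R -> R) (x d L1 be : R) :
  0 < d -> 0 <= be -> cont_on (x - d) (x + d) G ->
  (forall z, z <> x -> Rabs (z - x) < d -> exists e, 0 < e /\
     (forall u, Rabs (u - z) < e -> is_derive G u (dG u)) /\
     is_derive dG z (ddG z) /\ ddG z <= L1 + be * Rabs (dG z)) ->
  ~ convex_kink G x -> below_test G L1 be x.
Proof.
  intros Hd Hbe Hc Hcl Hnk s A d1 Hd1 Hz.
  apply Rnot_lt_le; intro Hlt.
  set (gap := 2 * A - (L1 + be * Rabs s)).
  assert (Hgap : 0 < gap) by (unfold gap; lra).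
  (* Lowering the curvature by [ep] makes the contact at [x] strict, so a tilt [th] small against
     [ep * rho] cannot move the contact point out of the window. The other cutoffs in [rho] and [th]
     keep the change of [be * |slope|] below what remains of the gap. *)
  set (ep := gap / 8).
  assert (Hden : 0 < 4 * (be + 1) * (2 * Rabs (A - ep) + 1)).
  { pose proof (Rabs_pos (A - ep)). apply Rmult_lt_0_compat; lra. }
  set (rho := Rmin (d / 2) (Rmin (d1 / 2) (gap / (4 * (be + 1) * (2 * Rabs (A - ep) + 1))))).
  assert (Hrho : 0 < rho).
  { unfold rho, ep in *. repeat apply Rmin_pos; try lra. apply Rdiv_lt_0_compat; lra. }
  assert (R1 : rho <= d / 2) by apply Rmin_l.
  assert (R2 : rho <= d1 / 2) by (eapply Rle_trans; [apply Rmin_r | apply Rmin_l]).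
  assert (R3 : rho * ((be + 1) * (2 * Rabs (A - ep) + 1)) <= gap / 4).
  { assert (rho <= gap / (4 * (be + 1) * (2 * Rabs (A - ep) + 1)))
      by (eapply Rle_trans; [apply Rmin_r | apply Rmin_r]).
    apply Rle_trans with (gap / (4 * (be + 1) * (2 * Rabs (A - ep) + 1))
        * ((be + 1) * (2 * Rabs (A - ep) + 1))).
    - apply Rmult_le_compat_r; auto. lra.
    - right. field. pose proof (Rabs_pos (A - ep)). lra. }
  assert (Hep : 0 < ep) by (unfold ep; lra).
  set (th := Rmin (ep * rho / 2) (gap / (8 * (be + 1)))).
  assert (Hth : 0 < th).
  { apply Rmin_pos.
    - assert (0 < ep * rho) by (apply Rmult_lt_0_compat; auto). lra.
    - apply Rdiv_lt_0_compat; lra. }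
  assert (T1 : th <= ep * rho / 2) by apply Rmin_l.
  assert (T2 : th * (be + 1) <= gap / 8).
  { apply Rle_trans with (gap / (8 * (be + 1)) * (be + 1)).
    - apply Rmult_le_compat_r; [lra | apply Rmin_r].
    - right. field. lra. }
  set (h := fun t z => G z - ((s + t) * (z - x) + (A - ep) * (z - x) ^ 2)).
  assert (Hmin : forall t, Rabs t = th ->
    forall z, Rabs (z - x) <= rho -> G x <= h t z).
  { intros t Ht.
    destruct (cont_on_min (x - rho) (x + rho) (h t)) as (z0 & Hz0 & Hm0); [lra| |].
    { unfold h. apply cont_on_minus.
      - apply cont_on_sub with (x - d) (x + d); auto; lra.
      - apply cont_on_ex_derive. intros z. auto_derive; auto. }
    destruct (Req_dec z0 x) as [E|NE].
    { intros z Hzx. apply Rabs_le_between in Hzx.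
      replace (G x) with (h t z0); [apply Hm0; lra|].
      rewrite E. unfold h. ring. }
    exfalso.
    assert (Hx0 : h t z0 <= G x).
    { replace (G x) with (h t x); [apply Hm0; lra|]. unfold h; ring. }
    assert (Ht' : - th <= t <= th) by (apply Rabs_le_between; lra).
    assert (Hint : Rabs (z0 - x) < rho).
    { assert (Hz1 := Hz z0 ltac:(apply Rabs_def1; lra)).
      unfold h in Hx0.
      assert (H1 : ep * (z0 - x) ^ 2 <= t * (z0 - x)) by lra.
      assert (H2 : t * (z0 - x) <= th * Rabs (z0 - x)).
      { eapply Rle_trans; [apply Rle_abs|]. rewrite Rabs_mult, Ht. lra. }
      rewrite <- (pow2_abs (z0 - x)) in H1.
      assert (0 < Rabs (z0 - x)) by (apply Rabs_pos_lt; lra).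
      assert (ep * Rabs (z0 - x) <= th).
      { apply Rmult_le_reg_r with (Rabs (z0 - x)); auto. lra. }
      apply Rmult_lt_reg_l with ep; auto. nra. }
    destruct (Hcl z0 NE ltac:(lra)) as (e & He & D1 & D2 & D3).
    set (e' := Rmin e (rho - Rabs (z0 - x))).
    assert (He' : 0 < e') by (apply Rmin_pos; lra).
    destruct (derive_2_at_min (h t) (fun z => dG z - ((s + t) + 2 * (A - ep) * (z - x)))
      z0 e' (ddG z0 - 2 * (A - ep))) as [E1 E2]; auto.
    { intros u Hu. unfold h. assert (e' <= e) by apply Rmin_l.
      apply (is_derive_minus G). { apply D1; lra. }
      auto_derive; auto. ring. }
    { apply (is_derive_minus dG); auto. auto_derive; auto. ring. }
    { intros u Hu. apply Hm0. assert (e' <= rho - Rabs (z0 - x)) by apply Rmin_r.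
      assert (Rabs (u - x) < rho).
      { replace (u - x) with ((u - z0) + (z0 - x)) by ring.
        eapply Rle_lt_trans; [apply Rabs_triang|]. lra. }
      apply Rabs_def2 in H0. lra. }
    assert (Habs : Rabs (dG z0) <= Rabs s + th + 2 * Rabs (A - ep) * rho).
    { replace (dG z0) with (s + (t + 2 * (A - ep) * (z0 - x))) by lra.
      eapply Rle_trans; [apply Rabs_triang|]. rewrite Rplus_assoc. apply Rplus_le_compat_l.
      eapply Rle_trans; [apply Rabs_triang|]. rewrite Ht. apply Rplus_le_compat_l.
      rewrite !Rabs_mult, (Rabs_right 2) by lra.
      apply Rmult_le_compat_l; [|lra]. pose proof (Rabs_pos (A - ep)). lra. }
    assert (Hb1 : be * Rabs (dG z0) <= be * (Rabs s + th + 2 * Rabs (A - ep) * rho))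
      by (apply Rmult_le_compat_l; auto).
    assert (Hb2 : be * (th + 2 * Rabs (A - ep) * rho) <= gap / 8 + gap / 4).
    { pose proof (Rabs_pos (A - ep)) as HA0.
      assert (be * th <= th * (be + 1)) by lra.
      assert (be * (2 * Rabs (A - ep) * rho) <= rho * ((be + 1) * (2 * Rabs (A - ep) + 1))).
      { replace (be * (2 * Rabs (A - ep) * rho)) with (rho * (be * (2 * Rabs (A - ep)))) by ring.
        apply Rmult_le_compat_l; [lra|]. apply Rmult_le_compat; lra. }
      lra. }
    assert (Eg : gap = 2 * A - (L1 + be * Rabs s)) by reflexivity.
    assert (Ee : ep = gap / 8) by reflexivity.
    lra. }
  (* Under both tilts the minimum stays at [x]. The larger of the two tilted parabolas has a corner
     there, and near [x] half of the tilt absorbs the quadratic part. *)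
  apply Hnk.
  set (e := Rmin rho (th / (2 * (Rabs (A - ep) + 1)))).
  pose proof (Rabs_pos (A - ep)) as HA0.
  assert (He : 0 < e).
  { apply Rmin_pos; auto. apply Rdiv_lt_0_compat; lra. }
  exists s, (th / 2), e. split; [lra|]. split; auto.
  intros z Hzx.
  assert (E1 : e <= rho) by apply Rmin_l.
  assert (E2 : Rabs (A - ep) * e <= th / 2).
  { apply Rle_trans with ((Rabs (A - ep) + 1) * (th / (2 * (Rabs (A - ep) + 1)))).
    - apply Rmult_le_compat; try lra. apply Rmin_r.
    - right; field; lra. }
  assert (M1 := Hmin th ltac:(apply Rabs_right; lra) z ltac:(lra)).
  assert (M2 := Hmin (- th) ltac:(rewrite Rabs_Ropp; apply Rabs_right; lra) z ltac:(lra)).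
  unfold h in M1, M2.
  assert (Hq : - (th / 2 * Rabs (z - x)) <= (A - ep) * (z - x) ^ 2).
  { rewrite <- pow2_abs. pose proof (Rabs_pos (z - x)).
    assert (Rabs (A - ep) * Rabs (z - x) <= th / 2).
    { apply Rle_trans with (Rabs (A - ep) * e); auto. apply Rmult_le_compat_l; auto. }
    assert (- Rabs (A - ep) <= A - ep) by (pose proof (Rle_abs (- (A - ep))); rewrite Rabs_Ropp in *; lra).
    nra. }
  assert (th * Rabs (z - x) = th * (z - x) \/ th * Rabs (z - x) = - th * (z - x)) as [E|E].
  { unfold Rabs; destruct Rcase_abs; [right|left]; ring. }
  - lra.
  - lra.
Qed.

Section Slice.
Context (G g : R -> R) (lo hi L1 be M Z c s0 : R).
Context (Hbe : 0 <= be) (HM : 0 < M) (Hc : 0 < c).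
Context (HcZ : L1 + be * Z < 2 * c * Z) (HZM : 2 * M < Z).
Context (Hs0 : s0 = / (4 * c)) (Hs0l : s0 <= (hi - lo) / 2) (HZs0 : 8 * M <= 3 * Z * s0).
Context (HGc : cont_on lo hi G).
Context (HGM : forall x, lo <= x <= hi -> Rabs (G x) <= M).
Context (Hg : forall x, lo <= x <= hi -> g x <= G x).
Context (HgM : forall x z, lo <= x <= hi -> lo <= z <= hi -> Rabs (g x - g z) <= M * Rabs (x - z)).
Context (HV1 : forall x, lo < x < hi -> below_test G L1 be x).
Context (HV2 : forall x, lo < x < hi -> g x < G x -> below_test (fun z => - G z) L1 be x).

(** If [G] rises faster, it crosses the concave barrier [Z (u - c u^2)] issued from [x]. At a
    contact point off the obstacle the curvature [- 2 c Z] violates the inequality for [- G]; on the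
    obstacle, a slope of at least [Z / 2 > M] would put [G] below [g] just to the left. Near the
    right end there is no room for this barrier; the reflected one, issued from [x'] to the left,
    touches [G] from below, and the inequality for [G] itself applies. *)
Lemma slice_increase (x x' : R) : lo <= x -> x <= x' -> x' <= hi -> G x' - G x <= Z * (x' - x).
Proof.
  intros Hx Hxx Hx'.
  assert (Hc4 : s0 * c = / 4) by (rewrite Hs0; field; lra).
  assert (Hs0p : 0 < s0) by (rewrite Hs0; apply Rinv_0_lt_compat; lra).
  assert (HZ : 0 < Z) by lra.
  assert (HcZ0 : 0 < c * Z) by (apply Rmult_lt_0_compat; lra).
  (* At its far end the barrier has risen by [3 / 4 * Z * s0 >= 2 * M], the possible oscillation of
     [G]; up to there [s0 = / (4 * c)] keeps its slope above [Z / 2]. *)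
  assert (HZsc : Z * (s0 - c * s0 ^ 2) = 3 / 4 * (Z * s0)).
  { replace (Z * (s0 - c * s0 ^ 2)) with (Z * s0 * (1 - s0 * c)) by ring. rewrite Hc4. field. }
  destruct (Rlt_dec s0 (x' - x)) as [Hfar|Hnear].
  { assert (B1 := HGM x ltac:(lra)). assert (B2 := HGM x' ltac:(lra)).
    apply Rabs_le_between in B1, B2.
    apply Rle_trans with (Z * s0); [lra | apply Rmult_le_compat_l; lra]. }
  apply Rnot_lt_le; intro Hlt.
  assert (Hsl : forall u, 0 < u -> u < s0 -> Z / 2 <= Z * (1 - 2 * c * u) <= Z).
  { intros u H1 H2. assert (c * u <= / 4) by nra. split; nra. }
  assert (Hpar : 0 <= c * Z * (x' - x) ^ 2) by (apply Rmult_le_pos; [lra | apply pow2_ge_0]).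
  assert (Hpoly : forall a b K, cont_on a b (fun z => Z * ((z - K) - c * (z - K) ^ 2))).
  { intros a b K. apply cont_on_ex_derive. intros z. auto_derive; auto. }
  destruct (Rle_dec (x + s0) hi) as [Hr|Hr].
  - destruct (cont_on_min x (x + s0) (fun z => Z * ((z - x) - c * (z - x) ^ 2) - G z))
      as (z0 & Hz0 & Hm0); [lra| |].
    { apply cont_on_minus; auto. apply cont_on_sub with lo hi; auto; lra. }
    assert (H1 := Hm0 x' ltac:(lra)).
    assert (Hneg : Z * ((z0 - x) - c * (z0 - x) ^ 2) - G z0 < - G x) by lra.
    assert (z0 <> x).
    { intros ->. rewrite Rminus_diag in Hneg. lra. }
    assert (z0 <> x + s0).
    { intros ->. replace (x + s0 - x) with s0 in Hneg by ring. rewrite HZsc in Hneg.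
      assert (B1 := HGM x ltac:(lra)). assert (B2 := HGM (x + s0) ltac:(lra)).
      apply Rabs_le_between in B1, B2. lra. }
    assert (Hs := Hsl (z0 - x) ltac:(lra) ltac:(lra)).
    set (s := Z * (1 - 2 * c * (z0 - x))) in *.
    assert (Htouch : forall z, x <= z <= x + s0 ->
      G z <= G z0 + s * (z - z0) - c * Z * (z - z0) ^ 2).
    { intros z Hz. assert (H2 := Hm0 z Hz). unfold s.
      replace (G z0 + Z * (1 - 2 * c * (z0 - x)) * (z - z0) - c * Z * (z - z0) ^ 2) with
        (G z0 + Z * ((z - x) - c * (z - x) ^ 2) - Z * ((z0 - x) - c * (z0 - x) ^ 2)) by ring.
      lra. }
    destruct (Rle_lt_dec (G z0) (g z0)) as [Hct|Hnc].
    + set (z := (x + z0) / 2). assert (Hz := Htouch z ltac:(unfold z; lra)).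
      assert (A1 := Hg z ltac:(unfold z; lra)).
      assert (A2 := HgM z0 z ltac:(lra) ltac:(unfold z; lra)).
      rewrite (Rabs_right (z0 - z)) in A2 by (unfold z; lra).
      apply Rabs_le_between in A2.
      assert (0 <= c * Z * (z - z0) ^ 2) by (apply Rmult_le_pos; [lra | apply pow2_ge_0]).
      assert (0 < z0 - z) by (unfold z; lra).
      assert (s * (z0 - z) <= M * (z0 - z)) by lra.
      assert (s <= M) by (apply Rmult_le_reg_r with (z0 - z); auto). lra.
    + set (e := Rmin (z0 - x) (x + s0 - z0)). assert (He : 0 < e) by (apply Rmin_pos; lra).
      assert (H2 := HV2 z0 ltac:(lra) Hnc (- s) (c * Z) e He).
      rewrite Rabs_Ropp, Rabs_right in H2 by lra.
      assert (be * s <= be * Z) by (apply Rmult_le_compat_l; lra).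
      assert (2 * (c * Z) <= L1 + be * s); [apply H2 | lra].
      intros z Hz. pose proof (Rmin_l (z0 - x) (x + s0 - z0)). pose proof (Rmin_r (z0 - x) (x + s0 - z0)).
      fold e in H4, H5. apply Rabs_def2 in Hz. specialize (Htouch z ltac:(lra)). lra.
  - destruct (cont_on_min (x' - s0) x' (fun z => G z - Z * ((z - x') - - c * (z - x') ^ 2)))
      as (z0 & Hz0 & Hm0); [lra| |].
    { apply cont_on_minus. { apply cont_on_sub with lo hi; auto; lra. }
      apply cont_on_ex_derive. intros z. auto_derive; auto. }
    assert (H1 := Hm0 x ltac:(lra)).
    assert (Hpar' : 0 <= c * Z * (x - x') ^ 2) by (apply Rmult_le_pos; [lra | apply pow2_ge_0]).
    assert (Hneg : G z0 - Z * ((z0 - x') - - c * (z0 - x') ^ 2) < G x') by lra.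
    assert (z0 <> x').
    { intros ->. rewrite Rminus_diag in Hneg. lra. }
    assert (z0 <> x' - s0).
    { intros ->. replace (x' - s0 - x') with (- s0) in Hneg by ring.
      replace (Z * (- s0 - - c * (- s0) ^ 2)) with (- (Z * (s0 - c * s0 ^ 2))) in Hneg by ring.
      rewrite HZsc in Hneg.
      assert (B1 := HGM x' ltac:(lra)). assert (B2 := HGM (x' - s0) ltac:(lra)).
      apply Rabs_le_between in B1, B2. lra. }
    assert (Hs := Hsl (x' - z0) ltac:(lra) ltac:(lra)).
    set (s := Z * (1 - 2 * c * (x' - z0))) in *.
    set (e := Rmin (z0 - (x' - s0)) (x' - z0)). assert (He : 0 < e) by (apply Rmin_pos; lra).
    assert (H2 := HV1 z0 ltac:(lra) s (c * Z) e He).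
    rewrite Rabs_right in H2 by lra.
    assert (be * s <= be * Z) by (apply Rmult_le_compat_l; lra).
    assert (2 * (c * Z) <= L1 + be * s); [apply H2 | lra].
    intros z Hz. pose proof (Rmin_l (z0 - (x' - s0)) (x' - z0)).
    pose proof (Rmin_r (z0 - (x' - s0)) (x' - z0)).
    fold e in H4, H5. apply Rabs_def2 in Hz. assert (H6 := Hm0 z ltac:(lra)). unfold s.
    replace (G z0 + Z * (1 - 2 * c * (x' - z0)) * (z - z0) + c * Z * (z - z0) ^ 2) with
      (G z0 + Z * ((z - x') - - c * (z - x') ^ 2) - Z * ((z0 - x') - - c * (z0 - x') ^ 2)) by ring.
    lra.
Qed.

End Slice.

(** All hypotheses are invariant under [x -> - x], so a bound on decreases is the bound on increases
    of the reflected function. *)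
Lemma slice_lipschitz (G g : R -> R) (lo hi L1 be M Z c s0 : R) :
  0 <= be -> 0 < M -> 0 < c -> L1 + be * Z < 2 * c * Z -> 2 * M < Z ->
  s0 = / (4 * c) -> s0 <= (hi - lo) / 2 -> 8 * M <= 3 * Z * s0 ->
  cont_on lo hi G -> (forall x, lo <= x <= hi -> Rabs (G x) <= M) ->
  (forall x, lo <= x <= hi -> g x <= G x) ->
  (forall x z, lo <= x <= hi -> lo <= z <= hi -> Rabs (g x - g z) <= M * Rabs (x - z)) ->
  (forall x, lo < x < hi -> below_test G L1 be x) ->
  (forall x, lo < x < hi -> g x < G x -> below_test (fun z => - G z) L1 be x) ->
  forall x z, lo <= x <= hi -> lo <= z <= hi -> Rabs (G x - G z) <= Z * Rabs (x - z).
Proof.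
  intros Hbe HM Hc HcZ HZM Hs0 Hs0l HZs0 HGc HGM Hg HgM HV1 HV2.
  assert (H : forall x z, lo <= x -> x <= z -> z <= hi -> Rabs (G x - G z) <= Z * (z - x)).
  { intros x z Hx Hxz Hz. apply Rabs_le; split.
    - assert (H := slice_increase G g lo hi L1 be M Z c s0 Hbe HM Hc HcZ HZM Hs0 Hs0l HZs0 HGc
        HGM Hg HgM HV1 HV2 x z Hx Hxz Hz). lra.
    - assert (H : (fun u => G (- u)) (- x) - (fun u => G (- u)) (- z) <= Z * (- x - - z)).
      { apply (slice_increase (fun u => G (- u)) (fun u => g (- u)) (- hi) (- lo) L1 be M Z c s0);
          auto; try lra.
        - intros u Hu e He. destruct (HGc (- u) ltac:(lra) e He) as [d [Hd H]].
          exists d; split; auto. intros q Hq Hqu. apply H; [lra|].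
          replace (- q - - u) with (- (q - u)) by ring. rewrite Rabs_Ropp; auto.
        - intros u Hu; apply HGM; lra.
        - intros u Hu; apply Hg; lra.
        - intros u q Hu Hq. eapply Rle_trans; [apply HgM; lra|].
          replace (- u - - q) with (- (u - q)) by ring. rewrite Rabs_Ropp; lra.
        - intros u Hu. rewrite <- (Ropp_involutive u). apply below_test_reflect, HV1; lra.
        - intros u Hu Hgu. rewrite <- (Ropp_involutive u).
          apply (below_test_reflect (fun q => - G q)), HV2; auto; lra. }
      cbv beta in H. rewrite !Ropp_involutive in H. lra. }
  intros x z Hx Hz. destruct (Rle_dec x z).
  - rewrite (Rabs_left1 (x - z)) by lra. replace (- (x - z)) with (z - x) by ring. apply H; lra.
  - rewrite (Rabs_right (x - z)) by lra. rewrite Rabs_minus_sym. apply H; lra.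
Qed.

(** This is [G[x1, x2, x3] <= La / 2] for the second divided difference, multiplied by the three
    gaps, which may vanish. Being linear in the values of [G], it passes to limits in time. *)
Definition chord_bound (G : R -> R) (La x1 x2 x3 : R) : Prop :=
  (x3 - x2) * G x1 + (x2 - x1) * G x3 - (x3 - x1) * G x2
    <= La / 2 * ((x2 - x1) * (x3 - x2) * (x3 - x1)).

(** Otherwise the parabola with second derivative [La] through the end points exceeds [G] somewhere,
    and a translate of it touches [G] from below inside. The slope at the contact point is at most
    [Z], so the test would give [La <= L1 + be * Z]. *)
Lemma slice_chord (G : R -> R) (L1 be Z La x1 x2 x3 : R) :
  0 <= be -> 0 < La -> L1 + be * Z < La -> x1 <= x2 -> x2 <= x3 -> cont_on x1 x3 G ->
  (forall x z, x1 <= x <= x3 -> x1 <= z <= x3 -> Rabs (G x - G z) <= Z * Rabs (x - z)) ->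
  (forall x, x1 < x < x3 -> below_test G L1 be x) -> chord_bound G La x1 x2 x3.
Proof.
  intros Hbe HLa0 HLa H12 H23 Hc HL HV. unfold chord_bound.
  destruct (Req_dec x1 x3) as [E|NE].
  { assert (x2 = x1) by lra. subst. right; ring. }
  apply Rnot_lt_le; intro Hlt.
  set (l := (G x3 - G x1) / (x3 - x1)).
  assert (Hl : l * (x3 - x1) = G x3 - G x1) by (unfold l; field; lra).
  set (h := fun z => G z - (G x1 + l * (z - x1) + La / 2 * ((z - x1) * (z - x3)))).
  destruct (cont_on_min x1 x3 h) as (z0 & Hz0 & Hm0); [lra| |].
  { unfold h. apply cont_on_minus; auto. apply cont_on_ex_derive. intros z. auto_derive; auto. }
  assert (Hh1 : h x1 = 0) by (unfold h; ring).
  assert (Hh3 : h x3 = 0) by (unfold h; rewrite Hl; ring).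
  assert (Hh2 : h x2 < 0).
  { apply Rmult_lt_reg_r with (x3 - x1); [lra|]. unfold h.
    replace ((G x2 - (G x1 + l * (x2 - x1) + La / 2 * ((x2 - x1) * (x2 - x3)))) * (x3 - x1)) with
      (G x2 * (x3 - x1) - G x1 * (x3 - x1) - (l * (x3 - x1)) * (x2 - x1)
       + La / 2 * ((x2 - x1) * (x3 - x2) * (x3 - x1))) by ring.
    rewrite Hl. lra. }
  assert (Hm2 := Hm0 x2 ltac:(lra)).
  assert (z0 <> x1) by (intros ->; lra). assert (z0 <> x3) by (intros ->; lra).
  set (s := l + La / 2 * (2 * z0 - x1 - x3)).
  set (e := Rmin (z0 - x1) (x3 - z0)). assert (He : 0 < e) by (apply Rmin_pos; lra).
  assert (He1 : e <= z0 - x1) by apply Rmin_l. assert (He2 : e <= x3 - z0) by apply Rmin_r.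
  assert (Htouch : forall z, x1 <= z <= x3 -> G z0 + s * (z - z0) + La / 2 * (z - z0) ^ 2 <= G z).
  { intros z Hz. assert (H1 := Hm0 z Hz). unfold h in H1. unfold s.
    replace (G z0 + (l + La / 2 * (2 * z0 - x1 - x3)) * (z - z0) + La / 2 * (z - z0) ^ 2) with
      (G z0 + l * (z - x1) + La / 2 * ((z - x1) * (z - x3))
        - (l * (z0 - x1) + La / 2 * ((z0 - x1) * (z0 - x3)))) by ring.
    lra. }
  assert (HB := HV z0 ltac:(lra) s (La / 2) e He).
  assert (H1 : 2 * (La / 2) <= L1 + be * Rabs s).
  { apply HB. intros z Hz. apply Rabs_def2 in Hz. apply Htouch; lra. }
  (* A step to the side on which the touching parabola rises, where [G] gains at most [Z] per unit
     length. *)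
  assert (Hs : Rabs s <= Z).
  { assert (Hcase : exists z, x1 <= z <= x3 /\ Rabs (z - z0) = e / 2 /\ s * (z - z0) = Rabs s * (e / 2)).
    { destruct (Rle_dec 0 s).
      - exists (z0 + e / 2). repeat split; try lra. + rewrite Rabs_right; lra.
        + rewrite (Rabs_right s); lra.
      - exists (z0 - e / 2). repeat split; try lra. + rewrite Rabs_left; lra.
        + rewrite (Rabs_left s); lra. }
    destruct Hcase as (z & Hz1 & Hz2 & Hz3).
    assert (T1 := Htouch z Hz1). assert (T2 := HL z z0 Hz1 ltac:(lra)).
    rewrite Hz2 in T2. apply Rabs_le_between in T2. rewrite Hz3 in T1.
    assert (0 <= La / 2 * (z - z0) ^ 2) by (apply Rmult_le_pos; [lra | apply pow2_ge_0]).
    apply Rmult_le_reg_r with (e / 2); lra. }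
  assert (be * Rabs s <= be * Z) by (apply Rmult_le_compat_l; auto). lra.
Qed.

(** * Times at which the curves do not cross *)

Section Curves.
Context (T : R) (p : nat) (y : nat -> R -> R).
Context (Hy : forall i, (i < p)%nat -> cont_on 0 T (y i)).

Definition separated (k t1 : R) (i j : nat) : Prop :=
  (forall t, Rabs (t - t1) < k -> y i t = y j t) \/
  (forall t, Rabs (t - t1) < k -> y i t <> y j t).

(* Around such a time, distinct curves neither meet nor split. *)
Definition good_time (t1 : R) : Prop :=
  exists k, 0 < k /\ forall i j, (i < p)%nat -> (j < p)%nat -> separated k t1 i j.

(** Pairs are treated one at a time: either both curves agree on the whole current window, or they
    differ at one of its times and the window shrinks around that time. Earlier pairs are not lost,
    as separation is inherited by smaller windows. *)
Lemma good_time_near_aux (l : list (nat * nat)) :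
  (forall q, In q l -> (fst q < p)%nat /\ (snd q < p)%nat) ->
  forall t k, 0 < k -> 0 < t - k -> t + k < T ->
  exists t1 k1, 0 < k1 /\ t - k <= t1 - k1 /\ t1 + k1 <= t + k /\
    forall q, In q l -> separated k1 t1 (fst q) (snd q).
Proof.
  induction l as [|[i j] l IH]; intros Hl t k Hk H0 HT.
  { exists t, k. repeat split; try lra. intros q []. }
  destruct (IH (fun q Hq => Hl q (or_intror Hq)) t k Hk H0 HT) as (t1 & k1 & Hk1 & A1 & A2 & A3).
  destruct (Hl (i, j) (or_introl eq_refl)) as [Hi Hj]; simpl in Hi, Hj.
  destruct (classic (forall u, Rabs (u - t1) < k1 -> y i u = y j u)) as [E|NE].
  { exists t1, k1. repeat split; auto. intros q [<-|Hq]; auto. left; auto. }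
  apply not_all_ex_not in NE. destruct NE as [u NE]. apply imply_to_and in NE.
  destruct NE as [Hu NE]. apply Rabs_def2 in Hu.
  assert (Hgap : 0 < Rabs (y i u - y j u)) by (apply Rabs_pos_lt; lra).
  destruct (Hy i Hi u ltac:(lra) (Rabs (y i u - y j u) / 2) ltac:(lra)) as [d1 [Hd1 C1]].
  destruct (Hy j Hj u ltac:(lra) (Rabs (y i u - y j u) / 2) ltac:(lra)) as [d2 [Hd2 C2]].
  set (k2 := Rmin (Rmin d1 d2) (Rmin (t1 + k1 - u) (u - (t1 - k1)))).
  assert (Hk2 : 0 < k2) by (unfold k2; repeat apply Rmin_pos; lra).
  assert (B : k2 <= d1 /\ k2 <= d2 /\ k2 <= t1 + k1 - u /\ k2 <= u - (t1 - k1)).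
  { unfold k2.
    pose proof (Rmin_l (Rmin d1 d2) (Rmin (t1 + k1 - u) (u - (t1 - k1)))).
    pose proof (Rmin_r (Rmin d1 d2) (Rmin (t1 + k1 - u) (u - (t1 - k1)))).
    pose proof (Rmin_l d1 d2). pose proof (Rmin_r d1 d2).
    pose proof (Rmin_l (t1 + k1 - u) (u - (t1 - k1))).
    pose proof (Rmin_r (t1 + k1 - u) (u - (t1 - k1))). lra. }
  exists u, k2. repeat split; try lra.
  intros q [<-|Hq].
  - right. simpl. intros s Hs E. assert (Hs' := Rabs_def2 _ _ Hs).
    specialize (C1 s ltac:(lra) ltac:(lra)). specialize (C2 s ltac:(lra) ltac:(lra)).
    assert (Rabs (y i u - y j u) < Rabs (y i u - y j u)); [|lra].
    replace (y i u - y j u) with ((y j s - y j u) + - (y i s - y i u)) at 1 by (rewrite E; ring).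
    eapply Rle_lt_trans; [apply Rabs_triang|]. rewrite Rabs_Ropp. lra.
  - destruct (A3 q Hq) as [Q|Q]; [left|right]; intros s Hs; apply Rabs_def2 in Hs;
      apply Q; apply Rabs_def1; lra.
Qed.

Lemma good_time_near (t k : R) : 0 < t < T -> 0 < k ->
  exists t1, Rabs (t1 - t) < k /\ 0 < t1 < T /\ good_time t1.
Proof.
  intros Ht Hk. set (k' := Rmin (k / 2) (Rmin (t / 2) ((T - t) / 2))).
  assert (Hk' : 0 < k') by (unfold k'; repeat apply Rmin_pos; lra).
  assert (B : k' <= k / 2 /\ k' <= t / 2 /\ k' <= (T - t) / 2).
  { unfold k'. pose proof (Rmin_l (k / 2) (Rmin (t / 2) ((T - t) / 2))).
    pose proof (Rmin_r (k / 2) (Rmin (t / 2) ((T - t) / 2))).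
    pose proof (Rmin_l (t / 2) ((T - t) / 2)). pose proof (Rmin_r (t / 2) ((T - t) / 2)). lra. }
  destruct (good_time_near_aux (list_prod (seq 0 p) (seq 0 p))) with (t := t) (k := k')
    as (t1 & k1 & Hk1 & A1 & A2 & A3); try lra.
  { intros [i j] Hq. apply in_prod_iff in Hq. rewrite !in_seq in Hq. simpl; lia. }
  exists t1. split. { apply Rabs_def1; lra. } split; [lra|].
  exists k1; split; auto. intros i j Hi Hj. apply (A3 (i, j)).
  apply in_prod_iff. rewrite !in_seq. lia.
Qed.

(** At a good time every curve through [(t1, z)] coincides with [y i0] nearby and the others stay
    away, so it is enough to remove one graph from the box. *)
Lemma single_curve_box (Xmin Xmax eps t1 z d0 : R) (i0 : nat) :
  good_time t1 -> 0 <= eps < t1 -> t1 < T -> Xmin < z < Xmax -> (i0 < p)%nat -> y i0 t1 = z -> 0 < d0 ->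
  exists k0 d, 0 < k0 /\ k0 <= d0 /\ 0 < d /\ d <= d0 /\ eps < t1 - k0 /\ t1 + k0 < T /\
    Xmin < z - d /\ z + d < Xmax /\
    forall t x, t1 - k0 <= t <= t1 + k0 -> z - d <= x <= z + d -> x <> y i0 t ->
      O_eps T Xmin Xmax p y eps t x.
Proof.
  intros (k & Hk & Hsep) He HT Hz Hi0 Hyz Hd0.
  assert (Hj : forall n, (n <= p)%nat -> exists e, 0 < e /\
    forall t x, Rabs (t - t1) < e -> Rabs (x - z) < e -> 0 <= t <= T -> x <> y i0 t ->
      forall j, (j < n)%nat -> x <> y j t).
  { induction n as [|n IH]; intros Hn.
    { exists 1; split; [lra|]. intros; lia. }
    destruct IH as [e [He' IH]]; [lia|].
    destruct (Hsep n i0 ltac:(lia) Hi0) as [Q|Q].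
    - exists (Rmin e k). split; [apply Rmin_pos; auto|].
      intros t x Ht Hx Ht' Hne j Hj. pose proof (Rmin_l e k). pose proof (Rmin_r e k).
      destruct (Nat.eq_dec j n) as [->|Nj].
      + rewrite Q; auto. lra.
      + apply IH; auto; try lra; lia.
    - assert (Q1 := Q t1 ltac:(rewrite Rminus_diag, Rabs_R0; auto)). rewrite Hyz in Q1.
      assert (Hgap : 0 < Rabs (y n t1 - z)) by (apply Rabs_pos_lt; lra).
      destruct (Hy n ltac:(lia) t1 ltac:(lra) (Rabs (y n t1 - z) / 2) ltac:(lra)) as [d1 [Hd1 C1]].
      exists (Rmin e (Rmin d1 (Rabs (y n t1 - z) / 2))). split; [repeat apply Rmin_pos; lra|].
      intros t x Ht Hx Ht' Hne j Hj.
      pose proof (Rmin_l e (Rmin d1 (Rabs (y n t1 - z) / 2))).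
      pose proof (Rmin_r e (Rmin d1 (Rabs (y n t1 - z) / 2))).
      pose proof (Rmin_l d1 (Rabs (y n t1 - z) / 2)). pose proof (Rmin_r d1 (Rabs (y n t1 - z) / 2)).
      destruct (Nat.eq_dec j n) as [->|Nj].
      + intro E. specialize (C1 t Ht' ltac:(lra)).
        assert (Rabs (y n t1 - z) < Rabs (y n t1 - z)); [|lra].
        replace (y n t1 - z) with ((x - z) + - (y n t - y n t1)) at 1 by lra.
        eapply Rle_lt_trans; [apply Rabs_triang|]. rewrite Rabs_Ropp. lra.
      + apply IH; auto; try lra; lia. }
  destruct (Hj p (le_n p)) as [e [He' Hj']].
  set (q := Rmin (Rmin e d0) (Rmin (Rmin (t1 - eps) (T - t1)) (Rmin (z - Xmin) (Xmax - z))) / 2).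
  assert (Hq0 : 0 < Rmin (Rmin e d0) (Rmin (Rmin (t1 - eps) (T - t1)) (Rmin (z - Xmin) (Xmax - z))))
    by (repeat apply Rmin_pos; lra).
  assert (Hq : 0 < q) by (unfold q; lra).
  assert (B : q < e /\ q < d0 /\ q < t1 - eps /\ q < T - t1 /\ q < z - Xmin /\ q < Xmax - z).
  { unfold q in *.
    pose proof (Rmin_l (Rmin e d0) (Rmin (Rmin (t1 - eps) (T - t1)) (Rmin (z - Xmin) (Xmax - z)))).
    pose proof (Rmin_r (Rmin e d0) (Rmin (Rmin (t1 - eps) (T - t1)) (Rmin (z - Xmin) (Xmax - z)))).
    pose proof (Rmin_l e d0). pose proof (Rmin_r e d0).
    pose proof (Rmin_l (Rmin (t1 - eps) (T - t1)) (Rmin (z - Xmin) (Xmax - z))).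
    pose proof (Rmin_r (Rmin (t1 - eps) (T - t1)) (Rmin (z - Xmin) (Xmax - z))).
    pose proof (Rmin_l (t1 - eps) (T - t1)). pose proof (Rmin_r (t1 - eps) (T - t1)).
    pose proof (Rmin_l (z - Xmin) (Xmax - z)). pose proof (Rmin_r (z - Xmin) (Xmax - z)). lra. }
  exists q, q. repeat split; try lra.
  apply Hj'; auto; try lra; apply Rabs_def1; lra.
Qed.

End Curves.

(** * Curvature bounds on the slices at good times *)

Section OneSided.
Context (T Xmin Xmax : R) (p : nat) (y : nat -> R -> R) (a b r w F : R -> R -> R)
  (Om : R -> R -> Prop) (M eta : R).
Context (HT : 0 < T) (HO : Xmin < Xmax) (HM : 1 <= M) (Heta : 0 < eta).
Context (Hy : forall i, (i < p)%nat -> cont_on 0 T (y i)).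
Context (HC : C23_on T Xmin Xmax p y w).
Context (Ca : cont_box 0 T Xmin Xmax a) (Cb : cont_box 0 T Xmin Xmax b)
  (Cr : cont_box 0 T Xmin Xmax r) (CF : cont_box 0 T Xmin Xmax F)
  (Cw : cont_box 0 T Xmin Xmax w).
Context (Hell : forall t x, 0 <= t <= T -> Xmin <= x <= Xmax -> eta <= a t x).
Context (HB : forall t x, 0 <= t <= T -> Xmin <= x <= Xmax ->
  Rabs (b t x) <= M /\ Rabs (r t x) <= M /\ Rabs (w t x) <= M /\ Rabs (F t x) <= M).
Context (Hsup : box_super T Xmin Xmax a b r w F Om).

Definition near_in (t z : R) : Prop :=
  exists d, 0 < d /\ forall s x, Rabs (s - t) < d -> Rabs (x - z) < d -> Om s x.

Lemma time_MVT (eps B x s t : R) :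
  0 <= eps -> Linf_bound T Xmin Xmax p y eps (dt w) B -> s <= t ->
  (forall u, s <= u <= t -> O_eps T Xmin Xmax p y eps u x) ->
  Rabs (w t x - w s x) <= B * (t - s).
Proof.
  intros He HBd Hst Hu.
  assert (Hu0 : forall u, s <= u <= t -> O_eps T Xmin Xmax p y 0 u x).
  { intros u Hu'. destruct (Hu u Hu') as (A1 & A2 & A3). repeat split; auto; lra. }
  apply (MVT_abs_le s t B (fun u => w u x) (fun u => dt w u x)); auto.
  - intros u Hu'. apply (C23_dt _ _ _ _ _ _ HC), Hu0; lra.
  - apply continuous_cont_on. intros u Hu'. apply (ex_derive_continuous (fun u => w u x)).
    eexists. apply (C23_dt _ _ _ _ _ _ HC), Hu0; lra.
  - intros u Hu'. apply HBd, Hu; lra.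
Qed.

Lemma space_slope_MVT (eps B t x1 x2 x3 : R) :
  0 <= eps -> Linf_bound T Xmin Xmax p y eps (dx (dx w)) B -> 0 <= B ->
  Xmin <= x1 -> x1 <= x2 -> x2 <= x3 -> x3 <= Xmax -> 0 <= t <= T ->
  (forall x, x1 < x < x3 -> O_eps T Xmin Xmax p y eps t x) ->
  Rabs ((w t x3 - w t x2) * (x2 - x1) - (w t x2 - w t x1) * (x3 - x2))
    <= B * (x3 - x1) * (x3 - x2) * (x2 - x1).
Proof.
  intros He HBd HB0 H1 H12 H23 H3 Ht Hu.
  destruct (Req_dec x1 x2) as [E|N1].
  { subst x2. rewrite !Rminus_diag, !Rmult_0_r, Rmult_0_l, Rminus_diag, Rabs_R0. lra. }
  destruct (Req_dec x2 x3) as [E|N2].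
  { subst x3. rewrite !Rminus_diag, !Rmult_0_r, !Rmult_0_l, Rminus_diag, Rabs_R0. lra. }
  assert (Hu0 : forall x, x1 < x < x3 -> O_eps T Xmin Xmax p y 0 t x).
  { intros x Hx. destruct (Hu x Hx) as (A1 & A2 & A3). repeat split; auto; lra. }
  assert (Hcs : cont_on x1 x3 (w t)).
  { apply cont_on_sub with Xmin Xmax; auto. apply (cont_box_space 0 T); auto. }
  destruct (MVT_on x1 x2 (w t) (dx w t)) as (c1 & Hc1 & E1); [lra| | |].
  { intros x Hx. apply (C23_dx _ _ _ _ _ _ HC), Hu0; lra. }
  { apply cont_on_sub with x1 x3; auto; lra. }
  destruct (MVT_on x2 x3 (w t) (dx w t)) as (c2 & Hc2 & E2); [lra| | |].
  { intros x Hx. apply (C23_dx _ _ _ _ _ _ HC), Hu0; lra. }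
  { apply cont_on_sub with x1 x3; auto; lra. }
  assert (E3 : Rabs (dx w t c2 - dx w t c1) <= B * (c2 - c1)).
  { apply (MVT_abs_le c1 c2 B (dx w t) (dx (dx w) t)); [lra| | |].
    - intros x Hx. apply (C23_dxx _ _ _ _ _ _ HC), Hu0; lra.
    - apply continuous_cont_on. intros x Hx. apply (ex_derive_continuous (dx w t)).
      eexists. apply (C23_dxx _ _ _ _ _ _ HC), Hu0; lra.
    - intros x Hx. apply HBd, Hu; lra. }
  rewrite E1, E2.
  replace (dx w t c2 * (x3 - x2) * (x2 - x1) - dx w t c1 * (x2 - x1) * (x3 - x2)) with
    ((dx w t c2 - dx w t c1) * ((x3 - x2) * (x2 - x1))) by ring.
  assert (0 < (x3 - x2) * (x2 - x1)) by (apply Rmult_lt_0_compat; lra).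
  rewrite Rabs_mult, (Rabs_right ((x3 - x2) * (x2 - x1))) by lra.
  rewrite (Rmult_assoc (B * (x3 - x1))). apply Rmult_le_compat_r; [lra|].
  eapply Rle_trans; [apply E3|]. apply Rmult_le_compat_l; lra.
Qed.

(** Purely qualitative: in a box with a single curve, [B] only has to be finite for the mean value
    bounds required by [no_convex_kink], and it leaves no trace in the conclusion. *)
Lemma good_time_no_kink (eps B t1 z : R) (i0 : nat) :
  0 <= eps < t1 -> t1 < T -> Xmin < z < Xmax ->
  Linf_bound T Xmin Xmax p y eps (dt w) B -> Linf_bound T Xmin Xmax p y eps (dx (dx w)) B ->
  good_time p y t1 -> (i0 < p)%nat -> y i0 t1 = z -> near_in t1 z -> ~ convex_kink (w t1) z.
Proof.
  intros He Ht1 Hz Hb1 Hb2 Hg Hi0 Hyz (d1 & Hd1 & HOm) (q & ka & e & Hka & He' & Hk).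
  destruct (single_curve_box T p y Hy Xmin Xmax eps t1 z (Rmin (d1 / 2) e) i0)
    as (k0 & d & Hk0 & Hk0' & Hd & Hd' & A1 & A2 & A3 & A4 & Hbox); auto.
  { apply Rmin_pos; lra. }
  pose proof (Rmin_l (d1 / 2) e). pose proof (Rmin_r (d1 / 2) e).
  set (B' := Rmax B 1).
  assert (HB1 : B <= B') by apply Rmax_l. assert (HB2 : 1 <= B') by apply Rmax_r.
  apply (no_convex_kink w (y i0) t1 z k0 d B' q ka Hk0 Hd ltac:(lra) Hka) with
    (T := T) (Xmin := Xmin) (Xmax := Xmax) (a := a) (b := b) (r := r) (F := F) (Om := Om)
    (eta := eta) (B := M * M); auto; try lra.
  - apply cont_on_sub with 0 T; auto; lra.
  - apply cont_box_sub with 0 T Xmin Xmax; auto; lra.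
  - intros x s t Hx Hs Hst Ht Hu. apply Rle_trans with (B * (t - s)).
    + apply time_MVT with eps; auto; try lra. intros u Hu'. apply Hbox; try lra.
      intro E. apply (Hu u Hu'). auto.
    + apply Rmult_le_compat_r; lra.
  - intros t x1 x2 x3 Ht H1 H12 H23 H3 HYt.
    apply space_slope_MVT with eps; auto; try lra.
    + intros t' x' Ho. apply Rle_trans with B; auto.
    + intros x Hx. apply Hbox; lra.
  - intros x Hx. apply Hk. apply Rabs_le; lra.
  - intros t x Ht Hx. destruct (HB t x Ht Hx) as (B1 & B2 & B3 & B4).
    assert (M <= M * M) by nra.
    repeat split; try lra. rewrite Rabs_mult. apply Rmult_le_compat; auto; apply Rabs_pos.
  - intros t x Ht Hx. apply HOm; apply Rabs_def1; lra.
Qed.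

(** The differential inequality solved for the second derivative by ellipticity. Thanks to [1 <= m]
    the factor [m] also covers the terms that do not involve [w_t], so the constant is linear in
    [m]. *)
Lemma classical_dxx_le (eps m t z : R) :
  0 <= eps -> Linf_bound T Xmin Xmax p y eps (dt w) m -> 1 <= m ->
  O_eps T Xmin Xmax p y eps t z -> near_in t z ->
  dx (dx w) t z <= m * (1 + M + M * M) / eta + M / eta * Rabs (dx w t z).
Proof.
  intros He Hb Hm Ho (d & Hd & HOm).
  assert (Ho0 : O_eps T Xmin Xmax p y 0 t z).
  { destruct Ho as (A1 & A2 & A3). repeat split; auto; lra. }
  assert (H := box_super_classical T Xmin Xmax p y w Hy HC a b r F Om t z d
    Ca Cb Cr CF Cw Hsup Ho0 Hd HOm).
  destruct Ho as (A1 & A2 & A3).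
  destruct (HB t z ltac:(lra) ltac:(lra)) as (B1 & B2 & B3 & B4).
  assert (E := Hell t z ltac:(lra) ltac:(lra)).
  assert (H1 := Hb t z (conj A1 (conj A2 A3))).
  assert (H2 : b t z * dx w t z <= M * Rabs (dx w t z)).
  { eapply Rle_trans; [apply Rle_abs|]. rewrite Rabs_mult. apply Rmult_le_compat_r; auto.
    apply Rabs_pos. }
  assert (H3 : r t z * w t z <= M * M).
  { eapply Rle_trans; [apply Rle_abs|]. rewrite Rabs_mult.
    apply Rmult_le_compat; auto; apply Rabs_pos. }
  apply Rabs_le_between in H1, B4.
  assert (Hd0 := Rabs_pos (dx w t z)).
  set (D := dx (dx w) t z) in *.
  assert (H4 : eta * D <= m * (1 + M + M * M) + M * Rabs (dx w t z)).
  { assert (0 <= M * Rabs (dx w t z)) by (apply Rmult_le_pos; lra).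
    assert (m * (1 + M + M * M) >= m + M + M * M) by nra.
    destruct (Rle_dec 0 D).
    - apply Rle_trans with (a t z * D); [apply Rmult_le_compat_r; lra | lra].
    - nra. }
  apply Rmult_le_reg_l with eta; auto. eapply Rle_trans; [apply H4|]. right; field; lra.
Qed.

(** The constants depend on [m], [M] and [eta] only. Off the curve the inequality is classical; on
    the curve it is inherited from both sides once convex kinks are excluded, and this is where a
    finite bound on [dx (dx w)] enters. *)
Lemma good_time_below_test (eps m t1 z : R) :
  0 <= eps < t1 -> t1 < T -> Xmin < z < Xmax ->
  Linf_bound T Xmin Xmax p y eps (dt w) m -> 1 <= m ->
  (exists B, Linf_bound T Xmin Xmax p y eps (dx (dx w)) B) ->
  good_time p y t1 -> near_in t1 z ->
  below_test (w t1) (m * (1 + M + M * M) / eta) (M / eta) z.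
Proof.
  intros He Ht1 Hz Hb Hm (B & HBx) Hg Hn.
  assert (Hbe : 0 <= M / eta) by (apply Rlt_le, Rdiv_lt_0_compat; lra).
  assert (Hoff : forall x, O_eps T Xmin Xmax p y eps t1 x -> near_in t1 x ->
    exists e, 0 < e /\ (forall u, Rabs (u - x) < e -> is_derive (w t1) u (dx w t1 u)) /\
      is_derive (dx w t1) x (dx (dx w) t1 x) /\
      dx (dx w) t1 x <= m * (1 + M + M * M) / eta + M / eta * Rabs (dx w t1 x)).
  { intros x Ho Hnx.
    destruct (O_eps_open _ _ _ _ _ _ _ _ (proj1 He) Hy Ho) as (e & He' & Hop).
    assert (Hop0 : forall u, Rabs (u - x) < e -> O_eps T Xmin Xmax p y 0 t1 u).
    { intros u Hu. destruct (Hop t1 u ltac:(rewrite Rminus_diag, Rabs_R0; auto) Hu) as (A1 & A2 & A3).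
      repeat split; auto; lra. }
    exists e. split; [|split; [|split]]; auto.
    - intros u Hu. apply (C23_dx _ _ _ _ _ _ HC), Hop0; auto.
    - apply (C23_dxx _ _ _ _ _ _ HC), Hop0. rewrite Rminus_diag, Rabs_R0; auto.
    - apply classical_dxx_le with eps; auto. lra. }
  destruct (classic (exists i0, (i0 < p)%nat /\ y i0 t1 = z)) as [(i0 & Hi0 & Hyz)|Nc].
  - destruct Hn as (dn & Hdn & HOm).
    destruct (single_curve_box T p y Hy Xmin Xmax eps t1 z (dn / 2) i0)
      as (k0 & d & Hk0 & Hk0' & Hd & Hd' & A1 & A2 & A3 & A4 & Hbox); auto; try lra.
    apply (below_test_punctured (w t1) (dx w t1) (dx (dx w) t1) z d); auto.
    + apply (cont_box_space 0 T); [|lra]. apply cont_box_sub with 0 T Xmin Xmax; auto; lra.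
    + intros x Hx Hxd. apply Rabs_def2 in Hxd. apply Hoff.
      * apply Hbox; lra.
      * exists (dn / 2). split; [lra|]. intros s u Hs Hu. apply HOm; try lra.
        apply Rabs_def2 in Hu. apply Rabs_def1; lra.
    + apply good_time_no_kink with eps (Rmax m B) i0; auto.
      * intros t x Ho. eapply Rle_trans; [apply Hb; auto | apply Rmax_l].
      * intros t x Ho. eapply Rle_trans; [apply HBx; auto | apply Rmax_r].
      * exists dn; auto.
  - assert (Ho : O_eps T Xmin Xmax p y eps t1 z).
    { repeat split; try lra. intros i Hi E. apply Nc. exists i; auto. }
    destruct (Hoff z Ho Hn) as (e & He' & D1 & D2 & D3).
    apply below_test_classical with (dx w t1) e (dx (dx w) t1 z); auto.
Qed.

End OneSided.

Lemma cont_on_const (a b c : R) : cont_on a b (fun _ => c).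
Proof.
  intros x _ e He. exists 1; split; [lra|]. intros. rewrite Rminus_diag, Rabs_R0; auto.
Qed.

Lemma cont_on_mult (a b : R) (f g : R -> R) :
  cont_on a b f -> cont_on a b g -> cont_on a b (fun x => f x * g x).
Proof.
  intros Hf Hg x Hx e He.
  set (q := Rabs (f x) + Rabs (g x) + 1).
  pose proof (Rabs_pos (f x)). pose proof (Rabs_pos (g x)).
  assert (Hq : 1 <= q) by (unfold q; lra).
  set (e' := Rmin 1 (e / (2 * q))).
  assert (He' : 0 < e') by (apply Rmin_pos; [lra | apply Rdiv_lt_0_compat; lra]).
  assert (E1 : e' <= 1) by apply Rmin_l.
  assert (E2 : e' * q <= e / 2).
  { apply Rle_trans with (e / (2 * q) * q).
    - apply Rmult_le_compat_r; [lra | apply Rmin_r].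
    - right; field; lra. }
  destruct (Hf x Hx e' He') as [d1 [Hd1 H1]]. destruct (Hg x Hx e' He') as [d2 [Hd2 H2]].
  exists (Rmin d1 d2); split; [apply Rmin_pos; auto|].
  intros z Hz Hzx. pose proof (Rmin_l d1 d2). pose proof (Rmin_r d1 d2).
  specialize (H1 z Hz ltac:(lra)). specialize (H2 z Hz ltac:(lra)).
  replace (f z * g z - f x * g x) with
    ((f z - f x) * (g z - g x) + ((f z - f x) * g x + f x * (g z - g x))) by ring.
  assert (A1 : Rabs ((f z - f x) * (g z - g x)) <= e' * 1).
  { rewrite Rabs_mult. apply Rmult_le_compat; try apply Rabs_pos; lra. }
  assert (A2 : Rabs ((f z - f x) * g x) <= e' * Rabs (g x)).
  { rewrite Rabs_mult. apply Rmult_le_compat_r; lra. }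
  assert (A3 : Rabs (f x * (g z - g x)) <= e' * Rabs (f x)).
  { rewrite Rabs_mult, Rmult_comm. apply Rmult_le_compat_r; lra. }
  eapply Rle_lt_trans; [apply Rabs_triang|].
  eapply Rle_lt_trans; [apply Rplus_le_compat_l, Rabs_triang|].
  unfold q in E2. lra.
Qed.

(** The left slopes [Lf], corrected by the curvature, never exceed the corrected right slopes [Rf].
    The supremum of the former is therefore the slope of a supporting parabola at [x]. *)
Lemma chord_touch (G : R -> R) (La Z x d : R) :
  0 < d -> 0 <= La ->
  (forall u v, x - d <= u <= x + d -> x - d <= v <= x + d -> Rabs (G u - G v) <= Z * Rabs (u - v)) ->
  (forall h k, 0 < h <= d -> 0 < k <= d -> chord_bound (fun u => - G u) La (x - h) x (x + k)) ->
  exists q, Rabs q <= Z + La * d /\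
    forall u, Rabs (u - x) <= d -> G x + q * (u - x) - La / 2 * (u - x) ^ 2 <= G u.
Proof.
  intros Hd HLa HL Hch.
  set (Lf := fun h => (G x - G (x - h)) / h - La / 2 * h).
  set (Rf := fun k => (G (x + k) - G x) / k + La / 2 * k).
  assert (HLR : forall h k, 0 < h <= d -> 0 < k <= d -> Lf h <= Rf k).
  { intros h k Hh Hk. assert (H := Hch h k Hh Hk). unfold chord_bound in H.
    apply Rmult_le_reg_r with (h * k); [apply Rmult_lt_0_compat; lra|].
    unfold Lf, Rf.
    replace (((G x - G (x - h)) / h - La / 2 * h) * (h * k)) with
      ((G x - G (x - h)) * k - La / 2 * h * h * k) by (field; lra).
    replace (((G (x + k) - G x) / k + La / 2 * k) * (h * k)) with
      ((G (x + k) - G x) * h + La / 2 * h * k * k) by (field; lra).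
    lra. }
  assert (HbR : Rf d <= Z + La * d).
  { assert (H := HL (x + d) x ltac:(lra) ltac:(lra)).
    replace (x + d - x) with d in H by ring. rewrite (Rabs_right d) in H by lra.
    apply Rabs_le_between in H. unfold Rf.
    assert ((G (x + d) - G x) / d <= Z).
    { apply Rmult_le_reg_r with d; auto. unfold Rdiv. rewrite Rmult_assoc, Rinv_l; lra. }
    nra. }
  assert (HbL : - (Z + La * d) <= Lf d).
  { assert (H := HL (x - d) x ltac:(lra) ltac:(lra)).
    replace (x - d - x) with (- d) in H by ring. rewrite Rabs_Ropp, (Rabs_right d) in H by lra.
    apply Rabs_le_between in H. unfold Lf.
    assert (- Z <= (G x - G (x - d)) / d).
    { apply Rmult_le_reg_r with d; auto. unfold Rdiv. rewrite Rmult_assoc, Rinv_l; lra. }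
    nra. }
  destruct (completeness (fun z => exists h, 0 < h <= d /\ z = Lf h)) as [q [Hq1 Hq2]].
  { exists (Rf d). intros z (h & Hh & ->). apply HLR; lra. }
  { exists (Lf d), d. split; [lra | auto]. }
  exists q. split.
  { apply Rabs_le; split.
    - eapply Rle_trans; [apply HbL|]. apply Hq1. exists d; split; [lra | auto].
    - apply Rle_trans with (Rf d); auto. apply Hq2. intros z (h & Hh & ->). apply HLR; lra. }
  intros u Hu. apply Rabs_le_between in Hu.
  destruct (Rtotal_order u x) as [Hlt|[->|Hgt]].
  - assert (H : Lf (x - u) <= q) by (apply Hq1; exists (x - u); split; [lra | auto]).
    unfold Lf in H. replace (x - (x - u)) with u in H by ring.
    assert (H1 : ((G x - G u) / (x - u) - La / 2 * (x - u)) * (x - u) <= q * (x - u))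
      by (apply Rmult_le_compat_r; lra).
    replace (((G x - G u) / (x - u) - La / 2 * (x - u)) * (x - u)) with
      (G x - G u - La / 2 * (x - u) * (x - u)) in H1 by (field; lra).
    lra.
  - rewrite Rminus_diag. right; ring.
  - assert (H : q <= Rf (u - x)).
    { apply Hq2. intros z (h & Hh & ->). apply HLR; lra. }
    unfold Rf in H. replace (x + (u - x)) with u in H by ring.
    assert (H1 : q * (u - x) <= ((G u - G x) / (u - x) + La / 2 * (u - x)) * (u - x))
      by (apply Rmult_le_compat_r; lra).
    replace (((G u - G x) / (u - x) + La / 2 * (u - x)) * (u - x)) with
      (G u - G x + La / 2 * (u - x) * (u - x)) in H1 by (field; lra).
    lra.
Qed.

(** * Regularity across the curves *)

(** Growth is controlled only to the right, with a [K] depending on the time. The times at which the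
    bound holds with [C + ep] include their supremum by continuity, and from there a short further
    step absorbs the quadratic error in [ep]. *)
Lemma dini_growth (h : R -> R) (A B C : R) :
  A <= B -> cont_on A B h ->
  (forall t, A <= t < B -> exists k K, 0 < k /\
     forall t', t <= t' <= t + k -> t' <= B -> - C * (t' - t) - K * (t' - t) ^ 2 <= h t' - h t) ->
  - C * (B - A) <= h B - h A.
Proof.
  intros HAB Hc Hd.
  destruct (Req_dec A B) as [->|NAB]; [lra|].
  apply Rnot_lt_le; intro Hlt.
  set (ep := (- C * (B - A) - (h B - h A)) / (2 * (B - A))).
  assert (Hep : 0 < ep) by (apply Rdiv_lt_0_compat; lra).
  assert (HepB : ep * (B - A) = (- C * (B - A) - (h B - h A)) / 2) by (unfold ep; field; lra).
  set (E := fun s => A <= s <= B /\ - (C + ep) * (s - A) <= h s - h A).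
  destruct (completeness E) as [ss [Hs1 Hs2]].
  { exists B. intros s [H _]; lra. }
  { exists A. split; lra. }
  assert (HssA : A <= ss) by (apply Hs1; split; lra).
  assert (HssB : ss <= B) by (apply Hs2; intros s [H _]; lra).
  assert (HEss : - (C + ep) * (ss - A) <= h ss - h A).
  { apply Rnot_lt_le; intro Hn.
    set (gap := - (C + ep) * (ss - A) - (h ss - h A)).
    assert (Hgap : 0 < gap) by (unfold gap; lra).
    destruct (Hc ss ltac:(lra) (gap / 2) ltac:(lra)) as [d [Hd0 Hdc]].
    set (K := Rabs (C + ep) + 1). assert (HK : 0 < K) by (unfold K; pose proof (Rabs_pos (C + ep)); lra).
    set (e := Rmin d (gap / (2 * K))).
    assert (He : 0 < e) by (apply Rmin_pos; auto; apply Rdiv_lt_0_compat; lra).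
    assert (He1 : e <= d) by apply Rmin_l.
    assert (He2 : K * e <= gap / 2).
    { apply Rle_trans with (K * (gap / (2 * K))).
      - apply Rmult_le_compat_l; [lra | apply Rmin_r].
      - right; field; lra. }
    assert (ss <= ss - e); [|lra].
    apply Hs2. intros s [H1 H2]. apply Rnot_lt_le; intro H3.
    assert (H4 : s <= ss) by (apply Hs1; split; auto).
    specialize (Hdc s H1 ltac:(apply Rabs_def1; lra)). apply Rabs_def2 in Hdc.
    assert (H5 : (C + ep) * (s - ss) <= gap / 2).
    { eapply Rle_trans; [apply Rle_abs|]. rewrite Rabs_mult.
      apply Rle_trans with (K * e); auto.
      apply Rmult_le_compat; try apply Rabs_pos. { unfold K; lra. } apply Rabs_le; lra. }
    unfold gap in *. lra. }
  assert (Hne : ss <> B).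
  { intros ->. lra. }
  destruct (Hd ss ltac:(lra)) as (k & K & Hk & HK).
  set (e := Rmin (Rmin k (B - ss)) (ep / (Rabs K + 1))).
  pose proof (Rabs_pos K).
  assert (He : 0 < e).
  { unfold e; repeat apply Rmin_pos; auto; try lra. apply Rdiv_lt_0_compat; lra. }
  assert (He1 : e <= k /\ e <= B - ss).
  { unfold e. pose proof (Rmin_l (Rmin k (B - ss)) (ep / (Rabs K + 1))).
    pose proof (Rmin_l k (B - ss)). pose proof (Rmin_r k (B - ss)). lra. }
  assert (He2 : K * e <= ep).
  { apply Rle_trans with ((Rabs K + 1) * (ep / (Rabs K + 1))).
    - apply Rle_trans with ((Rabs K + 1) * e).
      + apply Rmult_le_compat_r; [lra|]. pose proof (Rle_abs K). lra.
      + apply Rmult_le_compat_l; [lra | apply Rmin_r].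
    - right; field; lra. }
  specialize (HK (ss + e) ltac:(lra) ltac:(lra)).
  replace (ss + e - ss) with e in HK by ring.
  assert (K * e ^ 2 <= ep * e).
  { replace (K * e ^ 2) with (K * e * e) by ring. apply Rmult_le_compat_r; lra. }
  assert (ss + e <= ss); [|lra]. apply Hs1. split; lra.
Qed.

Section Dini.
Context (T Xmin Xmax : R) (a b r w F : R -> R -> R) (Om : R -> R -> Prop) (M : R).
Context (HM : 1 <= M).
Context (Cw : cont_box 0 T Xmin Xmax w).
Context (HB : forall t x, 0 <= t <= T -> Xmin <= x <= Xmax ->
  Rabs (a t x) <= M /\ Rabs (b t x) <= M /\ Rabs (r t x) <= M /\ Rabs (w t x) <= M /\
  Rabs (F t x) <= M).
Context (Hsup : box_super T Xmin Xmax a b r w F Om).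

(** Barrier argument: the supporting parabola, with doubled curvature and moving down at speed [C],
    stays below [w] on the sides of a small box starting at time [t]. If [w] dropped faster at [x],
    a translate would touch from below inside, where [C] beats the bounds on the terms in [a], [b],
    [r] and on [F]. *)
Lemma lower_dini (t x q La P d0 : R) :
  0 < t < T -> Xmin < x < Xmax -> near_in Om t x -> 0 < La -> Rabs q <= P -> 0 < d0 ->
  (forall u, Rabs (u - x) <= d0 -> w t x + q * (u - x) - La / 2 * (u - x) ^ 2 <= w t u) ->
  exists k K, 0 < k /\ forall t', t <= t' <= t + k ->
    - (1 + M + M * M + 4 * M * La + M * P) * (t' - t) - K * (t' - t) ^ 2 <= w t' x - w t x.
Proof.
  intros Ht Hx (dn & Hdn & HOm) HLa Hq Hd0 Htouch.
  set (C := 1 + M + M * M + 4 * M * La + M * P).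
  assert (HP : 0 <= P) by (pose proof (Rabs_pos q); lra).
  assert (HMP : 0 <= M * P) by (apply Rmult_le_pos; lra).
  assert (HMLa : 0 < M * La) by (apply Rmult_lt_0_compat; lra).
  assert (HC : 0 < C) by (unfold C; nra).
  set (d := Rmin (Rmin d0 1) (Rmin (dn / 2) (Rmin ((x - Xmin) / 2) ((Xmax - x) / 2)))).
  assert (Hd : 0 < d) by (unfold d; repeat apply Rmin_pos; lra).
  assert (D : d <= d0 /\ d <= 1 /\ d <= dn / 2 /\ d <= (x - Xmin) / 2 /\ d <= (Xmax - x) / 2).
  { unfold d. pose proof (Rmin_l (Rmin d0 1) (Rmin (dn / 2) (Rmin ((x - Xmin) / 2) ((Xmax - x) / 2)))).
    pose proof (Rmin_r (Rmin d0 1) (Rmin (dn / 2) (Rmin ((x - Xmin) / 2) ((Xmax - x) / 2)))).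
    pose proof (Rmin_l d0 1). pose proof (Rmin_r d0 1).
    pose proof (Rmin_l (dn / 2) (Rmin ((x - Xmin) / 2) ((Xmax - x) / 2))).
    pose proof (Rmin_r (dn / 2) (Rmin ((x - Xmin) / 2) ((Xmax - x) / 2))).
    pose proof (Rmin_l ((x - Xmin) / 2) ((Xmax - x) / 2)).
    pose proof (Rmin_r ((x - Xmin) / 2) ((Xmax - x) / 2)). lra. }
  (* Doubling the curvature gains this amount on the lateral sides; it pays for the change of [w] in
     time there. *)
  assert (Hom : 0 < La / 2 * d ^ 2) by (apply Rmult_lt_0_compat; [lra | nra]).
  destruct (cont_box_unif _ _ _ _ _ Cw (La / 2 * d ^ 2) Hom) as (e & He & Hun).
  set (k := Rmin (e / 2) (Rmin (dn / 2) ((T - t) / 2))).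
  assert (Hk : 0 < k) by (unfold k; repeat apply Rmin_pos; lra).
  assert (K1 : k <= e / 2 /\ k <= dn / 2 /\ k <= (T - t) / 2).
  { unfold k. pose proof (Rmin_l (e / 2) (Rmin (dn / 2) ((T - t) / 2))).
    pose proof (Rmin_r (e / 2) (Rmin (dn / 2) ((T - t) / 2))).
    pose proof (Rmin_l (dn / 2) ((T - t) / 2)). pose proof (Rmin_r (dn / 2) ((T - t) / 2)). lra. }
  (* At the final time [t + k] the quadratic term has dropped by [2 * M + P], enough for the
     oscillation of [w] and the term linear in [x]. *)
  set (K := (2 * M + P) / k ^ 2).
  assert (Hk2 : 0 < k ^ 2) by nra.
  assert (HK : K * k ^ 2 = 2 * M + P) by (unfold K; field; lra).
  assert (HK0 : 0 <= K) by (unfold K; apply Rlt_le, Rdiv_lt_0_compat; lra).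
  exists (k / 2), K. split; [lra|]. intros t2 Ht2.
  apply Rnot_lt_le; intro Hlt.
  assert (Hne : t2 <> t) by (intros ->; rewrite Rminus_diag in Hlt; lra).
  destruct (Hsup t (t + k) (x - d) (x + d) (- C) (- K) q (- La) t x t2 x)
    as (t' & x' & Ht' & Hx' & HF); try lra.
  { intros s u Hs Hu. apply HOm; apply Rabs_def1; lra. }
  { intros s u Hs Hu Hbd. unfold quad. rewrite (Rminus_diag x).
    apply Rle_trans with (w t x); [lra|].
    assert (Hqu : q * (u - x) <= P).
    { eapply Rle_trans; [apply Rle_abs|]. rewrite Rabs_mult.
      replace P with (P * 1) by ring.
      apply Rmult_le_compat; try apply Rabs_pos; auto. apply Rabs_le; lra. }
    assert (A1 : 0 <= C * (s - t)) by (apply Rmult_le_pos; lra).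
    assert (A2 : 0 <= K * (s - t) ^ 2) by (apply Rmult_le_pos; [lra | apply pow2_ge_0]).
    assert (A3 : 0 <= La / 2 * (u - x) ^ 2) by (apply Rmult_le_pos; [lra | apply pow2_ge_0]).
    assert (Hside : (u = x - d \/ u = x + d) -> w t x <= w s u - (- C * (s - t) + - K * (s - t) ^ 2
      + q * (u - x) + - La * (u - x) ^ 2)).
    { intros Hud.
      assert (E : (u - x) ^ 2 = d ^ 2) by (destruct Hud as [-> | ->]; ring).
      assert (H1 := Htouch u ltac:(apply Rabs_le; lra)).
      assert (H2 := Hun t u s u ltac:(lra) ltac:(lra) ltac:(lra) ltac:(lra)
        ltac:(apply Rabs_def1; lra) ltac:(rewrite Rminus_diag, Rabs_R0; auto)).
      apply Rabs_def2 in H2. rewrite E in *. lra. }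
    destruct Hbd as [-> | [-> | [Hu1 | Hu1]]].
    - assert (H1 := Htouch u ltac:(apply Rabs_le; lra)). rewrite Rminus_diag. lra.
    - replace (t + k - t) with k in * by ring. rewrite <- (Rplus_0_r (w t x)).
      destruct (HB t x ltac:(lra) ltac:(lra)) as (_ & _ & _ & B1 & _).
      destruct (HB (t + k) u ltac:(lra) ltac:(lra)) as (_ & _ & _ & B2 & _).
      apply Rabs_le_between in B1, B2. lra.
    - apply Hside; auto.
    - apply Hside; auto. }
  destruct (HB t' x' ltac:(lra) ltac:(lra)) as (B1 & B2 & B3 & B4 & B5).
  apply Rabs_le_between in B1, B5.
  assert (A1 : a t' x' * (2 * La) <= 2 * (M * La)) by nra.
  assert (A2 : b t' x' * (q + 2 * - La * (x' - x)) <= M * (P + 2 * La)).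
  { eapply Rle_trans; [apply Rle_abs|]. rewrite Rabs_mult.
    apply Rmult_le_compat; try apply Rabs_pos; auto.
    eapply Rle_trans; [apply Rabs_triang|]. apply Rplus_le_compat; auto.
    rewrite Rabs_mult, Rabs_left by lra.
    assert (Rabs (x' - x) <= 1) by (apply Rabs_le; lra). pose proof (Rabs_pos (x' - x)). nra. }
  assert (A3 : r t' x' * w t' x' <= M * M).
  { eapply Rle_trans; [apply Rle_abs|]. rewrite Rabs_mult.
    apply Rmult_le_compat; auto; apply Rabs_pos. }
  assert (A4 : 0 <= 2 * K * (t' - t)) by (apply Rmult_le_pos; lra).
  unfold C in HF. lra.
Qed.

End Dini.

Lemma Linf_bound_opp (T Xmin Xmax : R) (p : nat) (y : nat -> R -> R) (eps B : R) (g : R -> R -> R) :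
  Linf_bound T Xmin Xmax p y eps g B -> Linf_bound T Xmin Xmax p y eps (fun t x => - g t x) B.
Proof. intros H t x Ho. rewrite Rabs_Ropp. auto. Qed.

Lemma near_in_gt (T Xmin Xmax t z : R) (g v : R -> R -> R) :
  cont_box 0 T Xmin Xmax g -> cont_box 0 T Xmin Xmax v ->
  0 < t < T -> Xmin < z < Xmax -> g t z < v t z ->
  near_in (fun s x => g s x < v s x) t z.
Proof.
  intros Cg Cv Ht Hz Hgv.
  destruct (cont_box_minus _ _ _ _ _ _ Cv Cg t z ltac:(lra) ltac:(lra) (v t z - g t z) ltac:(lra))
    as (d & Hd & H).
  set (e := Rmin d (Rmin (Rmin t (T - t)) (Rmin (z - Xmin) (Xmax - z)))).
  assert (He : 0 < e) by (unfold e; repeat apply Rmin_pos; lra).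
  assert (B : e <= d /\ e <= t /\ e <= T - t /\ e <= z - Xmin /\ e <= Xmax - z).
  { unfold e. pose proof (Rmin_l d (Rmin (Rmin t (T - t)) (Rmin (z - Xmin) (Xmax - z)))).
    pose proof (Rmin_r d (Rmin (Rmin t (T - t)) (Rmin (z - Xmin) (Xmax - z)))).
    pose proof (Rmin_l (Rmin t (T - t)) (Rmin (z - Xmin) (Xmax - z))).
    pose proof (Rmin_r (Rmin t (T - t)) (Rmin (z - Xmin) (Xmax - z))).
    pose proof (Rmin_l t (T - t)). pose proof (Rmin_r t (T - t)).
    pose proof (Rmin_l (z - Xmin) (Xmax - z)). pose proof (Rmin_r (z - Xmin) (Xmax - z)). lra. }
  exists e; split; auto. intros s x Hs Hx.
  assert (Hs' := Rabs_def2 _ _ Hs). assert (Hx' := Rabs_def2 _ _ Hx).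
  specialize (H s x ltac:(lra) ltac:(lra) ltac:(lra) ltac:(lra)). apply Rabs_def2 in H. lra.
Qed.

(** * Bounds in space and time for the solution of the obstacle problem *)

Section Obstacle.
Context (T Xmin Xmax : R) (p : nat) (y : nat -> R -> R) (a b r f g v : R -> R -> R) (M eta : R).
Context (HT : 0 < T) (HO : Xmin < Xmax) (HM : 1 <= M) (Heta : 0 < eta).
Context (Hy : forall i, (i < p)%nat -> cont_on 0 T (y i)).
Context (HC : C23_on T Xmin Xmax p y v).
Context (Ca : cont_box 0 T Xmin Xmax a) (Cb : cont_box 0 T Xmin Xmax b)
  (Cr : cont_box 0 T Xmin Xmax r) (Cf : cont_box 0 T Xmin Xmax f)
  (Cg : cont_box 0 T Xmin Xmax g) (Cv : cont_box 0 T Xmin Xmax v).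
Context (Hell : forall t x, 0 <= t <= T -> Xmin <= x <= Xmax -> eta <= a t x).
Context (HB : forall t x, 0 <= t <= T -> Xmin <= x <= Xmax ->
  Rabs (a t x) <= M /\ Rabs (b t x) <= M /\ Rabs (r t x) <= M /\ Rabs (v t x) <= M /\
  Rabs (f t x) <= M).
Context (Hgl : forall t s x z, 0 <= t <= T -> 0 <= s <= T -> Xmin <= x <= Xmax ->
  Xmin <= z <= Xmax -> Rabs (g t x - g s z) <= M * (Rabs (t - s) + Rabs (x - z))).
Context (Hobs : forall t x, 0 <= t <= T -> Xmin <= x <= Xmax -> g t x <= v t x).
Context (Hsup : box_super T Xmin Xmax a b r v f (fun _ _ => True)).
Context (Hsub : box_super T Xmin Xmax a b r (fun t x => - v t x) (fun t x => - f t x)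
  (fun t x => g t x < v t x)).
Context (Hqual : forall eps, 0 < eps -> exists B, Linf_bound T Xmin Xmax p y eps (dx (dx v)) B).

Lemma near_in_all (t z : R) : near_in (fun _ _ => True) t z.
Proof. exists 1; split; [lra | auto]. Qed.

Lemma good_time_tests (eps m t1 : R) :
  0 < eps -> 1 <= m -> Linf_bound T Xmin Xmax p y eps (dt v) m ->
  eps < t1 < T -> good_time p y t1 ->
  (forall x, Xmin < x < Xmax ->
    below_test (v t1) (m * (1 + M + M * M) / eta) (M / eta) x) /\
  (forall x, Xmin < x < Xmax -> g t1 x < v t1 x ->
    below_test (fun z => - v t1 z) (m * (1 + M + M * M) / eta) (M / eta) x).
Proof.
  intros He Hm Hb Ht Hg. destruct (Hqual eps He) as [B HBx]. split.
  - intros x Hx. apply (good_time_below_test T Xmin Xmax p y a b r v f (fun _ _ => True) M eta)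
      with (eps := eps); auto; try lra.
    + intros t z Ht' Hz. destruct (HB t z Ht' Hz) as (B1 & B2 & B3 & B4 & B5). auto.
    + apply near_in_all.
  - intros x Hx Hgx.
    apply (good_time_below_test T Xmin Xmax p y a b r (fun t x => - v t x) (fun t x => - f t x)
      (fun t x => g t x < v t x) M eta HM Heta Hy (C23_on_opp _ _ _ _ _ _ HC) Ca Cb Cr)
      with (eps := eps); auto; try lra.
    + apply cont_box_opp; auto.
    + apply cont_box_opp; auto.
    + intros t z Ht' Hz. destruct (HB t z Ht' Hz) as (B1 & B2 & B3 & B4 & B5).
      rewrite !Rabs_Ropp. auto.
    + rewrite dt_opp. apply Linf_bound_opp; auto.
    + exists B. rewrite !dx_opp. apply Linf_bound_opp; auto.
    + apply near_in_gt with T Xmin Xmax; auto. lra.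
Qed.

(** [2 * cc] exceeds [M / eta] with room for the constant [L1] of the slice inequality, and the last
    summand makes [/ (4 * cc)] at most half of the interval. The summands of [K1] answer the
    conditions of [slice_lipschitz] on [Z]; the last one gives [8 * M <= 3 * Z * s0]. *)
Let cc := M / eta + 1 + 1 / (2 * (Xmax - Xmin)).
Let K1 := (1 + M + M * M) / eta + 2 * M + 1 + 32 * M * cc.
Let K2 := (1 + M + M * M) / eta + M / eta * K1 + 1.

Lemma cc_pos : 0 < M / eta /\ 0 < 1 / (2 * (Xmax - Xmin)) /\ 1 < cc.
Proof.
  assert (0 < M / eta) by (apply Rdiv_lt_0_compat; lra).
  assert (0 < 1 / (2 * (Xmax - Xmin))) by (apply Rdiv_lt_0_compat; lra).
  unfold cc; lra.
Qed.

Lemma K1_ge : 1 <= K1 /\ 2 * M + 1 <= K1 /\ (1 + M + M * M) / eta + 1 <= K1 /\ 32 * M * cc <= K1.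
Proof.
  destruct cc_pos as (_ & _ & Hc).
  assert (0 < (1 + M + M * M) / eta) by (apply Rdiv_lt_0_compat; nra).
  assert (0 < 32 * M * cc) by (apply Rmult_lt_0_compat; lra).
  unfold K1. repeat split; lra.
Qed.

Lemma K2_pos : 0 < K2.
Proof.
  destruct cc_pos as (H & _). destruct K1_ge as (H1 & _).
  assert (0 < (1 + M + M * M) / eta) by (apply Rdiv_lt_0_compat; nra).
  assert (0 < M / eta * K1) by (apply Rmult_lt_0_compat; lra). unfold K2; lra.
Qed.

Lemma good_time_slice (eps m t1 : R) :
  0 < eps -> 1 <= m -> Linf_bound T Xmin Xmax p y eps (dt v) m ->
  eps < t1 < T -> good_time p y t1 ->
  (forall x z, Xmin <= x <= Xmax -> Xmin <= z <= Xmax ->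
     Rabs (v t1 x - v t1 z) <= K1 * m * Rabs (x - z)) /\
  (forall x1 x2 x3, Xmin <= x1 -> x1 <= x2 -> x2 <= x3 -> x3 <= Xmax ->
     chord_bound (v t1) (K2 * m) x1 x2 x3) /\
  (forall x1 x2 x3, Xmin <= x1 -> x1 <= x2 -> x2 <= x3 -> x3 <= Xmax ->
     (forall x, x1 <= x <= x3 -> g t1 x < v t1 x) ->
     chord_bound (fun z => - v t1 z) (K2 * m) x1 x2 x3).
Proof.
  intros He Hm Hb Ht Hg.
  destruct (good_time_tests eps m t1 He Hm Hb Ht Hg) as [V1 V2].
  destruct cc_pos as (P1 & P2 & P3). destruct K1_ge as (Q1 & Q2 & Q3 & Q4).
  assert (HK1m : 0 < K1 * m) by (apply Rmult_lt_0_compat; lra).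
  assert (HL1 : m * (1 + M + M * M) / eta < K1 * m).
  { apply Rlt_le_trans with (((1 + M + M * M) / eta + 1) * m).
    - unfold Rdiv. lra.
    - apply Rmult_le_compat_r; lra. }
  assert (Hcs : cont_on Xmin Xmax (v t1)) by (apply (cont_box_space 0 T); auto; lra).
  assert (Hlip : forall x z, Xmin <= x <= Xmax -> Xmin <= z <= Xmax ->
     Rabs (v t1 x - v t1 z) <= K1 * m * Rabs (x - z)).
  { apply (slice_lipschitz (v t1) (g t1) Xmin Xmax (m * (1 + M + M * M) / eta) (M / eta) M
      (K1 * m) cc (/ (4 * cc))); auto; try lra.
    - assert (2 * cc * (K1 * m) >= 2 * (M / eta + 1) * (K1 * m)).
      { apply Rle_ge, Rmult_le_compat_r; [lra | unfold cc; lra]. }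
      assert (0 < M / eta * (K1 * m)) by (apply Rmult_lt_0_compat; lra). lra.
    - apply Rlt_le_trans with K1; [lra|]. rewrite <- (Rmult_1_r K1) at 1.
      apply Rmult_le_compat_l; lra.
    - apply Rmult_le_reg_l with (4 * cc); [lra|]. rewrite Rinv_r by lra.
      assert (1 / (2 * (Xmax - Xmin)) <= cc) by (unfold cc; lra).
      assert (1 / (2 * (Xmax - Xmin)) * (2 * (Xmax - Xmin)) = 1) by (field; lra). nra.
    - apply Rmult_le_reg_l with (4 * cc); [lra|].
      replace (4 * cc * (3 * (K1 * m) * / (4 * cc))) with (3 * (K1 * m)) by (field; lra).
      assert (K1 * 1 <= K1 * m) by (apply Rmult_le_compat_l; lra). lra.
    - intros x Hx. apply HB; lra.
    - intros x Hx. apply Hobs; lra.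
    - intros x z Hx Hz. eapply Rle_trans; [apply Hgl; lra|].
      rewrite Rminus_diag, Rabs_R0. lra. }
  assert (HLa : m * (1 + M + M * M) / eta + M / eta * (K1 * m) < K2 * m).
  { unfold K2, Rdiv. lra. }
  assert (HK2 := K2_pos).
  assert (HK2m : 0 < K2 * m) by (apply Rmult_lt_0_compat; lra).
  split; [auto | split].
  - intros x1 x2 x3 H1 H12 H23 H3.
    apply (slice_chord (v t1) (m * (1 + M + M * M) / eta) (M / eta) (K1 * m)); auto; try lra.
    + apply cont_on_sub with Xmin Xmax; auto.
    + intros x z Hx Hz. apply Hlip; lra.
    + intros x Hx. apply V1; lra.
  - intros x1 x2 x3 H1 H12 H23 H3 Hnc.
    apply (slice_chord (fun z => - v t1 z) (m * (1 + M + M * M) / eta) (M / eta) (K1 * m)); auto; try lra.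
    + apply cont_on_opp, cont_on_sub with Xmin Xmax; auto.
    + intros x z Hx Hz. replace (- v t1 x - - v t1 z) with (- (v t1 x - v t1 z)) by ring.
      rewrite Rabs_Ropp. apply Hlip; lra.
    + intros x Hx. apply V2; [lra|]. apply Hnc; lra.
Qed.

(** Good times are dense and [Phi] is continuous. For this reason the slice estimates are kept as
    nonstrict inequalities between values of [v]. *)
Lemma dense_le (Phi : R -> R) (t e : R) :
  cont_on 0 T Phi -> 0 < t < T -> 0 < e ->
  (forall t1, Rabs (t1 - t) < e -> 0 < t1 < T -> good_time p y t1 -> Phi t1 <= 0) -> Phi t <= 0.
Proof.
  intros Hc Ht He H. apply Rnot_lt_le; intro Hlt.
  destruct (Hc t ltac:(lra) (Phi t) Hlt) as (d & Hd & Hd').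
  destruct (good_time_near T p y Hy t (Rmin d e) Ht) as (t1 & A1 & A2 & A3).
  { apply Rmin_pos; auto. }
  pose proof (Rmin_l d e). pose proof (Rmin_r d e).
  specialize (H t1 ltac:(lra) A2 A3). specialize (Hd' t1 ltac:(lra) ltac:(lra)).
  apply Rabs_def2 in Hd'. lra.
Qed.

Lemma v_time_cont (x : R) : Xmin <= x <= Xmax -> cont_on 0 T (fun t => v t x).
Proof. intros Hx. apply (cont_box_time 0 T Xmin Xmax); auto. Qed.

(** Lets the estimate off contact pass to the limit: its premise has to hold already at the nearby
    good times. The positive gap [v - g] has a minimum on the segment and is uniformly
    continuous. *)
Lemma noncontact_stable (t x1 x3 : R) :
  0 <= t <= T -> Xmin <= x1 -> x1 <= x3 -> x3 <= Xmax ->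
  (forall x, x1 <= x <= x3 -> g t x < v t x) ->
  exists e, 0 < e /\ forall s, 0 <= s <= T -> Rabs (s - t) < e ->
    forall x, x1 <= x <= x3 -> g s x < v s x.
Proof.
  intros Ht H1 H13 H3 Hnc.
  assert (Cd := cont_box_minus _ _ _ _ _ _ Cv Cg).
  destruct (cont_on_min x1 x3 (fun x => v t x - g t x)) as (x0 & Hx0 & Hmin); auto.
  { apply (cont_on_sub Xmin Xmax); auto.
    apply (cont_box_space 0 T Xmin Xmax t (fun t x => v t x - g t x)); auto. }
  assert (Hp := Hnc x0 Hx0).
  destruct (cont_box_unif _ _ _ _ _ Cd (v t x0 - g t x0) ltac:(lra)) as (e & He & Hu).
  exists e; split; auto. intros s Hs Hst x Hx.
  specialize (Hu t x s x ltac:(lra) ltac:(lra) ltac:(lra) ltac:(lra) Hst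
    ltac:(rewrite Rminus_diag, Rabs_R0; auto)).
  specialize (Hmin x Hx). apply Rabs_def2 in Hu. lra.
Qed.

Lemma slice_estimates (eps m t : R) :
  0 < eps -> 1 <= m -> Linf_bound T Xmin Xmax p y eps (dt v) m -> eps < t < T ->
  (forall x z, Xmin <= x <= Xmax -> Xmin <= z <= Xmax ->
     Rabs (v t x - v t z) <= K1 * m * Rabs (x - z)) /\
  (forall x1 x2 x3, Xmin <= x1 -> x1 <= x2 -> x2 <= x3 -> x3 <= Xmax ->
     chord_bound (v t) (K2 * m) x1 x2 x3) /\
  (forall x1 x2 x3, Xmin <= x1 -> x1 <= x2 -> x2 <= x3 -> x3 <= Xmax ->
     (forall x, x1 <= x <= x3 -> g t x < v t x) ->
     chord_bound (fun z => - v t z) (K2 * m) x1 x2 x3).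
Proof.
  intros He Hm Hb Ht.
  assert (Hle : forall x z, Xmin <= x <= Xmax -> Xmin <= z <= Xmax ->
    v t x - v t z <= K1 * m * Rabs (x - z)).
  { intros x z Hx Hz. apply Rminus_le.
    apply (dense_le (fun t => v t x - v t z - K1 * m * Rabs (x - z)) t (t - eps)); try lra.
    - apply cont_on_minus; [|apply cont_on_const].
      apply cont_on_minus; apply v_time_cont; auto.
    - intros t1 H1 H2 H3. apply Rabs_def2 in H1.
      destruct (good_time_slice eps m t1 He Hm Hb ltac:(lra) H3) as (A & _).
      specialize (A x z Hx Hz). apply Rabs_le_between in A. lra. }
  assert (Hch : forall sg x1 x2 x3, Xmin <= x1 -> x1 <= x2 -> x2 <= x3 -> x3 <= Xmax ->
    cont_on 0 T (fun t => (x3 - x2) * (sg * v t x1) + (x2 - x1) * (sg * v t x3)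
      - (x3 - x1) * (sg * v t x2) - K2 * m / 2 * ((x2 - x1) * (x3 - x2) * (x3 - x1)))).
  { intros sg x1 x2 x3 H1 H12 H23 H3.
    assert (Hs : forall c x, Xmin <= x <= Xmax -> cont_on 0 T (fun t => c * (sg * v t x))).
    { intros c x Hx. apply cont_on_mult; [apply cont_on_const|].
      apply cont_on_mult; [apply cont_on_const | apply v_time_cont; auto]. }
    apply cont_on_minus; [|apply cont_on_const].
    apply cont_on_minus; [apply cont_on_plus|]; apply Hs; lra. }
  split; [|split].
  - intros x z Hx Hz. apply Rabs_le; split.
    + assert (H := Hle z x Hz Hx). rewrite Rabs_minus_sym in H. lra.
    + auto.
  - intros x1 x2 x3 H1 H12 H23 H3. unfold chord_bound. apply Rminus_le.
    assert (H := dense_le _ t (t - eps) (Hch 1 x1 x2 x3 H1 H12 H23 H3) ltac:(lra) ltac:(lra)).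
    cbv beta in H. rewrite !Rmult_1_l in H. apply H.
    intros t1 A1 A2 A3. apply Rabs_def2 in A1.
    destruct (good_time_slice eps m t1 He Hm Hb ltac:(lra) A3) as (_ & A & _).
    specialize (A x1 x2 x3 H1 H12 H23 H3). unfold chord_bound in A. lra.
  - intros x1 x2 x3 H1 H12 H23 H3 Hnc. unfold chord_bound.
    destruct (noncontact_stable t x1 x3 ltac:(lra) H1 ltac:(lra) H3 Hnc) as (e & He' & Hst).
    assert (H : (x3 - x2) * (-1 * v t x1) + (x2 - x1) * (-1 * v t x3)
      - (x3 - x1) * (-1 * v t x2) - K2 * m / 2 * ((x2 - x1) * (x3 - x2) * (x3 - x1)) <= 0); [|lra].
    apply (dense_le _ t (Rmin e (t - eps)) (Hch (-1) x1 x2 x3 H1 H12 H23 H3) ltac:(lra)).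
    { apply Rmin_pos; lra. }
    intros t1 A1 A2 A3. pose proof (Rmin_l e (t - eps)). pose proof (Rmin_r e (t - eps)).
    assert (A1' := Rabs_def2 _ _ A1).
    destruct (good_time_slice eps m t1 He Hm Hb ltac:(lra) A3) as (_ & _ & A).
    specialize (A x1 x2 x3 H1 H12 H23 H3 (Hst t1 ltac:(lra) ltac:(lra))). unfold chord_bound in A. lra.
Qed.

Let K3 := 1 + M + M * M + 4 * M * K2 + M * (K1 + K2).

(** [sg = 1] treats [v] and [sg = -1] treats [- v]. Off contact both are supersolutions whose second
    differences are bounded below, hence both are supported by parabolas with slope and curvature
    linear in [m]. *)
Lemma noncontact_dini (sg eps m t x : R) : sg = 1 \/ sg = -1 ->
  0 < eps -> 1 <= m -> Linf_bound T Xmin Xmax p y eps (dt v) m -> eps < t < T ->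
  Xmin < x < Xmax -> g t x < v t x ->
  exists k K, 0 < k /\ forall t', t <= t' <= t + k ->
    - (K3 * m) * (t' - t) - K * (t' - t) ^ 2 <= sg * v t' x - sg * v t x.
Proof.
  intros Hsg He Hm Hb Ht Hx Hnc.
  assert (HK2 := K2_pos). destruct K1_ge as (HK1 & _).
  destruct (slice_estimates eps m t He Hm Hb Ht) as (SL & SC & SV).
  destruct (near_in_gt T Xmin Xmax t x g v Cg Cv ltac:(lra) Hx Hnc) as (dn & Hdn & Hnear).
  set (d := Rmin (Rmin 1 (dn / 2)) (Rmin (x - Xmin) (Xmax - x))).
  assert (Hd : 0 < d) by (unfold d; repeat apply Rmin_pos; lra).
  assert (D : d <= 1 /\ d <= dn / 2 /\ d <= x - Xmin /\ d <= Xmax - x).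
  { unfold d. pose proof (Rmin_l (Rmin 1 (dn / 2)) (Rmin (x - Xmin) (Xmax - x))).
    pose proof (Rmin_r (Rmin 1 (dn / 2)) (Rmin (x - Xmin) (Xmax - x))).
    pose proof (Rmin_l 1 (dn / 2)). pose proof (Rmin_r 1 (dn / 2)).
    pose proof (Rmin_l (x - Xmin) (Xmax - x)). pose proof (Rmin_r (x - Xmin) (Xmax - x)). lra. }
  assert (HK2m : 0 < K2 * m) by (apply Rmult_lt_0_compat; lra).
  destruct (chord_touch (fun u => sg * v t u) (K2 * m) (K1 * m) x d Hd ltac:(lra)) as (q & Hq & Htq).
  { intros u z Hu Hz. rewrite <- Rmult_minus_distr_l, Rabs_mult.
    assert (Rabs sg = 1) by (destruct Hsg as [-> | ->]; [apply Rabs_R1 | rewrite Rabs_left; lra]).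
    rewrite H, Rmult_1_l. apply SL; lra. }
  { intros h k Hh Hk. unfold chord_bound. destruct Hsg as [-> | ->].
    - assert (H : chord_bound (fun z => - v t z) (K2 * m) (x - h) x (x + k)).
      { apply SV; try lra. intros u Hu. apply Hnear; apply Rabs_def1; lra. }
      unfold chord_bound in H. lra.
    - assert (H : chord_bound (v t) (K2 * m) (x - h) x (x + k)) by (apply SC; lra).
      unfold chord_bound in H. lra. }
  assert (Hq' : Rabs q <= (K1 + K2) * m).
  { eapply Rle_trans; [apply Hq|]. assert (K2 * m * d <= K2 * m * 1) by (apply Rmult_le_compat_l; lra). lra. }
  assert (Hfin : exists k K, 0 < k /\ forall t', t <= t' <= t + k ->
    - (1 + M + M * M + 4 * M * (K2 * m) + M * ((K1 + K2) * m)) * (t' - t) - K * (t' - t) ^ 2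
      <= sg * v t' x - sg * v t x).
  { destruct Hsg as [-> | ->].
    - destruct (lower_dini T Xmin Xmax a b r v f (fun _ _ => True) M HM Cv HB Hsup t x q (K2 * m)
        ((K1 + K2) * m) d) as (k & K & Hk & HD); auto; try lra.
      + apply near_in_all.
      + intros u Hu. specialize (Htq u Hu). lra.
      + exists k, K; split; auto. intros t' Ht'. specialize (HD t' Ht'). lra.
    - destruct (lower_dini T Xmin Xmax a b r (fun t x => - v t x) (fun t x => - f t x)
        (fun t x => g t x < v t x) M HM) with (t := t) (x := x) (q := q) (La := K2 * m)
        (P := (K1 + K2) * m) (d0 := d) as (k & K & Hk & HD); auto; try lra.
      + apply cont_box_opp; auto.
      + intros s z Hs Hz. rewrite !Rabs_Ropp. apply HB; auto.
      + exists dn; auto.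
      + intros u Hu. specialize (Htq u Hu). lra.
      + exists k, K; split; auto. intros t' Ht'. specialize (HD t' Ht'). lra. }
  destruct Hfin as (k & K & Hk & HD). exists k, K; split; auto.
  intros t' Ht'. eapply Rle_trans; [|apply HD; auto].
  apply Rplus_le_compat_r. apply Rmult_le_compat_r; [lra|]. apply Ropp_le_contravar.
  unfold K3. nra.
Qed.

Lemma K3_ge : M <= K3.
Proof.
  assert (HK2 := K2_pos). destruct K1_ge as (HK1 & _).
  assert (0 < M * K2) by (apply Rmult_lt_0_compat; lra).
  assert (0 < M * (K1 + K2)) by (apply Rmult_lt_0_compat; lra).
  unfold K3. nra.
Qed.

(** A fall of [v] is slow from every time on: off contact by [noncontact_dini], on contact because
    [v] stays above the Lipschitz function [g]. A rise is split at the last contact time [ss]: until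
    then [v] ends on the obstacle, afterwards the argument applies to [- v]. *)
Lemma time_lipschitz (eps m t t' x : R) :
  0 < eps -> 1 <= m -> Linf_bound T Xmin Xmax p y eps (dt v) m ->
  eps < t -> t <= t' -> t' < T -> Xmin < x < Xmax ->
  Rabs (v t' x - v t x) <= K3 * m * (t' - t).
Proof.
  intros He Hm Hb Ht Htt Ht' Hx.
  assert (HK3 := K3_ge).
  assert (HK3m : M <= K3 * m) by nra.
  assert (Hcx : cont_on 0 T (fun t => v t x)) by (apply v_time_cont; lra).
  assert (Hdin : forall sg s s', sg = 1 \/ sg = -1 -> t <= s -> s <= s' -> s' <= t' ->
    (forall u, s <= u < s' -> g u x < v u x \/ sg = 1) ->
    - (K3 * m) * (s' - s) <= sg * v s' x - sg * v s x).
  { intros sg s s' Hsg Hs Hss Hs' Hnc.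
    apply (dini_growth (fun u => sg * v u x)); auto.
    { apply cont_on_mult; [apply cont_on_const|]. apply cont_on_sub with 0 T; auto; lra. }
    intros u Hu. destruct (Rlt_le_dec (g u x) (v u x)) as [Hlt|Hle].
    - destruct (noncontact_dini sg eps m u x Hsg He Hm Hb ltac:(lra) Hx Hlt) as (k & K & Hk & HD).
      exists k, K; split; auto.
    - destruct (Hnc u Hu) as [Hn| ->]; [lra|].
      exists 1, 0. split; [lra|]. intros u' Hu' Hu2.
      assert (A1 := Hobs u' x ltac:(lra) ltac:(lra)).
      assert (A2 := Hgl u' u x x ltac:(lra) ltac:(lra) ltac:(lra) ltac:(lra)).
      rewrite (Rminus_diag x), Rabs_R0, (Rabs_right (u' - u)) in A2 by lra.
      apply Rabs_le_between in A2.
      assert (M * (u' - u) <= K3 * m * (u' - u)) by (apply Rmult_le_compat_r; lra). lra. }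
  apply Rabs_le; split.
  { assert (H := Hdin 1 t t' ltac:(auto) ltac:(lra) Htt ltac:(lra) ltac:(auto)). lra. }
  set (E := fun s => t <= s <= t' /\ v s x <= g s x).
  destruct (classic (exists s, E s)) as [Hex|Hno].
  - destruct (completeness E) as [ss [Hs1 Hs2]]; auto.
    { exists t'. intros s [H _]; lra. }
    assert (Hst : t <= ss <= t').
    { split.
      - destruct Hex as [s Hs]. apply Rle_trans with s; [apply Hs | apply Hs1; auto].
      - apply Hs2. intros s [H _]; lra. }
    assert (Hgx : cont_on 0 T (fun t => g t x)).
    { apply (cont_box_time 0 T Xmin Xmax); auto. lra. }
    assert (Hct : v ss x <= g ss x).
    { apply Rnot_lt_le; intro Hlt.
      destruct (cont_on_minus _ _ _ _ Hcx Hgx ss ltac:(lra) (v ss x - g ss x) ltac:(lra))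
        as (d & Hd & H).
      assert (ss <= ss - d); [|lra]. apply Hs2. intros s [A1 A2].
      apply Rnot_lt_le; intro A3. assert (A4 : s <= ss) by (apply Hs1; split; auto).
      specialize (H s ltac:(lra) ltac:(apply Rabs_def1; lra)). apply Rabs_def2 in H. lra. }
    assert (Hfirst : v ss x - v t x <= K3 * m * (ss - t)).
    { assert (A1 := Hobs t x ltac:(lra) ltac:(lra)).
      assert (A2 := Hgl ss t x x ltac:(lra) ltac:(lra) ltac:(lra) ltac:(lra)).
      rewrite (Rminus_diag x), Rabs_R0, (Rabs_right (ss - t)) in A2 by lra.
      apply Rabs_le_between in A2.
      assert (M * (ss - t) <= K3 * m * (ss - t)) by (apply Rmult_le_compat_r; lra). lra. }
    assert (Hlast : v t' x - v ss x <= K3 * m * (t' - ss)).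
    { destruct (Req_dec ss t') as [->|Nst]; [lra|].
      apply Rnot_lt_le; intro Hlt.
      destruct (Hcx ss ltac:(lra) (v t' x - v ss x - K3 * m * (t' - ss)) ltac:(lra)) as (d & Hd & H).
      (* There is contact at [ss] itself, so the growth bound starts slightly later and continuity
         covers the gap. *)
      set (s := ss + Rmin (d / 2) (t' - ss)).
      assert (0 < Rmin (d / 2) (t' - ss)) by (apply Rmin_pos; lra).
      pose proof (Rmin_l (d / 2) (t' - ss)). pose proof (Rmin_r (d / 2) (t' - ss)).
      specialize (H s ltac:(unfold s; lra) ltac:(unfold s; apply Rabs_def1; lra)).
      apply Rabs_def2 in H.
      assert (H3 := Hdin (-1) s t' ltac:(auto) ltac:(unfold s; lra) ltac:(unfold s; lra) ltac:(lra)).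
      assert (H4 : K3 * m * (t' - s) <= K3 * m * (t' - ss))
        by (apply Rmult_le_compat_l; [lra | unfold s; lra]).
      assert (- (K3 * m) * (t' - s) <= -1 * v t' x - -1 * v s x); [|lra].
      apply H3. intros u Hu. left. apply Rnot_le_lt; intro Hle.
      assert (u <= ss); [|unfold s in Hu; lra]. apply Hs1. split; auto. unfold s in Hu; lra. }
    lra.
  - assert (H := Hdin (-1) t t' ltac:(auto) ltac:(lra) Htt ltac:(lra)).
    assert (- (K3 * m) * (t' - t) <= -1 * v t' x - -1 * v t x); [|lra].
    apply H. intros u Hu. left. apply Rnot_le_lt; intro Hle. apply Hno. exists u. split; auto; lra.
Qed.

(** What counts is the order of the quantifiers: one [K] for all [eps] and [m], so that [m] can
    later follow the time level. *)
Lemma regularity : exists K, 1 <= K /\ forall eps m,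
  0 < eps -> 1 <= m -> Linf_bound T Xmin Xmax p y eps (dt v) m ->
  (forall t x z, eps < t < T -> Xmin <= x <= Xmax -> Xmin <= z <= Xmax ->
     Rabs (v t x - v t z) <= K * m * Rabs (x - z)) /\
  (forall t x1 x2 x3, eps < t < T -> Xmin <= x1 -> x1 <= x2 -> x2 <= x3 -> x3 <= Xmax ->
     chord_bound (v t) (K * m) x1 x2 x3) /\
  (forall t x1 x2 x3, eps < t < T -> Xmin <= x1 -> x1 <= x2 -> x2 <= x3 -> x3 <= Xmax ->
     (forall x, x1 <= x <= x3 -> g t x < v t x) ->
     chord_bound (fun z => - v t z) (K * m) x1 x2 x3) /\
  (forall t t' x, eps < t -> t <= t' -> t' < T -> Xmin < x < Xmax ->
     Rabs (v t' x - v t x) <= K * m * (t' - t)).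
Proof.
  assert (HK2 := K2_pos). destruct K1_ge as (HK1 & _). assert (HK3 := K3_ge).
  exists (K1 + K2 + K3). split; [lra|]. intros eps m He Hm Hb.
  assert (Hmono : forall k X, k <= K1 + K2 + K3 -> 0 <= X -> k * m * X <= (K1 + K2 + K3) * m * X).
  { intros k X Hk HX. apply Rmult_le_compat_r; auto. apply Rmult_le_compat_r; lra. }
  assert (Hc3 : forall x1 x2 x3, x1 <= x2 -> x2 <= x3 ->
    K2 * m / 2 * ((x2 - x1) * (x3 - x2) * (x3 - x1))
      <= (K1 + K2 + K3) * m / 2 * ((x2 - x1) * (x3 - x2) * (x3 - x1))).
  { intros x1 x2 x3 H1 H2.
    assert (0 <= (x2 - x1) * (x3 - x2) * (x3 - x1)) by (repeat apply Rmult_le_pos; lra).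
    assert (H3 := Hmono K2 _ ltac:(lra) H). lra. }
  split; [|split; [|split]].
  - intros t x z Ht Hx Hz. destruct (slice_estimates eps m t He Hm Hb Ht) as (A & _).
    eapply Rle_trans; [apply A; auto|]. apply Hmono; [lra | apply Rabs_pos].
  - intros t x1 x2 x3 Ht H1 H12 H23 H3. destruct (slice_estimates eps m t He Hm Hb Ht) as (_ & A & _).
    eapply Rle_trans; [apply A; auto|]. apply Hc3; auto.
  - intros t x1 x2 x3 Ht H1 H12 H23 H3 Hnc.
    destruct (slice_estimates eps m t He Hm Hb Ht) as (_ & _ & A).
    eapply Rle_trans; [apply A; auto|]. apply Hc3; auto.
  - intros t t' x Ht Htt Ht' Hx. eapply Rle_trans; [apply (time_lipschitz eps m); auto|].
    apply Hmono; lra.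
Qed.

End Obstacle.

(** * Consistency at a node *)

(** The discrete operators act here on functions of [(t, x)] instead of grid vectors, so that
    residuals are continuous in [t] and limits can be taken. *)
Definition Ah (a b r v : R -> R -> R) (h t x : R) : R :=
  - a t x * ((v t (x + h) - 2 * v t x + v t (x - h)) / h ^ 2)
  + b t x * ((v t (x + h) - v t (x - h)) / (2 * h)) + r t x * v t x.

Definition Bt (v : R -> R -> R) (ta t x : R) : R :=
  (3 * v t x - 4 * v (t - ta) x + v (t - 2 * ta) x) / (2 * ta).

Lemma cont_on_left_limit (lo hi t : R) (Phi : R -> R) :
  cont_on lo hi Phi -> lo < t <= hi -> (forall s, lo < s < t -> Phi s <= 0) -> Phi t <= 0.
Proof.
  intros Hc Ht H. apply Rnot_lt_le; intro Hlt.
  destruct (Hc t ltac:(lra) (Phi t) Hlt) as (d & Hd & Hd').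
  set (e := Rmin (d / 2) ((t - lo) / 2)).
  assert (0 < e) by (apply Rmin_pos; lra).
  assert (e <= d / 2) by apply Rmin_l. assert (e <= (t - lo) / 2) by apply Rmin_r.
  specialize (H (t - e) ltac:(lra)). specialize (Hd' (t - e) ltac:(lra) ltac:(apply Rabs_def1; lra)).
  apply Rabs_def2 in Hd'. lra.
Qed.

Lemma cont_on_abs (a b : R) (f : R -> R) : cont_on a b f -> cont_on a b (fun x => Rabs (f x)).
Proof.
  intros Hf x Hx e He. destruct (Hf x Hx e He) as (d & Hd & H). exists d; split; auto.
  intros z Hz Hzx. eapply Rle_lt_trans; [apply Rabs_triang_inv2 | auto].
Qed.

Lemma cont_on_shift (a b c : R) (f : R -> R) :
  cont_on (a - c) (b - c) f -> cont_on a b (fun x => f (x - c)).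
Proof.
  intros Hf x Hx e He. destruct (Hf (x - c) ltac:(lra) e He) as (d & Hd & H). exists d; split; auto.
  intros z Hz Hzx. apply H; [lra|]. replace (z - c - (x - c)) with (z - x) by ring. auto.
Qed.

Lemma mul_le_abs (X Y Z : R) : Rabs X <= Y -> X * Z <= Y * Rabs Z.
Proof.
  intros H. eapply Rle_trans; [apply Rle_abs|]. rewrite Rabs_mult.
  apply Rmult_le_compat_r; [apply Rabs_pos | auto].
Qed.

(** Derivatives are required in the open interval only: an outer stencil point may lie on a curve or
    on the boundary, and the estimate reaches it by continuity. *)
Lemma taylor_third (f d1 d2 d3 : R -> R) (x h M4 : R) :
  0 < h -> 0 <= M4 -> cont_on (x - h) (x + h) f ->
  (forall z, Rabs (z - x) < h -> is_derive f z (d1 z) /\ is_derive d1 z (d2 z) /\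
     is_derive d2 z (d3 z) /\ Rabs (d3 z) <= M4) ->
  forall z, Rabs (z - x) <= h ->
    Rabs (f z - (f x + d1 x * (z - x) + d2 x / 2 * (z - x) ^ 2)) <= M4 * h ^ 3.
Proof.
  intros Hh HM Hc H.
  assert (Hin : forall z u, Rabs (z - x) < h -> Rabs (u - x) <= Rabs (z - x) -> Rabs (u - x) < h)
    by (intros; lra).
  assert (B2 : forall z, Rabs (z - x) < h -> Rabs (d2 z - d2 x) <= M4 * h).
  { intros z Hz. apply Rle_trans with (M4 * Rabs (z - x)); [|apply Rmult_le_compat_l; lra].
    apply (MVT_abs_ball d2 d3). intros u Hu. destruct (H u ltac:(lra)) as (_ & _ & A & B). auto. }
  assert (B1 : forall z, Rabs (z - x) < h ->
    Rabs ((d1 z - d2 x * (z - x)) - (d1 x - d2 x * (x - x))) <= M4 * h * h).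
  { intros z Hz. apply Rle_trans with (M4 * h * Rabs (z - x)).
    2: { apply Rmult_le_compat_l; [apply Rmult_le_pos; lra | lra]. }
    apply (MVT_abs_ball (fun z => d1 z - d2 x * (z - x)) (fun z => d2 z - d2 x)).
    intros u Hu. destruct (H u ltac:(lra)) as (_ & A & _). split; [|apply B2; lra].
    apply (is_derive_minus d1); auto. auto_derive; auto. ring. }
  assert (B0 : forall z, Rabs (z - x) < h ->
    Rabs ((f z - (d1 x * (z - x) + d2 x / 2 * (z - x) ^ 2))
      - (f x - (d1 x * (x - x) + d2 x / 2 * (x - x) ^ 2))) <= M4 * h * h * h).
  { intros z Hz. apply Rle_trans with (M4 * h * h * Rabs (z - x)).
    2: { apply Rmult_le_compat_l; [repeat apply Rmult_le_pos; lra | lra]. }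
    apply (MVT_abs_ball (fun z => f z - (d1 x * (z - x) + d2 x / 2 * (z - x) ^ 2))
      (fun z => d1 z - (d1 x + d2 x * (z - x)))).
    intros u Hu. destruct (H u ltac:(lra)) as (A & _). split.
    - apply (is_derive_minus f); auto. auto_derive; auto. field.
    - replace (d1 u - (d1 x + d2 x * (u - x))) with
        ((d1 u - d2 x * (u - x)) - (d1 x - d2 x * (x - x))) by ring. apply B1; lra. }
  intros z Hz.
  apply (cont_on_abs_limit (x - h) (x + h) z (M4 * h ^ 3)
    (fun z => f z - (f x + d1 x * (z - x) + d2 x / 2 * (z - x) ^ 2))).
  { apply cont_on_minus; auto. apply cont_on_ex_derive. intros; auto_derive; auto. }
  { apply Rabs_le_between in Hz. lra. }
  intros e He.
  assert (HB : forall u, Rabs (u - x) < h ->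
    Rabs (f u - (f x + d1 x * (u - x) + d2 x / 2 * (u - x) ^ 2)) <= M4 * h ^ 3).
  { intros u Hu. replace (M4 * h ^ 3) with (M4 * h * h * h) by ring.
    replace (f u - (f x + d1 x * (u - x) + d2 x / 2 * (u - x) ^ 2)) with
      ((f u - (d1 x * (u - x) + d2 x / 2 * (u - x) ^ 2))
      - (f x - (d1 x * (x - x) + d2 x / 2 * (x - x) ^ 2))) by ring.
    apply B0; auto. }
  set (k := Rmin (1 / 2) (e / (2 * h))).
  assert (Hk : 0 < k) by (apply Rmin_pos; [lra | apply Rdiv_lt_0_compat; lra]).
  assert (Hk1 : k <= 1 / 2) by apply Rmin_l.
  assert (Hk2 : k * h <= e / 2).
  { apply Rle_trans with (e / (2 * h) * h).
    - apply Rmult_le_compat_r; [lra | apply Rmin_r].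
    - right; field; lra. }
  exists (z + k * (x - z)).
  assert (Hu : Rabs (z + k * (x - z) - x) < h).
  { replace (z + k * (x - z) - x) with ((1 - k) * (z - x)) by ring.
    rewrite Rabs_mult, Rabs_right by lra. pose proof (Rabs_pos (z - x)). nra. }
  split; [|split].
  - apply Rabs_def2 in Hu. lra.
  - replace (z + k * (x - z) - z) with (- (k * (z - x))) by ring.
    rewrite Rabs_Ropp, Rabs_mult, (Rabs_right k) by lra.
    apply Rle_lt_trans with (k * h); [apply Rmult_le_compat_l; lra | lra].
  - apply HB; auto.
Qed.

Section Node.
Context (T Xmin Xmax : R) (p : nat) (y : nat -> R -> R) (a b r f g v : R -> R -> R).
Context (M K eps m : R).
Context (HT : 0 < T) (HO : Xmin < Xmax) (HM : 1 <= M) (HK : 1 <= K) (Heps : 0 < eps) (Hm : 1 <= m).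
Context (Hy : forall i, (i < p)%nat -> cont_on 0 T (y i)).
Context (HC : C23_on T Xmin Xmax p y v).
Context (Ca : cont_box 0 T Xmin Xmax a) (Cb : cont_box 0 T Xmin Xmax b)
  (Cr : cont_box 0 T Xmin Xmax r) (Cf : cont_box 0 T Xmin Xmax f)
  (Cg : cont_box 0 T Xmin Xmax g) (Cv : cont_box 0 T Xmin Xmax v).
Context (Hell : forall t x, 0 <= t <= T -> Xmin <= x <= Xmax -> 0 <= a t x).
Context (HB : forall t x, 0 <= t <= T -> Xmin <= x <= Xmax ->
  Rabs (a t x) <= M /\ Rabs (b t x) <= M /\ Rabs (r t x) <= M /\ Rabs (v t x) <= M /\
  Rabs (f t x) <= M).
Context (Hgl : forall t s x z, 0 <= t <= T -> 0 <= s <= T -> Xmin <= x <= Xmax ->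
  Xmin <= z <= Xmax -> Rabs (g t x - g s z) <= M * (Rabs (t - s) + Rabs (x - z))).
Context (Hobs : forall t x, 0 <= t <= T -> Xmin <= x <= Xmax -> g t x <= v t x).
Context (Hsup : box_super T Xmin Xmax a b r v f (fun _ _ => True)).
Context (Hsub : box_super T Xmin Xmax a b r (fun t x => - v t x) (fun t x => - f t x)
  (fun t x => g t x < v t x)).
Context (Hdt : Linf_bound T Xmin Xmax p y eps (dt v) m).
Context (RL : forall t x z, eps < t < T -> Xmin <= x <= Xmax -> Xmin <= z <= Xmax ->
     Rabs (v t x - v t z) <= K * m * Rabs (x - z)).
Context (RC : forall t x1 x2 x3, eps < t < T -> Xmin <= x1 -> x1 <= x2 -> x2 <= x3 -> x3 <= Xmax ->
     chord_bound (v t) (K * m) x1 x2 x3).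
Context (RV : forall t x1 x2 x3, eps < t < T -> Xmin <= x1 -> x1 <= x2 -> x2 <= x3 -> x3 <= Xmax ->
     (forall x, x1 <= x <= x3 -> g t x < v t x) ->
     chord_bound (fun z => - v t z) (K * m) x1 x2 x3).
Context (RT : forall t t' x, eps < t -> t <= t' -> t' < T -> Xmin < x < Xmax ->
     Rabs (v t' x - v t x) <= K * m * (t' - t)).

Let A0 (t x : R) : R := - a t x * dx (dx v) t x + b t x * dx v t x + r t x * v t x.

(** The residual [E] of the equation is nonnegative, and zero off contact. Tested with [v - g - Gu]
    it leaves at most [- E * Gu <= 0], where [Gu] will be the discrete excess over the obstacle. *)
Lemma pde_slack (t x Gu : R) : O_eps T Xmin Xmax p y 0 t x -> 0 <= Gu ->
  (dt v t x + A0 t x - f t x) * (v t x - g t x - Gu) <= 0.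
Proof.
  intros Ho HGu. assert (Ho' := Ho). destruct Ho' as (Ht & Hx & _).
  assert (HE : 0 <= dt v t x + A0 t x - f t x).
  { assert (H := box_super_classical T Xmin Xmax p y v Hy HC a b r f _ t x 1
      Ca Cb Cr Cf Cv Hsup Ho Rlt_0_1 (fun _ _ _ _ => I)). unfold A0. lra. }
  assert (Hg := Hobs t x ltac:(lra) ltac:(lra)).
  destruct (Rlt_le_dec (g t x) (v t x)) as [Hlt|Hle].
  - destruct (near_in_gt T Xmin Xmax t x g v Cg Cv ltac:(lra) ltac:(lra) Hlt) as (d & Hd & Hn).
    assert (H := box_super_classical T Xmin Xmax p y (fun t x => - v t x) Hy
      (C23_on_opp _ _ _ _ _ _ HC) a b r (fun t x => - f t x) _ t x d Ca Cb Cr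
      (cont_box_opp _ _ _ _ _ Cf) (cont_box_opp _ _ _ _ _ Cv) Hsub Ho Hd Hn).
    rewrite dt_opp, !dx_opp in H. cbv beta in H. unfold A0 in *.
    assert (E : dt v t x + (- a t x * dx (dx v) t x + b t x * dx v t x + r t x * v t x) - f t x = 0)
      by lra.
    rewrite E. lra.
  - replace (v t x - g t x - Gu) with (- Gu) by lra. nra.
Qed.

Lemma Ah_consistent (M4 h t x : R) :
  0 <= M4 -> Linf_bound T Xmin Xmax p y eps (dx (dx (dx v))) M4 ->
  0 < h -> Xmin <= x - h -> x + h <= Xmax -> eps < t < T ->
  (forall z, x - h < z < x + h -> O_eps T Xmin Xmax p y eps t z) ->
  Rabs (Ah a b r v h t x - A0 t x) <= M * (2 + (Xmax - Xmin)) * (M4 * h).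
Proof.
  intros HM4 Hb4 Hh Hx1 Hx2 Ht Hop.
  assert (Hop0 : forall z, x - h < z < x + h -> O_eps T Xmin Xmax p y 0 t z).
  { intros z Hz. destruct (Hop z Hz) as (A1 & A2 & A3). repeat split; auto; lra. }
  assert (HTy : forall z, Rabs (z - x) <= h ->
    Rabs (v t z - (v t x + dx v t x * (z - x) + dx (dx v) t x / 2 * (z - x) ^ 2)) <= M4 * h ^ 3).
  { apply (taylor_third (v t) (dx v t) (dx (dx v) t) (dx (dx (dx v)) t)); auto.
    - apply cont_on_sub with Xmin Xmax; auto. apply (cont_box_space 0 T); auto. lra.
    - intros z Hz. apply Rabs_def2 in Hz.
      assert (Ho := Hop0 z ltac:(lra)).
      split; [apply (C23_dx _ _ _ _ _ _ HC); auto|].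
      split; [apply (C23_dxx _ _ _ _ _ _ HC); auto|].
      split; [apply (C23_dxxx _ _ _ _ _ _ HC); auto|]. apply Hb4, Hop; lra. }
  assert (T1 := HTy (x + h) ltac:(replace (x + h - x) with h by ring; rewrite Rabs_right; lra)).
  assert (T2 := HTy (x - h) ltac:(replace (x - h - x) with (- h) by ring; rewrite Rabs_left; lra)).
  replace (x + h - x) with h in T1 by ring. replace (x - h - x) with (- h) in T2 by ring.
  apply Rabs_le_between in T1, T2.
  destruct (HB t x ltac:(lra) ltac:(lra)) as (B1 & B2 & _).
  set (Q := M4 * h) in *. assert (HQ : 0 <= Q) by (apply Rmult_le_pos; lra).
  assert (HQ3 : M4 * h ^ 3 = Q * (h * h)) by (unfold Q; ring).
  assert (E1 : Rabs ((v t (x + h) - 2 * v t x + v t (x - h)) / h ^ 2 - dx (dx v) t x) <= 2 * Q).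
  { assert (Hh2 : 0 < h ^ 2) by nra.
    apply Rabs_le; split; apply Rmult_le_reg_r with (h ^ 2); auto;
      replace (((v t (x + h) - 2 * v t x + v t (x - h)) / h ^ 2 - dx (dx v) t x) * h ^ 2) with
        (v t (x + h) - 2 * v t x + v t (x - h) - dx (dx v) t x * h ^ 2) by (field; lra); lra. }
  assert (E2 : Rabs ((v t (x + h) - v t (x - h)) / (2 * h) - dx v t x) <= (Xmax - Xmin) * Q).
  { apply Rle_trans with (h * Q); [|apply Rmult_le_compat_r; lra].
    apply Rabs_le; split; apply Rmult_le_reg_r with (2 * h); try lra;
      replace (((v t (x + h) - v t (x - h)) / (2 * h) - dx v t x) * (2 * h)) with
        (v t (x + h) - v t (x - h) - dx v t x * (2 * h)) by (field; lra); lra. }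
  unfold Ah, A0.
  match goal with |- Rabs ?X <= _ => replace X with
    (- a t x * ((v t (x + h) - 2 * v t x + v t (x - h)) / h ^ 2 - dx (dx v) t x)
     + b t x * ((v t (x + h) - v t (x - h)) / (2 * h) - dx v t x)) by ring end.
  eapply Rle_trans; [apply Rabs_triang|]. rewrite !Rabs_mult, Rabs_Ropp.
  replace (M * (2 + (Xmax - Xmin)) * Q) with (M * (2 * Q) + M * ((Xmax - Xmin) * Q)) by ring.
  apply Rplus_le_compat; apply Rmult_le_compat; auto; apply Rabs_pos.
Qed.

(** Meant for the first two steps, where the time quotient is not compared with [v_t]: [v_t] is
    bounded by [m], and the equation transfers this to the tested space operator. *)
Lemma Ah_good (M4 h t x Gu : R) :
  0 <= M4 -> Linf_bound T Xmin Xmax p y eps (dx (dx (dx v))) M4 ->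
  0 < h -> Xmin <= x - h -> x + h <= Xmax -> eps < t < T ->
  (forall z, x - h < z < x + h -> O_eps T Xmin Xmax p y eps t z) -> 0 <= Gu ->
  Ah a b r v h t x * (v t x - g t x - Gu)
    <= (m + M + M * (2 + (Xmax - Xmin)) * (M4 * h)) * Rabs (v t x - g t x - Gu).
Proof.
  intros HM4 Hb4 Hh Hx1 Hx2 Ht Hop HGu.
  assert (HA := Ah_consistent M4 h t x HM4 Hb4 Hh Hx1 Hx2 Ht Hop).
  assert (Ho := Hop x ltac:(lra)). assert (Hd := Hdt t x Ho).
  assert (Ho0 : O_eps T Xmin Xmax p y 0 t x).
  { destruct Ho as (A1 & A2 & A3). repeat split; auto; lra. }
  assert (HP := pde_slack t x Gu Ho0 HGu).
  destruct (HB t x ltac:(lra) ltac:(lra)) as (_ & _ & _ & _ & Hf).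
  set (Z := v t x - g t x - Gu) in *.
  assert (Q1 := mul_le_abs _ _ Z HA).
  assert (Q2 := mul_le_abs _ _ Z ltac:(rewrite <- Rabs_Ropp in Hd; apply Hd)).
  assert (Q3 := mul_le_abs _ _ Z Hf).
  lra.
Qed.

Let CA := 2 * M * K + M * M.
Let CY := (2 * M * K + CA * (Xmax - Xmin)) * (K + M).

Lemma CA_pos : 1 <= CA /\ 0 < CY.
Proof.
  assert (1 <= CA) by (unfold CA; nra).
  split; auto. unfold CY. apply Rmult_lt_0_compat; [|lra].
  assert (0 < CA * (Xmax - Xmin)) by (apply Rmult_lt_0_compat; lra). nra.
Qed.

(** Bounded second differences from above bound [Ah] from below at every node, and off contact it is
    bounded on both sides. If the stencil meets the contact set and [Ah] is positive, [Gu] may be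
    dropped; then [v - g <= (K + M) m h], while [Ah * h] is [O(m)] by the Lipschitz bound. The
    product is the term [CY * m ^ 2], free of [|v - g - Gu|]. *)
Lemma Ah_rough (h t x Gu : R) :
  0 < h -> Xmin <= x - h -> x + h <= Xmax -> eps < t < T -> 0 <= Gu ->
  Ah a b r v h t x * (v t x - g t x - Gu)
    <= CA * m * Rabs (v t x - g t x - Gu) + CY * m ^ 2.
Proof.
  intros Hh Hx1 Hx2 Ht HGu. destruct CA_pos as [HCA HCY].
  destruct (HB t x ltac:(lra) ltac:(lra)) as (B1 & B2 & B3 & B4 & _).
  assert (Ha := Hell t x ltac:(lra) ltac:(lra)).
  assert (Hg := Hobs t x ltac:(lra) ltac:(lra)).
  set (D2 := v t (x + h) - 2 * v t x + v t (x - h)).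
  set (D1 := v t (x + h) - v t (x - h)).
  assert (HKm : 1 <= K * m) by nra.
  assert (Hh2 : 0 < h ^ 2) by nra.
  assert (HD1 : Rabs (D1 / (2 * h)) <= K * m).
  { assert (H := RL t (x + h) (x - h) Ht ltac:(lra) ltac:(lra)).
    replace (x + h - (x - h)) with (2 * h) in H by ring. rewrite (Rabs_right (2 * h)) in H by lra.
    unfold Rdiv. rewrite Rabs_mult, (Rabs_right (/ (2 * h))).
    - apply Rmult_le_reg_r with (2 * h); [lra|]. rewrite Rmult_assoc, Rinv_l; [|lra].
      unfold D1; lra.
    - apply Rle_ge, Rlt_le, Rinv_0_lt_compat; lra. }
  assert (HD2u : D2 / h ^ 2 <= K * m).
  { assert (H := RC t (x - h) x (x + h) Ht ltac:(lra) ltac:(lra) ltac:(lra) ltac:(lra)).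
    unfold chord_bound in H.
    replace (x + h - x) with h in H by ring. replace (x - (x - h)) with h in H by ring.
    replace (x + h - (x - h)) with (2 * h) in H by ring.
    apply Rmult_le_reg_r with (h ^ 2); auto. unfold Rdiv. rewrite Rmult_assoc, Rinv_l by lra.
    apply Rmult_le_reg_r with h; auto. unfold D2. lra. }
  assert (Hrest : Rabs (b t x * (D1 / (2 * h)) + r t x * v t x) <= M * (K * m) + M * M).
  { eapply Rle_trans; [apply Rabs_triang|]. rewrite !Rabs_mult.
    apply Rplus_le_compat; apply Rmult_le_compat; auto; apply Rabs_pos. }
  assert (HMM : M * M <= M * M * m) by nra.
  rewrite Rabs_right in B1 by lra.
  assert (Hlow : - (CA * m) <= Ah a b r v h t x).
  { unfold Ah. fold D2 D1. apply Rabs_le_between in Hrest.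
    assert (a t x * (D2 / h ^ 2) <= M * (K * m)).
    { apply Rle_trans with (a t x * (K * m)); [apply Rmult_le_compat_l; auto|].
      apply Rmult_le_compat_r; lra. }
    unfold CA. lra. }
  set (Z := v t x - g t x - Gu).
  assert (HZ := Rabs_pos Z).
  assert (HCm : 0 <= CY * m ^ 2) by (apply Rmult_le_pos; [lra | apply pow2_ge_0]).
  destruct (classic (forall z, x - h <= z <= x + h -> g t z < v t z)) as [Hnc|Hct].
  - assert (HD2l : - (K * m) <= D2 / h ^ 2).
    { assert (H := RV t (x - h) x (x + h) Ht ltac:(lra) ltac:(lra) ltac:(lra) ltac:(lra) Hnc).
      unfold chord_bound in H.
      replace (x + h - x) with h in H by ring. replace (x - (x - h)) with h in H by ring.
      replace (x + h - (x - h)) with (2 * h) in H by ring.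
      apply Rmult_le_reg_r with (h ^ 2); auto. unfold Rdiv. rewrite Rmult_assoc, Rinv_l by lra.
      apply Rmult_le_reg_r with h; auto. unfold D2. lra. }
    assert (HAb : Rabs (Ah a b r v h t x) <= CA * m).
    { apply Rabs_le; split; auto. unfold Ah. fold D2 D1. apply Rabs_le_between in Hrest.
      assert (- (M * (K * m)) <= a t x * (D2 / h ^ 2)).
      { apply Rle_trans with (a t x * - (K * m)); [|apply Rmult_le_compat_l; auto].
        assert (a t x * (K * m) <= M * (K * m)) by (apply Rmult_le_compat_r; lra). lra. }
      unfold CA. lra. }
    assert (H := mul_le_abs _ _ Z HAb). lra.
  - apply not_all_ex_not in Hct. destruct Hct as [z Hz]. apply imply_to_and in Hz.
    destruct Hz as [Hz Hgz]. assert (Hgz' := Hobs t z ltac:(lra) ltac:(lra)).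
    destruct (Rle_lt_dec 0 (Ah a b r v h t x)) as [Hpos|Hneg].
    + assert (HG : v t x - g t x <= (K + M) * m * h).
      { assert (H1 := RL t x z Ht ltac:(lra) ltac:(lra)).
        assert (H2 := Hgl t t x z ltac:(lra) ltac:(lra) ltac:(lra) ltac:(lra)).
        rewrite (Rminus_diag t), Rabs_R0 in H2.
        assert (H3 : Rabs (x - z) <= h) by (apply Rabs_le; lra).
        apply Rabs_le_between in H1, H2.
        assert (K * m * Rabs (x - z) <= K * m * h) by (apply Rmult_le_compat_l; lra).
        assert (M * (0 + Rabs (x - z)) <= M * m * h).
        { apply Rle_trans with (M * h); [apply Rmult_le_compat_l; lra|].
          apply Rmult_le_compat_r; nra. }
        lra. }
      assert (Hup : Ah a b r v h t x * h <= 2 * M * K * m + CA * m * (Xmax - Xmin)).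
      { assert (HD2h : - (2 * (K * m)) <= D2 / h ^ 2 * h).
        { assert (H1 := RL t (x + h) x Ht ltac:(lra) ltac:(lra)).
          assert (H2 := RL t (x - h) x Ht ltac:(lra) ltac:(lra)).
          replace (x + h - x) with h in H1 by ring. replace (x - h - x) with (- h) in H2 by ring.
          rewrite Rabs_Ropp in H2. rewrite (Rabs_right h) in H1, H2 by lra.
          apply Rabs_le_between in H1, H2.
          apply Rmult_le_reg_r with h; auto.
          replace (D2 / h ^ 2 * h * h) with D2 by (field; lra). unfold D2. lra. }
        assert (HaD : - (a t x * (D2 / h ^ 2)) * h <= 2 * M * K * m).
        { replace (- (a t x * (D2 / h ^ 2)) * h) with (a t x * - (D2 / h ^ 2 * h)) by ring.
          apply Rle_trans with (a t x * (2 * (K * m))); [apply Rmult_le_compat_l; lra|].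
          apply Rle_trans with (M * (2 * (K * m))); [apply Rmult_le_compat_r; lra | lra]. }
        assert (Hr2 : (b t x * (D1 / (2 * h)) + r t x * v t x) * h <= CA * m * (Xmax - Xmin)).
        { apply Rle_trans with ((M * (K * m) + M * M) * h).
          - apply Rmult_le_compat_r; [lra|]. eapply Rle_trans; [apply Rle_abs | auto].
          - assert (0 <= M * (K * m)) by nra.
            apply Rmult_le_compat; try lra; try nra. unfold CA. lra. }
        unfold Ah. fold D2 D1. lra. }
      assert (H1 : Ah a b r v h t x * Z <= Ah a b r v h t x * ((K + M) * m * h)).
      { apply Rmult_le_compat_l; auto. unfold Z; lra. }
      assert (H2 : Ah a b r v h t x * h * ((K + M) * m)
        <= (2 * M * K * m + CA * m * (Xmax - Xmin)) * ((K + M) * m)).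
      { apply Rmult_le_compat_r; auto. nra. }
      assert (H3 : 0 <= CA * m * Rabs Z) by (apply Rmult_le_pos; [nra | auto]).
      unfold CY. lra.
    + assert (HAb : Rabs (Ah a b r v h t x) <= CA * m).
      { rewrite Rabs_left; lra. }
      assert (H := mul_le_abs _ _ Z HAb). lra.
Qed.

Lemma Bt_rough (ta t x : R) :
  0 < ta -> eps < t - 2 * ta -> t < T -> Xmin < x < Xmax -> Rabs (Bt v ta t x) <= 2 * K * m.
Proof.
  intros Hta H1 H2 Hx. unfold Bt.
  assert (R1 := RT (t - ta) t x ltac:(lra) ltac:(lra) H2 Hx).
  assert (R2 := RT (t - 2 * ta) (t - ta) x ltac:(lra) ltac:(lra) ltac:(lra) Hx).
  apply Rabs_le_between in R1, R2.
  apply Rabs_le; split; apply Rmult_le_reg_r with (2 * ta); try lra;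
    unfold Rdiv; try (rewrite (Rmult_assoc _ (/ (2 * ta))), Rinv_l by lra); lra.
Qed.

Lemma Bt_good (M2 ta t x : R) :
  0 <= M2 -> Linf_bound T Xmin Xmax p y eps (dt (dt v)) M2 ->
  0 < ta -> (forall s, t - 2 * ta <= s <= t -> O_eps T Xmin Xmax p y eps s x) ->
  Rabs (Bt v ta t x - dt v t x) <= 4 * (M2 * ta).
Proof.
  intros HM2 Hb Hta Hop.
  assert (Hop0 : forall s, t - 2 * ta <= s <= t -> O_eps T Xmin Xmax p y 0 s x).
  { intros s Hs. destruct (Hop s Hs) as (A1 & A2 & A3). repeat split; auto; lra. }
  assert (B1 : forall u, t - 2 * ta <= u <= t -> Rabs (dt v t x - dt v u x) <= M2 * (t - u)).
  { intros u Hu. apply (MVT_abs_le u t M2 (fun s => dt v s x) (fun s => dt (dt v) s x)); [lra| | |].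
    - intros s Hs. apply (C23_dtt _ _ _ _ _ _ HC), Hop0; lra.
    - apply continuous_cont_on. intros s Hs. apply (ex_derive_continuous (fun s => dt v s x)).
      eexists. apply (C23_dtt _ _ _ _ _ _ HC), Hop0; lra.
    - intros s Hs. apply Hb, Hop; lra. }
  assert (B0 : forall u, t - 2 * ta <= u <= t ->
    Rabs ((v t x - dt v t x * t) - (v u x - dt v t x * u)) <= M2 * (t - u) * (t - u)).
  { intros u Hu.
    apply (MVT_abs_le u t (M2 * (t - u)) (fun s => v s x - dt v t x * s)
      (fun s => dt v s x - dt v t x)); [lra| | |].
    - intros s Hs. apply (is_derive_minus (fun s => v s x)).
      + apply (C23_dt _ _ _ _ _ _ HC), Hop0; lra.
      + auto_derive; auto. ring.
    - apply continuous_cont_on. intros s Hs.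
      apply (ex_derive_continuous (fun s => v s x - dt v t x * s)).
      eexists. apply (is_derive_minus (fun s => v s x)).
      + apply (C23_dt _ _ _ _ _ _ HC), Hop0; lra.
      + auto_derive; auto. 
    - intros s Hs. rewrite Rabs_minus_sym. eapply Rle_trans; [apply B1; lra|].
      apply Rmult_le_compat_l; lra. }
  assert (E1 := B0 (t - ta) ltac:(lra)). assert (E2 := B0 (t - 2 * ta) ltac:(lra)).
  replace (t - (t - ta)) with ta in E1 by ring.
  replace (t - (t - 2 * ta)) with (2 * ta) in E2 by ring.
  apply Rabs_le_between in E1, E2. unfold Bt.
  apply Rabs_le; split; apply Rmult_le_reg_r with (2 * ta); try lra;
    replace (((3 * v t x - 4 * v (t - ta) x + v (t - 2 * ta) x) / (2 * ta) - dt v t x) * (2 * ta))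
      with (3 * v t x - 4 * v (t - ta) x + v (t - 2 * ta) x - dt v t x * (2 * ta)) by (field; lra);
    lra.
Qed.

Lemma node_good (M2 M4 ta h t x Gu : R) :
  0 <= M2 -> Linf_bound T Xmin Xmax p y eps (dt (dt v)) M2 ->
  0 <= M4 -> Linf_bound T Xmin Xmax p y eps (dx (dx (dx v))) M4 ->
  0 < ta -> 0 < h -> Xmin <= x - h -> x + h <= Xmax -> eps < t - 2 * ta -> t < T ->
  (forall s z, t - 2 * ta <= s <= t -> x - h < z < x + h -> O_eps T Xmin Xmax p y eps s z) ->
  0 <= Gu ->
  (Bt v ta t x + Ah a b r v h t x - f t x) * (v t x - g t x - Gu)
    <= (4 * (M2 * ta) + M * (2 + (Xmax - Xmin)) * (M4 * h)) * Rabs (v t x - g t x - Gu).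
Proof.
  intros HM2 Hb2 HM4 Hb4 Hta Hh Hx1 Hx2 Ht1 Ht2 Hop HGu.
  assert (HA := Ah_consistent M4 h t x HM4 Hb4 Hh Hx1 Hx2 ltac:(lra)
    (fun z Hz => Hop t z ltac:(lra) Hz)).
  assert (HBt := Bt_good M2 ta t x HM2 Hb2 Hta (fun s Hs => Hop s x Hs ltac:(lra))).
  assert (Ho0 : O_eps T Xmin Xmax p y 0 t x).
  { destruct (Hop t x ltac:(lra) ltac:(lra)) as (A1 & A2 & A3). repeat split; auto; lra. }
  assert (HP := pde_slack t x Gu Ho0 HGu).
  set (Z := v t x - g t x - Gu) in *.
  assert (Q1 := mul_le_abs _ _ Z HA). assert (Q2 := mul_le_abs _ _ Z HBt). lra.
Qed.

Lemma Ah_cont (h x : R) : Xmin <= x - h -> x + h <= Xmax -> 0 < h ->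
  cont_on 0 T (fun t => Ah a b r v h t x).
Proof.
  intros H1 H2 Hh.
  assert (Hv : forall z, Xmin <= z <= Xmax -> cont_on 0 T (fun t => v t z)).
  { intros z Hz. apply (cont_box_time 0 T Xmin Xmax); auto. }
  unfold Ah. apply cont_on_plus; [apply cont_on_plus|]; apply cont_on_mult.
  - apply cont_on_opp. apply (cont_box_time 0 T Xmin Xmax); auto; lra.
  - apply cont_on_mult; [|apply cont_on_const].
    apply cont_on_plus; [apply cont_on_minus|]; try (apply Hv; lra).
    apply cont_on_mult; [apply cont_on_const | apply Hv; lra].
  - apply (cont_box_time 0 T Xmin Xmax); auto; lra.
  - apply cont_on_mult; [|apply cont_on_const]. apply cont_on_minus; apply Hv; lra.
  - apply (cont_box_time 0 T Xmin Xmax); auto; lra.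
  - apply Hv; lra.
Qed.

Lemma Bt_cont (ta x : R) : 0 < ta -> Xmin <= x <= Xmax ->
  cont_on (2 * ta) T (fun t => Bt v ta t x).
Proof.
  intros Hta Hx.
  assert (Hv : cont_on 0 T (fun t => v t x)).
  { apply (cont_box_time 0 T Xmin Xmax); auto. }
  unfold Bt. apply cont_on_mult; [|apply cont_on_const].
  apply cont_on_plus; [apply cont_on_minus|].
  - apply cont_on_mult; [apply cont_on_const | apply cont_on_sub with 0 T; auto; lra].
  - apply cont_on_mult; [apply cont_on_const|].
    apply (cont_on_shift _ _ ta (fun t => v t x)). apply cont_on_sub with 0 T; auto; lra.
  - apply (cont_on_shift _ _ (2 * ta) (fun t => v t x)). apply cont_on_sub with 0 T; auto; lra.
Qed.

(* [t = T] is allowed here: no derivative of [v] exists there, so the bounds are obtained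
   as limits from earlier times. *)
Lemma bdf_node_good (M2 M4 ta h t x Gu rho : R) :
  0 <= M2 -> Linf_bound T Xmin Xmax p y eps (dt (dt v)) M2 ->
  0 <= M4 -> Linf_bound T Xmin Xmax p y eps (dx (dx (dx v))) M4 ->
  0 < ta -> 0 < h -> Xmin <= x - h -> x + h <= Xmax -> eps < t - 2 * ta -> t <= T ->
  (forall i s, (i < p)%nat -> 0 <= s <= t -> t - s <= 3 * ta -> Rabs (y i s - y i t) <= rho) ->
  (forall i, (i < p)%nat -> rho + h < Rabs (x - y i t)) ->
  0 <= Gu ->
  (Bt v ta t x + Ah a b r v h t x - f t x) * (v t x - g t x - Gu)
    <= (4 * (M2 * ta) + M * (2 + (Xmax - Xmin)) * (M4 * h)) * Rabs (v t x - g t x - Gu).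
Proof.
  intros HM2 Hb2 HM4 Hb4 Hta Hh Hx1 Hx2 Ht1 Ht2 Hyc Hfar HGu.
  (* The limit runs over times within [ta] of [t], whose stencils reach back at most to
     [t - 3 * ta]; this explains the range allowed for the drift of the curves. *)
  set (lo := Rmax (eps + 2 * ta) (t - ta)).
  assert (L1 : eps + 2 * ta <= lo) by apply Rmax_l. assert (L2 : t - ta <= lo) by apply Rmax_r.
  assert (L3 : lo < t) by (apply Rmax_lub_lt; lra).
  apply Rminus_le.
  set (X := 4 * (M2 * ta) + M * (2 + (Xmax - Xmin)) * (M4 * h)).
  assert (Hvx : cont_on lo T (fun t => v t x)).
  { apply cont_on_sub with 0 T; try lra. apply (cont_box_time 0 T Xmin Xmax); auto; lra. }
  assert (HZ : cont_on lo T (fun t => v t x - g t x - Gu)).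
  { apply cont_on_minus; [|apply cont_on_const]. apply cont_on_minus; auto.
    apply cont_on_sub with 0 T; try lra. apply (cont_box_time 0 T Xmin Xmax); auto; lra. }
  apply (cont_on_left_limit lo T t (fun t =>
    (Bt v ta t x + Ah a b r v h t x - f t x) * (v t x - g t x - Gu) - X * Rabs (v t x - g t x - Gu))).
  - apply cont_on_minus; apply cont_on_mult; auto.
    + apply cont_on_minus; [apply cont_on_plus|].
      * apply cont_on_sub with (2 * ta) T; try lra. apply Bt_cont; auto; lra.
      * apply cont_on_sub with 0 T; try lra. apply Ah_cont; auto.
      * apply cont_on_sub with 0 T; try lra. apply (cont_box_time 0 T Xmin Xmax); auto; lra.
    + apply cont_on_const.
    + apply cont_on_abs; auto.
  - lra.
  - intros s Hs. apply Rle_minus. apply node_good; auto; try lra.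
    intros u z Hu Hz. split; [lra|]. split; [lra|]. intros i Hi E.
    assert (H1 := Hyc i u Hi ltac:(lra) ltac:(lra)). assert (H2 := Hfar i Hi).
    assert (Rabs (x - y i t) < rho + h); [|lra].
    replace (x - y i t) with ((x - z) + (y i u - y i t)) by (rewrite E; ring).
    eapply Rle_lt_trans; [apply Rabs_triang|].
    assert (Rabs (x - z) < h) by (apply Rabs_def1; lra). lra.
Qed.

Lemma bdf_node_rough (ta h t x Gu : R) :
  0 < ta -> 0 < h -> Xmin <= x - h -> x + h <= Xmax -> eps < t - 2 * ta -> t <= T -> 0 <= Gu ->
  (Bt v ta t x + Ah a b r v h t x - f t x) * (v t x - g t x - Gu)
    <= ((2 * K + CA + M) * m) * Rabs (v t x - g t x - Gu) + CY * m ^ 2.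
Proof.
  intros Hta Hh Hx1 Hx2 Ht1 Ht2 HGu.
  set (lo := eps + 2 * ta).
  assert (Hvx : cont_on lo T (fun t => v t x)).
  { apply cont_on_sub with 0 T; try (unfold lo; lra). apply (cont_box_time 0 T Xmin Xmax); auto; lra. }
  assert (HZ : cont_on lo T (fun t => v t x - g t x - Gu)).
  { apply cont_on_minus; [|apply cont_on_const]. apply cont_on_minus; auto.
    apply cont_on_sub with 0 T; try (unfold lo; lra). apply (cont_box_time 0 T Xmin Xmax); auto; lra. }
  apply Rminus_le.
  apply (cont_on_left_limit lo T t (fun t =>
    (Bt v ta t x + Ah a b r v h t x - f t x) * (v t x - g t x - Gu)
    - (((2 * K + CA + M) * m) * Rabs (v t x - g t x - Gu) + CY * m ^ 2))).
  - apply cont_on_minus; [|apply cont_on_plus; [|apply cont_on_const]]; apply cont_on_mult; auto.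
    + apply cont_on_minus; [apply cont_on_plus|].
      * apply cont_on_sub with (2 * ta) T; try (unfold lo; lra). apply Bt_cont; auto; lra.
      * apply cont_on_sub with 0 T; try (unfold lo; lra). apply Ah_cont; auto.
      * apply cont_on_sub with 0 T; try (unfold lo; lra). apply (cont_box_time 0 T Xmin Xmax); auto; lra.
    + apply cont_on_const.
    + apply cont_on_abs; auto.
  - unfold lo; lra.
  - unfold lo. intros s Hs. apply Rle_minus.
    assert (HA := Ah_rough h s x Gu Hh Hx1 Hx2 ltac:(lra) HGu).
    assert (HBt := Bt_rough ta s x Hta ltac:(lra) ltac:(lra) ltac:(lra)).
    destruct (HB s x ltac:(lra) ltac:(lra)) as (_ & _ & _ & _ & Hf).
    set (Z := v s x - g s x - Gu) in *.
    assert (Q2 := mul_le_abs _ _ Z HBt).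
    assert (Hf' : Rabs (- f s x) <= M * m).
    { rewrite Rabs_Ropp. apply Rle_trans with (M * 1); [lra|]. apply Rmult_le_compat_l; lra. }
    assert (Q3 := mul_le_abs _ _ Z Hf'). lra.
Qed.

End Node.

(** * Powers, sums and counting *)

Lemma Rpower_pos (x a : R) : 0 < Rpower x a.
Proof. apply exp_pos. Qed.

Lemma Rpower_anti_exp (x a b : R) : 0 < x <= 1 -> a <= b -> Rpower x b <= Rpower x a.
Proof.
  intros Hx Hab. unfold Rpower.
  assert (Hl : ln x <= 0) by (rewrite <- ln_1; apply ln_le; lra).
  destruct (Req_dec (b * ln x) (a * ln x)) as [->|N]; [lra|].
  left. apply exp_increasing. nra.
Qed.

Lemma Rpower_mono_base (x z a : R) : 0 < x <= z -> 0 <= a -> Rpower x a <= Rpower z a.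
Proof.
  intros Hx Ha. apply Rle_Rpower_l; lra.
Qed.

Lemma Rpower_anti_base (x z a : R) : 0 < x <= z -> 0 <= a -> Rpower z (- a) <= Rpower x (- a).
Proof.
  intros Hx Ha. rewrite !Rpower_Ropp. apply Rinv_le_contravar; [apply Rpower_pos|].
  apply Rpower_mono_base; auto.
Qed.

Lemma Rpower_neg_ge_1 (x a : R) : 0 < x <= 1 -> 0 <= a -> 1 <= Rpower x (- a).
Proof.
  intros Hx Ha. rewrite <- (Rpower_O x) by lra. apply Rpower_anti_exp; lra.
Qed.

Lemma Rpower_mul_self (x a : R) : 0 < x -> x * Rpower x a = Rpower x (1 + a).
Proof. intros Hx. rewrite Rpower_plus, Rpower_1; auto. Qed.

Lemma Rpower_sq (x a : R) : Rpower x a ^ 2 = Rpower x (2 * a).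
Proof. replace (2 * a) with (a + a) by ring. rewrite Rpower_plus. ring. Qed.

Lemma Rpower_half (s a : R) : 0 < s -> Rpower (s / 2) (- a) = Rpower 2 a * Rpower s (- a).
Proof.
  intros Hs. unfold Rdiv. rewrite <- Rpower_mult_distr by lra. rewrite Rmult_comm. f_equal.
  unfold Rpower. rewrite ln_Rinv by lra. f_equal. ring.
Qed.

Lemma is_derive_Rpower_x (x a : R) : 0 < x ->
  is_derive (fun z => Rpower z a) x (a * Rpower x (a - 1)).
Proof.
  intros Hx. unfold Rminus. rewrite Rpower_plus, Rpower_Ropp, Rpower_1 by auto.
  unfold Rpower. auto_derive; auto. field. lra.
Qed.

Lemma sum1_ext (n : nat) (f g : nat -> R) :
  (forall k, (1 <= k <= n)%nat -> f k = g k) -> sum1 n f = sum1 n g.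
Proof.
  induction n as [|n IH]; intros H; simpl; auto.
  rewrite IH; [rewrite H; auto; lia | intros; apply H; lia].
Qed.

Lemma sum1_le (n : nat) (f g : nat -> R) :
  (forall k, (1 <= k <= n)%nat -> f k <= g k) -> sum1 n f <= sum1 n g.
Proof.
  induction n as [|n IH]; intros H; simpl; [lra|].
  apply Rplus_le_compat; [apply IH; intros; apply H; lia | apply H; lia].
Qed.

Lemma sum1_plus (n : nat) (f g : nat -> R) : sum1 n (fun k => f k + g k) = sum1 n f + sum1 n g.
Proof. induction n as [|n IH]; simpl; [ring | rewrite IH; ring]. Qed.

Lemma sum1_scal (n : nat) (c : R) (f : nat -> R) : sum1 n (fun k => c * f k) = c * sum1 n f.
Proof. induction n as [|n IH]; simpl; [ring | rewrite IH; ring]. Qed.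

Lemma sum1_const (n : nat) (c : R) : sum1 n (fun _ => c) = INR n * c.
Proof. induction n as [|n IH]; [simpl; ring|]. rewrite S_INR. simpl sum1. rewrite IH; ring. Qed.

Lemma sum1_nonneg (n : nat) (f : nat -> R) :
  (forall k, (1 <= k <= n)%nat -> 0 <= f k) -> 0 <= sum1 n f.
Proof.
  intros H. rewrite <- (Rmult_0_r (INR n)), <- sum1_const. apply sum1_le; auto.
Qed.

Lemma sum1_telescope_le (n : nat) (f F : nat -> R) :
  (forall k, (1 <= k <= n)%nat -> f k <= F (S k) - F k) -> sum1 n f <= F (S n) - F 1%nat.
Proof.
  induction n as [|n IH]; intros H; simpl; [lra|].
  assert (H1 := H (S n) ltac:(lia)).
  assert (H2 : sum1 n f <= F (S n) - F 1%nat) by (apply IH; intros; apply H; lia). lra.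
Qed.

Lemma power_sum_antiderivative (s ta : R) (n : nat) (Psi : R -> R) :
  0 <= s -> 0 < ta -> (forall x, 0 < x -> is_derive Psi x (Rpower x (- s))) ->
  sum1 n (fun k => ta * Rpower (INR k * ta) (- s))
    <= Rpower 2 s * (Psi (INR (S n) * ta) - Psi ta).
Proof.
  intros Hs Hta HPsi. rewrite Rmult_minus_distr_l.
  assert (E1 : Psi ta = Psi (INR 1 * ta)) by (f_equal; simpl; ring). rewrite E1.
  apply (sum1_telescope_le n _ (fun k => Rpower 2 s * Psi (INR k * ta))).
  intros k Hk. assert (H1k : 1 <= INR k) by (apply (le_INR 1); lia).
  assert (Hk0 : 0 < INR k * ta) by (apply Rmult_lt_0_compat; lra).
  rewrite S_INR.
  destruct (MVT_on (INR k * ta) ((INR k + 1) * ta) Psi (fun x => Rpower x (- s))) as (c & Hc & E).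
  { lra. }
  { intros x Hx. apply HPsi; lra. }
  { apply continuous_cont_on. intros x Hx. apply (ex_derive_continuous Psi). eexists. apply HPsi; lra. }
  rewrite <- Rmult_minus_distr_l, E.
  replace ((INR k + 1) * ta - INR k * ta) with ta by ring.
  assert (Hc2 : Rpower (2 * (INR k * ta)) (- s) <= Rpower c (- s)).
  { apply Rpower_anti_base; auto. split; [lra|]. nra. }
  rewrite <- Rpower_mult_distr in Hc2 by lra.
  assert (H2 : Rpower 2 s * Rpower 2 (- s) = 1).
  { rewrite <- Rpower_plus, Rplus_opp_r, Rpower_O; lra. }
  assert (Hp2 := Rpower_pos 2 s).
  apply Rle_trans with (Rpower 2 s * (Rpower 2 (- s) * Rpower (INR k * ta) (- s)) * ta).
  - rewrite <- (Rmult_assoc (Rpower 2 s)), H2. lra.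
  - rewrite <- (Rmult_assoc (Rpower 2 s) (Rpower c (- s))). apply Rmult_le_compat_r; [lra|].
    apply Rmult_le_compat_l; lra.
Qed.

Lemma Pw_nonneg (be ta : R) : 0 <= Pw be ta.
Proof. unfold Pw. destruct Req_EM_T; [apply Rabs_pos | left; apply Rpower_pos]. Qed.

(** The threshold stems from [exp 1 <= 3]: in the exceptional case it makes [|ln ta|] at least
    [1]. *)
Lemma Rpower_le_Pw (be ta : R) : 0 < ta <= / 3 -> Rpower ta be <= Pw be ta.
Proof.
  intros Hta. unfold Pw. destruct Req_EM_T as [->|N]; [|lra].
  rewrite Rpower_O by lra.
  assert (1 <= - ln ta).
  { rewrite <- ln_Rinv by lra.
    rewrite <- (ln_exp 1) at 1. apply ln_le; [apply exp_pos|].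
    apply Rle_trans with 3; [apply exp_le_3|].
    rewrite <- (Rinv_inv 3). apply Rinv_le_contravar; lra. }
  rewrite Rabs_left; lra.
Qed.

(** [Pw] accounts for the lower end point [ta] of the integral, the summand [1] for the upper one,
    which is at most [2 * T]. Either may dominate, according to the sign of [1 - 2 * al]. *)
Lemma power_sum (T al : R) : 0 < T -> 0 <= al ->
  exists C, 0 <= C /\ forall ta n, 0 < ta -> INR n * ta <= T ->
    sum1 n (fun k => ta * Rpower (INR k * ta) (- (2 * al))) <= C * (1 + Pw (1 - 2 * al) ta).
Proof.
  intros HT Hal.
  assert (Hp2 := Rpower_pos 2 (2 * al)).
  destruct (Req_dec (1 - 2 * al) 0) as [E|N].
  - exists (Rpower 2 (2 * al) * (Rabs (ln (2 * T)) + 1)).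
    split. { apply Rmult_le_pos; [lra|]. pose proof (Rabs_pos (ln (2 * T))). lra. }
    intros ta n Hta Hn.
    destruct (Nat.eq_dec n 0) as [->|Nn].
    { simpl. pose proof (Pw_nonneg (1 - 2 * al) ta). pose proof (Rabs_pos (ln (2 * T))).
      apply Rmult_le_pos; [apply Rmult_le_pos|]; lra. }
    eapply Rle_trans; [apply (power_sum_antiderivative (2 * al) ta n ln); try lra|].
    { intros x Hx. replace (- (2 * al)) with (- (1)) by lra.
      rewrite Rpower_Ropp, Rpower_1 by auto. auto_derive; auto. ring. }
    rewrite Rmult_assoc. apply Rmult_le_compat_l; [lra|].
    rewrite E. unfold Pw. destruct Req_EM_T as [_|F]; [|lra].
    assert (H1n : 1 <= INR n) by (apply (le_INR 1); lia).
    assert (ln (INR (S n) * ta) <= ln (2 * T)).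
    { rewrite S_INR. apply ln_le; [apply Rmult_lt_0_compat; lra | nra]. }
    pose proof (Rle_abs (ln (2 * T))). pose proof (Rle_abs (- ln ta)). rewrite Rabs_Ropp in *.
    pose proof (Rabs_pos (ln (2 * T))). pose proof (Rabs_pos (ln ta)).
    assert (0 <= Rabs (ln (2 * T)) * Rabs (ln ta)) by (apply Rmult_le_pos; lra). lra.
  - set (be := 1 - 2 * al) in *.
    assert (HPsi : forall x, 0 < x -> is_derive (fun z => Rpower z be / be) x (Rpower x (- (2 * al)))).
    { intros x Hx. apply is_derive_ext with (fun z => / be * Rpower z be).
      { intros; simpl; unfold Rdiv; ring. }
      replace (Rpower x (- (2 * al))) with (/ be * (be * Rpower x (be - 1))).
      - apply (is_derive_scal (fun z => Rpower z be)). apply is_derive_Rpower_x; auto.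
      - rewrite <- Rmult_assoc, Rinv_l, Rmult_1_l by auto. f_equal. unfold be; ring. }
    exists (Rpower 2 (2 * al) * (Rpower (2 * T) be + 1) / Rabs be).
    assert (Hbe : 0 < Rabs be) by (apply Rabs_pos_lt; auto).
    assert (Hp2T := Rpower_pos (2 * T) be).
    split. { apply Rlt_le, Rdiv_lt_0_compat; auto. apply Rmult_lt_0_compat; lra. }
    intros ta n Hta Hn.
    destruct (Nat.eq_dec n 0) as [->|Nn].
    { simpl. pose proof (Pw_nonneg be ta). apply Rmult_le_pos; [|lra].
      apply Rlt_le, Rdiv_lt_0_compat; auto. apply Rmult_lt_0_compat; lra. }
    eapply Rle_trans; [apply (power_sum_antiderivative (2 * al) ta n (fun z => Rpower z be / be)); auto; lra|].
    cbv beta. unfold Rdiv. rewrite !Rmult_assoc. apply Rmult_le_compat_l; [lra|].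
    assert (H1n : 1 <= INR n) by (apply (le_INR 1); lia).
    assert (Hpt := Rpower_pos ta be).
    unfold Pw. destruct Req_EM_T as [F|_]; [contradiction|].
    assert (Hib : 0 < / Rabs be) by (apply Rinv_0_lt_compat; auto).
    apply Rle_trans with (/ Rabs be * (Rpower (2 * T) be + Rpower ta be)).
    + destruct (Rlt_dec 0 be) as [Hpos|Hneg].
      * rewrite Rabs_right in * by lra.
        assert (Rpower (INR (S n) * ta) be <= Rpower (2 * T) be).
        { apply Rpower_mono_base; [|lra]. rewrite S_INR. split; [apply Rmult_lt_0_compat; lra | nra]. }
        apply Rle_trans with (/ be * (Rpower (INR (S n) * ta) be - Rpower ta be)); [right; ring|].
        apply Rmult_le_compat_l; lra.
      * rewrite Rabs_left in * by lra.
        pose proof (Rpower_pos (INR (S n) * ta) be).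
        apply Rle_trans with (/ - be * (Rpower ta be - Rpower (INR (S n) * ta) be)).
        { right. field. auto. }
        apply Rmult_le_compat_l; lra.
    + rewrite (Rmult_comm (Rpower (2 * T) be + 1)), Rmult_assoc.
      apply Rmult_le_compat_l; [lra|].
      assert (0 < Rpower (2 * T) be * Rpower ta be) by (apply Rmult_lt_0_compat; auto). lra.
Qed.

(** A real-valued indicator, decided classically, so that a single bound serves nodes near and away
    from the curves. *)
Definition indic (P : Prop) : R := if excluded_middle_informative P then 1 else 0.

Lemma indic_true (P : Prop) : P -> indic P = 1.
Proof. intros H. unfold indic. destruct excluded_middle_informative; tauto. Qed.

Lemma indic_false (P : Prop) : ~ P -> indic P = 0.
Proof. intros H. unfold indic. destruct excluded_middle_informative; tauto. Qed.

Lemma indic_bounds (P : Prop) : 0 <= indic P <= 1.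
Proof. unfold indic. destruct excluded_middle_informative; lra. Qed.

(* Each grid point within [rho] of [c] advances the clamped coordinate by exactly [h]. *)
Lemma count_near (X0 h c rho : R) (n : nat) : 0 < h -> 0 <= rho ->
  sum1 n (fun j => h * indic (Rabs (X0 + INR j * h - c) <= rho)) <= 2 * rho + h.
Proof.
  intros Hh Hrho.
  set (F := fun k => clamp (c - rho - h) (c + rho) (X0 + (INR k - 1) * h)).
  assert (HF : forall k, c - rho - h <= F k <= c + rho) by (intros k; apply clamp_in; lra).
  apply Rle_trans with (F (S n) - F 1%nat).
  - apply sum1_telescope_le. intros k Hk. unfold F. rewrite S_INR.
    replace (INR k + 1 - 1) with (INR k) by ring.
    destruct (classic (Rabs (X0 + INR k * h - c) <= rho)) as [H|H].
    + rewrite indic_true by auto. apply Rabs_le_between in H.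
      rewrite !clamp_id by lra. right; ring.
    + rewrite indic_false by auto. rewrite Rmult_0_r.
      unfold clamp, Rmax, Rmin. repeat destruct Rle_dec; lra.
  - assert (A := HF (S n)). assert (B := HF 1%nat). lra.
Qed.

Lemma count_near_many (X0 h rho : R) (c : nat -> R) (q n : nat) : 0 < h -> 0 <= rho ->
  sum1 n (fun j => h * indic (exists i, (i < q)%nat /\ Rabs (X0 + INR j * h - c i) <= rho))
    <= INR q * (2 * rho + h).
Proof.
  intros Hh Hrho. induction q as [|q IH].
  - simpl INR. rewrite Rmult_0_l.
    rewrite <- (Rmult_0_r (INR n)), <- sum1_const. apply sum1_le. intros k Hk.
    rewrite indic_false; [lra|]. intros (i & Hi & _). lia.
  - rewrite S_INR.
    apply Rle_trans with (sum1 n (fun j =>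
      h * indic (exists i, (i < q)%nat /\ Rabs (X0 + INR j * h - c i) <= rho)
      + h * indic (Rabs (X0 + INR j * h - c q) <= rho))).
    + apply sum1_le. intros k Hk. rewrite <- Rmult_plus_distr_l. apply Rmult_le_compat_l; [lra|].
      destruct (classic (exists i, (i < S q)%nat /\ Rabs (X0 + INR k * h - c i) <= rho))
        as [(i & Hi & Hd)|H].
      * destruct (Nat.eq_dec i q) as [->|Nq].
        { rewrite (indic_true (Rabs (X0 + INR k * h - c q) <= rho)) by auto.
          destruct (indic_bounds (exists i, (i < q)%nat /\ Rabs (X0 + INR k * h - c i) <= rho)).
          destruct (indic_bounds (exists i, (i < S q)%nat /\ Rabs (X0 + INR k * h - c i) <= rho)). lra. }
        rewrite (indic_true (exists i, (i < q)%nat /\ Rabs (X0 + INR k * h - c i) <= rho))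
          by (exists i; split; auto; lia).
        destruct (indic_bounds (Rabs (X0 + INR k * h - c q) <= rho)).
        destruct (indic_bounds (exists i, (i < S q)%nat /\ Rabs (X0 + INR k * h - c i) <= rho)). lra.
      * rewrite indic_false by auto.
        destruct (indic_bounds (exists i, (i < q)%nat /\ Rabs (X0 + INR k * h - c i) <= rho)).
        destruct (indic_bounds (Rabs (X0 + INR k * h - c q) <= rho)). lra.
    + rewrite sum1_plus. assert (H := count_near X0 h (c q) rho n Hh Hrho). lra.
Qed.

(** For [al1 < 1] a dyadic step from [s] to [2 s] costs [O(s ^ (1 - al1))]; these costs telescope,
    and continuity at [0] closes the series. For [al1 >= 1] the factor [t * t ^ (- al1)] is at least
    [1], and boundedness of [v] is enough. *)
Lemma start_modulus (T Xmin Xmax al1 C1 M K : R) (p : nat) (y : nat -> R -> R) (v : R -> R -> R) :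
  0 <= al1 -> 0 <= C1 -> 1 <= K -> 0 < M -> 0 < T ->
  cont_box 0 T Xmin Xmax v ->
  (forall t x, 0 <= t <= T -> Xmin <= x <= Xmax -> Rabs (v t x) <= M) ->
  (forall eps, 0 < eps -> Linf_bound T Xmin Xmax p y eps (dt v) (C1 * Rpower eps (- al1))) ->
  (forall eps m, 0 < eps -> 1 <= m -> Linf_bound T Xmin Xmax p y eps (dt v) m ->
     forall t t' x, eps < t -> t <= t' -> t' < T -> Xmin < x < Xmax ->
     Rabs (v t' x - v t x) <= K * m * (t' - t)) ->
  exists D, 0 <= D /\ forall t x, 0 < t -> t <= 1 -> t < T -> Xmin < x < Xmax ->
    Rabs (v t x - v 0 x) <= D * (t * Rpower t (- al1)).
Proof.
  intros Hal HC1 HK HM HT Cv HvM Hb HR.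
  destruct (Rle_lt_dec 1 al1) as [Hge|Hlt].
  { exists (2 * M). split; [lra|]. intros t x H0 H1 HtT Hx.
    assert (1 <= t * Rpower t (- al1)).
    { rewrite Rpower_mul_self by auto. replace (1 + - al1) with (- (al1 - 1)) by ring.
      apply Rpower_neg_ge_1; lra. }
    assert (B1 := HvM t x ltac:(lra) ltac:(lra)). assert (B2 := HvM 0 x ltac:(lra) ltac:(lra)).
    apply Rabs_le_between in B1, B2.
    apply Rle_trans with (2 * M * 1); [apply Rabs_le; lra | apply Rmult_le_compat_l; lra]. }
  set (ga := 1 - al1). assert (Hga : 0 < ga) by (unfold ga; lra).
  set (K' := K * (1 + C1 * Rpower 2 al1)).
  assert (HK' : 0 < K').
  { unfold K'. pose proof (Rpower_pos 2 al1).
    assert (0 <= C1 * Rpower 2 al1) by (apply Rmult_le_pos; lra). apply Rmult_lt_0_compat; lra. }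
  (* Chosen so that [q * s ^ ga] is the increment of the power [ga] from [s] to [2 * s]. *)
  set (q := Rpower 2 ga - 1).
  assert (Hq : 0 < q).
  { unfold q. rewrite <- (Rpower_O 2) by lra. pose proof (Rpower_lt 2 0 ga ltac:(lra) Hga). lra. }
  exists (K' / q). assert (HKq : 0 < K' / q) by (apply Rdiv_lt_0_compat; auto).
  split; [lra|]. intros t x H0 H1 HtT Hx.
  rewrite Rpower_mul_self by auto. replace (1 + - al1) with ga by (unfold ga; ring).
  assert (Hstep : forall s, 0 < s -> 2 * s <= t ->
    Rabs (v (2 * s) x - v s x) <= K' / q * (Rpower (2 * s) ga - Rpower s ga)).
  { intros s Hs Hst.
    assert (Hs2 : Rpower (s / 2) (- al1) = Rpower 2 al1 * Rpower s (- al1)).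
    { apply Rpower_half; auto. }
    assert (Hs1 := Rpower_neg_ge_1 s al1 ltac:(lra) Hal).
    assert (Hpp : 0 <= C1 * Rpower 2 al1).
    { pose proof (Rpower_pos 2 al1). apply Rmult_le_pos; lra. }
    assert (Hbs := Hb (s / 2) ltac:(lra)). rewrite Hs2 in Hbs.
    assert (Hm : C1 * (Rpower 2 al1 * Rpower s (- al1))
      <= (1 + C1 * Rpower 2 al1) * Rpower s (- al1)) by lra.
    assert (H := HR (s / 2) ((1 + C1 * Rpower 2 al1) * Rpower s (- al1)) ltac:(lra)).
    eapply Rle_trans; [apply H; try lra|].
    - apply Rle_trans with (1 * 1); [lra|]. apply Rmult_le_compat; lra.
    - intros u z Ho. eapply Rle_trans; [apply (Hbs u z Ho) | auto].
    - replace (2 * s - s) with s by ring.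
      replace (K * ((1 + C1 * Rpower 2 al1) * Rpower s (- al1)) * s) with
        (K' * (s * Rpower s (- al1))) by (unfold K'; ring).
      rewrite Rpower_mul_self by auto. replace (1 + - al1) with ga by (unfold ga; ring).
      rewrite <- Rpower_mult_distr by lra.
      replace (Rpower 2 ga * Rpower s ga - Rpower s ga) with (q * Rpower s ga) by (unfold q; ring).
      right. field. lra. }
  assert (Hdy : forall n, Rabs (v t x - v (t * (/ 2) ^ n) x)
    <= K' / q * (Rpower t ga - Rpower (t * (/ 2) ^ n) ga)).
  { induction n as [|n IH].
    - simpl. rewrite Rmult_1_r, !Rminus_diag, Rabs_R0. lra.
    - assert (Hp : 0 < (/ 2) ^ n) by (apply pow_lt; lra).
      assert (Hp1 : (/ 2) ^ n <= 1).
      { rewrite <- (pow1 n). apply pow_incr; lra. }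
      set (s := t * (/ 2) ^ S n).
      assert (Es : t * (/ 2) ^ n = 2 * s) by (unfold s; simpl; field).
      assert (Hs : 0 < s) by (unfold s; simpl; apply Rmult_lt_0_compat; lra).
      assert (A := Hstep s Hs ltac:(nra)). rewrite Es in IH.
      replace (v t x - v s x) with ((v t x - v (2 * s) x) + (v (2 * s) x - v s x)) by ring.
      eapply Rle_trans; [apply Rabs_triang|]. lra. }
  apply Rnot_lt_le; intro Hbad.
  set (gap := Rabs (v t x - v 0 x) - K' / q * Rpower t ga).
  destruct (cont_box_time 0 T Xmin Xmax x v Cv ltac:(lra) 0 ltac:(lra) gap ltac:(unfold gap; lra))
    as (d & Hd & Hc).
  destruct (pow_lt_1_zero (/ 2) ltac:(rewrite Rabs_right; lra) (d / (2 * t)) ) as [n Hn].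
  { apply Rdiv_lt_0_compat; lra. }
  specialize (Hn n (le_n n)). rewrite Rabs_right in Hn by (apply Rle_ge, pow_le; lra).
  assert (Hp : 0 < (/ 2) ^ n) by (apply pow_lt; lra).
  assert (Hp1 : (/ 2) ^ n <= 1) by (rewrite <- (pow1 n); apply pow_incr; lra).
  set (s := t * (/ 2) ^ n) in *.
  assert (Hs : 0 < s) by (unfold s; apply Rmult_lt_0_compat; lra).
  assert (Hsd : s < d).
  { unfold s. apply Rlt_trans with (t * (d / (2 * t))); [apply Rmult_lt_compat_l; auto|].
    replace (t * (d / (2 * t))) with (d / 2) by (field; lra). lra. }
  assert (HsT : s <= t) by (unfold s; nra).
  specialize (Hc s ltac:(lra) ltac:(apply Rabs_def1; lra)).
  assert (A := Hdy n). fold s in A.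
  assert (Hps := Rpower_pos s ga).
  assert (0 < K' / q * Rpower s ga) by (apply Rmult_lt_0_compat; auto).
  assert (Rabs (v t x - v 0 x) <= Rabs (v t x - v s x) + Rabs (v s x - v 0 x)).
  { replace (v t x - v 0 x) with ((v t x - v s x) + (v s x - v 0 x)) at 1 by ring. apply Rabs_triang. }
  unfold gap in Hc. lra.
Qed.

(** * Discrete energy estimates *)

Definition Lgrid (h : R) (a b r e : nat -> R) (j : nat) : R :=
  - a j * ((e (S j) - 2 * e j + e (j - 1)%nat) / h ^ 2)
  + b j * ((e (S j) - e (j - 1)%nat) / (2 * h)) + r j * e j.

Lemma young (k x z : R) : 0 < k -> Rabs (x * z) <= k * x ^ 2 + z ^ 2 / (4 * k).
Proof.
  intros Hk.
  assert (E : k * x ^ 2 + z ^ 2 / (4 * k) - x * z = k * (x - z / (2 * k)) ^ 2) by (field; lra).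
  assert (E' : k * x ^ 2 + z ^ 2 / (4 * k) + x * z = k * (x + z / (2 * k)) ^ 2) by (field; lra).
  pose proof (Rmult_le_pos k _ ltac:(lra) (pow2_ge_0 (x - z / (2 * k)))).
  pose proof (Rmult_le_pos k _ ltac:(lra) (pow2_ge_0 (x + z / (2 * k)))).
  apply Rabs_le; lra.
Qed.

(** Summation by parts in local form, with [P = ep - e] and [Q = e - em]. Of the [4 k Q^2] supplied
    by ellipticity, one [k Q^2] goes to the variation of [a], one to the drift along [Q] and one to
    the increment on the right; the drift along [P] is paid by the square [k P^2] handed on to the
    next node. *)
Lemma garding_pointwise (h k La M am a0 b0 r0 em e ep : R) :
  0 < h -> 0 < k -> 4 * k <= a0 -> Rabs (a0 - am) <= La * h -> Rabs b0 <= M -> Rabs r0 <= M ->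
  - (h ^ 2 * ((- a0 * ((ep - 2 * e + em) / h ^ 2) + b0 * ((ep - em) / (2 * h)) + r0 * e) * e))
    - (La ^ 2 / (4 * k) + M ^ 2 / (8 * k) + M) * h ^ 2 * (e ^ 2 + em ^ 2)
  <= (a0 * e * (ep - e) + k * (ep - e) ^ 2) - (am * em * (e - em) + k * (e - em) ^ 2).
Proof.
  intros Hh Hk Ha HLa Hb Hr.
  replace (h ^ 2 * ((- a0 * ((ep - 2 * e + em) / h ^ 2) + b0 * ((ep - em) / (2 * h)) + r0 * e) * e))
    with (- a0 * (ep - 2 * e + em) * e + h / 2 * b0 * (ep - em) * e + h ^ 2 * r0 * e ^ 2)
    by (field; lra).
  set (P := ep - e). set (Q := e - em).
  assert (HM : 0 <= M) by (pose proof (Rabs_pos b0); lra).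
  assert (Y1 : Rabs ((a0 - am) * em * Q) <= k * Q ^ 2 + (La * h * Rabs em) ^ 2 / (4 * k)).
  { apply Rle_trans with (Rabs (Q * (La * h * Rabs em))); [|apply young; auto].
    rewrite !Rabs_mult, Rabs_Rabsolu.
    assert (Rabs (a0 - am) <= Rabs La * Rabs h).
    { rewrite <- Rabs_mult. eapply Rle_trans; [apply HLa | apply Rle_abs]. }
    pose proof (Rabs_pos em). pose proof (Rabs_pos Q).
    replace (Rabs Q * (Rabs La * Rabs h * Rabs em)) with (Rabs La * Rabs h * Rabs em * Rabs Q) by ring.
    apply Rmult_le_compat_r; auto. apply Rmult_le_compat_r; auto. }
  assert (Yb : forall D, Rabs (h / 2 * b0 * D * e) <= k * D ^ 2 + (h / 2 * M * Rabs e) ^ 2 / (4 * k)).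
  { intros D. apply Rle_trans with (Rabs (D * (h / 2 * M * Rabs e))); [|apply young; auto].
    rewrite !Rabs_mult, Rabs_Rabsolu, (Rabs_right M) by lra.
    pose proof (Rabs_pos e). pose proof (Rabs_pos D). pose proof (Rabs_pos (h / 2)).
    replace (Rabs D * (Rabs (h / 2) * M * Rabs e)) with (Rabs (h / 2) * M * Rabs D * Rabs e) by ring.
    apply Rmult_le_compat_r; auto. apply Rmult_le_compat_r; auto. apply Rmult_le_compat_l; auto. }
  assert (Y2 := Yb P). assert (Y3 := Yb Q).
  apply Rabs_le_between in Y1, Y2, Y3, Hr.
  assert (E1 : (La * h * Rabs em) ^ 2 / (4 * k) = La ^ 2 / (4 * k) * h ^ 2 * em ^ 2).
  { rewrite <- (pow2_abs em). field; lra. }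
  assert (E2 : (h / 2 * M * Rabs e) ^ 2 / (4 * k) = M ^ 2 / (16 * k) * h ^ 2 * e ^ 2).
  { rewrite <- (pow2_abs e). field; lra. }
  rewrite E1 in Y1. rewrite E2 in Y2, Y3.
  assert (E3 : M ^ 2 / (8 * k) = 2 * (M ^ 2 / (16 * k))) by (field; lra).
  rewrite E3.
  assert (Hh2 : 0 <= h ^ 2) by apply pow2_ge_0.
  assert (He2 := pow2_ge_0 e). assert (Hem2 := pow2_ge_0 em).
  assert (HP := pow2_ge_0 P). assert (HQ := pow2_ge_0 Q).
  assert (R1 : 0 <= h ^ 2 * e ^ 2) by (apply Rmult_le_pos; auto).
  assert (R2 : 0 <= h ^ 2 * em ^ 2) by (apply Rmult_le_pos; auto).
  assert (R3 : - (M * (h ^ 2 * e ^ 2)) <= h ^ 2 * r0 * e ^ 2) by nra.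
  assert (R4 : 0 <= M * (h ^ 2 * em ^ 2)) by (apply Rmult_le_pos; auto).
  assert (R5 : 4 * k * Q ^ 2 <= a0 * Q ^ 2) by (apply Rmult_le_compat_r; auto).
  assert (R6 : 0 <= k * Q ^ 2) by (apply Rmult_le_pos; lra).
  assert (HL2 : 0 <= La ^ 2 / (4 * k)).
  { apply Rmult_le_pos; [apply pow2_ge_0 | left; apply Rinv_0_lt_compat; lra]. }
  assert (HM2 : 0 <= M ^ 2 / (16 * k)).
  { apply Rmult_le_pos; [apply pow2_ge_0 | left; apply Rinv_0_lt_compat; lra]. }
  assert (R7 := Rmult_le_pos _ _ HL2 R1). assert (R8 := Rmult_le_pos _ _ HM2 R2).
  replace (ep - em) with (P + Q) by (unfold P, Q; ring).
  replace (ep - 2 * e + em) with (P - Q) by (unfold P, Q; ring).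
  assert (E4 : e = em + Q) by (unfold Q; ring).
  assert (E5 : a0 * Q * e = a0 * Q ^ 2 + am * em * Q + (a0 - am) * em * Q) by (rewrite E4; ring).
  lra.
Qed.

(** Zero boundary values give both ends of the telescoped sum the favourable sign. The factor [2]
    appears because the pointwise error involves [e j] and [e (j - 1)]; the remaining constants are
    those for [k = eta / 4]. *)
Lemma garding (J : nat) (h eta La M : R) (a b r e : nat -> R) :
  0 < h -> 0 < eta -> e 0%nat = 0 -> e (S J) = 0 ->
  (forall j, (j <= J)%nat -> eta <= a j) ->
  (forall j, (j < J)%nat -> Rabs (a (S j) - a j) <= La * h) ->
  (forall j, (1 <= j <= J)%nat -> Rabs (b j) <= M /\ Rabs (r j) <= M) ->
  - (2 * (La ^ 2 / eta + M ^ 2 / (2 * eta) + M)) * sum1 J (fun j => h * e j ^ 2)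
    <= sum1 J (fun j => h * (Lgrid h a b r e j * e j)).
Proof.
  intros Hh Heta He0 HeJ Ha HLa Hbr.
  destruct (Nat.eq_dec J 0) as [->|NJ]; [simpl; lra|].
  set (k := eta / 4).
  set (Cc := La ^ 2 / (4 * k) + M ^ 2 / (8 * k) + M).
  assert (HCc : La ^ 2 / eta + M ^ 2 / (2 * eta) + M = Cc) by (unfold Cc, k; field; lra).
  assert (HM : 0 <= M).
  { destruct (Hbr 1%nat ltac:(lia)) as [H _]. pose proof (Rabs_pos (b 1%nat)). lra. }
  assert (HCc0 : 0 <= Cc).
  { rewrite <- HCc. assert (0 <= La ^ 2 / eta).
    { apply Rmult_le_pos; [apply pow2_ge_0 | left; apply Rinv_0_lt_compat; lra]. }
    assert (0 <= M ^ 2 / (2 * eta)).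
    { apply Rmult_le_pos; [apply pow2_ge_0 | left; apply Rinv_0_lt_compat; lra]. }
    lra. }
  set (Phi := fun j => a j * e j * (e (S j) - e j) + k * (e (S j) - e j) ^ 2).
  assert (Hsum : sum1 J (fun j => - h ^ 2 * (Lgrid h a b r e j * e j)
     + - (Cc * h ^ 2) * (e j ^ 2 + e (j - 1)%nat ^ 2)) <= Phi J - Phi 0%nat).
  { replace J with (S J - 1)%nat at 2 by lia.
    apply (sum1_telescope_le J _ (fun q => Phi (q - 1)%nat)). intros q Hq. cbv beta.
    replace (S q - 1)%nat with q by lia.
    destruct (Hbr q Hq) as [Hb Hr].
    assert (HL := HLa (q - 1)%nat ltac:(lia)). replace (S (q - 1)) with q in HL by lia.
    assert (H := garding_pointwise h k La M (a (q - 1)%nat) (a q) (b q) (r q) (e (q - 1)%nat) (e q)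
      (e (S q)) Hh ltac:(unfold k; lra) ltac:(assert (H := Ha q ltac:(lia)); unfold k; lra) HL Hb Hr).
    unfold Phi, Lgrid. replace (S (q - 1)) with q by lia. fold Cc in H. lra. }
  assert (HPhi0 : 0 <= Phi 0%nat).
  { unfold Phi. rewrite He0. pose proof (pow2_ge_0 (e 1%nat - 0)). unfold k. nra. }
  assert (HPhiJ : Phi J <= 0).
  { unfold Phi. rewrite HeJ. assert (H := Ha J ltac:(lia)). pose proof (pow2_ge_0 (e J)).
    unfold k. nra. }
  rewrite sum1_plus, !sum1_scal, sum1_plus in Hsum.
  assert (Hshift : sum1 J (fun j => e (j - 1)%nat ^ 2) <= sum1 J (fun j => e j ^ 2)).
  { apply Rminus_le. rewrite <- (Rmult_1_l (sum1 J (fun j => e j ^ 2))).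
    replace (sum1 J (fun j => e (j - 1)%nat ^ 2) - 1 * sum1 J (fun j => e j ^ 2)) with
      (sum1 J (fun j => e (j - 1)%nat ^ 2) + -1 * sum1 J (fun j => e j ^ 2)) by ring.
    rewrite <- sum1_scal, <- sum1_plus.
    eapply Rle_trans; [apply (sum1_telescope_le J _ (fun j => - e (j - 1)%nat ^ 2))|].
    { intros q Hq. cbv beta. replace (S q - 1)%nat with q by lia. lra. }
    cbv beta. replace (S J - 1)%nat with J by lia. simpl (1 - 1)%nat. rewrite He0.
    pose proof (pow2_ge_0 (e J)). simpl in *. lra. }
  rewrite !sum1_scal. rewrite HCc.
  set (S1 := sum1 J (fun j => e j ^ 2)) in *.
  set (S2 := sum1 J (fun j => Lgrid h a b r e j * e j)) in *.
  assert (Hh2 : 0 < h ^ 2) by nra.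
  assert (0 <= Cc * h ^ 2) by (apply Rmult_le_pos; lra).
  apply Rmult_le_reg_l with h; auto. nra.
Qed.

(** G-stability identity: [2 * (3 e2 - 4 e1 + e0) * e2] is the increment of the energy, from
    [e1^2 + (2 e1 - e0)^2] to [e2^2 + (2 e2 - e1)^2], plus the square [(e2 - 2 e1 + e0)^2], which is
    dropped. *)
Lemma bdf_energy (J : nat) (h ta KG : R) (e0 e1 e2 Le X Y : nat -> R) :
  0 < h -> 0 < ta ->
  (forall j, (1 <= j <= J)%nat ->
     ((3 * e2 j - 4 * e1 j + e0 j) / (2 * ta) + Le j) * e2 j <= X j * Rabs (e2 j) + Y j) ->
  - KG * sum1 J (fun j => h * e2 j ^ 2) <= sum1 J (fun j => h * (Le j * e2 j)) ->
  sum1 J (fun j => h * (e2 j ^ 2 + (2 * e2 j - e1 j) ^ 2))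
  <= sum1 J (fun j => h * (e1 j ^ 2 + (2 * e1 j - e0 j) ^ 2))
     + 4 * ta * KG * sum1 J (fun j => h * e2 j ^ 2)
     + 4 * ta * sum1 J (fun j => h * (X j * Rabs (e2 j))) + 4 * ta * sum1 J (fun j => h * Y j).
Proof.
  intros Hh Hta Hn Hg.
  assert (H : sum1 J (fun j => h * (e2 j ^ 2 + (2 * e2 j - e1 j) ^ 2)
      + (-1) * (h * (e1 j ^ 2 + (2 * e1 j - e0 j) ^ 2)))
    <= sum1 J (fun j => 4 * ta * (h * (X j * Rabs (e2 j))) + 4 * ta * (h * Y j)
        + - (4 * ta) * (h * (Le j * e2 j)))).
  { apply sum1_le. intros j Hj. assert (H := Hn j Hj).
    assert (Hid : 4 * ta * ((3 * e2 j - 4 * e1 j + e0 j) / (2 * ta) * e2 j)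
      = 2 * (3 * e2 j - 4 * e1 j + e0 j) * e2 j) by (field; lra).
    assert (H4 : 4 * ta * (((3 * e2 j - 4 * e1 j + e0 j) / (2 * ta) + Le j) * e2 j)
      <= 4 * ta * (X j * Rabs (e2 j) + Y j)) by (apply Rmult_le_compat_l; lra).
    assert (Hsq := pow2_ge_0 (e2 j - 2 * e1 j + e0 j)).
    assert (H5 : e2 j ^ 2 + (2 * e2 j - e1 j) ^ 2 - (e1 j ^ 2 + (2 * e1 j - e0 j) ^ 2)
      <= 4 * ta * (X j * Rabs (e2 j)) + 4 * ta * Y j - 4 * ta * (Le j * e2 j)) by nra.
    apply (Rmult_le_compat_l h) in H5; [|lra]. lra. }
  rewrite !sum1_plus, !sum1_scal in H. rewrite !sum1_scal in *. nra.
Qed.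

(** [th] is [1] for implicit Euler and [/ 2] for Crank-Nicolson, whose explicit half is later put
    into [X]. *)
Lemma first_step_energy (J : nat) (h ta KG th : R) (e Le X Y : nat -> R) :
  0 < h -> 0 < ta -> 0 < th ->
  (forall j, (1 <= j <= J)%nat -> (e j / ta + th * Le j) * e j <= X j * Rabs (e j) + Y j) ->
  - KG * sum1 J (fun j => h * e j ^ 2) <= sum1 J (fun j => h * (Le j * e j)) ->
  sum1 J (fun j => h * e j ^ 2)
  <= ta * th * KG * sum1 J (fun j => h * e j ^ 2)
     + ta * sum1 J (fun j => h * (X j * Rabs (e j))) + ta * sum1 J (fun j => h * Y j).
Proof.
  intros Hh Hta Hth Hn Hg.
  assert (H : sum1 J (fun j => h * e j ^ 2)
    <= sum1 J (fun j => ta * (h * (X j * Rabs (e j))) + ta * (h * Y j)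
        + - (ta * th) * (h * (Le j * e j)))).
  { apply sum1_le. intros j Hj. assert (H := Hn j Hj).
    assert (Hid : ta * (e j / ta * e j) = e j ^ 2) by (field; lra).
    assert (H4 : ta * ((e j / ta + th * Le j) * e j) <= ta * (X j * Rabs (e j) + Y j))
      by (apply Rmult_le_compat_l; lra).
    assert (H5 : e j ^ 2 <= ta * (X j * Rabs (e j)) + ta * Y j - ta * th * (Le j * e j)) by lra.
    apply (Rmult_le_compat_l h) in H5; [|lra]. lra. }
  rewrite !sum1_plus, !sum1_scal in H. rewrite !sum1_scal in *.
  assert (0 < ta * th) by (apply Rmult_lt_0_compat; auto). nra.
Qed.

Lemma sum1_young (J : nat) (h c d : R) (e X : nat -> R) : 0 < h -> 0 < c -> 1 <= 4 * c * d ->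
  sum1 J (fun j => h * (X j * Rabs (e j)))
    <= c * sum1 J (fun j => h * X j ^ 2) + d * sum1 J (fun j => h * e j ^ 2).
Proof.
  intros Hh Hc Hcd. rewrite <- !sum1_scal, <- sum1_plus. apply sum1_le. intros j Hj.
  assert (H := young c (X j) (Rabs (e j)) Hc). rewrite pow2_abs in H.
  apply Rabs_le_between in H.
  assert (e j ^ 2 / (4 * c) <= d * e j ^ 2).
  { unfold Rdiv. rewrite Rmult_comm. apply Rmult_le_compat_r; [apply pow2_ge_0|].
    apply Rmult_le_reg_l with (4 * c); [lra|]. rewrite Rinv_r; lra. }
  assert (H1 : X j * Rabs (e j) <= c * X j ^ 2 + d * e j ^ 2) by lra.
  apply (Rmult_le_compat_l h) in H1; lra.
Qed.

Lemma sum_le_energy (J : nat) (h : R) (e1 e2 : nat -> R) : 0 < h ->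
  sum1 J (fun j => h * e2 j ^ 2) <= sum1 J (fun j => h * (e2 j ^ 2 + (2 * e2 j - e1 j) ^ 2)).
Proof.
  intros Hh. apply sum1_le. intros j _. pose proof (pow2_ge_0 (2 * e2 j - e1 j)).
  apply Rmult_le_compat_l; lra.
Qed.

(** * Second differences of the initial datum *)

Lemma C2_second_difference (w : R -> R) (B x h : R) :
  (forall z, ex_derive w z /\ ex_derive (Derive w) z) -> 0 < h ->
  (forall z, x - h <= z <= x + h -> Rabs (Derive (Derive w) z) <= B) ->
  Rabs (w (x + h) - 2 * w x + w (x - h)) <= 2 * B * h ^ 2.
Proof.
  intros Hd Hh HB.
  assert (Hw : forall z, is_derive w z (Derive w z)) by (intros z; apply Derive_correct, Hd).
  assert (Hw' : forall z, is_derive (Derive w) z (Derive (Derive w) z))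
    by (intros z; apply (Derive_correct (Derive w)), Hd).
  destruct (MVT_on (x - h) x w (Derive w)) as (a & Ha & Ea); [lra | auto | |].
  { apply continuous_cont_on. intros z _. exact (ex_derive_continuous w z (proj1 (Hd z))). }
  destruct (MVT_on x (x + h) w (Derive w)) as (b & Hb & Eb); [lra | auto | |].
  { apply continuous_cont_on. intros z _. exact (ex_derive_continuous w z (proj1 (Hd z))). }
  assert (H : Rabs (Derive w b - Derive w a) <= B * (b - a)).
  { apply (MVT_abs_le a b B (Derive w) (Derive (Derive w))); [lra | auto | |].
    - apply continuous_cont_on. intros z _.
      exact (ex_derive_continuous (Derive w) z (proj2 (Hd z))).
    - intros z Hz. apply HB; lra. }
  assert (HB0 : 0 <= B).
  { eapply Rle_trans; [apply Rabs_pos | apply (HB x); lra]. }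
  replace (w (x + h) - 2 * w x + w (x - h)) with ((Derive w b - Derive w a) * h).
  - rewrite Rabs_mult, (Rabs_right h) by lra.
    replace (2 * B * h ^ 2) with (B * (2 * h) * h) by ring.
    apply Rmult_le_compat_r; [lra|]. eapply Rle_trans; [apply H|].
    apply Rmult_le_compat_l; lra.
  - replace (w (x + h) - 2 * w x + w (x - h)) with ((w (x + h) - w x) - (w x - w (x - h))) by ring.
    rewrite Ea, Eb. ring.
Qed.

(** A stencil whose centre is farther than [h] from every breakpoint lies within one piece, where
    [w0] agrees with a twice differentiable function on the line. *)
Lemma piecewise_second_difference (Xmin Xmax : R) (w0 : R -> R) : piecewise_C2 Xmin Xmax w0 ->
  exists (q : nat) (z : nat -> R) (B : R), 0 <= B /\ forall h x,
    0 < h -> Xmin <= x - h -> x + h <= Xmax ->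
    ~ (exists k, (k < q)%nat /\ Rabs (x - z k) <= h) ->
    Rabs (w0 (x + h) - 2 * w0 x + w0 (x - h)) <= B * h ^ 2.
Proof.
  intros (m & z & Hz0 & Hzm & Hinc & Hpc).
  assert (HBm : forall n, (n <= m)%nat -> exists B, 0 <= B /\ forall k, (k < n)%nat ->
    forall h x, 0 < h -> z k <= x - h -> x + h <= z (S k) ->
    Rabs (w0 (x + h) - 2 * w0 x + w0 (x - h)) <= B * h ^ 2).
  { induction n as [|n IH]; intros Hn.
    { exists 0. split; [lra|]. intros; lia. }
    destruct IH as (B & HB0 & HB); [lia|].
    destruct (Hpc n ltac:(lia)) as (w & Hw & Hwe).
    destruct (cont_box_bounded 0 0 (z n) (z (S n)) (fun _ x => Derive (Derive w) x)) as (M & HM & HMb).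
    { apply cont_box_of_cont_on, continuous_cont_on. intros x _. apply Hw. }
    exists (B + 2 * M). split; [lra|]. intros k Hk h x Hh H1 H2.
    assert (Hh2 := pow2_ge_0 h).
    destruct (Nat.eq_dec k n) as [->|Nk].
    - rewrite <- !Hwe by lra.
      apply Rle_trans with (2 * M * h ^ 2).
      + apply C2_second_difference; auto.
        * intros u. destruct (Hw u) as (A1 & A2 & _). auto.
        * intros u Hu. apply (HMb 0 u); lra.
      + apply Rmult_le_compat_r; lra.
    - apply Rle_trans with (B * h ^ 2); [apply (HB k); auto; lia|].
      apply Rmult_le_compat_r; lra. }
  destruct (HBm m (le_n m)) as (B & HB0 & HB).
  exists (S m), z, B. split; auto. intros h x Hh H1 H2 Hno.
  assert (Hcov : forall n, (n <= m)%nat -> x <= z n -> exists k, (k < n)%nat /\ z k < x <= z (S k)).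
  { induction n as [|n IH]; intros Hn Hx.
    - exfalso. rewrite Hz0 in Hx. lra.
    - destruct (Rle_lt_dec x (z n)) as [Hle|Hlt].
      + destruct (IH ltac:(lia) Hle) as (k & Hk & Hkx). exists k. split; auto. 
      + exists n. split; [lia | lra]. }
  destruct (Hcov m (le_n m) ltac:(lra)) as (k & Hk & Hkx).
  apply (HB k); auto.
  - apply Rnot_lt_le; intro Hlt. apply Hno. exists k. split; [lia|]. apply Rabs_le; lra.
  - apply Rnot_lt_le; intro Hlt. apply Hno. exists (S k). split; [lia|]. apply Rabs_le; lra.
Qed.

(** * The obstacle scheme *)

(* Both complementarity systems are tested with the error [u - v = Gu - Gv]; the discrete
   one contributes [- A Gv <= 0]. *)
Lemma complementarity_error (A B Fv Gv X Y : R) :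
  Rmin A B = 0 -> 0 <= Gv -> Fv * (Gv - B) <= X * Rabs (Gv - B) + Y ->
  (A - Fv) * (B - Gv) <= X * Rabs (B - Gv) + Y.
Proof.
  intros Hmin HG H.
  assert (HAB : A * (B - Gv) <= 0).
  { unfold Rmin in Hmin. destruct Rle_dec; nra. }
  rewrite Rabs_minus_sym. lra.
Qed.

Lemma tau_pos (T : R) (N : nat) : 0 < T -> (1 <= N)%nat -> 0 < tau T N /\ INR N * tau T N = T.
Proof.
  intros HT HN. assert (0 < INR N) by (apply lt_0_INR; lia). unfold tau. split.
  - apply Rdiv_lt_0_compat; auto.
  - field; lra.
Qed.

(** * The uniform grid and the matrix as a central difference operator *)

Section Grid.
Context (Xmin Xmax : R) (J : nat) (HO : Xmin < Xmax).

Let h := hh Xmin Xmax J.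

Lemma hh_pos : 0 < h.
Proof.
  unfold h, hh. apply Rdiv_lt_0_compat; [lra|]. apply lt_0_INR; lia.
Qed.

Lemma hh_total : INR (S J) * h = Xmax - Xmin.
Proof.
  unfold h, hh. rewrite Nat.add_1_r. field. assert (0 < INR (S J)) by (apply lt_0_INR; lia). lra.
Qed.

Lemma xg_S (j : nat) : xg Xmin Xmax J (S j) = xg Xmin Xmax J j + h.
Proof. unfold xg. rewrite S_INR. fold h. ring. Qed.

Lemma xg_pred (j : nat) : (1 <= j)%nat -> xg Xmin Xmax J (j - 1) = xg Xmin Xmax J j - h.
Proof. intros Hj. destruct j as [|j]; [lia|]. rewrite xg_S. replace (S j - 1)%nat with j by lia. ring. Qed.

Lemma xg_0 : xg Xmin Xmax J 0 = Xmin.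
Proof. unfold xg. simpl. ring. Qed.

Lemma xg_last : xg Xmin Xmax J (S J) = Xmax.
Proof. unfold xg. fold h. rewrite hh_total. ring. Qed.

Lemma xg_range (j : nat) : (j <= S J)%nat -> Xmin <= xg Xmin Xmax J j <= Xmax.
Proof.
  intros Hj. assert (Ht := hh_total). unfold xg. fold h. assert (Hh := hh_pos).
  pose proof (pos_INR j). assert (INR j <= INR (S J)) by (apply le_INR; auto).
  assert (INR j * h <= INR (S J) * h) by (apply Rmult_le_compat_r; lra).
  assert (0 <= INR j * h) by (apply Rmult_le_pos; lra). lra.
Qed.

Lemma xg_interior (j : nat) : (1 <= j <= J)%nat ->
  Xmin <= xg Xmin Xmax J j - h /\ xg Xmin Xmax J j + h <= Xmax.
Proof.
  intros Hj. rewrite <- xg_pred, <- xg_S by lia.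
  split; apply xg_range; lia.
Qed.

Lemma sum_h_le : sum1 J (fun _ => h) <= Xmax - Xmin.
Proof.
  rewrite sum1_const. assert (Ht := hh_total). rewrite S_INR in Ht. assert (Hh := hh_pos). lra.
Qed.

Lemma hh_le : h <= Xmax - Xmin.
Proof.
  assert (Ht := hh_total). rewrite S_INR in Ht. assert (Hh := hh_pos).
  assert (0 <= INR J * h) by (apply Rmult_le_pos; [apply pos_INR | lra]). lra.
Qed.

Lemma Lh_Lgrid (T : R) (sigma b r : R -> R -> R) (N n : nat) (w : nat -> R) (j : nat) :
  Lh T Xmin Xmax sigma b r J N n w j
  = Lgrid h (fun j => a_of sigma (tg T N n) (xg Xmin Xmax J j))
      (fun j => b (tg T N n) (xg Xmin Xmax J j)) (fun j => r (tg T N n) (xg Xmin Xmax J j)) w j.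
Proof.
  unfold Lh, Lgrid, a_of. fold h. assert (Hh := hh_pos). field. lra.
Qed.

Lemma Lgrid_Ah (a b r v : R -> R -> R) (t : R) (j : nat) : (1 <= j)%nat ->
  Lgrid h (fun j => a t (xg Xmin Xmax J j)) (fun j => b t (xg Xmin Xmax J j))
    (fun j => r t (xg Xmin Xmax J j)) (fun j => v t (xg Xmin Xmax J j)) j
  = Ah a b r v h t (xg Xmin Xmax J j).
Proof. intros Hj. unfold Lgrid, Ah. rewrite xg_S, xg_pred by auto. reflexivity. Qed.

End Grid.

(** * Error recursion and global error bound *)

Section Scheme.
Context (T Xmin Xmax : R) (p : nat) (y : nat -> R -> R) (sigma b r f phi v : R -> R -> R)
  (v0 vl vr : R -> R).
Context (al0 al1 al2 al3 al4 C1 C2 C3 C4 M K D La Ky eta : R).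
Let a := a_of sigma.
Let g := fun t x => phi t x + f t x.
Context (HT : 0 < T) (HO : Xmin < Xmax) (HM : 1 <= M) (HK : 1 <= K) (HD : 0 <= D)
  (HKy : 0 <= Ky) (Heta : 0 < eta).
Context (Hal : 0 <= al1 /\ 0 <= al2 /\ 0 <= al3 /\ 0 <= al4) (Hal0 : 0 < al0 <= 1)
  (HCi : 0 <= C1 /\ 0 <= C2 /\ 0 <= C3 /\ 0 <= C4).
Context (Hy : forall i, (i < p)%nat -> cont_on 0 T (y i)).
Context (HC : C23_on T Xmin Xmax p y v).
Context (Ca : cont_box 0 T Xmin Xmax a) (Cb : cont_box 0 T Xmin Xmax b)
  (Cr : cont_box 0 T Xmin Xmax r) (Cf : cont_box 0 T Xmin Xmax f)
  (Cg : cont_box 0 T Xmin Xmax g) (Cv : cont_box 0 T Xmin Xmax v).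
Context (Hell : forall t x, 0 <= t <= T -> Xmin <= x <= Xmax -> eta <= a t x).
Context (HaL : forall t x z, 0 <= t <= T -> Xmin <= x <= Xmax -> Xmin <= z <= Xmax ->
  Rabs (a t x - a t z) <= La * Rabs (x - z)).
Context (HB : forall t x, 0 <= t <= T -> Xmin <= x <= Xmax ->
  Rabs (a t x) <= M /\ Rabs (b t x) <= M /\ Rabs (r t x) <= M /\ Rabs (v t x) <= M /\
  Rabs (f t x) <= M).
Context (Hgl : forall t s x z, 0 <= t <= T -> 0 <= s <= T -> Xmin <= x <= Xmax ->
  Xmin <= z <= Xmax -> Rabs (g t x - g s z) <= M * (Rabs (t - s) + Rabs (x - z))).
Context (Hobs : forall t x, 0 <= t <= T -> Xmin <= x <= Xmax -> g t x <= v t x).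
Context (Hsup : box_super T Xmin Xmax a b r v f (fun _ _ => True)).
Context (Hsub : box_super T Xmin Xmax a b r (fun t x => - v t x) (fun t x => - f t x)
  (fun t x => g t x < v t x)).
Context (Hbd1 : forall eps, 0 < eps -> Linf_bound T Xmin Xmax p y eps (dt v) (C1 * Rpower eps (- al1))).
Context (Hbd2 : forall eps, 0 < eps -> Linf_bound T Xmin Xmax p y eps (dt (dt v)) (C2 * Rpower eps (- al2))).
Context (Hbd4 : forall eps, 0 < eps -> Linf_bound T Xmin Xmax p y eps (dx (dx (dx v))) (C4 * Rpower eps (- al4))).
Context (Hreg : forall eps m, 0 < eps -> 1 <= m -> Linf_bound T Xmin Xmax p y eps (dt v) m ->
  (forall t x z, eps < t < T -> Xmin <= x <= Xmax -> Xmin <= z <= Xmax ->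
     Rabs (v t x - v t z) <= K * m * Rabs (x - z)) /\
  (forall t x1 x2 x3, eps < t < T -> Xmin <= x1 -> x1 <= x2 -> x2 <= x3 -> x3 <= Xmax ->
     chord_bound (v t) (K * m) x1 x2 x3) /\
  (forall t x1 x2 x3, eps < t < T -> Xmin <= x1 -> x1 <= x2 -> x2 <= x3 -> x3 <= Xmax ->
     (forall x, x1 <= x <= x3 -> g t x < v t x) ->
     chord_bound (fun z => - v t z) (K * m) x1 x2 x3) /\
  (forall t t' x, eps < t -> t <= t' -> t' < T -> Xmin < x < Xmax ->
     Rabs (v t' x - v t x) <= K * m * (t' - t))).
Context (Hstart : forall t x, 0 < t -> t <= 1 -> t < T -> Xmin < x < Xmax ->
    Rabs (v t x - v 0 x) <= D * (t * Rpower t (- al1))).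
Context (Hhold : forall i, (i < p)%nat -> forall t s, 0 <= t <= T -> 0 <= s <= T ->
  Rabs (y i t - y i s) <= Ky * Rpower (Rabs (t - s)) al0).
Context (Hv0 : forall x, Xmin <= x <= Xmax -> v 0 x = v0 x).
Context (Hvl : forall t, 0 <= t <= T -> v t Xmin = vl t /\ v t Xmax = vr t).

Let W := Xmax - Xmin.
Let KG := 2 * (La ^ 2 / eta + M ^ 2 / (2 * eta) + M).
Let CA := 2 * M * K + M * M.
Let CY := (2 * M * K + CA * (Xmax - Xmin)) * (K + M).
Let rho (ta : R) := Ky * Rpower (3 * ta) al0.

(* Grid points whose stencil may be crossed by a curve during the last three time steps. *)
Let bad (ta h t x : R) : Prop := exists i, (i < p)%nat /\ Rabs (x - y i t) <= rho ta + h.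

(** The summand [1] meets the requirement [1 <= m] of the regularity estimates. *)
Let mm (eps : R) := 1 + C1 * Rpower eps (- al1).

Lemma KG_pos : 0 < KG.
Proof.
  unfold KG.
  assert (0 <= La ^ 2 / eta).
  { apply Rmult_le_pos; [apply pow2_ge_0 | left; apply Rinv_0_lt_compat; lra]. }
  assert (0 <= M ^ 2 / (2 * eta)).
  { apply Rmult_le_pos; [apply pow2_ge_0 | left; apply Rinv_0_lt_compat; lra]. }
  lra.
Qed.

Lemma mm_ok (eps : R) : 0 < eps -> 1 <= mm eps /\ Linf_bound T Xmin Xmax p y eps (dt v) (mm eps).
Proof.
  intros He. unfold mm. pose proof (Rpower_pos eps (- al1)).
  assert (0 <= C1 * Rpower eps (- al1)) by (apply Rmult_le_pos; lra).
  split; [lra|]. intros t x Ho. eapply Rle_trans; [apply (Hbd1 eps); auto | lra].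
Qed.

Lemma rho_bounds (ta : R) : 0 < ta -> 0 <= rho ta <= 3 * Ky * Rpower ta al0.
Proof.
  intros Hta. unfold rho. rewrite <- Rpower_mult_distr by lra.
  pose proof (Rpower_pos 3 al0). pose proof (Rpower_pos ta al0).
  assert (Rpower 3 al0 <= 3).
  { rewrite <- (Rpower_1 3) at 2 by lra. apply Rle_Rpower; lra. }
  assert (Rpower 3 al0 * Rpower ta al0 <= 3 * Rpower ta al0) by (apply Rmult_le_compat_r; lra).
  assert (0 <= Rpower 3 al0 * Rpower ta al0) by (apply Rmult_le_pos; lra).
  split; [apply Rmult_le_pos; auto|].
  replace (3 * Ky * Rpower ta al0) with (Ky * (3 * Rpower ta al0)) by ring.
  apply Rmult_le_compat_l; auto.
Qed.

Lemma curve_drift (ta t : R) (i : nat) (s : R) : 0 < ta -> 0 < t -> t <= T -> (i < p)%nat ->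
  0 <= s <= t -> t - s <= 3 * ta -> Rabs (y i s - y i t) <= rho ta.
Proof.
  intros Hta Ht HtT Hi Hs Hts.
  destruct (Req_dec s t) as [->|N].
  { rewrite Rminus_diag, Rabs_R0. apply rho_bounds; auto. }
  eapply Rle_trans; [apply Hhold; auto; lra|]. unfold rho. apply Rmult_le_compat_l; auto.
  apply Rpower_mono_base; [|lra]. rewrite Rabs_left by lra. lra.
Qed.

(** Each curve spoils the nodes in an interval of half-width [rho + h], of total weight at most
    [2 rho + 3 h], and Holder continuity makes [rho] a multiple of [ta ^ al0]. *)
Lemma bad_measure (J : nat) (ta t : R) : 0 < ta ->
  sum1 J (fun j => hh Xmin Xmax J * indic (bad ta (hh Xmin Xmax J) t (xg Xmin Xmax J j)))
    <= INR p * (6 * Ky + 3) * (Rpower ta al0 + hh Xmin Xmax J).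
Proof.
  intros Hta. assert (Hh := hh_pos Xmin Xmax J HO). destruct (rho_bounds ta Hta) as [R1 R2].
  set (h := hh Xmin Xmax J) in *.
  assert (H := count_near_many Xmin h (rho ta + h) (fun i => y i t) p J Hh ltac:(lra)).
  eapply Rle_trans; [exact H|].
  rewrite Rmult_assoc. apply Rmult_le_compat_l; [apply pos_INR|].
  pose proof (Rpower_pos ta al0).
  assert (0 <= Ky * h) by (apply Rmult_le_pos; lra). lra.
Qed.

Lemma bdf_node (ta h t x eps Gu : R) :
  0 < ta -> 0 < h -> Xmin <= x - h -> x + h <= Xmax -> 0 < eps -> eps < t - 2 * ta -> t <= T -> 0 <= Gu ->
  (Bt v ta t x + Ah a b r v h t x - f t x) * (v t x - g t x - Gu)
    <= ((4 * (C2 * Rpower eps (- al2) * ta) + M * (2 + W) * (C4 * Rpower eps (- al4) * h))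
        + (2 * K + CA + M) * mm eps * indic (bad ta h t x)) * Rabs (v t x - g t x - Gu)
       + CY * mm eps ^ 2 * indic (bad ta h t x).
Proof.
  intros Hta Hh Hx1 Hx2 He Hte HtT HGu.
  destruct (mm_ok eps He) as [Hm1 Hm2].
  destruct (Hreg eps (mm eps) He Hm1 Hm2) as (RL & RC & RV & RT).
  pose proof (Rpower_pos eps (- al2)). pose proof (Rpower_pos eps (- al4)).
  assert (HM2 : 0 <= C2 * Rpower eps (- al2)) by (apply Rmult_le_pos; lra).
  assert (HM4 : 0 <= C4 * Rpower eps (- al4)) by (apply Rmult_le_pos; lra).
  assert (Hell0 : forall t x, 0 <= t <= T -> Xmin <= x <= Xmax -> 0 <= a t x).
  { intros t' x' H1 H2. specialize (Hell t' x' H1 H2). lra. }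
  assert (HZ := Rabs_pos (v t x - g t x - Gu)).
  assert (HXg : 0 <= 4 * (C2 * Rpower eps (- al2) * ta) + M * (2 + W) * (C4 * Rpower eps (- al4) * h)).
  { assert (0 <= C2 * Rpower eps (- al2) * ta) by (apply Rmult_le_pos; lra).
    assert (0 <= M * (2 + W) * (C4 * Rpower eps (- al4) * h)).
    { apply Rmult_le_pos; apply Rmult_le_pos; unfold W; lra. }
    lra. }
  destruct (classic (bad ta h t x)) as [Hb|Hg].
  - rewrite indic_true by auto. rewrite !Rmult_1_r.
    eapply Rle_trans; [apply (bdf_node_rough T Xmin Xmax a b r f g v M K eps (mm eps)); auto|].
    fold CA CY. apply Rplus_le_compat_r. apply Rmult_le_compat_r; auto. lra.
  - rewrite indic_false by auto. rewrite !Rmult_0_r, !Rplus_0_r.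
    apply (bdf_node_good T Xmin Xmax p y a b r f g v M eps) with (rho := rho ta); auto.
    + intros i s Hi Hs Hts. apply curve_drift; auto; lra.
    + intros i Hi. apply Rnot_le_lt; intro Hle. apply Hg. exists i; auto.
Qed.

(** In the first two steps the time stencil reaches [t = 0], where no derivative bound holds. Hence
    only the space operator is estimated, with [eps = ta / 2], which lies before every positive time
    level. *)
Lemma start_node (ta h t x Gu : R) :
  0 < ta -> 0 < h -> Xmin <= x - h -> x + h <= Xmax -> ta <= t < T -> 0 <= Gu ->
  Ah a b r v h t x * (v t x - g t x - Gu)
    <= ((CA + M) * mm (ta / 2) + M * (2 + W) * (C4 * Rpower (ta / 2) (- al4) * h))
         * Rabs (v t x - g t x - Gu)
       + CY * mm (ta / 2) ^ 2 * indic (bad ta h t x).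
Proof.
  intros Hta Hh Hx1 Hx2 Ht HGu.
  assert (He : 0 < ta / 2) by lra.
  destruct (mm_ok (ta / 2) He) as [Hm1 Hm2].
  destruct (Hreg (ta / 2) (mm (ta / 2)) He Hm1 Hm2) as (RL & RC & RV & RT).
  pose proof (Rpower_pos (ta / 2) (- al4)).
  assert (HM4 : 0 <= C4 * Rpower (ta / 2) (- al4)) by (apply Rmult_le_pos; lra).
  assert (Hell0 : forall t x, 0 <= t <= T -> Xmin <= x <= Xmax -> 0 <= a t x).
  { intros t' x' H1 H2. specialize (Hell t' x' H1 H2). lra. }
  assert (HZ := Rabs_pos (v t x - g t x - Gu)).
  assert (HX4 : 0 <= M * (2 + W) * (C4 * Rpower (ta / 2) (- al4) * h)).
  { apply Rmult_le_pos; apply Rmult_le_pos; unfold W; lra. }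
  assert (HCA : 1 <= CA) by (unfold CA; nra).
  assert (HMm : M <= M * mm (ta / 2)) by nra.
  destruct (classic (bad ta h t x)) as [Hb|Hg].
  - rewrite indic_true by auto. rewrite Rmult_1_r.
    eapply Rle_trans; [apply (Ah_rough T Xmin Xmax a b r f g v M K (ta / 2) (mm (ta / 2))); auto; lra|].
    fold CA CY. apply Rplus_le_compat_r. apply Rmult_le_compat_r; auto. lra.
  - rewrite indic_false by auto. rewrite Rmult_0_r, Rplus_0_r.
    eapply Rle_trans; [apply (Ah_good T Xmin Xmax p y a b r f g v M (ta / 2) (mm (ta / 2)))
      with (M4 := C4 * Rpower (ta / 2) (- al4)); auto; try lra|].
    + intros z Hz. split; [lra|]. split; [lra|]. intros i Hi E. apply Hg. exists i. split; auto.
      rewrite <- E. destruct (rho_bounds ta Hta) as [R1 _].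
      assert (Rabs (x - z) < h) by (apply Rabs_def1; lra). lra.
    + apply Rmult_le_compat_r; auto. fold W.
      assert (mm (ta / 2) * 1 <= CA * mm (ta / 2)).
      { rewrite Rmult_comm. apply Rmult_le_compat_r; lra. }
      lra.
Qed.

(** Factors lost when a power bound taken at half of a time is rewritten at that time. *)
Let c1 := Rpower 2 al1.
Let c2 := Rpower 2 al2.
Let c4 := Rpower 2 al4.
Let CM := M * (2 + W).
Let KX := (CA + M) * (1 + C1 * c1) + 5 * D + M + CM * (C4 * c4).
Let Xs (ta h : R) := KX * (Rpower ta (- al1) + Rpower ta (- al4) * h).
Let Ys (ta h t x : R) := CY * (1 + C1 * c1) ^ 2 * Rpower ta (- (2 * al1)) * indic (bad ta h t x).
Let P := INR p * (6 * Ky + 3).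
Let Bn (ta h : R) := Bnd al0 al1 al2 al3 al4 ta h.

Lemma const_pos : 1 <= CA /\ 0 < CY /\ 0 < W /\ 0 < CM /\ 0 <= P /\ 0 < c1 /\ 0 < c2 /\ 0 < c4
  /\ 0 <= KX /\ 0 <= C1 * c1.
Proof.
  assert (HCA : 1 <= CA) by (unfold CA; nra).
  assert (HW : 0 < W) by (unfold W; lra).
  assert (HCM : 0 < CM) by (unfold CM; apply Rmult_lt_0_compat; lra).
  assert (Hc1 : 0 < c1) by apply Rpower_pos. assert (Hc2 : 0 < c2) by apply Rpower_pos.
  assert (Hc4 : 0 < c4) by apply Rpower_pos.
  assert (HC1 : 0 <= C1 * c1) by (apply Rmult_le_pos; lra).
  assert (HC4 : 0 <= C4 * c4) by (apply Rmult_le_pos; lra).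
  assert (HCY : 0 < CY).
  { unfold CY. fold W. apply Rmult_lt_0_compat; [|lra].
    assert (0 < CA * W) by (apply Rmult_lt_0_compat; lra). nra. }
  assert (HP : 0 <= P) by (unfold P; apply Rmult_le_pos; [apply pos_INR | lra]).
  repeat (split; auto).
  unfold KX. assert (0 <= (CA + M) * (1 + C1 * c1)) by (apply Rmult_le_pos; lra).
  assert (0 <= CM * (C4 * c4)) by (apply Rmult_le_pos; lra). lra.
Qed.

(** Common form of both kinds of first step and of the step to level [2]. [Z] collects the time
    quotient, the source and, for Crank-Nicolson, the operator at time [0]; the worst quotient, that
    of BDF2, gives the [5 * D]. *)
Lemma start_node_total (ta h t x Gu Z ex : R) :
  0 < ta -> ta <= 1 -> 0 < h -> Xmin <= x - h -> x + h <= Xmax -> ta <= t < T -> 0 <= Gu ->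
  Rabs Z <= (5 * D + M) * Rpower ta (- al1) + ex ->
  forall th, 0 <= th <= 1 ->
  (Z + th * Ah a b r v h t x) * (v t x - g t x - Gu)
    <= (Xs ta h + ex) * Rabs (v t x - g t x - Gu) + Ys ta h t x.
Proof.
  intros Hta Hta1 Hh Hx1 Hx2 Ht HGu HZ th Hth.
  destruct const_pos as (Q1 & Q2 & Q3 & Q4 & Q5 & Q6 & Q7 & Q8 & Q9 & Q10).
  assert (HN := start_node ta h t x Gu Hta Hh Hx1 Hx2 Ht HGu).
  set (G := v t x - g t x - Gu) in *. assert (HG := Rabs_pos G).
  assert (HZG := mul_le_abs _ _ G HZ).
  assert (Hp1 := Rpower_neg_ge_1 ta al1 ltac:(lra) ltac:(lra)).
  assert (Hp4 := Rpower_pos ta (- al4)).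
  assert (Hmm : 1 <= mm (ta / 2) <= (1 + C1 * c1) * Rpower ta (- al1)).
  { split; [apply mm_ok; lra|]. unfold mm. rewrite Rpower_half by auto. fold c1. lra. }
  rewrite Rpower_half in HN by auto. fold c4 CM in HN.
  destruct (indic_bounds (bad ta h t x)) as [I0 I1].
  set (ib := indic (bad ta h t x)) in *.
  assert (Hsq : mm (ta / 2) ^ 2 <= (1 + C1 * c1) ^ 2 * Rpower ta (- (2 * al1))).
  { replace (- (2 * al1)) with (2 * - al1) by ring. rewrite <- Rpower_sq, <- Rpow_mult_distr.
    apply pow_incr. lra. }
  assert (HY : CY * mm (ta / 2) ^ 2 * ib <= Ys ta h t x).
  { unfold Ys. fold ib. apply Rmult_le_compat_r; auto. rewrite Rmult_assoc.
    apply Rmult_le_compat_l; lra. }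
  assert (HY0 : 0 <= CY * mm (ta / 2) ^ 2 * ib).
  { apply Rmult_le_pos; auto. apply Rmult_le_pos; [lra | apply pow2_ge_0]. }
  set (XA := (CA + M) * mm (ta / 2) + CM * (C4 * (c4 * Rpower ta (- al4)) * h)) in *.
  assert (HXA0 : 0 <= XA).
  { unfold XA. assert (0 <= (CA + M) * mm (ta / 2)) by (apply Rmult_le_pos; lra).
    assert (0 <= CM * (C4 * (c4 * Rpower ta (- al4)) * h)).
    { apply Rmult_le_pos; [lra|]. apply Rmult_le_pos; [|lra].
      apply Rmult_le_pos; [lra|]. apply Rmult_le_pos; lra. }
    lra. }
  assert (HXA : XA + (5 * D + M) * Rpower ta (- al1) <= Xs ta h).
  { unfold Xs, XA.
    assert (A1 : (CA + M) * mm (ta / 2) <= (CA + M) * (1 + C1 * c1) * Rpower ta (- al1)).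
    { rewrite Rmult_assoc. apply Rmult_le_compat_l; lra. }
    assert (A2 : 0 <= CM * (C4 * c4)).
    { apply Rmult_le_pos; [lra|]. apply Rmult_le_pos; lra. }
    assert (A3 : 0 <= (CA + M) * (1 + C1 * c1) + 5 * D + M).
    { assert (0 <= (CA + M) * (1 + C1 * c1)) by (apply Rmult_le_pos; lra). lra. }
    assert (A4 : 0 <= CM * (C4 * c4) * Rpower ta (- al1)) by (apply Rmult_le_pos; lra).
    assert (A5 : 0 <= ((CA + M) * (1 + C1 * c1) + 5 * D + M) * (Rpower ta (- al4) * h)).
    { apply Rmult_le_pos; auto. apply Rmult_le_pos; lra. }
    unfold KX. lra. }
  assert (HXAG : (XA + (5 * D + M) * Rpower ta (- al1)) * Rabs G <= Xs ta h * Rabs G)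
    by (apply Rmult_le_compat_r; auto).
  assert (HXG0 : 0 <= XA * Rabs G) by (apply Rmult_le_pos; auto).
  set (AG := Ah a b r v h t x * G) in *.
  replace ((Z + th * Ah a b r v h t x) * G) with (Z * G + th * AG) by (unfold AG; ring).
  assert (th * AG <= XA * Rabs G + CY * mm (ta / 2) ^ 2 * ib).
  { apply Rle_trans with (th * (XA * Rabs G + CY * mm (ta / 2) ^ 2 * ib)).
    - apply Rmult_le_compat_l; lra.
    - rewrite <- (Rmult_1_l (XA * Rabs G + _)) at 2. apply Rmult_le_compat_r; lra. }
  lra.
Qed.

Lemma Bnd_parts (ta h : R) : 0 < ta -> 0 < h ->
  h ^ 2 * Pw (1 - 2 * al4) ta <= Bn ta h /\ ta ^ 2 * Pw (1 - 2 * al2) ta <= Bn ta h /\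
  (Rpower ta al0 + h) * Pw (1 - 2 * al1) ta <= Bn ta h /\ Rpower ta al0 + h <= Bn ta h /\
  0 <= Bn ta h.
Proof.
  intros Hta Hh. unfold Bn, Bnd. pose proof (Rpower_pos ta al0).
  assert (0 <= h ^ 2 * Pw (1 - 2 * al4) ta) by (apply Rmult_le_pos; [nra | apply Pw_nonneg]).
  assert (0 <= ta ^ 2 * Pw (1 - 2 * al2) ta) by (apply Rmult_le_pos; [nra | apply Pw_nonneg]).
  assert (0 <= h * Pw (1 - 2 * al3) ta) by (apply Rmult_le_pos; [lra | apply Pw_nonneg]).
  assert (0 <= (Rpower ta al0 + h) * Pw (1 - 2 * al1) ta) by (apply Rmult_le_pos; [lra | apply Pw_nonneg]).
  lra.
Qed.

Let CS := 2 * W * KX ^ 2 * 2 + CY * (1 + C1 * c1) ^ 2 * P.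

(** A residual of size [ta ^ (- al1)] is affordable in a single step, where its square has weight
    [ta ^ 2]: since [ta <= ta ^ al0], the result is at most [ta ^ al0 * ta ^ (1 - 2 al1)], a term of
    the bound. *)
Lemma start_sum (J : nat) (ta t : R) : 0 < ta <= / 3 ->
  ta ^ 2 * sum1 J (fun _ => hh Xmin Xmax J * Xs ta (hh Xmin Xmax J) ^ 2)
  + ta * sum1 J (fun j => hh Xmin Xmax J * Ys ta (hh Xmin Xmax J) t (xg Xmin Xmax J j))
  <= CS * Bn ta (hh Xmin Xmax J).
Proof.
  intros Hta. assert (Hh := hh_pos Xmin Xmax J HO). assert (HhW := hh_le Xmin Xmax J HO).
  destruct const_pos as (Q1 & Q2 & Q3 & Q4 & Q5 & Q6 & Q7 & Q8 & Q9 & Q10).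
  assert (Hbad := bad_measure J ta t ltac:(lra)).
  assert (Hsum := sum_h_le Xmin Xmax J HO).
  set (h := hh Xmin Xmax J) in *. fold P in Hbad. fold W in Hsum.
  destruct (Bnd_parts ta h ltac:(lra) Hh) as (B4 & _ & B1 & _ & B0).
  assert (L1 := Rpower_le_Pw (1 - 2 * al1) ta Hta). assert (L4 := Rpower_le_Pw (1 - 2 * al4) ta Hta).
  assert (E1 : ta * Rpower ta (- (2 * al1)) = Rpower ta (1 - 2 * al1)).
  { rewrite Rpower_mul_self by lra. f_equal; ring. }
  assert (E4 : ta * Rpower ta (- (2 * al4)) = Rpower ta (1 - 2 * al4)).
  { rewrite Rpower_mul_self by lra. f_equal; ring. }
  assert (S1 : Rpower ta (- al1) ^ 2 = Rpower ta (- (2 * al1))) by (rewrite Rpower_sq; f_equal; ring).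
  assert (S4 : Rpower ta (- al4) ^ 2 = Rpower ta (- (2 * al4))) by (rewrite Rpower_sq; f_equal; ring).
  assert (Hta0 : ta <= Rpower ta al0).
  { rewrite <- (Rpower_1 ta) at 1 by lra. apply Rpower_anti_exp; lra. }
  assert (Hp0 := Rpower_pos ta al0).
  assert (HX : ta ^ 2 * sum1 J (fun _ => h * Xs ta h ^ 2) <= 2 * W * KX ^ 2 * 2 * Bn ta h).
  { assert (HXs : ta ^ 2 * Xs ta h ^ 2 <= 2 * KX ^ 2 * (2 * Bn ta h)).
    { unfold Xs. rewrite Rpow_mult_distr.
      assert (Hq : (Rpower ta (- al1) + Rpower ta (- al4) * h) ^ 2
        <= 2 * Rpower ta (- (2 * al1)) + 2 * (Rpower ta (- (2 * al4)) * h ^ 2)).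
      { rewrite <- S1, <- S4. pose proof (pow2_ge_0 (Rpower ta (- al1) - Rpower ta (- al4) * h)). lra. }
      assert (A1 : ta ^ 2 * Rpower ta (- (2 * al1)) <= Bn ta h).
      { replace (ta ^ 2 * Rpower ta (- (2 * al1))) with (ta * (ta * Rpower ta (- (2 * al1)))) by ring.
        rewrite E1. eapply Rle_trans; [|apply B1].
        apply Rmult_le_compat; try lra. left; apply Rpower_pos. }
      assert (A4 : ta ^ 2 * (Rpower ta (- (2 * al4)) * h ^ 2) <= Bn ta h).
      { replace (ta ^ 2 * (Rpower ta (- (2 * al4)) * h ^ 2)) with
          (h ^ 2 * (ta * (ta * Rpower ta (- (2 * al4))))) by ring.
        rewrite E4. eapply Rle_trans; [|apply B4]. apply Rmult_le_compat_l; [nra|].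
        pose proof (Rpower_pos ta (1 - 2 * al4)). nra. }
      apply Rle_trans with (KX ^ 2 * (ta ^ 2 * (2 * Rpower ta (- (2 * al1)) + 2 * (Rpower ta (- (2 * al4)) * h ^ 2)))).
      - replace (ta ^ 2 * (KX ^ 2 * (Rpower ta (- al1) + Rpower ta (- al4) * h) ^ 2)) with
          (KX ^ 2 * (ta ^ 2 * (Rpower ta (- al1) + Rpower ta (- al4) * h) ^ 2)) by ring.
        apply Rmult_le_compat_l; [apply pow2_ge_0|]. apply Rmult_le_compat_l; [apply pow2_ge_0 | auto].
      - replace (2 * KX ^ 2 * (2 * Bn ta h)) with (KX ^ 2 * (4 * Bn ta h)) by ring.
        apply Rmult_le_compat_l; [apply pow2_ge_0|]. lra. }
    rewrite (sum1_ext J (fun _ => h * Xs ta h ^ 2) (fun _ => Xs ta h ^ 2 * h)) by (intros; ring).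
    rewrite sum1_scal.
    apply Rle_trans with (ta ^ 2 * (Xs ta h ^ 2 * W)).
    - apply Rmult_le_compat_l; [apply pow2_ge_0|]. apply Rmult_le_compat_l; [apply pow2_ge_0 | auto].
    - rewrite <- Rmult_assoc. apply Rle_trans with (2 * KX ^ 2 * (2 * Bn ta h) * W); [|lra].
      apply Rmult_le_compat_r; lra. }
  assert (HYb : ta * sum1 J (fun j => h * Ys ta h t (xg Xmin Xmax J j))
    <= CY * (1 + C1 * c1) ^ 2 * P * Bn ta h).
  { unfold Ys.
    rewrite (sum1_ext J _ (fun j => CY * (1 + C1 * c1) ^ 2 * Rpower ta (- (2 * al1))
      * (h * indic (bad ta h t (xg Xmin Xmax J j))))) by (intros; ring).
    rewrite sum1_scal.
    assert (Hk : 0 <= CY * (1 + C1 * c1) ^ 2) by (apply Rmult_le_pos; [lra | apply pow2_ge_0]).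
    pose proof (Rpower_pos ta (- (2 * al1))).
    apply Rle_trans with (ta * (CY * (1 + C1 * c1) ^ 2 * Rpower ta (- (2 * al1)) * (P * (Rpower ta al0 + h)))).
    - apply Rmult_le_compat_l; [lra|]. apply Rmult_le_compat_l; auto. apply Rmult_le_pos; lra.
    - replace (ta * (CY * (1 + C1 * c1) ^ 2 * Rpower ta (- (2 * al1)) * (P * (Rpower ta al0 + h)))) with
        (CY * (1 + C1 * c1) ^ 2 * P * ((Rpower ta al0 + h) * (ta * Rpower ta (- (2 * al1))))) by ring.
      rewrite E1. apply Rmult_le_compat_l; [apply Rmult_le_pos; auto|].
      eapply Rle_trans; [|apply B1]. apply Rmult_le_compat_l; lra. }
  unfold CS. lra.
Qed.

Let err (J N : nat) (u : nat -> nat -> R) (n j : nat) : R :=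
  u n j - v (tg T N n) (xg Xmin Xmax J j).
Let Le (J N : nat) (u : nat -> nat -> R) (n j : nat) : R :=
  Lgrid (hh Xmin Xmax J) (fun j => a (tg T N n) (xg Xmin Xmax J j))
    (fun j => b (tg T N n) (xg Xmin Xmax J j)) (fun j => r (tg T N n) (xg Xmin Xmax J j))
    (err J N u n) j.
Let Qe (J N : nat) (u : nat -> nat -> R) (n : nat) : R :=
  sum1 J (fun j => hh Xmin Xmax J * (err J N u n j ^ 2 + (2 * err J N u n j - err J N u (n - 1) j) ^ 2)).
Let S2 (J N : nat) (u : nat -> nat -> R) (n : nat) : R :=
  sum1 J (fun j => hh Xmin Xmax J * err J N u n j ^ 2).

Lemma tg_range (N n : nat) : (1 <= N)%nat -> (n <= N)%nat -> 0 <= tg T N n <= T.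
Proof.
  intros HN Hn. destruct (tau_pos T N HT HN) as [Ht HNt]. unfold tg.
  pose proof (pos_INR n). assert (INR n <= INR N) by (apply le_INR; auto).
  split; [apply Rmult_le_pos; lra|].
  apply Rle_trans with (INR N * tau T N); [apply Rmult_le_compat_r; lra | lra].
Qed.

Lemma tg_S (N n : nat) : tg T N (S n) = tg T N n + tau T N.
Proof. unfold tg. rewrite S_INR. ring. Qed.

Lemma err_boundary (J N : nat) (u : nat -> nat -> R) (n : nat) : (1 <= N)%nat -> (n <= N)%nat ->
  scheme_common T Xmin Xmax sigma b r f phi v0 vl vr J N u ->
  err J N u n 0%nat = 0 /\ err J N u n (S J) = 0.
Proof.
  intros HN Hn (Hbd & _). destruct (Hbd n Hn) as [H1 H2]. rewrite Nat.add_1_r in H2.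
  destruct (Hvl (tg T N n) (tg_range N n HN Hn)) as [V1 V2].
  unfold err. rewrite xg_0, (xg_last Xmin Xmax J). lra.
Qed.

Lemma err_initial (J N : nat) (u : nat -> nat -> R) (j : nat) : (1 <= N)%nat -> (j <= S J)%nat ->
  scheme_common T Xmin Xmax sigma b r f phi v0 vl vr J N u -> err J N u 0 j = 0.
Proof.
  intros HN Hj Hsc. destruct (err_boundary J N u 0 HN ltac:(lia) Hsc) as [E0 E1].
  destruct (Nat.eq_dec j 0) as [->|N0]; auto. destruct (Nat.eq_dec j (S J)) as [->|N1]; auto.
  destruct Hsc as (_ & Hin & _). unfold err. rewrite Hin by lia.
  unfold tg. simpl INR. rewrite Rmult_0_l, Hv0; [ring|]. apply xg_range; auto.
Qed.

Lemma err_garding (J N : nat) (u : nat -> nat -> R) (n : nat) : (1 <= N)%nat -> (n <= N)%nat ->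
  scheme_common T Xmin Xmax sigma b r f phi v0 vl vr J N u ->
  - KG * S2 J N u n <= sum1 J (fun j => hh Xmin Xmax J * (Le J N u n j * err J N u n j)).
Proof.
  intros HN Hn Hsc. destruct (err_boundary J N u n HN Hn Hsc) as [E0 E1].
  assert (Ht := tg_range N n HN Hn).
  apply garding with (eta := eta); auto.
  - apply hh_pos; auto.
  - intros j Hj. apply Hell; auto. apply xg_range; auto; lia.
  - intros j Hj. eapply Rle_trans; [apply HaL; auto; apply xg_range; auto; lia|].
    rewrite xg_S. assert (Hh := hh_pos Xmin Xmax J HO).
    replace (xg Xmin Xmax J j + hh Xmin Xmax J - xg Xmin Xmax J j) with (hh Xmin Xmax J) by ring.
    rewrite Rabs_right; lra.
  - intros j Hj. destruct (HB (tg T N n) (xg Xmin Xmax J j) Ht) as (_ & B1 & B2 & _); auto.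
    apply xg_range; auto; lia.
Qed.

Lemma Lh_split (J N : nat) (u : nat -> nat -> R) (n j : nat) : (1 <= j)%nat ->
  Lh T Xmin Xmax sigma b r J N n (u n) j
  = Le J N u n j + Ah a b r v (hh Xmin Xmax J) (tg T N n) (xg Xmin Xmax J j).
Proof.
  intros Hj. rewrite Lh_Lgrid by auto. fold a. unfold Le.
  rewrite <- (Lgrid_Ah Xmin Xmax J a b r v (tg T N n) j Hj).
  change (err J N u n) with (fun j => u n j - v (tg T N n) (xg Xmin Xmax J j)).
  unfold Lgrid, Rdiv. ring.
Qed.

Lemma Rmin_shift (A B c : R) : Rmin A B - c = 0 -> Rmin (A - c) (B - c) = 0.
Proof. unfold Rmin. repeat destruct Rle_dec; lra. Qed.

Lemma bdf_error_node (J N : nat) (u : nat -> nat -> R) (n j : nat) (X Y : R) :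
  (1 <= N)%nat -> (1 <= n)%nat -> (n + 1 <= N)%nat -> (1 <= j <= J)%nat ->
  scheme_common T Xmin Xmax sigma b r f phi v0 vl vr J N u ->
  let t := tg T N (S n) in let x := xg Xmin Xmax J j in
  (forall Gu, 0 <= Gu -> (Bt v (tau T N) t x + Ah a b r v (hh Xmin Xmax J) t x - f t x)
      * (v t x - g t x - Gu) <= X * Rabs (v t x - g t x - Gu) + Y) ->
  ((3 * err J N u (S n) j - 4 * err J N u n j + err J N u (n - 1) j) / (2 * tau T N)
    + Le J N u (S n) j) * err J N u (S n) j <= X * Rabs (err J N u (S n) j) + Y.
Proof.
  intros HN Hn HnN Hj Hsc t x HF.
  destruct (tau_pos T N HT HN) as [Hta _].
  destruct Hsc as (_ & _ & Hs). assert (H := Rmin_shift _ _ _ (Hs n j Hn HnN Hj)).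
  rewrite (Lh_split J N u (S n) j) in H by lia. fold t x in H.
  assert (Ht1 : t - tau T N = tg T N n) by (unfold t; rewrite tg_S; ring).
  assert (Ht2 : t - 2 * tau T N = tg T N (n - 1)).
  { unfold t. rewrite tg_S. destruct n as [|n]; [lia|]. replace (S n - 1)%nat with n by lia.
    rewrite tg_S. ring. }
  assert (HGu : 0 <= u (S n) j - phi t x - f t x).
  { unfold Rmin in H. destruct Rle_dec; lra. }
  assert (Hgv : 0 <= v t x - g t x).
  { assert (g t x <= v t x); [|lra]. apply Hobs.
    - apply tg_range; auto; lia.
    - apply xg_range; auto; lia. }
  assert (HC' := complementarity_error _ _ _ _ X Y H Hgv (HF _ HGu)).
  replace (u (S n) j - phi t x - f t x - (v t x - g t x)) with (err J N u (S n) j) in HC'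
    by (unfold err, g; fold t x; ring).
  eapply Rle_trans; [|apply HC']. right. f_equal.
  unfold Bt. rewrite Ht1, Ht2. unfold err. fold t x. field. lra.
Qed.

Lemma tau_small (N : nat) : (1 <= N)%nat -> 4 * tau T N < T -> (4 < N)%nat.
Proof.
  intros HN H. destruct (tau_pos T N HT HN) as [Hta HNt].
  apply INR_lt. simpl. apply Rmult_lt_reg_r with (tau T N); auto. lra.
Qed.

Lemma Ys_nonneg (ta h t x : R) : 0 <= Ys ta h t x.
Proof.
  destruct const_pos as (_ & Q2 & _). unfold Ys.
  apply Rmult_le_pos; [|apply indic_bounds].
  apply Rmult_le_pos; [|left; apply Rpower_pos].
  apply Rmult_le_pos; [lra | apply pow2_ge_0].
Qed.

Lemma S2_nonneg (J N : nat) (u : nat -> nat -> R) (n : nat) : 0 <= S2 J N u n.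
Proof.
  assert (Hh := hh_pos Xmin Xmax J HO). apply sum1_nonneg. intros k _.
  apply Rmult_le_pos; [lra | apply pow2_ge_0].
Qed.

Lemma S2_le_Qe (J N : nat) (u : nat -> nat -> R) (n : nat) : S2 J N u n <= Qe J N u n.
Proof. apply sum_le_energy. apply hh_pos; auto. Qed.

Lemma start_modulus_M (ta t x : R) : 0 < ta -> ta <= 1 -> 0 <= t <= T -> Xmin <= x <= Xmax ->
  Rabs (f t x) <= M * Rpower ta (- al1).
Proof.
  intros Hta H1 Ht Hx. destruct (HB t x Ht Hx) as (_ & _ & _ & _ & B5).
  assert (Hp := Rpower_neg_ge_1 ta al1 ltac:(lra) ltac:(lra)).
  apply Rle_trans with (M * 1); [lra | apply Rmult_le_compat_l; lra].
Qed.

(** Young's inequality is weighted by [4 * ta], so that the squared residual gains a power of [ta].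
    The price is a fixed fraction of the unknown energy and the factor [2] on [Qe J N u 1]; this can
    be paid once, but not in a recursion. *)
Lemma second_step (J N : nat) (u : nat -> nat -> R) : (1 <= N)%nat ->
  tau T N <= / 3 -> 4 * tau T N < T -> 16 * tau T N * (KG + 1) <= 1 ->
  scheme_common T Xmin Xmax sigma b r f phi v0 vl vr J N u ->
  Qe J N u 2 <= 2 * Qe J N u 1 + 32 * CS * Bn (tau T N) (hh Xmin Xmax J).
Proof.
  intros HN Ht3 HtT HtK Hsc. destruct (tau_pos T N HT HN) as [Hta HNt].
  assert (HN4 := tau_small N HN HtT).
  assert (Hh := hh_pos Xmin Xmax J HO). assert (HKG := KG_pos).
  set (ta := tau T N) in *. set (h := hh Xmin Xmax J) in *.
  assert (Ht2 : tg T N 2 = 2 * ta) by (unfold tg; simpl; fold ta; ring).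
  assert (Hnode : forall j, (1 <= j <= J)%nat ->
    ((3 * err J N u 2 j - 4 * err J N u 1 j + err J N u 0 j) / (2 * ta)
      + Le J N u 2 j) * err J N u 2 j
      <= Xs ta h * Rabs (err J N u 2 j) + Ys ta h (tg T N 2) (xg Xmin Xmax J j)).
  { intros j Hj. apply (bdf_error_node J N u 1 j); auto; try lia.
    intros Gu HGu. fold ta h. destruct (xg_interior Xmin Xmax J HO j Hj) as [X1 X2]. fold h in X1, X2.
    set (x := xg Xmin Xmax J j) in *.
    replace (Bt v ta (tg T N 2) x + Ah a b r v h (tg T N 2) x - f (tg T N 2) x) with
      ((Bt v ta (tg T N 2) x - f (tg T N 2) x) + 1 * Ah a b r v h (tg T N 2) x) by ring.
    replace (Xs ta h) with (Xs ta h + 0) by ring.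
    apply start_node_total; auto; try lra.
    assert (HF := start_modulus_M ta (tg T N 2) x Hta ltac:(lra) ltac:(lra) ltac:(lra)).
    (* Both differences are taken relative to the initial value:
       [(3 * 2 ta + 4 * ta) / (2 ta) = 5]. *)
    assert (HBt : Rabs (Bt v ta (tg T N 2) x) <= 5 * D * Rpower ta (- al1)).
    { unfold Bt. rewrite Ht2.
      replace (2 * ta - ta) with ta by ring. replace (2 * ta - 2 * ta) with 0 by ring.
      assert (A1 := Hstart ta x Hta ltac:(lra) ltac:(lra) ltac:(lra)).
      assert (A2 := Hstart (2 * ta) x ltac:(lra) ltac:(lra) ltac:(lra) ltac:(lra)).
      assert (A3 : Rpower (2 * ta) (- al1) <= Rpower ta (- al1)) by (apply Rpower_anti_base; lra).
      assert (A4 : D * (2 * ta * Rpower (2 * ta) (- al1)) <= D * (2 * ta * Rpower ta (- al1))).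
      { apply Rmult_le_compat_l; auto. apply Rmult_le_compat_l; lra. }
      replace (3 * v (2 * ta) x - 4 * v ta x + v 0 x) with
        (3 * (v (2 * ta) x - v 0 x) - 4 * (v ta x - v 0 x)) by ring.
      apply Rabs_le_between in A1, A2.
      apply Rabs_le; split; apply Rmult_le_reg_r with (2 * ta); try lra;
        unfold Rdiv; rewrite (Rmult_assoc _ (/ (2 * ta))), Rinv_l by lra; lra. }
    rewrite Rplus_0_r. unfold Rminus. eapply Rle_trans; [apply Rabs_triang|].
    rewrite Rabs_Ropp. lra. }
  assert (HE := bdf_energy J h ta KG (err J N u 0) (err J N u 1) (err J N u 2) (Le J N u 2)
    (fun _ => Xs ta h) (fun j => Ys ta h (tg T N 2) (xg Xmin Xmax J j)) Hh Hta Hnode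
    (err_garding J N u 2 HN ltac:(lia) Hsc)).
  cbv beta in HE.
  assert (HY := sum1_young J h (4 * ta) (/ (16 * ta)) (err J N u 2) (fun _ => Xs ta h) Hh
    ltac:(lra) ltac:(right; field; lra)).
  assert (HS := start_sum J ta (tg T N 2) ltac:(lra)). fold h in HS.
  assert (HSQ := S2_le_Qe J N u 2).
  fold h (S2 J N u 2) in HE, HY.
  change (sum1 J (fun j => h * err J N u 2 j ^ 2)) with (S2 J N u 2) in HE, HY.
  change (sum1 J (fun j => h * (err J N u 2 j ^ 2 + (2 * err J N u 2 j - err J N u 1 j) ^ 2)))
    with (Qe J N u 2) in HE.
  change (sum1 J (fun j => h * (err J N u 1 j ^ 2 + (2 * err J N u 1 j - err J N u 0 j) ^ 2)))
    with (Qe J N u 1) in HE.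
  apply (Rmult_le_compat_l (4 * ta)) in HY; [|lra].
  rewrite Rmult_plus_distr_l in HY.
  replace (4 * ta * (/ (16 * ta) * S2 J N u 2)) with (/ 4 * S2 J N u 2) in HY by (field; lra).
  assert (HS2 := S2_nonneg J N u 2).
  assert (HK1 : 4 * ta * KG * S2 J N u 2 <= / 4 * S2 J N u 2) by (apply Rmult_le_compat_r; lra).
  assert (Hlin : 4 * ta * sum1 J (fun j => h * Ys ta h (tg T N 2) (xg Xmin Xmax J j))
    <= 16 * (ta * sum1 J (fun j => h * Ys ta h (tg T N 2) (xg Xmin Xmax J j)))).
  { assert (0 <= sum1 J (fun j => h * Ys ta h (tg T N 2) (xg Xmin Xmax J j))); [|nra].
    apply sum1_nonneg. intros j _. apply Rmult_le_pos; [lra|]. apply Ys_nonneg. }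
  lra.
Qed.

Lemma first_step_bound (J N : nat) (u : nat -> nat -> R) (th : R) (ex : nat -> R) : (1 <= N)%nat ->
  tau T N <= / 3 -> 16 * tau T N * (KG + 1) <= 1 -> 0 < th <= 1 ->
  scheme_common T Xmin Xmax sigma b r f phi v0 vl vr J N u ->
  (forall j, (1 <= j <= J)%nat -> (err J N u 1 j / tau T N + th * Le J N u 1 j) * err J N u 1 j
    <= (Xs (tau T N) (hh Xmin Xmax J) + ex j) * Rabs (err J N u 1 j)
       + Ys (tau T N) (hh Xmin Xmax J) (tg T N 1) (xg Xmin Xmax J j)) ->
  S2 J N u 1 <= 4 * CS * Bn (tau T N) (hh Xmin Xmax J)
    + 4 * tau T N ^ 2 * sum1 J (fun j => hh Xmin Xmax J * ex j ^ 2).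
Proof.
  intros HN Ht3 HtK Hth Hsc Hnode. destruct (tau_pos T N HT HN) as [Hta HNt].
  assert (Hh := hh_pos Xmin Xmax J HO). assert (HKG := KG_pos).
  set (ta := tau T N) in *. set (h := hh Xmin Xmax J) in *.
  assert (HE := first_step_energy J h ta KG th (err J N u 1) (Le J N u 1)
    (fun j => Xs ta h + ex j) (fun j => Ys ta h (tg T N 1) (xg Xmin Xmax J j)) Hh Hta ltac:(lra) Hnode
    (err_garding J N u 1 HN HN Hsc)).
  cbv beta in HE.
  assert (HY := sum1_young J h ta (/ (4 * ta)) (err J N u 1) (fun j => Xs ta h + ex j) Hh
    ltac:(lra) ltac:(right; field; lra)).
  assert (HS := start_sum J ta (tg T N 1) ltac:(lra)). fold h in HS.
  change (sum1 J (fun j => h * err J N u 1 j ^ 2)) with (S2 J N u 1) in HE, HY.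
  apply (Rmult_le_compat_l ta) in HY; [|lra].
  rewrite Rmult_plus_distr_l in HY.
  replace (ta * (/ (4 * ta) * S2 J N u 1)) with (/ 4 * S2 J N u 1) in HY by (field; lra).
  assert (HS2 := S2_nonneg J N u 1).
  assert (HK1 : ta * th * KG * S2 J N u 1 <= / 4 * S2 J N u 1).
  { apply Rmult_le_compat_r; auto. apply Rle_trans with (ta * 1 * KG); [|lra].
    apply Rmult_le_compat_r; [lra|]. apply Rmult_le_compat_l; lra. }
  assert (Hsq : sum1 J (fun j => h * (Xs ta h + ex j) ^ 2)
    <= 2 * sum1 J (fun _ => h * Xs ta h ^ 2) + 2 * sum1 J (fun j => h * ex j ^ 2)).
  { rewrite <- !sum1_scal, <- sum1_plus. apply sum1_le. intros j _.
    pose proof (pow2_ge_0 (Xs ta h - ex j)).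
    assert (H2 : (Xs ta h + ex j) ^ 2 <= 2 * Xs ta h ^ 2 + 2 * ex j ^ 2) by lra.
    apply (Rmult_le_compat_l h) in H2; lra. }
  apply (Rmult_le_compat_l (ta ^ 2)) in Hsq; [|apply pow2_ge_0].
  assert (Hlin : ta * sum1 J (fun j => h * Ys ta h (tg T N 1) (xg Xmin Xmax J j))
    <= 2 * (ta * sum1 J (fun j => h * Ys ta h (tg T N 1) (xg Xmin Xmax J j)))).
  { assert (0 <= sum1 J (fun j => h * Ys ta h (tg T N 1) (xg Xmin Xmax J j))); [|nra].
    apply sum1_nonneg. intros j _. apply Rmult_le_pos; [lra|]. apply Ys_nonneg. }
  lra.
Qed.

Lemma start_quotient (ta x : R) : 0 < ta -> ta <= 1 -> ta < T -> Xmin < x < Xmax ->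
  Rabs ((v ta x - v 0 x) / ta) <= D * Rpower ta (- al1).
Proof.
  intros H0 H1 H2 Hx. assert (A1 := Hstart ta x H0 H1 H2 Hx).
  unfold Rdiv. rewrite Rabs_mult, (Rabs_right (/ ta)).
  - apply Rmult_le_reg_r with ta; auto. rewrite Rmult_assoc, Rinv_l by lra. lra.
  - apply Rle_ge, Rlt_le, Rinv_0_lt_compat; auto.
Qed.

Lemma IE_node (J N : nat) (u : nat -> nat -> R) (j : nat) : (1 <= N)%nat ->
  tau T N <= / 3 -> 4 * tau T N < T -> (1 <= j <= J)%nat ->
  scheme_common T Xmin Xmax sigma b r f phi v0 vl vr J N u ->
  first_step_IE T Xmin Xmax sigma b r f phi J N u ->
  (err J N u 1 j / tau T N + 1 * Le J N u 1 j) * err J N u 1 j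
    <= (Xs (tau T N) (hh Xmin Xmax J) + 0) * Rabs (err J N u 1 j)
       + Ys (tau T N) (hh Xmin Xmax J) (tg T N 1) (xg Xmin Xmax J j).
Proof.
  intros HN Ht3 HtT Hj Hsc Hie. destruct (tau_pos T N HT HN) as [Hta HNt].
  assert (Hh := hh_pos Xmin Xmax J HO).
  assert (E0 := err_initial J N u j HN ltac:(lia) Hsc).
  assert (H := Rmin_shift _ _ _ (Hie j Hj)). rewrite Lh_split in H by lia.
  destruct (xg_interior Xmin Xmax J HO j Hj) as [X1 X2].
  assert (Ht1 : tg T N 1 = tau T N) by (unfold tg; simpl; ring).
  assert (Et0 : tg T N 0 = 0) by (unfold tg; simpl; ring).
  set (ta := tau T N) in *. set (h := hh Xmin Xmax J) in *.
  set (x := xg Xmin Xmax J j) in *. set (t := tg T N 1) in *.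
  assert (HGu : 0 <= u 1%nat j - phi t x - f t x) by (unfold Rmin in H; destruct Rle_dec; lra).
  assert (Hgv : 0 <= v t x - g t x) by (assert (g t x <= v t x) by (apply Hobs; lra); lra).
  assert (HF : ((v t x - v 0 x) / ta - f t x + 1 * Ah a b r v h t x)
      * (v t x - g t x - (u 1%nat j - phi t x - f t x))
    <= (Xs ta h + 0) * Rabs (v t x - g t x - (u 1%nat j - phi t x - f t x)) + Ys ta h t x).
  { apply start_node_total; auto; try lra.
    assert (HfM := start_modulus_M ta t x Hta ltac:(lra) ltac:(lra) ltac:(lra)).
    assert (Hq := start_quotient ta x Hta ltac:(lra) ltac:(lra) ltac:(lra)). rewrite <- Ht1 in Hq at 1.
    pose proof (Rpower_pos ta (- al1)).
    assert (0 <= D * Rpower ta (- al1)) by (apply Rmult_le_pos; lra).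
    unfold Rminus at 1. eapply Rle_trans; [apply Rabs_triang|]. rewrite Rabs_Ropp. lra. }
  assert (HC' := complementarity_error _ _ _ _ _ _ H Hgv HF).
  replace (u 1%nat j - phi t x - f t x - (v t x - g t x)) with (err J N u 1 j) in HC'
    by (unfold err, g; fold t x; ring).
  eapply Rle_trans; [|apply HC']. right. f_equal.
  assert (Eu : u 0%nat j = v 0 x).
  { unfold err in E0. rewrite Et0 in E0. fold x in E0. lra. }
  rewrite Eu. unfold err. fold t x. field. lra.
Qed.

Lemma first_step_IE_bound (J N : nat) (u : nat -> nat -> R) : (1 <= N)%nat ->
  tau T N <= / 3 -> 4 * tau T N < T -> 16 * tau T N * (KG + 1) <= 1 ->
  scheme_common T Xmin Xmax sigma b r f phi v0 vl vr J N u ->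
  first_step_IE T Xmin Xmax sigma b r f phi J N u ->
  S2 J N u 1 <= 4 * CS * Bn (tau T N) (hh Xmin Xmax J).
Proof.
  intros HN Ht3 HtT HtK Hsc Hie.
  assert (H := first_step_bound J N u 1 (fun _ => 0) HN Ht3 HtK ltac:(lra) Hsc
    (fun j Hj => IE_node J N u j HN Ht3 HtT Hj Hsc Hie)).
  cbv beta in H.
  rewrite (sum1_ext J (fun j => hh Xmin Xmax J * 0 ^ 2) (fun _ => 0)) in H by (intros; ring).
  rewrite sum1_const in H. lra.
Qed.

Lemma CN_node (J N : nat) (u : nat -> nat -> R) (j : nat) (ex : R) : (1 <= N)%nat ->
  tau T N <= / 3 -> 4 * tau T N < T -> (1 <= j <= J)%nat ->
  Rabs (Ah a b r v (hh Xmin Xmax J) 0 (xg Xmin Xmax J j)) <= ex ->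
  scheme_common T Xmin Xmax sigma b r f phi v0 vl vr J N u ->
  first_step_CN T Xmin Xmax sigma b r f phi J N u ->
  (err J N u 1 j / tau T N + / 2 * Le J N u 1 j) * err J N u 1 j
    <= (Xs (tau T N) (hh Xmin Xmax J) + ex) * Rabs (err J N u 1 j)
       + Ys (tau T N) (hh Xmin Xmax J) (tg T N 1) (xg Xmin Xmax J j).
Proof.
  intros HN Ht3 HtT Hj Hex Hsc Hcn. destruct (tau_pos T N HT HN) as [Hta HNt].
  assert (Hh := hh_pos Xmin Xmax J HO).
  assert (E0 := err_initial J N u j HN ltac:(lia) Hsc).
  (* The error vanishes at level [0], so the explicit half of the step contributes only the operator
     applied to the exact initial values. *)
  assert (EL0 : Le J N u 0 j = 0).
  { unfold Le, Lgrid. rewrite !(err_initial J N u) by (auto; lia). unfold Rdiv. ring. }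
  assert (H := Hcn j Hj). rewrite !Lh_split in H by lia. rewrite EL0 in H.
  destruct (xg_interior Xmin Xmax J HO j Hj) as [X1 X2].
  assert (Ht1 : tg T N 1 = tau T N) by (unfold tg; simpl; ring).
  assert (Et0 : tg T N 0 = 0) by (unfold tg; simpl; ring).
  rewrite Et0 in H.
  set (ta := tau T N) in *. set (h := hh Xmin Xmax J) in *.
  set (x := xg Xmin Xmax J j) in *. set (t := tg T N 1) in *.
  assert (HGu : 0 <= u 1%nat j - phi t x - f t x) by (unfold Rmin in H; destruct Rle_dec; lra).
  assert (Hgv : 0 <= v t x - g t x) by (assert (g t x <= v t x) by (apply Hobs; lra); lra).
  assert (HF : ((v t x - v 0 x) / ta - f (ta / 2) x + / 2 * Ah a b r v h 0 x + / 2 * Ah a b r v h t x)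
      * (v t x - g t x - (u 1%nat j - phi t x - f t x))
    <= (Xs ta h + ex) * Rabs (v t x - g t x - (u 1%nat j - phi t x - f t x)) + Ys ta h t x).
  { apply start_node_total; auto; try lra.
    assert (HfM := start_modulus_M ta (ta / 2) x Hta ltac:(lra) ltac:(lra) ltac:(lra)).
    assert (Hq := start_quotient ta x Hta ltac:(lra) ltac:(lra) ltac:(lra)). rewrite <- Ht1 in Hq at 1.
    pose proof (Rpower_pos ta (- al1)).
    assert (0 <= D * Rpower ta (- al1)) by (apply Rmult_le_pos; lra).
    pose proof (Rabs_pos (Ah a b r v h 0 x)).
    assert (HA2 : Rabs (/ 2 * Ah a b r v h 0 x) <= ex) by (rewrite Rabs_mult, Rabs_right; lra).
    eapply Rle_trans; [apply Rabs_triang|].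
    assert (HA3 : Rabs ((v t x - v 0 x) / ta - f (ta / 2) x)
      <= Rabs ((v t x - v 0 x) / ta) + Rabs (f (ta / 2) x)).
    { unfold Rminus at 1. eapply Rle_trans; [apply Rabs_triang|]. rewrite Rabs_Ropp. lra. }
    lra. }
  assert (HC' := complementarity_error _ _ _ _ _ _ H Hgv HF).
  replace (u 1%nat j - phi t x - f t x - (v t x - g t x)) with (err J N u 1 j) in HC'
    by (unfold err, g; fold t x; ring).
  eapply Rle_trans; [|apply HC']. right. f_equal.
  assert (Eu : u 0%nat j = v 0 x).
  { unfold err in E0. rewrite Et0 in E0. fold x in E0. lra. }
  rewrite Eu. unfold err. fold t x. field. lra.
Qed.

Lemma CS_nonneg : 0 <= CS.
Proof.
  destruct const_pos as (Q1 & Q2 & Q3 & Q4 & Q5 & _).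
  unfold CS. pose proof (pow2_ge_0 KX). pose proof (pow2_ge_0 (1 + C1 * c1)).
  assert (0 <= W * KX ^ 2) by (apply Rmult_le_pos; lra).
  assert (0 <= CY * (1 + C1 * c1) ^ 2 * P) by (apply Rmult_le_pos; [apply Rmult_le_pos; lra | auto]).
  lra.
Qed.

(** At time [0] the operator acts on [v0]: it is bounded on smooth pieces, and of order [1 / h]
    within [h] of a breakpoint, where the Lipschitz bound is all that remains. *)
Lemma initial_Ah_bound : Lip1 Xmin Xmax v0 -> piecewise_C2 Xmin Xmax v0 ->
  exists (q : nat) (z : nat -> R) (CV : R), 0 <= CV /\ forall h x,
    0 < h -> Xmin <= x - h -> x + h <= Xmax ->
    Rabs (Ah a b r v h 0 x) <= CV * (1 + indic (exists k, (k < q)%nat /\ Rabs (x - z k) <= h) / h).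
Proof.
  intros (L & HL0 & HL) Hpc.
  destruct (piecewise_second_difference Xmin Xmax v0 Hpc) as (q & z & B & HB0 & HBd).
  exists q, z, (M * (B + 2 * L) + M * L + M * M).
  assert (HMB : 0 <= M * (B + 2 * L)) by (apply Rmult_le_pos; lra).
  assert (HML : 0 <= M * L) by (apply Rmult_le_pos; lra).
  split; [nra|]. intros h x Hh H1 H2.
  destruct (HB 0 x ltac:(lra) ltac:(lra)) as (B1 & B2 & B3 & B4 & _).
  set (nr := exists k, (k < q)%nat /\ Rabs (x - z k) <= h).
  assert (Hh2 : 0 < h ^ 2) by nra.
  assert (Hih : 0 < / h) by (apply Rinv_0_lt_compat; auto).
  destruct (indic_bounds nr) as [I0 I1].
  assert (Hir : 0 <= indic nr / h) by (apply Rmult_le_pos; lra).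
  assert (D2 : Rabs ((v 0 (x + h) - 2 * v 0 x + v 0 (x - h)) / h ^ 2) <= (B + 2 * L) * (1 + indic nr / h)).
  { rewrite !Hv0 by lra. unfold Rdiv at 1. rewrite Rabs_mult, (Rabs_right (/ h ^ 2))
      by (apply Rle_ge, Rlt_le, Rinv_0_lt_compat; auto).
    apply Rmult_le_reg_r with (h ^ 2); auto. rewrite Rmult_assoc, Rinv_l, Rmult_1_r by lra.
    destruct (classic nr) as [Hn|Hn].
    - rewrite indic_true by auto.
      assert (A1 := HL (x + h) x ltac:(lra) ltac:(lra)). assert (A2 := HL (x - h) x ltac:(lra) ltac:(lra)).
      replace (x + h - x) with h in A1 by ring. replace (x - h - x) with (- h) in A2 by ring.
      rewrite Rabs_Ropp in A2. rewrite (Rabs_right h) in A1, A2 by lra.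
      replace ((B + 2 * L) * (1 + 1 / h) * h ^ 2) with ((B + 2 * L) * h ^ 2 + (B + 2 * L) * h) by (field; lra).
      assert (0 <= (B + 2 * L) * h ^ 2) by (apply Rmult_le_pos; lra).
      assert (0 <= B * h) by (apply Rmult_le_pos; lra).
      apply Rabs_le_between in A1, A2. apply Rabs_le; lra.
    - rewrite indic_false by auto. unfold Rdiv. rewrite Rmult_0_l, Rplus_0_r, Rmult_1_r.
      eapply Rle_trans; [apply HBd; auto|]. apply Rmult_le_compat_r; lra. }
  assert (D1 : Rabs ((v 0 (x + h) - v 0 (x - h)) / (2 * h)) <= L).
  { rewrite !Hv0 by lra. unfold Rdiv. rewrite Rabs_mult, (Rabs_right (/ (2 * h)))
      by (apply Rle_ge, Rlt_le, Rinv_0_lt_compat; lra).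
    apply Rmult_le_reg_r with (2 * h); [lra|]. rewrite Rmult_assoc, Rinv_l, Rmult_1_r by lra.
    eapply Rle_trans; [apply HL; lra|]. replace (x + h - (x - h)) with (2 * h) by ring.
    rewrite Rabs_right; lra. }
  unfold Ah. eapply Rle_trans; [apply Rabs_triang|].
  eapply Rle_trans; [apply Rplus_le_compat_r, Rabs_triang|]. rewrite !Rabs_mult, Rabs_Ropp.
  assert (E1 := Rmult_le_compat _ _ _ _ (Rabs_pos _) (Rabs_pos _) B1 D2).
  assert (E2 := Rmult_le_compat _ _ _ _ (Rabs_pos _) (Rabs_pos _) B2 D1).
  assert (E3 := Rmult_le_compat _ _ _ _ (Rabs_pos _) (Rabs_pos _) B3 B4).
  assert (0 <= (M * L + M * M) * (indic nr / h)) by (apply Rmult_le_pos; [nra | auto]).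
  lra.
Qed.

(** Source of [ta ^ 2 / h]: each of the [q] breakpoints affects nodes of total weight at most
    [3 * h], at which the squared residual is of order [1 / h ^ 2]. *)
Lemma first_step_CN_bound : Lip1 Xmin Xmax v0 -> piecewise_C2 Xmin Xmax v0 ->
  exists C, 0 <= C /\ forall (J N : nat) (u : nat -> nat -> R), (1 <= N)%nat ->
  tau T N <= / 3 -> 4 * tau T N < T -> 16 * tau T N * (KG + 1) <= 1 ->
  scheme_common T Xmin Xmax sigma b r f phi v0 vl vr J N u ->
  first_step_CN T Xmin Xmax sigma b r f phi J N u ->
  S2 J N u 1 <= C * (Bn (tau T N) (hh Xmin Xmax J) + tau T N ^ 2 / hh Xmin Xmax J).
Proof.
  intros HLip Hpc. destruct (initial_Ah_bound HLip Hpc) as (q & z & CV & HCV & HAh).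
  destruct const_pos as (Q1 & Q2 & Q3 & Q4 & Q5 & Q6 & Q7 & Q8 & Q9 & Q10).
  assert (HCS := CS_nonneg).
  pose proof (pos_INR q) as Hq0. pose proof (pow2_ge_0 CV) as HCV2.
  assert (HCW : 0 <= CV ^ 2 * W) by (apply Rmult_le_pos; lra).
  assert (HCq : 0 <= CV ^ 2 * INR q) by (apply Rmult_le_pos; lra).
  exists (4 * CS + 8 * (CV ^ 2 * W) + 24 * (CV ^ 2 * INR q)). split; [lra|].
  intros J N u HN Ht3 HtT HtK Hsc Hcn. destruct (tau_pos T N HT HN) as [Hta HNt].
  assert (Hh := hh_pos Xmin Xmax J HO).
  set (ex := fun j => CV * (1 + indic (exists k, (k < q)%nat /\
    Rabs (xg Xmin Xmax J j - z k) <= hh Xmin Xmax J) / hh Xmin Xmax J)).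
  assert (H := first_step_bound J N u (/ 2) ex HN Ht3 HtK ltac:(lra) Hsc
    (fun j Hj => CN_node J N u j (ex j) HN Ht3 HtT Hj
      (HAh _ _ Hh (proj1 (xg_interior Xmin Xmax J HO j Hj)) (proj2 (xg_interior Xmin Xmax J HO j Hj)))
      Hsc Hcn)).
  assert (Hsum := sum_h_le Xmin Xmax J HO). fold W in Hsum.
  set (ta := tau T N) in *. set (h := hh Xmin Xmax J) in *.
  destruct (Bnd_parts ta h Hta Hh) as (_ & _ & _ & B0 & B1).
  assert (Hta0 : ta <= Rpower ta al0).
  { rewrite <- (Rpower_1 ta) at 1 by lra. apply Rpower_anti_exp; lra. }
  assert (Hcnt := count_near_many Xmin h h z q J Hh ltac:(lra)).
  assert (Hex : sum1 J (fun j => h * ex j ^ 2) <= 2 * CV ^ 2 * W + 6 * CV ^ 2 * INR q / h).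
  { apply Rle_trans with (sum1 J (fun j => 2 * CV ^ 2 * h + 2 * CV ^ 2 / h ^ 2
      * (h * indic (exists k, (k < q)%nat /\ Rabs (xg Xmin Xmax J j - z k) <= h)))).
    - apply sum1_le. intros j _. unfold ex. fold h.
      set (ib := indic (exists k, (k < q)%nat /\ Rabs (xg Xmin Xmax J j - z k) <= h)).
      assert (Hib : ib ^ 2 = ib).
      { unfold ib, indic. destruct excluded_middle_informative; ring. }
      assert (Hs : (1 + ib / h) ^ 2 <= 2 + 2 * (ib / h ^ 2)).
      { pose proof (pow2_ge_0 (1 - ib / h)).
        assert ((ib / h) ^ 2 = ib / h ^ 2).
        { unfold Rdiv. rewrite Rpow_mult_distr, Hib. f_equal. field. lra. }
        lra. }
      apply Rle_trans with (h * (CV ^ 2 * (2 + 2 * (ib / h ^ 2)))).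
      + rewrite Rpow_mult_distr. apply Rmult_le_compat_l; [lra|]. apply Rmult_le_compat_l; auto.
      + right. field. lra.
    - rewrite sum1_plus, 2 sum1_scal. apply Rplus_le_compat.
      + apply Rmult_le_compat_l; [lra | auto].
      + apply Rle_trans with (2 * CV ^ 2 / h ^ 2 * (INR q * (2 * h + h))).
        * apply Rmult_le_compat_l; [|exact Hcnt].
          apply Rmult_le_pos; [lra | left; apply Rinv_0_lt_compat; nra].
        * right. field. lra. }
  assert (Hex2 : ta ^ 2 * sum1 J (fun j => h * ex j ^ 2)
    <= 2 * (CV ^ 2 * W) * ta ^ 2 + 6 * (CV ^ 2 * INR q) * (ta ^ 2 / h)).
  { apply Rle_trans with (ta ^ 2 * (2 * CV ^ 2 * W + 6 * CV ^ 2 * INR q / h)).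
    - apply Rmult_le_compat_l; [apply pow2_ge_0 | auto].
    - right. field. lra. }
  assert (Hth : 0 <= ta ^ 2 / h) by (apply Rmult_le_pos; [nra | left; apply Rinv_0_lt_compat; auto]).
  assert (Htsq : ta ^ 2 <= Bn ta h) by nra.
  assert (CV ^ 2 * W * ta ^ 2 <= CV ^ 2 * W * Bn ta h) by (apply Rmult_le_compat_l; auto).
  assert (0 <= CS * (ta ^ 2 / h)) by (apply Rmult_le_pos; auto).
  assert (0 <= CV ^ 2 * W * (ta ^ 2 / h)) by (apply Rmult_le_pos; auto).
  assert (0 <= CV ^ 2 * INR q * Bn ta h) by (apply Rmult_le_pos; auto).
  lra.
Qed.

(** Up to a constant, [Gk ta h k] is [ta] times the residual at level [k + 2]: the squared time
    error, the squared space error, and the share of bad nodes times a bound for the square of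
    [mm]. *)
Let sk (al ta : R) (k : nat) : R := ta * Rpower (INR k * ta) (- (2 * al)).
Let Gk (ta h : R) (k : nat) : R :=
  ta ^ 2 * sk al2 ta k + h ^ 2 * sk al4 ta k + (Rpower ta al0 + h) * (ta + sk al1 ta k).
Let BB := 2 * (2 * K + CA + M) ^ 2 + CY.
Let CR := 64 * W * (C2 * c2) ^ 2 + 4 * W * (CM * (C4 * c4)) ^ 2
  + BB * P * (2 + 2 * (C1 * c1) ^ 2).

Lemma CR_pos : 0 <= CR.
Proof.
  destruct const_pos as (Q1 & Q2 & Q3 & Q4 & Q5 & _).
  assert (0 <= BB).
  { unfold BB. pose proof (pow2_ge_0 (2 * K + CA + M)). lra. }
  pose proof (pow2_ge_0 (C2 * c2)). pose proof (pow2_ge_0 (CM * (C4 * c4))). pose proof (pow2_ge_0 (C1 * c1)).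
  assert (0 <= W * (C2 * c2) ^ 2) by (apply Rmult_le_pos; lra).
  assert (0 <= W * (CM * (C4 * c4)) ^ 2) by (apply Rmult_le_pos; lra).
  assert (0 <= BB * P * (2 + 2 * (C1 * c1) ^ 2)) by (apply Rmult_le_pos; [apply Rmult_le_pos; auto | lra]).
  unfold CR. lra.
Qed.

(** At level [k + 2] the time stencil starts at [k * ta], so the derivative bounds may be taken at
    [eps = k * ta / 2]. Young's inequality is now unweighted, and moving the unknown energy to the
    left costs only a factor [1 + O(ta)]. *)
Lemma regular_step (J N : nat) (u : nat -> nat -> R) (k : nat) : (1 <= N)%nat -> (1 <= k)%nat ->
  (k + 2 <= N)%nat -> 16 * tau T N * (KG + 1) <= 1 ->
  scheme_common T Xmin Xmax sigma b r f phi v0 vl vr J N u ->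
  Qe J N u (S (S k)) <= (1 + 8 * (KG + 1) * tau T N)
    * (Qe J N u (S k) + 4 * CR * Gk (tau T N) (hh Xmin Xmax J) k).
Proof.
  intros HN Hk HkN HtK Hsc. destruct (tau_pos T N HT HN) as [Hta HNt].
  assert (Hh := hh_pos Xmin Xmax J HO). assert (HKG := KG_pos).
  destruct const_pos as (Q1 & Q2 & Q3 & Q4 & Q5 & Q6 & Q7 & Q8 & Q9 & Q10).
  assert (HtR := tg_range N (S (S k)) HN ltac:(lia)).
  assert (Hbad := bad_measure J (tau T N) (tg T N (S (S k))) Hta). fold P in Hbad.
  assert (Hsum := sum_h_le Xmin Xmax J HO). fold W in Hsum.
  assert (HCR := CR_pos).
  set (ta := tau T N) in *. set (h := hh Xmin Xmax J) in *.
  set (t := tg T N (S (S k))) in *.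
  assert (Htk : t = INR k * ta + 2 * ta) by (unfold t, tg; rewrite !S_INR; fold ta; ring).
  assert (Hk1 : 1 <= INR k) by (apply (le_INR 1); lia).
  assert (Hkt : 0 < INR k * ta) by (apply Rmult_lt_0_compat; lra).
  set (eps := INR k * ta / 2).
  assert (Heps : 0 < eps) by (unfold eps; lra).
  set (Ag := 4 * (C2 * Rpower eps (- al2) * ta) + M * (2 + W) * (C4 * Rpower eps (- al4) * h)).
  set (Bg := (2 * K + CA + M) * mm eps).
  set (ib := fun j => indic (bad ta h t (xg Xmin Xmax J j))) in *.
  assert (Hnode : forall j, (1 <= j <= J)%nat ->
    ((3 * err J N u (S (S k)) j - 4 * err J N u (S k) j + err J N u k j) / (2 * ta)
      + Le J N u (S (S k)) j) * err J N u (S (S k)) j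
      <= (Ag + Bg * ib j) * Rabs (err J N u (S (S k)) j) + CY * mm eps ^ 2 * ib j).
  { intros j Hj.
    assert (HBE := bdf_error_node J N u (S k) j (Ag + Bg * ib j) (CY * mm eps ^ 2 * ib j)).
    rewrite (Nat.sub_succ k 0), Nat.sub_0_r in HBE. apply HBE; auto; try lia. clear HBE.
    intros Gu HGu. fold ta h t. destruct (xg_interior Xmin Xmax J HO j Hj) as [X1 X2]. fold h in X1, X2.
    apply bdf_node; auto; try lra. unfold eps; lra. }
  assert (HE := bdf_energy J h ta KG (err J N u k) (err J N u (S k)) (err J N u (S (S k)))
    (Le J N u (S (S k))) (fun j => Ag + Bg * ib j) (fun j => CY * mm eps ^ 2 * ib j) Hh Hta Hnode
    (err_garding J N u (S (S k)) HN ltac:(lia) Hsc)).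
  cbv beta in HE.
  assert (HY := sum1_young J h (/ 2) (/ 2) (err J N u (S (S k))) (fun j => Ag + Bg * ib j) Hh
    ltac:(lra) ltac:(lra)).
  assert (HSQ := S2_le_Qe J N u (S (S k))).
  change (sum1 J (fun j => h * err J N u (S (S k)) j ^ 2)) with (S2 J N u (S (S k))) in HE, HY.
  match type of HE with ?l <= _ => change l with (Qe J N u (S (S k))) in HE end.
  replace (sum1 J (fun j => h * (err J N u (S k) j ^ 2 + (2 * err J N u (S k) j - err J N u k j) ^ 2)))
    with (Qe J N u (S k)) in HE
    by (unfold Qe; replace (S k - 1)%nat with k by lia; reflexivity).
  assert (HR : / 2 * sum1 J (fun j => h * (Ag + Bg * ib j) ^ 2)
    + sum1 J (fun j => h * (CY * mm eps ^ 2 * ib j))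
    <= CR * (ta ^ 2 * Rpower (INR k * ta) (- (2 * al2)) + h ^ 2 * Rpower (INR k * ta) (- (2 * al4))
        + (Rpower ta al0 + h) * (1 + Rpower (INR k * ta) (- (2 * al1))))).
  { set (p1 := Rpower (INR k * ta) (- (2 * al1))). set (p2 := Rpower (INR k * ta) (- (2 * al2))).
    set (p4 := Rpower (INR k * ta) (- (2 * al4))).
    assert (Hp1 : 0 < p1) by apply Rpower_pos. assert (Hp2 : 0 < p2) by apply Rpower_pos.
    assert (Hp4 : 0 < p4) by apply Rpower_pos.
    assert (Hpe : forall al, Rpower eps (- al) ^ 2 = Rpower 2 al ^ 2 * Rpower (INR k * ta) (- (2 * al))).
    { intros al. unfold eps. rewrite Rpower_half by auto. rewrite Rpow_mult_distr. f_equal.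
      rewrite Rpower_sq. f_equal. ring. }
    assert (HAg : Ag ^ 2 <= 32 * (C2 * c2) ^ 2 * (ta ^ 2 * p2) + 2 * (CM * (C4 * c4)) ^ 2 * (h ^ 2 * p4)).
    { unfold Ag. fold CM.
      pose proof (pow2_ge_0 (4 * (C2 * Rpower eps (- al2) * ta) - CM * (C4 * Rpower eps (- al4) * h))).
      assert (E2 := Hpe al2). assert (E4 := Hpe al4). fold c2 p2 in E2. fold c4 p4 in E4.
      assert (F2 : (4 * (C2 * Rpower eps (- al2) * ta)) ^ 2 = 16 * (C2 * c2) ^ 2 * (ta ^ 2 * p2)).
      { rewrite !Rpow_mult_distr, E2. ring. }
      assert (F4 : (CM * (C4 * Rpower eps (- al4) * h)) ^ 2 = (CM * (C4 * c4)) ^ 2 * (h ^ 2 * p4)).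
      { rewrite !Rpow_mult_distr, E4. ring. }
      lra. }
    assert (Hmm : 0 <= mm eps ^ 2 <= (2 + 2 * (C1 * c1) ^ 2) * (1 + p1)).
    { split; [apply pow2_ge_0|]. unfold mm.
      assert (E1 := Hpe al1). fold c1 p1 in E1.
      pose proof (pow2_ge_0 (1 - C1 * Rpower eps (- al1))).
      assert (F1 : (C1 * Rpower eps (- al1)) ^ 2 = (C1 * c1) ^ 2 * p1).
      { rewrite !Rpow_mult_distr, E1. ring. }
      pose proof (pow2_ge_0 (C1 * c1)). lra. }
    assert (HBB : Bg ^ 2 + CY * mm eps ^ 2 <= BB * mm eps ^ 2).
    { unfold Bg, BB. rewrite Rpow_mult_distr.
      pose proof (Rmult_le_pos _ _ (pow2_ge_0 (2 * K + CA + M)) (proj1 Hmm)). lra. }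
    assert (HBB0 : 0 <= BB).
    { unfold BB. pose proof (pow2_ge_0 (2 * K + CA + M)). lra. }
    apply Rle_trans with (sum1 J (fun j => Ag ^ 2 * h + BB * mm eps ^ 2 * (h * ib j))).
    - rewrite <- sum1_scal, <- sum1_plus. apply sum1_le. intros j _.
      assert (Hib : ib j ^ 2 = ib j /\ 0 <= ib j <= 1).
      { unfold ib, indic. destruct excluded_middle_informative; lra. }
      destruct Hib as (I1 & I2 & I3).
      pose proof (pow2_ge_0 (Ag - Bg * ib j)).
      assert (H5 : (Ag + Bg * ib j) ^ 2 <= 2 * Ag ^ 2 + 2 * (Bg ^ 2 * ib j)).
      { replace (Bg ^ 2 * ib j) with ((Bg * ib j) ^ 2) by (rewrite Rpow_mult_distr, I1; ring). lra. }
      assert (H6 : (Bg ^ 2 + CY * mm eps ^ 2) * ib j <= BB * mm eps ^ 2 * ib j)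
        by (apply Rmult_le_compat_r; auto).
      assert (H7 : / 2 * (Ag + Bg * ib j) ^ 2 + CY * mm eps ^ 2 * ib j <= Ag ^ 2 + BB * mm eps ^ 2 * ib j) by lra.
      apply (Rmult_le_compat_l h) in H7; lra.
    - rewrite sum1_plus, 2 sum1_scal.
      assert (A1 : Ag ^ 2 * sum1 J (fun _ => h) <= Ag ^ 2 * W).
      { apply Rmult_le_compat_l; [apply pow2_ge_0 | auto]. }
      assert (A2 : Ag ^ 2 * W <= (32 * (C2 * c2) ^ 2 * (ta ^ 2 * p2) + 2 * (CM * (C4 * c4)) ^ 2 * (h ^ 2 * p4)) * W).
      { apply Rmult_le_compat_r; lra. }
      pose proof (Rpower_pos ta al0).
      assert (Hah : 0 <= Rpower ta al0 + h) by lra.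
      assert (A3 : BB * mm eps ^ 2 * sum1 J (fun j => h * ib j)
        <= BB * ((2 + 2 * (C1 * c1) ^ 2) * (1 + p1)) * (P * (Rpower ta al0 + h))).
      { apply Rmult_le_compat.
        - apply Rmult_le_pos; lra.
        - apply sum1_nonneg. intros j _. apply Rmult_le_pos; [lra | apply indic_bounds].
        - apply Rmult_le_compat_l; lra.
        - exact Hbad. }
      set (U2 := ta ^ 2 * p2) in *. set (U4 := h ^ 2 * p4) in *. set (U1 := (Rpower ta al0 + h) * (1 + p1)).
      assert (HU2 : 0 <= U2) by (apply Rmult_le_pos; [apply pow2_ge_0 | lra]).
      assert (HU4 : 0 <= U4) by (apply Rmult_le_pos; [apply pow2_ge_0 | lra]).
      assert (HU1 : 0 <= U1) by (apply Rmult_le_pos; lra).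
      replace (BB * ((2 + 2 * (C1 * c1) ^ 2) * (1 + p1)) * (P * (Rpower ta al0 + h))) with
        (BB * P * (2 + 2 * (C1 * c1) ^ 2) * U1) in A3 by (unfold U1; ring).
      set (k2 := W * (C2 * c2) ^ 2) in *. set (k4 := W * (CM * (C4 * c4)) ^ 2) in *.
      set (k1 := BB * P * (2 + 2 * (C1 * c1) ^ 2)) in *.
      assert (Hk2 : 0 <= k2) by (apply Rmult_le_pos; [lra | apply pow2_ge_0]).
      assert (Hk4 : 0 <= k4) by (apply Rmult_le_pos; [lra | apply pow2_ge_0]).
      assert (Hk1' : 0 <= k1).
      { unfold k1. pose proof (pow2_ge_0 (C1 * c1)).
        apply Rmult_le_pos; [apply Rmult_le_pos; auto | lra]. }
      assert (ECR : CR = 64 * k2 + 4 * k4 + k1) by (unfold CR, k1, k2, k4; ring).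
      rewrite ECR.
      replace ((32 * (C2 * c2) ^ 2 * U2 + 2 * (CM * (C4 * c4)) ^ 2 * U4) * W) with
        (32 * k2 * U2 + 2 * k4 * U4) in A2 by (unfold k2, k4; ring).
      pose proof (Rmult_le_pos _ _ Hk2 HU2). pose proof (Rmult_le_pos _ _ Hk2 HU4).
      pose proof (Rmult_le_pos _ _ Hk2 HU1). pose proof (Rmult_le_pos _ _ Hk4 HU2).
      pose proof (Rmult_le_pos _ _ Hk4 HU4). pose proof (Rmult_le_pos _ _ Hk4 HU1).
      pose proof (Rmult_le_pos _ _ Hk1' HU2). pose proof (Rmult_le_pos _ _ Hk1' HU4).
      lra. }
  assert (HS2 := S2_nonneg J N u (S (S k))).
  assert (HGk : CR * Gk ta h k = ta * (CR * (ta ^ 2 * Rpower (INR k * ta) (- (2 * al2)) + h ^ 2 * Rpower (INR k * ta) (- (2 * al4))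
        + (Rpower ta al0 + h) * (1 + Rpower (INR k * ta) (- (2 * al1)))))).
  { unfold Gk, sk. ring. }
  apply (Rmult_le_compat_l ta) in HR; [|lra]. rewrite <- HGk in HR.
  apply (Rmult_le_compat_l (4 * ta)) in HY; [|lra].
  set (Q := Qe J N u (S (S k))) in *. set (Q' := Qe J N u (S k)) in *.
  set (S2k := S2 J N u (S (S k))) in *.
  assert (Hx : Q <= Q' + 4 * CR * Gk ta h k + 4 * ta * (KG + 1) * Q).
  { assert (4 * ta * (KG + 1) * S2k <= 4 * ta * (KG + 1) * Q).
    { apply Rmult_le_compat_l; auto. apply Rmult_le_pos; lra. }
    assert (0 <= ta * S2k) by (apply Rmult_le_pos; lra). lra. }
  set (kx := 4 * (KG + 1) * ta) in *.
  assert (Hkx : 0 < kx) by (unfold kx; apply Rmult_lt_0_compat; lra).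
  assert (Hkx2 : kx <= / 4) by (unfold kx; lra).
  replace (8 * (KG + 1) * ta) with (2 * kx) by (unfold kx; ring).
  assert (Hx' : Q * (1 - kx) <= Q' + 4 * CR * Gk ta h k) by (unfold kx; lra).
  assert (HQ0 : 0 <= Q) by lra.
  (* For [kx <= / 4] the inverse of [1 - kx] is at most [1 + 2 * kx]. *)
  apply Rle_trans with (Q * ((1 + 2 * kx) * (1 - kx))).
  - assert (1 <= (1 + 2 * kx) * (1 - kx)) by nra. nra.
  - replace (Q * ((1 + 2 * kx) * (1 - kx))) with ((1 + 2 * kx) * (Q * (1 - kx))) by ring.
    apply Rmult_le_compat_l; lra.
Qed.

(** [power_sum] turns the sum of each singular power into [1 + Pw (1 - 2 al) ta]. The summands [1]
    have prefactors [ta ^ 2], [h ^ 2] and [ta ^ al0 + h], all covered by the term [ta ^ al0 + h] of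
    the bound. *)
Lemma Gk_sum : exists C, 0 <= C /\ forall ta h n, 0 < ta <= / 3 -> 0 < h -> h <= W -> INR n * ta <= T ->
  sum1 n (fun k => Gk ta h k) <= C * Bn ta h.
Proof.
  destruct const_pos as (_ & _ & HW & _).
  destruct (power_sum T al1 HT ltac:(lra)) as (D1 & HD1 & S1).
  destruct (power_sum T al2 HT ltac:(lra)) as (D2 & HD2 & S2').
  destruct (power_sum T al4 HT ltac:(lra)) as (D4 & HD4 & S4).
  exists (2 * D2 + D4 * (1 + W) + T + 2 * D1). split.
  { assert (0 <= D4 * (1 + W)) by (apply Rmult_le_pos; lra). lra. }
  intros ta h n Hta Hh HhW Hn.
  destruct (Bnd_parts ta h ltac:(lra) Hh) as (B4 & B2 & B1 & B0 & Bp).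
  assert (Hta0 : ta <= Rpower ta al0).
  { rewrite <- (Rpower_1 ta) at 1 by lra. apply Rpower_anti_exp; lra. }
  assert (Hp0 := Rpower_pos ta al0).
  specialize (S1 ta n ltac:(lra) Hn). specialize (S2' ta n ltac:(lra) Hn). specialize (S4 ta n ltac:(lra) Hn).
  unfold Gk, sk. rewrite 2 sum1_plus, (sum1_scal n (ta ^ 2)), (sum1_scal n (h ^ 2)), (sum1_scal n (Rpower ta al0 + h)),
    sum1_plus, sum1_const.
  assert (A2 : ta ^ 2 * sum1 n (fun k => ta * Rpower (INR k * ta) (- (2 * al2))) <= 2 * D2 * Bn ta h).
  { apply Rle_trans with (ta ^ 2 * (D2 * (1 + Pw (1 - 2 * al2) ta))).
    - apply Rmult_le_compat_l; [apply pow2_ge_0 | auto].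
    - replace (ta ^ 2 * (D2 * (1 + Pw (1 - 2 * al2) ta))) with
        (D2 * (ta ^ 2 + ta ^ 2 * Pw (1 - 2 * al2) ta)) by ring.
      replace (2 * D2 * Bn ta h) with (D2 * (Bn ta h + Bn ta h)) by ring.
      apply Rmult_le_compat_l; auto. apply Rplus_le_compat; auto. nra. }
  assert (A4 : h ^ 2 * sum1 n (fun k => ta * Rpower (INR k * ta) (- (2 * al4))) <= D4 * (1 + W) * Bn ta h).
  { apply Rle_trans with (h ^ 2 * (D4 * (1 + Pw (1 - 2 * al4) ta))).
    - apply Rmult_le_compat_l; [apply pow2_ge_0 | auto].
    - replace (h ^ 2 * (D4 * (1 + Pw (1 - 2 * al4) ta))) with
        (D4 * (h * h + h ^ 2 * Pw (1 - 2 * al4) ta)) by ring.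
      rewrite Rmult_assoc. apply Rmult_le_compat_l; auto.
      assert (h * h <= W * Bn ta h) by (apply Rmult_le_compat; lra). lra. }
  assert (A1 : (Rpower ta al0 + h) * (INR n * ta + sum1 n (fun k => ta * Rpower (INR k * ta) (- (2 * al1))))
    <= (T + 2 * D1) * Bn ta h).
  { apply Rle_trans with ((Rpower ta al0 + h) * (T + D1 * (1 + Pw (1 - 2 * al1) ta))).
    - apply Rmult_le_compat_l; lra.
    - replace ((Rpower ta al0 + h) * (T + D1 * (1 + Pw (1 - 2 * al1) ta))) with
        ((T + D1) * (Rpower ta al0 + h) + D1 * ((Rpower ta al0 + h) * Pw (1 - 2 * al1) ta)) by ring.
      assert ((T + D1) * (Rpower ta al0 + h) <= (T + D1) * Bn ta h) by (apply Rmult_le_compat_l; lra).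
      assert (D1 * ((Rpower ta al0 + h) * Pw (1 - 2 * al1) ta) <= D1 * Bn ta h)
        by (apply Rmult_le_compat_l; auto).
      lra. }
  lra.
Qed.

Lemma Gk_nonneg (ta h : R) (k : nat) : 0 < ta -> 0 < h -> 0 <= Gk ta h k.
Proof.
  intros Hta Hh. unfold Gk, sk.
  assert (Hs : forall al, 0 < ta * Rpower (INR k * ta) (- (2 * al)))
    by (intros; apply Rmult_lt_0_compat; [auto | apply Rpower_pos]).
  assert (A1 := Hs al1). assert (A2 := Hs al2). assert (A4 := Hs al4).
  pose proof (Rpower_pos ta al0).
  assert (0 <= ta ^ 2 * (ta * Rpower (INR k * ta) (- (2 * al2)))) by (apply Rmult_le_pos; [nra | lra]).
  assert (0 <= h ^ 2 * (ta * Rpower (INR k * ta) (- (2 * al4)))) by (apply Rmult_le_pos; [nra | lra]).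
  assert (0 <= (Rpower ta al0 + h) * (ta + ta * Rpower (INR k * ta) (- (2 * al1))))
    by (apply Rmult_le_pos; lra).
  lra.
Qed.

(** Discrete Gronwall from level [2] on; level [1] enters through [second_step]. As the error at
    level [0] is zero, the energy at level [1] is [5] times the squared norm. *)
Lemma later_steps : exists C, 1 <= C /\ forall (J N : nat) (u : nat -> nat -> R), (1 <= N)%nat ->
  tau T N <= / 3 -> 4 * tau T N < T -> 16 * tau T N * (KG + 1) <= 1 ->
  scheme_common T Xmin Xmax sigma b r f phi v0 vl vr J N u ->
  forall n, (1 <= n <= N)%nat ->
    S2 J N u n <= C * (S2 J N u 1 + Bn (tau T N) (hh Xmin Xmax J)).
Proof.
  destruct Gk_sum as (CG & HCG & Hsum). assert (HKG := KG_pos). assert (HCR := CR_pos).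
  destruct const_pos as (Q1 & Q2 & Q3 & Q4 & Q5 & Q6 & Q7 & Q8 & Q9 & Q10).
  assert (HCS := CS_nonneg).
  set (ka := 8 * (KG + 1)). assert (Hka : 0 < ka) by (unfold ka; lra).
  assert (HX : 1 <= exp (ka * T)).
  { rewrite <- exp_0. left. apply exp_increasing. apply Rmult_lt_0_compat; auto. }
  set (B := 10 + 32 * CS + 4 * CR * CG).
  assert (HCC : 0 <= CR * CG) by (apply Rmult_le_pos; auto).
  assert (HB10 : 10 <= B) by (unfold B; lra).
  exists (exp (ka * T) * B). split; [nra|].
  intros J N u HN Ht3 HtT HtK Hsc n Hn. destruct (tau_pos T N HT HN) as [Hta HNt].
  assert (Hh := hh_pos Xmin Xmax J HO). assert (HhW := hh_le Xmin Xmax J HO).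
  assert (H2 := second_step J N u HN Ht3 HtT HtK Hsc).
  assert (Hstep := fun k Hk HkN => regular_step J N u k HN Hk HkN HtK Hsc).
  destruct (Bnd_parts (tau T N) (hh Xmin Xmax J) Hta Hh) as (_ & _ & _ & _ & HBn).
  assert (HQ1 : Qe J N u 1 = 5 * S2 J N u 1).
  { unfold Qe, S2. rewrite <- sum1_scal. apply sum1_ext. intros j Hj.
    replace (1 - 1)%nat with 0%nat by reflexivity.
    rewrite (err_initial J N u j) by (auto; lia). ring. }
  assert (HS1 := S2_nonneg J N u 1).
  set (ta := tau T N) in *. set (h := hh Xmin Xmax J) in *.
  assert (HGn := fun k => Gk_nonneg ta h k Hta Hh).
  set (SB := S2 J N u 1 + Bn ta h). assert (HSB : 0 <= SB) by (unfold SB; lra).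
  assert (Hone : S2 J N u 1 <= exp (ka * T) * B * SB).
  { apply Rle_trans with (1 * 1 * SB); [unfold SB; lra|].
    apply Rmult_le_compat_r; auto. apply Rmult_le_compat; lra. }
  destruct n as [|[|k]]; [lia | auto |].
  assert (Hind : forall k, (k + 2 <= N)%nat -> Qe J N u (S (S k))
    <= (1 + ka * ta) ^ k * (Qe J N u 2 + 4 * CR * sum1 k (fun i => Gk ta h i))).
  { clear k Hn. induction k as [|k IH]; intros Hk.
    - simpl. lra.
    - assert (HI := IH ltac:(lia)). assert (HS := Hstep (S k) ltac:(lia) ltac:(lia)). fold ka in HS.
      assert (Hp : 1 <= (1 + ka * ta) ^ k).
      { apply pow_R1_Rle. assert (0 < ka * ta) by (apply Rmult_lt_0_compat; auto). lra. }
      simpl sum1. simpl pow.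
      eapply Rle_trans; [apply HS|]. rewrite (Rmult_assoc (1 + ka * ta)). apply Rmult_le_compat_l.
      { assert (0 < ka * ta) by (apply Rmult_lt_0_compat; auto). lra. }
      assert (0 <= 4 * CR * Gk ta h (S k)) by (apply Rmult_le_pos; [lra | apply HGn]).
      rewrite (Rmult_plus_distr_l (4 * CR)), <- Rplus_assoc, Rmult_plus_distr_l.
      apply Rplus_le_compat; auto. nra. }
  assert (HF := Hind k ltac:(lia)).
  assert (HkT : INR k * ta <= T).
  { rewrite <- HNt. apply Rmult_le_compat_r; [lra|]. apply le_INR; lia. }
  assert (Hpow : (1 + ka * ta) ^ k <= exp (ka * T)).
  { assert (0 < ka * ta) by (apply Rmult_lt_0_compat; auto).
    apply Rle_trans with (exp (ka * ta) ^ k).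
    - apply pow_incr. split; [lra|]. left. apply exp_ineq1. lra.
    - rewrite <- Rpower_pow by apply exp_pos. unfold Rpower. rewrite ln_exp. destruct (Req_dec (INR k * (ka * ta)) (ka * T)) as [->|Nk]; [lra|].
      left. apply exp_increasing.
      assert (ka * (INR k * ta) <= ka * T) by (apply Rmult_le_compat_l; lra). lra. }
  assert (Hs := Hsum ta h k ltac:(lra) Hh HhW HkT).
  assert (Hinner : Qe J N u 2 + 4 * CR * sum1 k (fun i => Gk ta h i) <= B * SB).
  { assert (4 * CR * sum1 k (fun i => Gk ta h i) <= 4 * CR * (CG * Bn ta h))
      by (apply Rmult_le_compat_l; lra).
    assert (0 <= CS * S2 J N u 1) by (apply Rmult_le_pos; auto).
    assert (0 <= CR * CG * S2 J N u 1) by (apply Rmult_le_pos; auto).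
    unfold B, SB. lra. }
  eapply Rle_trans; [apply S2_le_Qe|]. eapply Rle_trans; [apply HF|].
  rewrite (Rmult_assoc (exp (ka * T))). apply Rmult_le_compat; auto.
  - apply pow_le. assert (0 < ka * ta) by (apply Rmult_lt_0_compat; auto). lra.
  - assert (0 <= 4 * CR * sum1 k (fun i => Gk ta h i)).
    { apply Rmult_le_pos; [lra|]. apply sum1_nonneg. intros i _. apply HGn. }
    assert (0 <= Qe J N u 2) by (eapply Rle_trans; [apply S2_nonneg | apply S2_le_Qe]). lra.
Qed.

(** [/ 3] is the threshold of [Rpower_le_Pw], [4 * tau < T] keeps the first two levels before [T],
    and the last condition absorbs the Garding term. *)
Lemma step_size_threshold : exists delta, 0 < delta /\ forall N, tau T N < delta ->
  tau T N <= / 3 /\ 4 * tau T N < T /\ 16 * tau T N * (KG + 1) <= 1.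
Proof.
  assert (HKG := KG_pos).
  assert (Hi : 0 < / (16 * (KG + 1))) by (apply Rinv_0_lt_compat; lra).
  exists (Rmin (Rmin (/ 3) (T / 4)) (/ (16 * (KG + 1)))). split.
  - repeat apply Rmin_glb_lt; lra.
  - intros N HN.
    assert (H1 := Rlt_le_trans _ _ _ HN (Rmin_l _ _)). assert (H2 := Rlt_le_trans _ _ _ HN (Rmin_r _ _)).
    assert (H3 := Rlt_le_trans _ _ _ H1 (Rmin_l _ _)). assert (H4 := Rlt_le_trans _ _ _ H1 (Rmin_r _ _)).
    repeat split; try lra.
    apply (Rmult_lt_compat_r (16 * (KG + 1))) in H2; [|lra]. rewrite Rinv_l in H2; lra.
Qed.

Lemma error_bound_IE : exists C, 0 <= C /\ exists delta, 0 < delta /\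
  forall (J N : nat) (u : nat -> nat -> R), (1 <= N)%nat -> tau T N < delta ->
  scheme_common T Xmin Xmax sigma b r f phi v0 vl vr J N u ->
  first_step_IE T Xmin Xmax sigma b r f phi J N u ->
  forall n, (1 <= n <= N)%nat -> S2 J N u n <= C * Bn (tau T N) (hh Xmin Xmax J).
Proof.
  destruct later_steps as (CL & HCL & HL). destruct step_size_threshold as (delta & Hd & Hstep).
  exists (CL * (4 * CS + 1)). split.
  { apply Rmult_le_pos; [lra|]. pose proof CS_nonneg. lra. }
  exists delta. split; auto. intros J N u HN Hta Hsc Hie n Hn.
  destruct (Hstep N Hta) as (T1 & T2 & T3).
  eapply Rle_trans; [apply (HL J N u HN T1 T2 T3 Hsc n Hn)|].
  rewrite Rmult_assoc. apply Rmult_le_compat_l; [lra|].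
  assert (H1 := first_step_IE_bound J N u HN T1 T2 T3 Hsc Hie). lra.
Qed.

Lemma error_bound_CN : Lip1 Xmin Xmax v0 -> piecewise_C2 Xmin Xmax v0 ->
  exists C, 0 <= C /\ exists delta, 0 < delta /\
  forall (J N : nat) (u : nat -> nat -> R), (1 <= N)%nat -> tau T N < delta ->
  scheme_common T Xmin Xmax sigma b r f phi v0 vl vr J N u ->
  first_step_CN T Xmin Xmax sigma b r f phi J N u ->
  forall n, (1 <= n <= N)%nat ->
    S2 J N u n <= C * (Bn (tau T N) (hh Xmin Xmax J) + tau T N ^ 2 / hh Xmin Xmax J).
Proof.
  intros HLip Hpc. destruct (first_step_CN_bound HLip Hpc) as (CF & HCF & HF).
  destruct later_steps as (CL & HCL & HL). destruct step_size_threshold as (delta & Hd & Hstep).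
  exists (CL * (CF + 1)). split; [apply Rmult_le_pos; lra|].
  exists delta. split; auto. intros J N u HN Hta Hsc Hcn n Hn.
  destruct (Hstep N Hta) as (T1 & T2 & T3).
  eapply Rle_trans; [apply (HL J N u HN T1 T2 T3 Hsc n Hn)|].
  rewrite Rmult_assoc. apply Rmult_le_compat_l; [lra|].
  assert (H1 := HF J N u HN T1 T2 T3 Hsc Hcn).
  destruct (tau_pos T N HT HN) as [Ht0 _]. assert (Hh := hh_pos Xmin Xmax J HO).
  assert (0 <= tau T N ^ 2 / hh Xmin Xmax J).
  { apply Rmult_le_pos; [apply pow2_ge_0 | left; apply Rinv_0_lt_compat; auto]. }
  lra.
Qed.

End Scheme.

(** * Lipschitz data and assembly of the theorem *)

Lemma Lip2_cont_box (T Xmin Xmax : R) (F : R -> R -> R) :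
  Lip2 T Xmin Xmax F -> cont_box 0 T Xmin Xmax F.
Proof.
  intros (L & HL & H) t x Ht Hx eps Heps. exists (eps / (2 * (L + 1))).
  assert (Hd : 0 < eps / (2 * (L + 1))) by (apply Rdiv_lt_0_compat; lra).
  split; auto. intros s z Hs Hz H1 H2.
  eapply Rle_lt_trans; [apply H; auto|].
  set (d := eps / (2 * (L + 1))) in *.
  assert (He : eps = 2 * (L + 1) * d) by (unfold d; field; lra).
  assert (L * (Rabs (s - t) + Rabs (z - x)) <= L * (2 * d)) by (apply Rmult_le_compat_l; lra).
  lra.
Qed.

Lemma Lip2_a_of (T Xmin Xmax : R) (sigma : R -> R -> R) :
  Lip2 T Xmin Xmax sigma -> Lip2 T Xmin Xmax (a_of sigma).
Proof.
  intros H. destruct (cont_box_bounded _ _ _ _ _ (Lip2_cont_box _ _ _ _ H)) as (S & HS & Hb).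
  destruct H as (L & HL & H). exists (S * L). split; [apply Rmult_le_pos; lra|].
  intros t s x z Ht Hs Hx Hz. unfold a_of.
  replace (sigma t x ^ 2 / 2 - sigma s z ^ 2 / 2) with
    ((sigma t x + sigma s z) / 2 * (sigma t x - sigma s z)) by field.
  rewrite Rabs_mult, Rmult_assoc. apply Rmult_le_compat; try apply Rabs_pos; auto.
  assert (H1 := Hb t x Ht Hx). assert (H2 := Hb s z Hs Hz).
  apply Rabs_le_between in H1, H2. apply Rabs_le. lra.
Qed.

Lemma Lip2_plus (T Xmin Xmax : R) (F G : R -> R -> R) :
  Lip2 T Xmin Xmax F -> Lip2 T Xmin Xmax G -> Lip2 T Xmin Xmax (fun t x => F t x + G t x).
Proof.
  intros (L1 & P1 & H1) (L2 & P2 & H2). exists (L1 + L2). split; [lra|].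
  intros t s x z Ht Hs Hx Hz.
  replace (F t x + G t x - (F s z + G s z)) with ((F t x - F s z) + (G t x - G s z)) by ring.
  eapply Rle_trans; [apply Rabs_triang|].
  assert (A1 := H1 t s x z Ht Hs Hx Hz). assert (A2 := H2 t s x z Ht Hs Hx Hz). lra.
Qed.

Theorem theorem4p12
  (T Xmin Xmax : R) (sigma b r f phi : R -> R -> R) (v0 vl vr : R -> R)
  (v : R -> R -> R) (p : nat) (y : nat -> R -> R)
  (al0 al1 al2 al3 al4 C1 C2 C3 C4 : R)
  (HT : 0 < T) (HO : Xmin < Xmax)
  (Hsig : Lip2 T Xmin Xmax sigma) (Hb : Lip2 T Xmin Xmax b) (Hr : Lip2 T Xmin Xmax r)
  (Hf : Lip2 T Xmin Xmax f) (Hphi : Lip2 T Xmin Xmax phi) (Hv0 : Lip1 Xmin Xmax v0)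
  (Hcompat : forall x, Xmin <= x <= Xmax -> v0 x >= phi 0 x + f 0 x)
  (Hvisc : viscosity_solution T Xmin Xmax sigma b r f phi v0 vl vr v)
  (* (A1) *)
  (HA1bd : exists M, forall t x, 0 <= t <= T -> Xmin <= x <= Xmax ->
      Rabs (a_of sigma t x) <= M /\ Rabs (b t x) <= M /\ Rabs (r t x) <= M)
  (HA1ell : exists eta0, 0 < eta0 /\ forall t x, 0 <= t <= T -> Xmin <= x <= Xmax ->
      eta0 <= a_of sigma t x)
  (HA1lip : exists L, forall t x z, 0 <= t <= T -> Xmin <= x <= Xmax -> Xmin <= z <= Xmax ->
      Rabs (a_of sigma t x - a_of sigma t z) <= L * Rabs (x - z))
  (* (A2) *)
  (Hy : forall i, (i < p)%nat -> cont_on_interval T (y i) /\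
      forall t, 0 <= t <= T -> Xmin <= y i t <= Xmax)
  (HC23 : C23_on T Xmin Xmax p y v)
  (Hal : 0 <= al1 /\ 0 <= al2 /\ 0 <= al3 /\ 0 <= al4)
  (HC : 0 <= C1 /\ 0 <= C2 /\ 0 <= C3 /\ 0 <= C4)
  (Hbd1 : forall eps, 0 < eps -> Linf_bound T Xmin Xmax p y eps (dt v) (C1 * Rpower eps (- al1)))
  (Hbd2 : forall eps, 0 < eps -> Linf_bound T Xmin Xmax p y eps (dt (dt v)) (C2 * Rpower eps (- al2)))
  (Hbd3 : forall eps, 0 < eps -> Linf_bound T Xmin Xmax p y eps (dx (dx v)) (C3 * Rpower eps (- al3)))
  (Hbd4 : forall eps, 0 < eps -> Linf_bound T Xmin Xmax p y eps (dx (dx (dx v))) (C4 * Rpower eps (- al4)))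
  (* (A3) *)
  (Hal0 : 0 < al0 <= 1)
  (HA3 : exists K, forall i, (i < p)%nat -> forall t s, 0 <= t <= T -> 0 <= s <= T ->
      Rabs (y i t - y i s) <= K * Rpower (Rabs (t - s)) al0)
  (Hal2 : al2 < 1) :
  (* implicit Euler first step *)
  (exists C, 0 <= C /\ exists delta, 0 < delta /\
     forall (J N : nat) (u : nat -> nat -> R), (1 <= J)%nat -> (1 <= N)%nat ->
       tau T N < delta -> hh Xmin Xmax J < delta ->
       scheme_common T Xmin Xmax sigma b r f phi v0 vl vr J N u ->
       first_step_IE T Xmin Xmax sigma b r f phi J N u ->
       forall n, (1 <= n <= N)%nat ->
         err2 T Xmin Xmax v J N u n
           <= C * Bnd al0 al1 al2 al3 al4 (tau T N) (hh Xmin Xmax J))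
  /\
  (* Crank-Nicolson first step, under (A4) *)
  ((Lip1 Xmin Xmax v0 /\ piecewise_C2 Xmin Xmax v0) ->
   exists C, 0 <= C /\ exists delta, 0 < delta /\
     forall (J N : nat) (u : nat -> nat -> R), (1 <= J)%nat -> (1 <= N)%nat ->
       tau T N < delta -> hh Xmin Xmax J < delta ->
       scheme_common T Xmin Xmax sigma b r f phi v0 vl vr J N u ->
       first_step_CN T Xmin Xmax sigma b r f phi J N u ->
       forall n, (1 <= n <= N)%nat ->
         err2 T Xmin Xmax v J N u n
           <= C * (Bnd al0 al1 al2 al3 al4 (tau T N) (hh Xmin Xmax J)
                   + tau T N ^ 2 / hh Xmin Xmax J)).
Proof.
  pose proof Hvisc as (Cv & Hvi & Hvl & _).
  assert (Hg := Lip2_plus _ _ _ _ _ Hphi Hf).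
  assert (Ca := Lip2_cont_box _ _ _ _ (Lip2_a_of _ _ _ _ Hsig)).
  assert (Cb := Lip2_cont_box _ _ _ _ Hb). assert (Cr := Lip2_cont_box _ _ _ _ Hr).
  assert (Cf := Lip2_cont_box _ _ _ _ Hf). assert (Cg := Lip2_cont_box _ _ _ _ Hg).
  destruct HA1bd as (M1 & HM1). destruct HA1ell as (eta & Heta & Hell).
  destruct HA1lip as (La & HaL). destruct HA3 as (Ky & Hhold).
  destruct (cont_box_bounded _ _ _ _ _ Cv) as (Mv & HMv & Bv).
  destruct (cont_box_bounded _ _ _ _ _ Cf) as (Mf & HMf & Bf).
  destruct Hg as (Lg & HLg & Hgl).
  set (M := 1 + Rabs M1 + Mv + Mf + Lg). pose proof (Rabs_pos M1).
  assert (HM : 1 <= M) by (unfold M; lra).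
  assert (HB : forall t x, 0 <= t <= T -> Xmin <= x <= Xmax ->
    Rabs (a_of sigma t x) <= M /\ Rabs (b t x) <= M /\ Rabs (r t x) <= M /\ Rabs (v t x) <= M /\
    Rabs (f t x) <= M).
  { intros t x Ht Hx. destruct (HM1 t x Ht Hx) as (A1 & A2 & A3).
    assert (A4 := Bv t x Ht Hx). assert (A5 := Bf t x Ht Hx). pose proof (Rle_abs M1).
    unfold M. repeat split; lra. }
  assert (HglM : forall t s x z, 0 <= t <= T -> 0 <= s <= T -> Xmin <= x <= Xmax ->
    Xmin <= z <= Xmax -> Rabs (phi t x + f t x - (phi s z + f s z)) <= M * (Rabs (t - s) + Rabs (x - z))).
  { intros t s x z Ht Hs Hx Hz. eapply Rle_trans; [apply Hgl; auto|].
    apply Rmult_le_compat_r; [|unfold M; lra].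
    pose proof (Rabs_pos (t - s)). pose proof (Rabs_pos (x - z)). lra. }
  assert (HholdK : forall i, (i < p)%nat -> forall t s, 0 <= t <= T -> 0 <= s <= T ->
    Rabs (y i t - y i s) <= Rabs Ky * Rpower (Rabs (t - s)) al0).
  { intros i Hi t s Ht Hs. eapply Rle_trans; [apply Hhold; auto|].
    apply Rmult_le_compat_r; [left; apply Rpower_pos | apply Rle_abs]. }
  assert (Hyc : forall i, (i < p)%nat -> cont_on 0 T (y i)) by (intros i Hi; apply (Hy i Hi)).
  assert (Hobs := visc_above_obstacle T Xmin Xmax sigma b r f phi v0 vl vr v Hvisc HT HO Cg).
  assert (Hsup := visc_box_super T Xmin Xmax sigma b r f phi v0 vl vr v Hvisc).
  assert (Hsub := visc_box_sub T Xmin Xmax sigma b r f phi v0 vl vr v Hvisc).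
  destruct (regularity T Xmin Xmax p y (a_of sigma) b r f (fun t x => phi t x + f t x) v M eta
    HO HM Heta Hyc HC23 Ca Cb Cr Cf Cg Cv Hell HB HglM Hobs Hsup Hsub
    (fun eps Heps => ex_intro _ _ (Hbd3 eps Heps))) as (K & HK & Hreg).
  destruct (start_modulus T Xmin Xmax al1 C1 M K p y v (proj1 Hal) (proj1 HC) HK ltac:(lra) HT Cv
    (fun t x Ht Hx => proj1 (proj2 (proj2 (proj2 (HB t x Ht Hx))))) Hbd1
    (fun eps m He Hm Hd => proj2 (proj2 (proj2 (Hreg eps m He Hm Hd))))) as (D & HD & Hstart).
  split.
  - destruct (error_bound_IE T Xmin Xmax p y sigma b r f phi v v0 vl vr al0 al1 al2 al3 al4 C1 C2 C3 C4
      M K D La (Rabs Ky) eta HT HO HM HK HD (Rabs_pos Ky) Heta Hal Hal0 HC Hyc HC23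
      Ca Cb Cr Cf Cg Cv Hell HaL HB HglM Hobs Hsup Hsub Hbd1 Hbd2 Hbd4 Hreg Hstart HholdK Hvi Hvl)
      as (C & HC0 & delta & Hd & H0).
    exists C. split; [auto|]. exists delta. split; [auto|].
    intros J N u _ HN Hta _ Hsc Hst n Hn. exact (H0 J N u HN Hta Hsc Hst n Hn).
  - intros [_ Hpc].
    destruct (error_bound_CN T Xmin Xmax p y sigma b r f phi v v0 vl vr al0 al1 al2 al3 al4 C1 C2 C3 C4
      M K D La (Rabs Ky) eta HT HO HM HK HD (Rabs_pos Ky) Heta Hal Hal0 HC Hyc HC23
      Ca Cb Cr Cf Cg Cv Hell HaL HB HglM Hobs Hsup Hsub Hbd1 Hbd2 Hbd4 Hreg Hstart HholdK Hvi Hvl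
      Hv0 Hpc) as (C & HC0 & delta & Hd & H0).
    exists C. split; [auto|]. exists delta. split; [auto|].
    intros J N u _ HN Hta _ Hsc Hst n Hn. exact (H0 J N u HN Hta Hsc Hst n Hn).
Qed.
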